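(* Let $K$ be a compact subset of $\overline{\Lambda_+}$, let $p\in(0,\infty)$, and let $\mu\in\mathcal M_+(E\times F_{\mathbb C})$ be such that $\rho(\operatorname{Supp}\mu)$ is bounded. Assume that $\mathcal B^p_K(\mathcal N)\neq\{0\}$ and that $\mu$ is a $p$-sampling measure for $\mathcal B^p_K(\mathcal N)$. Then $M_1(\mu)$ is bounded and there are $R,C>0$ such that $$[M_R(\mu)]_0\geq C\quad\text{on }\mathcal N.$$
   Context: Setting. $E$ is a complex Hilbert space of finite dimension $n\geq 0$, $F$ is a real Hilbert space of finite dimension $m$, $F'$ is the dual of $F$, $F_{\mathbb C}$ its complexification, and $\Phi\colon E\times E\to F_{\mathbb C}$ is a hermitian map ($\mathbb C$-linear in the first variable, $\Phi(\zeta',\zeta)=\overline{\Phi(\zeta,\zeta')}$); $\Phi(\zeta):=\Phi(\zeta,\zeta)\in F$. The open convex cone $\Lambda_+=\{\lambda\in F':\ \langle\lambda,\Phi(\zeta)\rangle>0\ \ \forall\zeta\in E\setminus\{0\}\}$ is assumed non-empty; $\overline{\Lambda_+}$ is its closure. Set $\rho(\zeta,z)=\operatorname{Im}z-\Phi(\zeta)\in F$ for $(\zeta,z)\in E\times F_{\mathbb C}$. $\mathcal N=E\times F$ is the Lie group with product $(\zeta,x)(\zeta',x')=(\zeta+\zeta',x+x'+2\operatorname{Im}\Phi(\zeta,\zeta'))$, and $E\times F_{\mathbb C}$ is the Lie group with product $(\zeta,z)(\zeta',z')=(\zeta+\zeta',z+z'+2i\Phi(\zeta',\zeta))$. For a function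 $f$ on $E\times F_{\mathbb C}$ and $h\in F$, $f_h(\zeta,x)=f(\zeta,x+i\Phi(\zeta)+ih)$ for $(\zeta,x)\in\mathcal N$ (the same notation $[f]_h$ is used). $L^p(\mathcal N)$ is taken with respect to Lebesgue (= Haar) measure on $E\times F$. Bernstein spaces. For $K\subseteq F'$ compact, $H_K(h)=\sup_{\lambda\in -K}\langle\lambda,h\rangle\in[-\infty,\infty)$, $h\in F$. A $C^1$ function on $\mathcal N$ is CR if it is annihilated by $\overline{Z_v}$ for all $v\in E$, where $Z_v$ is the left-invariant vector field on $\mathcal N$ equal at the origin to the Wirtinger derivative $\frac12(\partial_v-i\partial_{iv})$. $\mathcal O_K(\mathcal N)$ is the space of $C^\infty$ CR functions on $\mathcal N$ growing at most polynomially together with every left-invariant derivative, such that the Fourier transform on $F$ (with kernel $e^{-i\langle\lambda,x\rangle}$) of $f(\zeta,\cdot)$ is supported in $K$ for every $\zeta\in E$. $\operatorname{Hol}_K(E\times F_{\mathbb C})$ is the set of holomorphic $f$ on $E\times F_{\mathbb C}$ such that $|f(\zeta,z)|\leq C(1+|\zeta|+|z|)^Ne^{H_K(\rho(\zeta,z))}$ for some $N,C>0$ and $f_0\in\mathcal O_K(\mathcal N)$. For $p\in(0,\infty]$, $\mathcal B^p_K(\mathcal N)=\{f\in\operatorname{Hol}_K(E\times F_{\mathbb C}): f_0\in L^p(\mathcal N)\}$ with (quasi-)norm $\|f\|_{\mathcal B^p_K(\mathcal N)}=\|f_0\|_{L^p(\mathcal N)}$. Distances. Set $\theta=\frac12$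 if $n>0$, $\theta=1$ if $n=0$. $d_{\mathcal N}$ is a fixed left-invariant distance on $\mathcal N$ which is $\theta$-homogeneous: $d_{\mathcal N}(t\cdot a,t\cdot b)=t^\theta d_{\mathcal N}(a,b)$ with $t\cdot(\zeta,x)=(t^{1/2}\zeta,tx)$, $t>0$. $E\times F_{\mathbb C}$ is endowed with $d((\zeta,z),(\zeta',z'))=\max\big(d_{\mathcal N}((\zeta,\operatorname{Re}z),(\zeta',\operatorname{Re}z')),|\rho(\zeta,z)-\rho(\zeta',z')|\big)$; $\overline B(\cdot,R)$ denotes closed $d$-balls. Measures. $\mathcal M_+(E\times F_{\mathbb C})$ is the set of positive Radon measures on $E\times F_{\mathbb C}$, and $M_R(\mu)(\zeta,z)=\mu(\overline B((\zeta,z),R))$. $\mu$ is $p$-sampling for $\mathcal B^p_K(\mathcal N)$ if $\mathcal B^p_K(\mathcal N)\subseteq L^p(\mu)$ continuously and the canonical mapping $\mathcal B^p_K(\mathcal N)\to L^p(\mu)$ is an isomorphism onto its image. *)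

(* Defs.v *)
(* MathComp-Analysis, with the complex numbers R[i] of real-closed. *)
From HB Require Import structures.
From mathcomp Require Import all_boot all_order all_algebra.
From mathcomp Require Import complex.
From mathcomp Require Import all_classical all_reals all_analysis.
Set Implicit Arguments.
Unset Strict Implicit.
Unset Printing Implicit Defensive.
Import Order.TTheory GRing.Theory Num.Theory.
Import numFieldNormedType.Exports.
Local Open Scope classical_set_scope.
Local Open Scope ring_scope.
Local Open Scope complex_scope.

(* The standard topology of the complex numbers, as for any numFieldType. *)
HB.instance Definition _ (R : realType) := GRing.ComAlgebra.copy R[i] R[i]^o.
HB.instance Definition _ (R : realType) := Vector.copy R[i] R[i]^o.
HB.instance Definition _ (R : realType) := NormedModule.copy R[i] R[i]^o.

Section ProductSigmaFinite.
Context (R : realType) (d1 d2 : measure_display).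
Context (T1 : measurableType d1) (T2 : measurableType d2).
Context (m1 : {sigma_finite_measure set T1 -> \bar R}).
Context (m2 : {sigma_finite_measure set T2 -> \bar R}).

Lemma product_sigma_finite : sigma_finite setT (m1 \x m2)%E.
Proof.
have /sigma_finiteP[F [TF ndF Foo]] := sigma_finiteT m1.
have /sigma_finiteP[G [TG ndG Goo]] := sigma_finiteT m2.
exists (fun n => F n `*` G n).
  rewrite -setXTT TF TG predeqE => -[x y]; split.
    move=> [/= [n _ Fnx] [k _ Gky]]; exists (maxn n k) => //; split.
    - by move: x Fnx; exact/subsetPset/ndF/leq_maxl.
    - by move: y Gky; exact/subsetPset/ndG/leq_maxr.
  by move=> [n _ []/= ? ?]; split; exists n.
move=> k; have [? ?] := Foo k; have [? ?] := Goo k.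
split; first exact: measurableX.
by rewrite product_measure1E// lte_mul_pinfty// ge0_fin_numE.
Qed.

(* An alias: on [m1 \x m2] itself, canonical inference of sigma-finiteness only
   finds the library's instance for subprobabilities. *)
Definition sf_product : set (T1 * T2) -> \bar R := (m1 \x m2)%E.

HB.instance Definition _ := Measure.on sf_product.
HB.instance Definition _ :=
  Measure_isSigmaFinite.Build _ _ _ sf_product product_sigma_finite.

End ProductSigmaFinite.

Section TupleMeasure.
Context (R : realType) (d : measure_display) (T : measurableType d).
Context (mu : {sigma_finite_measure set T -> \bar R}).

Definition tuple_cons (k : nat) (p : T * k.-tuple T) : k.+1.-tuple T :=
  [tuple of p.1 :: p.2].

Lemma measurable_tuple_cons k : measurable_fun setT (@tuple_cons k).
Proof. exact: measurable_cons. Qed.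

Definition cons_measure (k : nat)
    (nu : {sigma_finite_measure set (k.-tuple T) -> \bar R}) :
    set (k.+1.-tuple T) -> \bar R :=
  pushforward (mu \x nu)%E (@tuple_cons k).

Section Instances.
Context (k : nat) (nu : {sigma_finite_measure set (k.-tuple T) -> \bar R}).

Let cons_measure0 : cons_measure nu set0 = 0%E.
Proof. by rewrite /cons_measure /pushforward preimage_set0 measure0. Qed.

Let cons_measure_ge0 A : (0 <= cons_measure nu A)%E.
Proof. by rewrite /cons_measure /pushforward; exact: measure_ge0. Qed.

Let cons_measure_sigma_additive : semi_sigma_additive (cons_measure nu).
Proof.
move=> F mF tF mUF; rewrite /cons_measure /pushforward preimage_bigcup.
apply: measure_semi_sigma_additive.
- by move=> n; rewrite -[X in measurable X]setTI; exact: measurable_tuple_cons.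
- apply/trivIsetP => /= i j _ _ ij; rewrite -preimage_setI.
  by move/trivIsetP : tF => /(_ _ _ _ _ ij) ->//; rewrite preimage_set0.
- rewrite -preimage_bigcup -[X in measurable X]setTI.
  exact: measurable_tuple_cons.
Qed.

HB.instance Definition _ := isMeasure.Build _ _ _ (cons_measure nu)
  cons_measure0 cons_measure_ge0 cons_measure_sigma_additive.

Let tuple_uncons (t : k.+1.-tuple T) : T * k.-tuple T :=
  (thead t, [tuple of behead t]).

Let measurable_tuple_uncons : measurable_fun setT tuple_uncons.
Proof.
apply: measurable_fun_pair; first by exact: (@measurable_tnth _ T k.+1 ord0).
apply/measurable_fun_tnthP => i.
rewrite (_ : _ \o _ = (@tnth k.+1 T)^~ (lift ord0 i)).
  exact: measurable_tnth.
apply/funext => t /=; rewrite tnth_behead; congr tnth.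
by apply: val_inj; rewrite /= inordK ?ltnS.
Qed.

Let cons_measure_sigma_finite : sigma_finite setT (cons_measure nu).
Proof.
have [F TF Foo] := product_sigma_finite mu nu.
exists (fun n => tuple_uncons @^-1` F n).
  by rewrite -preimage_bigcup -TF preimage_setT.
move=> n; have [mF Fn] := Foo n; split.
  by rewrite -[X in measurable X]setTI; exact: measurable_tuple_uncons.
rewrite /cons_measure /pushforward (_ : _ @^-1` _ = F n)//.
rewrite -comp_preimage (_ : _ \o _ = id)//.
apply/funext => -[x t]; rewrite /tuple_uncons /tuple_cons /=.
by congr pair; apply: val_inj.
Qed.

HB.instance Definition _ :=
  Measure_isSigmaFinite.Build _ _ _ (cons_measure nu) cons_measure_sigma_finite.

End Instances.

(* The k-fold product of mu with itself. *)
Fixpoint tuple_measure (k : nat) :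
    {sigma_finite_measure set (k.-tuple T) -> \bar R} :=
  if k is k'.+1 then cons_measure (tuple_measure k') else \d_([tuple]).

End TupleMeasure.

(* The complex Hilbert space E of dimension n is C^n = 'rV[R[i]]_n, the real
   Hilbert space F of dimension m is R^m = 'rV[R]_m and F_C is 'rV[R[i]]_m.
   The dual F' is also 'rV[R]_m, through the bilinear pairing [pairing]. The
   norms of the paper are the Euclidean ones below, whereas the norms of the
   library on matrices are sup norms; they define the same topology. *)

Section Spaces.
Context {R : realType}.

Definition cabs (z : R[i]) : R :=
  Num.sqrt (complex.Re z ^+ 2 + complex.Im z ^+ 2).
Definition enorm (k : nat) (x : 'rV[R]_k) : R :=
  Num.sqrt (\sum_i x 0 i ^+ 2).
Definition ecnorm (k : nat) (z : 'rV[R[i]]_k) : R :=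
  Num.sqrt (\sum_i cabs (z 0 i) ^+ 2).
Definition pairing (k : nat) (l h : 'rV[R]_k) : R := \sum_i l 0 i * h 0 i.

Definition vRe (k : nat) (z : 'rV[R[i]]_k) : 'rV[R]_k := map_mx (@complex.Re R) z.
Definition vIm (k : nat) (z : 'rV[R[i]]_k) : 'rV[R]_k := map_mx (@complex.Im R) z.
Definition vC (k : nat) (x : 'rV[R]_k) : 'rV[R[i]]_k :=
  map_mx (real_complex R) x.

End Spaces.

(* Lebesgue measure is carried by spaces of tuples, and functions on E x F are
   integrated after composition with the coordinate bijections [ptF], [ptN]. *)

Section Lebesgue.
Context (R : realType) (n m : nat).
Local Notation Rm := (measurableTypeR R).
Let leb : {sigma_finite_measure set Rm -> \bar R} := @lebesgue_measure R.
Let leb2 : {sigma_finite_measure set (Rm * Rm)%type -> \bar R} :=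
  sf_product leb leb.

Definition lebF : {sigma_finite_measure set (m.-tuple Rm) -> \bar R} :=
  tuple_measure leb m.
Definition lebE : {sigma_finite_measure set (n.-tuple (Rm * Rm)%type) -> \bar R} :=
  tuple_measure leb2 n.
Definition lebN :
    {sigma_finite_measure set (n.-tuple (Rm * Rm) * m.-tuple Rm)%type -> \bar R} :=
  sf_product lebE lebF.

Definition ptF (s : m.-tuple Rm) : 'rV[R]_m := \row_i tnth s i.
Definition ptE (t : n.-tuple (Rm * Rm)%type) : 'rV[R[i]]_n :=
  \row_i ((tnth t i).1 +i* (tnth t i).2).
Definition ptN (u : n.-tuple (Rm * Rm)%type * m.-tuple Rm) :
    'rV[R[i]]_n * 'rV[R]_m :=
  (ptE u.1, ptF u.2).

End Lebesgue.
Arguments ptF {R m}.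
Arguments ptE {R n}.
Arguments ptN {R n m}.

Section ComplexIntegration.
Context {R : realType} {d : measure_display} {T : measurableType d}.

Definition cintegral (mu : {measure set T -> \bar R}) (f : T -> R[i]) : R[i] :=
  (\int[mu]_x complex.Re (f x)) +i* (\int[mu]_x complex.Im (f x)).

Definition Lpnorm (mu : {measure set T -> \bar R}) (p : R) (f : T -> R[i]) :
    \bar R :=
  Lnorm mu p%:E (fun x => (cabs (f x))%:E).

Definition inLp (mu : {measure set T -> \bar R}) (p : R) (f : T -> R[i]) : Prop :=
  [/\ measurable_fun setT (fun x => complex.Re (f x)),
      measurable_fun setT (fun x => complex.Im (f x)) &
      (Lpnorm mu p f < +oo)%E].

End ComplexIntegration.

(* Differentiation along a family of curves: [line p v] is a curve starting at
   p at time 0. Affine lines give the ordinary directional derivatives, and the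
   lines t |-> p . (t v) of a group give the left-invariant derivatives. *)

Section Derivatives.
Context {R : realType}.

Definition cderivable0 (g : R -> R[i]) : Prop :=
  derivable (fun t => complex.Re (g t)) 0 1 /\
  derivable (fun t => complex.Im (g t)) 0 1.
Definition cderive0 (g : R -> R[i]) : R[i] :=
  derive1 (fun t => complex.Re (g t)) 0 +i* derive1 (fun t => complex.Im (g t)) 0.

Context {V : topologicalType} (line : V -> V -> R -> V).

Definition deriv_along (v : V) (f : V -> R[i]) : V -> R[i] :=
  fun p => cderive0 (fun t => f (line p v t)).
Definition iter_deriv_along (vs : seq V) (f : V -> R[i]) : V -> R[i] :=
  foldr deriv_along f vs.

(* C^oo, when [line] is the family of affine lines *)
Definition smooth_along (f : V -> R[i]) : Prop :=
  forall vs : seq V,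
    continuous (iter_deriv_along vs f) /\
    forall v p, cderivable0 (fun t => iter_deriv_along vs f (line p v t)).

End Derivatives.

Section Setting.
Context {R : realType} {n m : nat}.
Local Notation E := 'rV[R[i]]_n.
Local Notation F := 'rV[R]_m.
Local Notation FC := 'rV[R[i]]_m.
Context (Phi : E -> E -> FC).

Definition hermitian_map : Prop :=
  (forall (a : R[i]) (u v w : E), Phi (a *: u + v) w = a *: Phi u w + Phi v w) /\
  (forall u v : E, Phi v u = map_mx (@conjc R) (Phi u v)).

(* Phi (z, z) has real coordinates when Phi is hermitian *)
Definition Phid (z : E) : F := vRe (Phi z z).

Definition Lambda_plus : set F :=
  [set l | forall z : E, z != 0 -> 0 < pairing l (Phid z)].

Definition rho (w : E * FC) : F := vIm w.2 - Phid w.1.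

Definition slice (T : Type) (f : E * FC -> T) (h : F) (a : E * F) : T :=
  f (a.1, vC a.2 + 'i *: vC (Phid a.1) + 'i *: vC h).

Definition mulN (a b : E * F) : E * F :=
  (a.1 + b.1, a.2 + b.2 + 2%:R *: vIm (Phi a.1 b.1)).

Definition scaleN (t : R) (a : E * F) : E * F := (t%:C *: a.1, t *: a.2).

Definition affine_lineN (p v : E * F) (t : R) : E * F :=
  (p.1 + t%:C *: v.1, p.2 + t *: v.2).
(* t |-> t v is the one-parameter subgroup of N with velocity v *)
Definition left_lineN (p v : E * F) (t : R) : E * F := mulN p (scaleN t v).
Definition affine_lineF (p v : F) (t : R) : F := p + t *: v.

Definition smoothN (f : E * F -> R[i]) : Prop := smooth_along affine_lineN f.

(* conj Z_v = (X_v + i X_(iv)) / 2 for the left-invariant fields X_v, X_(iv) *)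
Definition Zbar (v : E) (f : E * F -> R[i]) (a : E * F) : R[i] :=
  2%:R^-1 * (deriv_along left_lineN (v, 0) f a +
             'i * deriv_along left_lineN ('i *: v, 0) f a).
Definition CR (f : E * F -> R[i]) : Prop := forall v a, Zbar v f a = 0.

Definition moderate (f : E * F -> R[i]) : Prop :=
  exists (N : nat) (C : R), forall a : E * F,
    cabs (f a) <= C * (1 + ecnorm a.1 + enorm a.2) ^+ N.

Definition fourier (phi : F -> R[i]) (x : F) : R[i] :=
  cintegral (lebF R m) (fun s =>
    phi (ptF s) * (cos (pairing (ptF s) x) -i* sin (pairing (ptF s) x))).

(* The Fourier transform of the tempered distribution g vanishes on test
   functions supported in the complement of K. *)
Definition spectrum_in (K : set F) (g : F -> R[i]) : Prop :=
  forall phi : F -> R[i],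
    smooth_along affine_lineF phi ->
    compact (closure [set l | phi l != 0]) ->
    closure [set l | phi l != 0] `&` K = set0 ->
    cintegral (lebF R m) (fun s => g (ptF s) * fourier phi (ptF s)) = 0.

Definition O_K (K : set F) : set (E * F -> R[i]) :=
  [set f | [/\ smoothN f, CR f,
    (forall vs, moderate (iter_deriv_along left_lineN vs f)) &
    (forall z, spectrum_in K (fun x => f (z, x)))]].

Definition support_fun (K : set F) (h : F) : \bar R :=
  ereal_sup [set (pairing l h)%:E | l in [set - k | k in K]].

Definition Hol_K (K : set F) : set (E * FC -> R[i]) :=
  [set f | [/\ (forall w : E * FC, differentiable (f : E * FC -> R[i]) w),
    (exists (N : nat) (C : R), 0 < C /\ forall w : E * FC,
      ((cabs (f w))%:E <=
       (C * (1 + ecnorm w.1 + ecnorm w.2) ^+ N)%:E *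
         expeR (support_fun K (rho w)))%E) &
    O_K K (slice f 0)]].

Definition bernstein (p : R) (K : set F) : set (E * FC -> R[i]) :=
  [set f | Hol_K K f /\ inLp (lebN R n m) p (slice f 0 \o ptN)].

Definition bernstein_norm (p : R) (f : E * FC -> R[i]) : \bar R :=
  Lpnorm (lebN R n m) p (slice f 0 \o ptN).

Definition theta : R := if n is 0 then 1 else 2%:R^-1.

Definition dilationN (t : R) (a : E * F) : E * F :=
  ((Num.sqrt t)%:C *: a.1, t *: a.2).

Definition homogeneous_left_distance (dN : E * F -> E * F -> R) : Prop :=
  [/\ (forall a b, 0 <= dN a b),
      (forall a b, dN a b = 0 <-> a = b),
      (forall a b, dN a b = dN b a) &
      (forall a b c, dN a c <= dN a b + dN b c)] /\
  [/\ (forall a b c, dN (mulN c a) (mulN c b) = dN a b) &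
      (forall t a b, 0 < t ->
         dN (dilationN t a) (dilationN t b) = t `^ theta * dN a b)].

Definition distEFC (dN : E * F -> E * F -> R) (w w' : E * FC) : R :=
  Num.max (dN (w.1, vRe w.2) (w'.1, vRe w'.2)) (enorm (rho w - rho w')).

Definition cballEFC (dN : E * F -> E * F -> R) (w : E * FC) (r : R) :
    set (E * FC) :=
  [set w' | distEFC dN w w' <= r].

Local Notation Borel := (g_sigma_algebraType (@open (E * FC)%type)).

Definition radon (mu : {measure set Borel -> \bar R}) : Prop :=
  [/\ (forall A : set (E * FC), compact A -> (mu A < +oo)%E),
      (forall A : set Borel, measurable A ->
        mu A = ereal_inf [set mu U | U in
          [set U : set (E * FC) | open U /\ A `<=` U]]) &
      (forall U : set (E * FC), open U ->
        mu U = ereal_sup [set mu A | A in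
          [set A : set (E * FC) | compact A /\ A `<=` U]])].

Definition msupport (mu : {measure set Borel -> \bar R}) : set (E * FC) :=
  [set w | forall U : set (E * FC), open U -> U w -> (0 < mu U)%E].

Definition M_ (dN : E * F -> E * F -> R) (r : R)
    (mu : {measure set Borel -> \bar R}) (w : E * FC) : \bar R :=
  mu (cballEFC dN w r).

(* The canonical map from the Bernstein space to L^p(mu) is well defined,
   continuous, injective, and has a continuous inverse on its image. *)
Definition sampling (p : R) (K : set F) (mu : {measure set Borel -> \bar R}) :
    Prop :=
  [/\ (forall f, bernstein p K f -> inLp mu p (f : Borel -> R[i])),
      (forall f, bernstein p K f -> forall e : R, 0 < e ->
        exists2 dl : R, 0 < dl & forall g, bernstein p K g ->
          (bernstein_norm p (fun w => (f w - g w)%R) < dl%:E)%E ->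
          (Lpnorm mu p (fun w : Borel => (f w - g w)%R) < e%:E)%E),
      (forall f g, bernstein p K f -> bernstein p K g ->
        {ae mu, forall w, f w = g w} -> f = g) &
      (forall f, bernstein p K f -> forall e : R, 0 < e ->
        exists2 dl : R, 0 < dl & forall g, bernstein p K g ->
          (Lpnorm mu p (fun w : Borel => (f w - g w)%R) < dl%:E)%E ->
          (bernstein_norm p (fun w => (f w - g w)%R) < e%:E)%E)].

End Setting.

(* Main.v *)
Require Import Defs.
From HB Require Import structures.
From mathcomp Require Import all_boot all_order all_algebra.
From mathcomp Require Import ring lra complex.
From mathcomp Require Import all_classical all_reals all_analysis.
From mathcomp Require Import measurable_realfun.
Set Implicit Arguments.
Unset Strict Implicit.
Unset Printing Implicit Defensive.
Import Order.TTheory GRing.Theory Num.Theory.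
Import numFieldNormedType.Exports.
Local Open Scope classical_set_scope.
Local Open Scope ring_scope.
Local Open Scope complex_scope.

(** Sampling compares two energies of a function [f] of the Bernstein space, the
    integral of [|f|^p] over the group and its integral with respect to [mu]. Left
    translations of the group extend to affine automorphisms of [E * F_C] that
    preserve the Bernstein space and its norm ([bernstein_actL], [energyN_actL]).
    So the translates of one non-zero [f] have [mu]-energies bounded above
    ([uniform_energy]) and bounded below by a positive constant ([lower_energy]),
    uniformly in the translation. Both conclusions are read off from these bounds.

    Upper bound ([tube_mass]). A point of a compact set is not a zero of some
    translate of [f]: otherwise [f] would vanish on a whole fibre of [rho], and
    functions of the space are determined by any such fibre ([slice_unique]). By
    compactness finitely many translates are bounded below on pieces that cover
    the set, and Markov's inequality bounds the mass of each piece. Since the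
    energies are bounded uniformly, so are the masses of all the translates of the
    set. The part of a ball that [mu] sees lies in such a translate, because
    [rho] is bounded on the support.

    Lower bound ([ball_lower]). The energy of a translate is concentrated near the
    corresponding point, uniformly in the translation ([tail_majorant]): far from
    the point it is less than half of the lower bound on the whole energy. Near
    the point [f] is bounded, so the other half forces the measure to charge a
    tube of fixed radius.

    Both parts rest on a sub-mean value inequality ([submean]): in the strip where
    [rho] is bounded, [|f w|^p] is at most an average of [|f|^p] over the group
    around the group coordinate of [w], with an integrable kernel. It combines two
    one-variable facts, used one coordinate at a time ([iterate_coordinates]). In
    the directions of [E] the function is entire along suitable lines, and
    [local_bound] bounds its value by an area integral. In those of [F] it has
    exponential type, because [K] is bounded, and [strip_bound] bounds its value off
    the real line by a weighted integral over the real line, for every exponent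
    [p > 0]. Both come from Goursat's theorem on rectangles ([goursat]). *)

(** * Modulus, continuity and differentiability in epsilon-delta form *)

Section Modulus.
Context {R : realType}.
Implicit Types (z w : R[i]) (a b : R).

Lemma cabsE z : cabs z = ComplexField.Normc.normc z.
Proof. by case: z. Qed.

Lemma normr_cabs z : `|z| = (cabs z)%:C.
Proof. by rewrite normc_def. Qed.

Lemma cabs_ge0 z : 0 <= cabs z. Proof. exact: sqrtr_ge0. Qed.

Lemma cabs0 : cabs (0 : R[i]) = 0.
Proof. by rewrite cabsE ComplexField.Normc.normc0. Qed.

Lemma cabs1 : cabs (1 : R[i]) = 1.
Proof. by rewrite cabsE ComplexField.Normc.normc1. Qed.

Lemma cabsM z w : cabs (z * w) = cabs z * cabs w.
Proof. by rewrite !cabsE ComplexField.Normc.normcM. Qed.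

Lemma cabsV z : cabs z^-1 = (cabs z)^-1.
Proof. by rewrite !cabsE ComplexField.Normc.normcV. Qed.

Lemma cabsX z k : cabs (z ^+ k) = cabs z ^+ k.
Proof. by elim: k => [|k IH]; rewrite ?expr0 ?cabs1// !exprS cabsM IH. Qed.

Lemma cabsN z : cabs (- z) = cabs z.
Proof. by case: z => x y; rewrite /cabs/= !sqrrN. Qed.

Lemma cabsD z w : cabs (z + w) <= cabs z + cabs w.
Proof. by rewrite -lecR raddfD/= -!normr_cabs ler_normD. Qed.

Lemma cabsB z w : cabs (z - w) <= cabs z + cabs w.
Proof. by rewrite (le_trans (cabsD _ _))// cabsN. Qed.

Lemma cabsBC z w : cabs (z - w) = cabs (w - z).
Proof. by rewrite -cabsN opprB. Qed.

Lemma cabs_eq0 z : (cabs z == 0) = (z == 0).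
Proof.
apply/eqP/eqP => [|->]; last exact: cabs0.
by rewrite cabsE => /ComplexField.Normc.eq0_normc.
Qed.

Lemma cabs_gt0 z : (0 < cabs z) = (z != 0).
Proof. by rewrite lt_def cabs_eq0 cabs_ge0 andbT. Qed.

Lemma cabs_real a : cabs a%:C = `|a|.
Proof. by rewrite /cabs/= expr0n addr0 sqrtr_sqr. Qed.

Lemma cabs_i : cabs ('i : R[i]) = 1.
Proof. by rewrite /cabs/= expr0n expr1n add0r sqrtr1. Qed.

Lemma cabs_sqr z : cabs z ^+ 2 = complex.Re z ^+ 2 + complex.Im z ^+ 2.
Proof. by rewrite sqr_sqrtr// addr_ge0// sqr_ge0. Qed.

Lemma normr_Re_le z : `|complex.Re z| <= cabs z.
Proof. by rewrite -sqrtr_sqr ler_sqrt ?addr_ge0 ?sqr_ge0// lerDl sqr_ge0. Qed.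

Lemma normr_Im_le z : `|complex.Im z| <= cabs z.
Proof. by rewrite -sqrtr_sqr ler_sqrt ?addr_ge0 ?sqr_ge0// lerDr sqr_ge0. Qed.

Lemma cabs_le_ReIm z : cabs z <= `|complex.Re z| + `|complex.Im z|.
Proof.
case: z => x y /=; rewrite (_ : x +i* y = x%:C + 'i * y%:C); last first.
  by apply/eqP; rewrite eq_complex/=; apply/andP; split; apply/eqP; ring.
by rewrite (le_trans (cabsD _ _))// cabsM cabs_i mul1r !cabs_real.
Qed.

Lemma complexD a b a' b' : (a +i* b) + (a' +i* b') = (a + a') +i* (b + b').
Proof. by []. Qed.

Lemma cReD z w : complex.Re (z + w) = complex.Re z + complex.Re w.
Proof. by case: z; case: w. Qed.
Lemma cImD z w : complex.Im (z + w) = complex.Im z + complex.Im w.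
Proof. by case: z; case: w. Qed.
Lemma cReN z : complex.Re (- z) = - complex.Re z. Proof. by case: z. Qed.
Lemma cImN z : complex.Im (- z) = - complex.Im z. Proof. by case: z. Qed.
Lemma cReB z w : complex.Re (z - w) = complex.Re z - complex.Re w.
Proof. by rewrite cReD cReN. Qed.
Lemma cImB z w : complex.Im (z - w) = complex.Im z - complex.Im w.
Proof. by rewrite cImD cImN. Qed.
Lemma cReM z w : complex.Re (z * w) =
  complex.Re z * complex.Re w - complex.Im z * complex.Im w.
Proof. by case: z; case: w. Qed.
Lemma cImM z w : complex.Im (z * w) =
  complex.Re z * complex.Im w + complex.Im z * complex.Re w.
Proof. by case: z; case: w. Qed.

End Modulus.

Section EpsilonDelta.
Context {R : realType}.
Implicit Types (z w : R[i]) (V : R[i] -> R[i]).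

Lemma nbhs_cabsP w (P : set R[i]) :
  nbhs w P <-> exists2 d : R, 0 < d & forall z, cabs (z - w) < d -> P z.
Proof.
split=> [/nbhs_normP[d /= d0 dP]|[d d0 dP]].
  have [dI dR] : complex.Im d = 0 /\ 0 < complex.Re d.
    by move: d0; rewrite ltcE/= => /andP[/eqP ->].
  exists (complex.Re d) => // z zd; apply: dP => /=.
  rewrite distrC normr_cabs (_ : d = (complex.Re d)%:C) ?ltcR//.
  by case: d dI {d0 dR zd} => ? ? /= ->.
apply/nbhs_normP; exists d%:C => /=; first by rewrite ltcR.
by move=> z /=; rewrite distrC normr_cabs ltcR; exact: dP.
Qed.

Lemma cvg_cabsP (T : Type) (A : set_system T) (FA : Filter A) (f : T -> R[i]) l :
  f @ A --> l <-> forall e : R, 0 < e -> \forall x \near A, cabs (f x - l) < e.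
Proof.
split=> [fl e e0|h].
  by apply: (fl [set z | cabs (z - l) < e]); apply/nbhs_cabsP; exists e.
move=> P /nbhs_cabsP[d d0 dP]; apply: filterS (h _ d0) => x; exact: dP.
Qed.

Lemma continuous_cabsP V w : {for w, continuous V} <->
  forall e : R, 0 < e -> exists2 d : R, 0 < d &
    forall z, cabs (z - w) < d -> cabs (V z - V w) < e.
Proof.
split=> [Vw e e0|h].
  by have /cvg_cabsP/(_ _ e0)/nbhs_cabsP := Vw.
by apply/(@cvg_cabsP _ (nbhs w)) => e e0; apply/nbhs_cabsP; exact: h.
Qed.

Lemma differentiable_cabs V w : differentiable V w ->
  exists l, forall e : R, 0 < e -> exists2 d : R, 0 < d &
    forall h, cabs h < d -> cabs (V (w + h) - V w - l * h) <= e * cabs h.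
Proof.
move=> /derivable1_diffP /cvg_ex[l /cvg_cabsP Vl]; exists l => e e0.
have /nbhs_cabsP[d d0 dP] := Vl _ e0.
exists d; first exact: d0.
move=> h hd; have [->|h0] := eqVneq h 0.
  by rewrite addr0 subrr mulr0 subr0 cabs0 mulr0.
have hd0 : cabs (h - 0) < d by rewrite subr0.
have /= := dP h hd0 h0; rewrite [h *: 1]mulr1 [h + w]addrC => qh.
rewrite (_ : _ - l * h = h * (h^-1 * (V (w + h) - V w) - l)); last first.
  by rewrite mulrBr mulrA divff// mul1r [h * l]mulrC.
by rewrite cabsM mulrC ler_wpM2r ?cabs_ge0// ltW.
Qed.

Lemma continuous_epsP (f : R -> R) (x : R) : {for x, continuous f} <->
  forall e : R, 0 < e -> exists2 d : R, 0 < d &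
    forall t, `|t - x| < d -> `|f t - f x| < e.
Proof.
split=> [fx e e0|h].
  have : nbhs x (fun t => `|f x - f t| < e) by exact: (cvgrPdist_lt _ _).1 fx e e0.
  move=> /nbhs_normP[d /= d0 dP].
  by exists d => // t td; rewrite distrC; apply: dP => /=; rewrite distrC.
apply/(@cvgrPdist_lt _ _ _ (nbhs x)) => e e0; have [d d0 dP] := h _ e0.
by apply/nbhs_normP; exists d => //= t td; rewrite distrC; apply: dP; rewrite distrC.
Qed.

Lemma continuous_line V (x y : R) : {for (x +i* y), continuous V} ->
  {for x, continuous (fun t => complex.Re (V (t +i* y)))} /\
  {for x, continuous (fun t => complex.Im (V (t +i* y)))}.
Proof.
move=> /continuous_cabsP Vc; split; apply/continuous_epsP => e e0;
  have [d d0 dP] := Vc _ e0; exists d => // t td; rewrite -?cReB -?cImB.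
  rewrite (le_lt_trans (normr_Re_le _))//; apply: dP.
  by rewrite (_ : _ - _ = (t - x)%:C) ?cabs_real//; congr (_ +i* _); rewrite subrr.
rewrite (le_lt_trans (normr_Im_le _))//; apply: dP.
by rewrite (_ : _ - _ = (t - x)%:C) ?cabs_real//; congr (_ +i* _); rewrite subrr.
Qed.

Lemma continuous_column V (x y : R) : {for (x +i* y), continuous V} ->
  {for y, continuous (fun t => complex.Re (V (x +i* t)))} /\
  {for y, continuous (fun t => complex.Im (V (x +i* t)))}.
Proof.
have E (t : R) : x +i* t - x +i* y = 'i * (t - y)%:C.
  by apply/eqP; rewrite eq_complex/=; apply/andP; split; apply/eqP; ring.
move=> /continuous_cabsP Vc; split; apply/continuous_epsP => e e0;
  have [d d0 dP] := Vc _ e0; exists d => // t td; rewrite -?cReB -?cImB.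
  rewrite (le_lt_trans (normr_Re_le _))//; apply: dP.
  by rewrite E cabsM cabs_i mul1r cabs_real.
rewrite (le_lt_trans (normr_Im_le _))//; apply: dP.
by rewrite E cabsM cabs_i mul1r cabs_real.
Qed.

End EpsilonDelta.

Section Holomorphic.
Context {R : realType}.
Implicit Types (F G : R[i] -> R[i]) (w c : R[i]).

Lemma holo_cst c w : differentiable (fun _ : R[i] => c) w.
Proof. exact: differentiable_cst. Qed.

Lemma holo_id w : differentiable (fun z : R[i] => z) w.
Proof. by apply/derivable1_diffP; exact: derivable_id. Qed.

Lemma holoD F G w : differentiable F w -> differentiable G w ->
  differentiable (fun z => F z + G z) w.
Proof. by move=> dF dG; exact: (differentiableD dF dG). Qed.

Lemma holoB F G w : differentiable F w -> differentiable G w ->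
  differentiable (fun z => F z - G z) w.
Proof. by move=> dF dG; exact: (differentiableB dF dG). Qed.

Lemma holoM F G w : differentiable F w -> differentiable G w ->
  differentiable (fun z => F z * G z) w.
Proof. by move=> dF dG; exact: (differentiableM dF dG). Qed.

Lemma holoX F k w : differentiable F w -> differentiable (fun z => F z ^+ k) w.
Proof.
move=> dF; elim: k => [|k IH].
  by under eq_fun do rewrite expr0; exact: holo_cst.
by under eq_fun do rewrite exprS; exact: holoM.
Qed.

Lemma holoV F w : differentiable F w -> F w != 0 ->
  differentiable (fun z => (F z)^-1) w.
Proof. by move=> dF F0; exact: (differentiableV dF F0). Qed.

Lemma holo_comp F G w : differentiable F w -> differentiable G (F w) ->
  differentiable (fun z => G (F z)) w.
Proof. by move=> dF dG; exact: (differentiable_comp dF dG). Qed.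

Lemma holo_cont F w : differentiable F w -> {for w, continuous F}.
Proof. exact: differentiable_continuous. Qed.

Lemma ccontB F G w : {for w, continuous F} -> {for w, continuous G} ->
  {for w, continuous (fun z => F z - G z)}.
Proof. by move=> cF cG; exact: (cvgB cF cG). Qed.

Lemma ccontM F G w : {for w, continuous F} -> {for w, continuous G} ->
  {for w, continuous (fun z => F z * G z)}.
Proof. by move=> cF cG; exact: (cvgM cF cG). Qed.

End Holomorphic.

(** * Integrals of continuous functions over segments *)

Section Segment.
Context {R : realType}.
Implicit Types (f g : R -> R) (a b c : R).

Definition segment_integral a b f : R :=
  \int[lebesgue_measure]_(x in `[a, b]) f x.
Local Notation Ri := segment_integral.

Definition cont_on a b f := forall x, a <= x <= b -> {for x, continuous f}.

Lemma cont_on_integrable a b f : cont_on a b f ->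
  lebesgue_measure.-integrable `[a, b] (EFin \o f).
Proof.
move=> cf; apply: continuous_compact_integrable; first exact: segment_compact.
apply: continuous_in_subspaceT => x; rewrite inE/= in_itv/=; exact: cf.
Qed.

Lemma segment_integral_split a b c f : a <= b -> b <= c -> cont_on a c f ->
  Ri a c f = Ri a b f + Ri b c f.
Proof.
move=> ab bc cf; rewrite /Ri; have fi := cont_on_integrable cf.
have := @Rintegral_itvB _ f (BLeft a) (BRight c) b fi; rewrite !bnd_simp.
move=> /(_ ab bc); rewrite Rintegral_itv_obnd_cbnd; last first.
  by apply: integrableS fi => //; apply: subset_itv; rewrite bnd_simp.
by move=> <-; rewrite addrC subrK.
Qed.

Lemma segment_integralD a b f g : cont_on a b f -> cont_on a b g ->
  Ri a b (fun x => f x + g x) = Ri a b f + Ri a b g.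
Proof. by move=> cf cg; rewrite /Ri RintegralD//; exact: cont_on_integrable. Qed.

Lemma segment_integralZ a b k f : cont_on a b f ->
  Ri a b (fun x => k * f x) = k * Ri a b f.
Proof. by move=> cf; rewrite /Ri RintegralZl//; exact: cont_on_integrable. Qed.

Lemma segment_integral_cst a b k : a <= b -> Ri a b (fun=> k) = k * (b - a).
Proof.
move=> ab; rewrite /Ri Rintegral_cst//= lebesgue_measure_itv/= lte_fin.
by case: ltgtP ab => //= -> _; rewrite subrr.
Qed.

Lemma eq_segment_integral a b f g : (forall x, a <= x <= b -> f x = g x) ->
  Ri a b f = Ri a b g.
Proof.
by move=> fg; apply: eq_Rintegral => x; rewrite inE/= in_itv/=; exact: fg.
Qed.

Lemma le_segment_integral a b f g : cont_on a b f -> cont_on a b g ->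
  (forall x, a <= x <= b -> f x <= g x) -> Ri a b f <= Ri a b g.
Proof.
by move=> cf cg fg; apply: le_Rintegral => //; exact: cont_on_integrable.
Qed.

Lemma normr_segment_integral_le a b f k : a <= b -> cont_on a b f ->
  (forall x, a <= x <= b -> `|f x| <= k) -> `|Ri a b f| <= k * (b - a).
Proof.
move=> ab cf fk; have cc (r : R) : cont_on a b (fun=> r).
  by move=> x _; exact: cst_continuous.
rewrite ler_norml -mulNr -!segment_integral_cst//; apply/andP; split.
  by apply: le_segment_integral => // x xab; have := fk x xab; rewrite ler_norml => /andP[].
by apply: le_segment_integral => // x xab; have := fk x xab; rewrite ler_norml => /andP[].
Qed.

Lemma segment_integral_id a b : a <= b ->
  Ri a b id = (b ^+ 2 - a ^+ 2) / 2.
Proof.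
rewrite le_eqVlt => /predU1P[->|ab].
  by rewrite subrr mul0r /Ri set_itv1 Rintegral_set1.
rewrite /Ri /Rintegral.
rewrite (@continuous_FTC2 _ id (fun x => x ^+ 2 / 2) a b)//.
- by rewrite /= -mulrBl.
- by apply: continuous_subspaceT => x; exact: cvg_id.
- split.
  + by move=> x _; apply: derivableM => //; exact: exprn_derivable.
  + by apply: cvg_at_right_filter; apply: cvgM; [exact: exprn_continuous|exact: cvg_cst].
  + by apply: cvg_at_left_filter; apply: cvgM; [exact: exprn_continuous|exact: cvg_cst].
- move=> x _; rewrite derive1E deriveM//=.
  by rewrite derive_cst scaler0 add0r exp_derive /GRing.scale/= expr1; field.
Qed.

End Segment.
Notation Ri := segment_integral.

(** * Goursat's theorem on rectangles *)

Section Rectangle.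
Context {R : realType}.
Implicit Types (V W : R[i] -> R[i]) (x y : R).

(** The real part of the integral of [V] along the boundary of the rectangle
    [x0, x1] x [y0, y1]. The imaginary part is that of [- 'i * V], so that real
    parts are enough everywhere. *)
Definition boundary_integral V x0 x1 y0 y1 : R :=
  Ri x0 x1 (fun x => complex.Re (V (x +i* y0)))
  - Ri x0 x1 (fun x => complex.Re (V (x +i* y1)))
  - Ri y0 y1 (fun y => complex.Im (V (x1 +i* y)))
  + Ri y0 y1 (fun y => complex.Im (V (x0 +i* y))).
Local Notation J := boundary_integral.

Definition rect_cont V x0 x1 y0 y1 := forall x y,
  x0 <= x <= x1 -> y0 <= y <= y1 -> {for (x +i* y), continuous V}.

Lemma rect_contS V x0 x1 y0 y1 x0' x1' y0' y1' :
  x0 <= x0' -> x1' <= x1 -> y0 <= y0' -> y1' <= y1 ->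
  rect_cont V x0 x1 y0 y1 -> rect_cont V x0' x1' y0' y1'.
Proof.
move=> h1 h2 h3 h4 cV x y /andP[a b] /andP[c d]; apply: cV.
  by rewrite (le_trans h1 a) (le_trans b h2).
by rewrite (le_trans h3 c) (le_trans d h4).
Qed.

Lemma rect_cont_line V x0 x1 y0 y1 y : rect_cont V x0 x1 y0 y1 -> y0 <= y <= y1 ->
  cont_on x0 x1 (fun x => complex.Re (V (x +i* y))).
Proof. by move=> cV yy x xx; have [] := continuous_line (cV _ _ xx yy). Qed.

Lemma rect_cont_column V x0 x1 y0 y1 x : rect_cont V x0 x1 y0 y1 -> x0 <= x <= x1 ->
  cont_on y0 y1 (fun y => complex.Im (V (x +i* y))).
Proof. by move=> cV xx y yy; have [] := continuous_column (cV _ _ xx yy). Qed.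

Lemma boundary_integral_splitx V x0 x1 x2 y0 y1 :
  x0 <= x1 -> x1 <= x2 -> y0 <= y1 -> rect_cont V x0 x2 y0 y1 ->
  J V x0 x2 y0 y1 = J V x0 x1 y0 y1 + J V x1 x2 y0 y1.
Proof.
move=> x01 x12 y01 cV; rewrite /J.
rewrite !(@segment_integral_split _ x0 x1 x2)//.
- by ring.
- by apply: rect_cont_line cV _; rewrite y01 lexx.
- by apply: rect_cont_line cV _; rewrite y01 lexx.
Qed.

Lemma boundary_integral_splity V x0 x1 y0 y1 y2 :
  x0 <= x1 -> y0 <= y1 -> y1 <= y2 -> rect_cont V x0 x1 y0 y2 ->
  J V x0 x1 y0 y2 = J V x0 x1 y0 y1 + J V x0 x1 y1 y2.
Proof.
move=> x01 y01 y12 cV; rewrite /J.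
rewrite !(@segment_integral_split _ y0 y1 y2)//.
- by ring.
- by apply: rect_cont_column cV _; rewrite x01 lexx.
- by apply: rect_cont_column cV _; rewrite x01 lexx.
Qed.

Lemma segment_integral_refl x f : Ri x x f = 0.
Proof. by rewrite /Ri set_itv1 Rintegral_set1. Qed.

Lemma boundary_integral_xx V x y0 y1 : J V x x y0 y1 = 0.
Proof. by rewrite /J !segment_integral_refl subrr sub0r addrC subrr. Qed.

Lemma boundary_integral_yy V x0 x1 y : J V x0 x1 y y = 0.
Proof. by rewrite /J !segment_integral_refl !subrr addr0. Qed.

Lemma eq_boundary_integral V W x0 x1 y0 y1 : x0 <= x1 -> y0 <= y1 ->
  (forall x y, x0 <= x <= x1 -> y0 <= y <= y1 -> V (x +i* y) = W (x +i* y)) ->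
  J V x0 x1 y0 y1 = J W x0 x1 y0 y1.
Proof.
move=> x01 y01 VW; rewrite /J; congr (_ - _ - _ + _);
  by apply: eq_segment_integral => t tt; rewrite VW ?lexx ?x01 ?y01.
Qed.

Lemma boundary_integralD V W x0 x1 y0 y1 : x0 <= x1 -> y0 <= y1 ->
  rect_cont V x0 x1 y0 y1 -> rect_cont W x0 x1 y0 y1 ->
  J (fun w => V w + W w) x0 x1 y0 y1 = J V x0 x1 y0 y1 + J W x0 x1 y0 y1.
Proof.
move=> x01 y01 cV cW; rewrite /J.
have E1 y : y0 <= y <= y1 ->
    Ri x0 x1 (fun x => complex.Re (V (x +i* y) + W (x +i* y))) =
    Ri x0 x1 (fun x => complex.Re (V (x +i* y))) +
    Ri x0 x1 (fun x => complex.Re (W (x +i* y))).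
  move=> yy; rewrite -segment_integralD; last 2 first.
  - exact: rect_cont_line cV yy.
  - exact: rect_cont_line cW yy.
  by apply: eq_segment_integral => x _; rewrite cReD.
have E2 x : x0 <= x <= x1 ->
    Ri y0 y1 (fun y => complex.Im (V (x +i* y) + W (x +i* y))) =
    Ri y0 y1 (fun y => complex.Im (V (x +i* y))) +
    Ri y0 y1 (fun y => complex.Im (W (x +i* y))).
  move=> xx; rewrite -segment_integralD; last 2 first.
  - exact: rect_cont_column cV xx.
  - exact: rect_cont_column cW xx.
  by apply: eq_segment_integral => y _; rewrite cImD.
by rewrite !E1 ?E2 ?lexx ?x01 ?y01//; ring.
Qed.

Lemma segment_integral_affine a b k c : a <= b ->
  Ri a b (fun x : R => k + c * x) = k * (b - a) + c * ((b ^+ 2 - a ^+ 2) / 2).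
Proof.
move=> ab; have ci : cont_on a b (fun x : R => x) by move=> x _; exact: cvg_id.
rewrite segment_integralD.
- by rewrite segment_integral_cst// segment_integralZ// segment_integral_id.
- by move=> x _; exact: cst_continuous.
- by move=> x _; apply: cvgM; [exact: cvg_cst|exact: cvg_id].
Qed.

Lemma boundary_integral_affine (u l p : R[i]) x0 x1 y0 y1 : x0 <= x1 -> y0 <= y1 ->
  J (fun w => u + l * (w - p)) x0 x1 y0 y1 = 0.
Proof.
move=> x01 y01; rewrite /J.
have E1 y : Ri x0 x1 (fun x => complex.Re (u + l * (x +i* y - p))) =
    Ri x0 x1 (fun x => (complex.Re u - complex.Re l * complex.Re p
       - complex.Im l * (y - complex.Im p)) + complex.Re l * x).
  apply: eq_segment_integral => x _.
  by rewrite cReD cReM cReB cImB /=; ring.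
have E2 x : Ri y0 y1 (fun y => complex.Im (u + l * (x +i* y - p))) =
    Ri y0 y1 (fun y => (complex.Im u - complex.Re l * complex.Im p
       + complex.Im l * (x - complex.Re p)) + complex.Re l * y).
  apply: eq_segment_integral => y _.
  by rewrite cImD cImM cReB cImB /=; ring.
by rewrite !E1 !E2 !segment_integral_affine//; field.
Qed.

Lemma normr_boundary_integral_le V x0 x1 y0 y1 k : x0 <= x1 -> y0 <= y1 ->
  rect_cont V x0 x1 y0 y1 ->
  (forall x y, x0 <= x <= x1 -> y0 <= y <= y1 -> cabs (V (x +i* y)) <= k) ->
  `|J V x0 x1 y0 y1| <= 2 * k * ((x1 - x0) + (y1 - y0)).
Proof.
move=> x01 y01 cV Vk.
have H1 y : y0 <= y <= y1 ->
    `|Ri x0 x1 (fun x => complex.Re (V (x +i* y)))| <= k * (x1 - x0).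
  move=> yy; apply: normr_segment_integral_le => //; first exact: rect_cont_line cV yy.
  by move=> x xx; rewrite (le_trans (normr_Re_le _))// Vk.
have H2 x : x0 <= x <= x1 ->
    `|Ri y0 y1 (fun y => complex.Im (V (x +i* y)))| <= k * (y1 - y0).
  move=> xx; apply: normr_segment_integral_le => //; first exact: rect_cont_column cV xx.
  by move=> y yy; rewrite (le_trans (normr_Im_le _))// Vk.
rewrite /J; have h0 : y0 <= y0 <= y1 by rewrite lexx.
have h1 : y0 <= y1 <= y1 by rewrite lexx y01.
have h2 : x0 <= x0 <= x1 by rewrite lexx.
have h3 : x0 <= x1 <= x1 by rewrite lexx x01.
have := H1 _ h0; have := H1 _ h1; have := H2 _ h2; have := H2 _ h3.
by rewrite !ler_norml => /andP[? ?] /andP[? ?] /andP[? ?] /andP[? ?]; apply/andP; split; lra.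
Qed.

End Rectangle.
Notation J := boundary_integral.

Section Goursat.
Context {R : realType}.
Implicit Types (V : R[i] -> R[i]) (x y : R).

Definition rect_diff V x0 x1 y0 y1 := forall x y,
  x0 <= x <= x1 -> y0 <= y <= y1 -> differentiable V (x +i* y).

Lemma rect_diff_cont V x0 x1 y0 y1 : rect_diff V x0 x1 y0 y1 ->
  rect_cont V x0 x1 y0 y1.
Proof. by move=> dV x y xx yy; apply: differentiable_continuous; exact: dV. Qed.

(** The affine part of [V] at [p] has no boundary integral, and what remains is
    small compared with the size of the rectangle. *)
Lemma boundary_integral_small V (p : R[i]) (e : R) : differentiable V p -> 0 < e ->
  exists2 d : R, 0 < d & forall x0 x1 y0 y1, x0 <= x1 -> y0 <= y1 ->
    x0 <= complex.Re p <= x1 -> y0 <= complex.Im p <= y1 ->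
    (x1 - x0) + (y1 - y0) < d -> rect_cont V x0 x1 y0 y1 ->
    `|J V x0 x1 y0 y1| <= 2 * e * ((x1 - x0) + (y1 - y0)) ^+ 2.
Proof.
move=> /differentiable_cabs[l Vl] e0; have [d d0 dP] := Vl _ e0.
exists d => // x0 x1 y0 y1 x01 y01 px py small cV.
set s := (x1 - x0) + (y1 - y0) in small *.
pose A : R[i] -> R[i] := fun w => V p + l * (w - p).
pose W : R[i] -> R[i] := fun w => V w - A w.
have cA (w : R[i]) : {for w, continuous A}.
  apply: holo_cont; apply: holoD; first exact: holo_cst.
  by apply: holoM; [exact: holo_cst|apply: holoB; [exact: holo_id|exact: holo_cst]].
have cW : rect_cont W x0 x1 y0 y1.
  by move=> x y xx yy; apply: ccontB; [exact: cV|exact: cA].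
have -> : J V x0 x1 y0 y1 = J W x0 x1 y0 y1.
  rewrite -[RHS]add0r -(boundary_integral_affine (V p) l p x01 y01).
  have cA' : rect_cont A x0 x1 y0 y1 by move=> x y _ _; exact: cA.
  rewrite -(boundary_integralD x01 y01 cA' cW).
  apply: (eq_boundary_integral x01 y01) => x y _ _.
  by rewrite /W addrC subrK.
have pw x y : x0 <= x <= x1 -> y0 <= y <= y1 -> cabs (x +i* y - p) <= s.
  move=> xx yy; rewrite (le_trans (cabs_le_ReIm _))// cReB cImB/=.
  rewrite lerD// ler_norml; apply/andP; split; lra.
rewrite (_ : 2 * e * s ^+ 2 = 2 * (e * s) * s); last by ring.
apply: normr_boundary_integral_le => // x y xx yy.
have := dP (x +i* y - p); rewrite [p + _]addrC subrK => /(_ _)/wrap[].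
  by rewrite (le_lt_trans (pw _ _ xx yy)).
rewrite /W /A opprD addrA => /le_trans; apply.
by rewrite ler_wpM2l ?(ltW e0)// pw.
Qed.

Section Bisection.
Context (V : R[i] -> R[i]) (X0 Y0 a b e : R).
Context (a0 : 0 < a) (b0 : 0 < b) (e0 : 0 < e).
Context (dV : rect_diff V X0 (X0 + a) Y0 (Y0 + b)).
Local Notation h k := (2^-1 ^+ k : R).

Let bad (k : nat) (s : R * R) : Prop :=
  [/\ X0 <= s.1 /\ s.1 + a * h k <= X0 + a,
      Y0 <= s.2 /\ s.2 + b * h k <= Y0 + b &
      e * (a * h k) * (b * h k) < `|J V s.1 (s.1 + a * h k) s.2 (s.2 + b * h k)|].

Let nested (k : nat) (s t : R * R) : Prop :=
  [/\ s.1 <= t.1, t.1 + a * h k.+1 <= s.1 + a * h k,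
      s.2 <= t.2 & t.2 + b * h k.+1 <= s.2 + b * h k].

Let h_gt0 k : 0 < h k. Proof. by rewrite exprn_gt0// invr_gt0. Qed.

Let hS k : h k = 2 * h k.+1. Proof. by rewrite exprS mulrA divff// mul1r. Qed.

Let bisect k s : bad k s -> exists t, bad k.+1 t /\ nested k s t.
Proof.
case: s => x y [/= [s1 s2] [s3 s4] s5].
have := hS k; have := h_gt0 k.+1; set u := h k.+1 => u0 hk.
rewrite hk in s2 s4 s5.
have au : 0 < a * u by rewrite mulr_gt0.
have bu : 0 < b * u by rewrite mulr_gt0.
have sx : x + a * (2 * u) = x + a * u + a * u by ring.
have sy : y + b * (2 * u) = y + b * u + b * u by ring.
rewrite {}sx {}sy in s2 s4 s5.
have cV := rect_diff_cont dV.
have Jeq : J V x (x + a * u + a * u) y (y + b * u + b * u) =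
  J V x (x + a * u) y (y + b * u) + J V (x + a * u) (x + a * u + a * u) y (y + b * u) +
  (J V x (x + a * u) (y + b * u) (y + b * u + b * u) +
   J V (x + a * u) (x + a * u + a * u) (y + b * u) (y + b * u + b * u)).
  have lx1 : x <= x + a * u by lra.
  have lx2 : x + a * u <= x + a * u + a * u by lra.
  have ly1 : y <= y + b * u by lra.
  have ly2 : y + b * u <= y + b * u + b * u by lra.
  have cQ : rect_cont V x (x + a * u + a * u) y (y + b * u + b * u).
    by apply: rect_contS cV.
  rewrite (boundary_integral_splity (le_trans lx1 lx2) ly1 ly2 cQ).
  rewrite (boundary_integral_splitx lx1 lx2 ly1); last first.
    by apply: rect_contS cQ; rewrite ?lexx.
  rewrite (boundary_integral_splitx lx1 lx2 ly2)//.
  by apply: rect_contS cQ; rewrite ?lexx.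
rewrite {}Jeq in s5.
have [t1|t1] := ltP (e * (a * u) * (b * u)) (`|J V x (x + a * u) y (y + b * u)|).
  by exists (x, y); rewrite /bad /nested /=; do !split=> //; rewrite -?/u ?hk; lra.
have [t2|t2] := ltP (e * (a * u) * (b * u))
    (`|J V (x + a * u) (x + a * u + a * u) y (y + b * u)|).
  by exists (x + a * u, y); rewrite /bad /nested /=; do !split=> //; rewrite -?/u ?hk; lra.
have [t3|t3] := ltP (e * (a * u) * (b * u))
    (`|J V x (x + a * u) (y + b * u) (y + b * u + b * u)|).
  by clear t1 t2; exists (x, y + b * u); rewrite /bad /nested /=; do !split=> //; rewrite -?/u ?hk; lra.
have [t4|t4] := ltP (e * (a * u) * (b * u))
    (`|J V (x + a * u) (x + a * u + a * u) (y + b * u) (y + b * u + b * u)|).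
  by clear t1 t2 t3; exists (x + a * u, y + b * u); rewrite /bad /nested /=; do !split=> //; rewrite -?/u ?hk; lra.
exfalso; move: s5; apply/negP; rewrite -leNgt.
rewrite (le_trans (ler_normD _ _))//.
have := lerD (le_trans (ler_normD _ _) (lerD t1 t2)) (le_trans (ler_normD _ _) (lerD t3 t4)).
move/le_trans; apply; rewrite le_eqVlt; apply/orP; left; apply/eqP; ring.
Qed.

(** If the bound failed, it would fail, in proportion, on one of the four quarters,
    and so on; the nested rectangles meet at a point where
    [boundary_integral_small] contradicts these failures. *)
Lemma goursat_bisection : `|J V X0 (X0 + a) Y0 (Y0 + b)| <= e * a * b.
Proof.
rewrite leNgt; apply/negP => J0.
pose next k s := xget s [set t | bad k.+1 t /\ nested k s t].
pose s := fix s k := if k is k'.+1 then next k' (s k') else (X0, Y0).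
have sP k : bad k (s k).
  elim: k => [|k IH]; first by rewrite /bad/= !mulr1; split.
  by rewrite /= /next; case: xgetP => [t -> []//|/(_ _)]; have [t ht] := bisect IH => /(_ t).
have sN k : nested k (s k) (s k.+1).
  by rewrite /= /next; case: xgetP => [t -> []//|/(_ _)]; have [t ht] := bisect (sP k) => /(_ t).
have mono (f g : nat -> R) : (forall k, f k <= f k.+1) -> (forall k, g k.+1 <= g k) ->
    (forall k, f k <= g k) -> exists l, forall k, f k <= l <= g k.
  move=> fS gS fg; have fn : nondecreasing_seq f by apply/nondecreasing_seqP.
  have gn : nonincreasing_seq g by apply/nonincreasing_seqP.
  have fgjk j k : f j <= g k.
    have [jk|kj] := leqP j k; first by rewrite (le_trans (fn _ _ jk)).
    by rewrite (le_trans (fg j))// gn// ltnW.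
  exists (sup (range f)) => k; apply/andP; split.
    apply: ub_le_sup; last by exists k.
    by exists (g 0) => _ [j _ <-]; exact: fgjk.
  by apply: ge_sup; [exists (f 0), 0%N|move=> _ [j _ <-]; exact: fgjk].
have [px pxP] : exists l, forall k, (s k).1 <= l <= (s k).1 + a * h k.
  apply: mono => k; try by have [] := sN k.
  by rewrite lerDl mulr_ge0 ?(ltW a0) ?(ltW (h_gt0 k)).
have [py pyP] : exists l, forall k, (s k).2 <= l <= (s k).2 + b * h k.
  apply: mono => k; try by have [] := sN k.
  by rewrite lerDl mulr_ge0 ?(ltW b0) ?(ltW (h_gt0 k)).
have dp : differentiable V (px +i* py).
  by apply: dV; [have := pxP 0%N|have := pyP 0%N]; rewrite /= expr0 mulr1.
(* with this constant the local estimate on the k-th rectangle is exactly the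
   bound that [bad k] denies *)
pose e' := e * a * b / (2 * (a + b) ^+ 2).
have ab0 : 0 < (a + b) ^+ 2 by rewrite exprn_gt0 ?addr_gt0.
have e'0 : 0 < e' by rewrite /e'; apply: divr_gt0; do ?[apply: mulr_gt0 => //]; rewrite ltr0n.
have [d d0 dP] := boundary_integral_small dp e'0.
have [k hk] : exists k, (a + b) * h k < d.
  have : (a + b) * h k @[k --> \oo] --> (a + b) * 0.
    by apply: cvgM; [exact: cvg_cst|apply: cvg_expr; rewrite ger0_norm ?invr_ge0// invf_lt1// ltr1n].
  rewrite mulr0 => /cvgrPdist_lt/(_ _ d0)[k _ /(_ k (leqnn k))] /=.
  rewrite sub0r normrN ger0_norm; first by exists k.
  by rewrite mulr_ge0 ?addr_ge0 ?(ltW a0) ?(ltW b0) ?(ltW (h_gt0 k)).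
have [[s1 s2] [s3 s4] s5] := sP k.
move: s5; apply/negP; rewrite -leNgt.
have ak : 0 < a * h k by rewrite mulr_gt0.
have bk : 0 < b * h k by rewrite mulr_gt0.
rewrite (le_trans (dP _ _ _ _ _ _ (pxP k) (pyP k) _ _))//.
- by rewrite lerDl ltW.
- by rewrite lerDl ltW.
- by rewrite ![(s k).1 + _]addrC ![(s k).2 + _]addrC !addrK -mulrDl.
- by apply: rect_contS (rect_diff_cont dV).
rewrite ![(s k).1 + _]addrC ![(s k).2 + _]addrC !addrK -mulrDl /e'.
rewrite le_eqVlt; apply/orP; left; apply/eqP; field.
by rewrite gt_eqF// addr_gt0.
Qed.

End Bisection.

Theorem goursat V x0 x1 y0 y1 : x0 <= x1 -> y0 <= y1 ->
  rect_diff V x0 x1 y0 y1 -> J V x0 x1 y0 y1 = 0.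
Proof.
rewrite le_eqVlt => /predU1P[-> *|x01]; first exact: boundary_integral_xx.
rewrite le_eqVlt => /predU1P[-> *|y01]; first exact: boundary_integral_yy.
move=> dV; apply/eqP; rewrite -normr_le0; apply/ler_addgt0Pr => e e0; rewrite add0r.
pose a := x1 - x0; pose b := y1 - y0.
have a0 : 0 < a by rewrite subr_gt0.
have b0 : 0 < b by rewrite subr_gt0.
have E1 : x1 = x0 + a by rewrite /a addrC subrK.
have E2 : y1 = y0 + b by rewrite /b addrC subrK.
have e'0 : 0 < e / (a * b) by rewrite divr_gt0 ?mulr_gt0.
rewrite E1 E2 in dV *; rewrite (le_trans (goursat_bisection a0 b0 e'0 dV))//.
by rewrite -mulrA divfK// gt_eqF// mulr_gt0.
Qed.

(** A small rectangle around [p] contributes little, by boundedness, and Goursat's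
    theorem applies to the rest. *)
Theorem goursat_except V (p : R[i]) x0 x1 y0 y1 : x0 <= x1 -> y0 <= y1 ->
  rect_cont V x0 x1 y0 y1 ->
  (forall x y, x0 <= x <= x1 -> y0 <= y <= y1 -> x +i* y != p ->
     differentiable V (x +i* y)) ->
  J V x0 x1 y0 y1 = 0.
Proof.
move=> x01 y01 cV dV.
have [pin|pout] := boolP ((x0 <= complex.Re p <= x1) && (y0 <= complex.Im p <= y1)); last first.
  apply: goursat => // x y xx yy; apply: dV => //.
  by apply: contra pout => /eqP <-; rewrite /= xx yy.
case/andP: pin; case: p dV => px py /= dV /andP[px0 px1] /andP[py0 py1].
have J0 u0 u1 v0 v1 : x0 <= u0 -> u0 <= u1 -> u1 <= x1 -> y0 <= v0 -> v0 <= v1 ->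
    v1 <= y1 -> [|| px < u0, u1 < px, py < v0, v1 < py, u0 == u1 | v0 == v1] ->
    J V u0 u1 v0 v1 = 0.
  move=> h1 h2 h3 h4 h5 h6.
  have [/eqP <- _|_] := boolP (u0 == u1); first exact: boundary_integral_xx.
  have [/eqP <- _|_] := boolP (v0 == v1); first exact: boundary_integral_yy.
  rewrite !orbF => out; apply: goursat => // x y /andP[xx0 xx1] /andP[yy0 yy1].
  apply: dV; rewrite ?(le_trans h1 xx0) ?(le_trans xx1 h3) ?(le_trans h4 yy0) ?(le_trans yy1 h6)//.
  apply: contraL out => /eqP[<- <-]; rewrite !negb_or -!leNgt.
  by rewrite xx0 xx1 yy0 yy1.
have /continuous_cabsP/(_ _ ltr01)[d d0 dP] : {for (px +i* py), continuous V}.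
  by apply: cV; rewrite ?px0 ?py0.
pose k := cabs (V (px +i* py)) + 1.
have k0 : 0 < k by rewrite ltr_wpDl ?cabs_ge0.
apply/eqP; rewrite -normr_le0; apply/ler_addgt0Pr => e e0; rewrite add0r.
(* half the side of the small square: its points are within [d] of [p], and its
   boundary integral is at most [2 k (4 n)] *)
pose n : R := Num.min (d / 4) (e / (8 * k)).
have n0 : 0 < n by rewrite lt_min !divr_gt0 ?mulr_gt0.
have nd : n <= d / 4 by rewrite ge_min lexx.
have ne : n <= e / (8 * k) by rewrite ge_min lexx orbT.
pose u0 := Num.max x0 (px - n); pose u1 := Num.min x1 (px + n).
pose v0 := Num.max y0 (py - n); pose v1 := Num.min y1 (py + n).
have hmax (z w : R) : z <= w -> [/\ z <= Num.max z (w - n), w - n <= Num.max z (w - n),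
    Num.max z (w - n) <= w & (Num.max z (w - n) == z) || (Num.max z (w - n) < w)].
  move=> zw; have [H|H] := leP z (w - n); split; rewrite ?lexx ?eqxx//; first [lra
    | by apply/orP; right; lra].
have hmin (z w : R) : w <= z -> [/\ Num.min z (w + n) <= z, Num.min z (w + n) <= w + n,
    w <= Num.min z (w + n) & (Num.min z (w + n) == z) || (w < Num.min z (w + n))].
  move=> zw; have [H|H] := leP z (w + n); split; rewrite ?lexx ?eqxx//; first [lra
    | by apply/orP; right; lra].
have hu0 := hmax _ _ px0; have hu1 := hmin _ _ px1.
have hv0 := hmax _ _ py0; have hv1 := hmin _ _ py1.
rewrite -/u0 -/u1 -/v0 -/v1 in hu0 hu1 hv0 hv1.
case: hu0 => a1 a2 a3 a4; case: hu1 => b1 b2 b3 b4.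
case: hv0 => c1 c2 c3 c4; case: hv1 => d1 d2 d3 d4.
have u01 := le_trans a3 b3; have v01 := le_trans c3 d3.
rewrite (boundary_integral_splitx a1 (le_trans u01 b1) y01 cV).
rewrite (boundary_integral_splitx u01 b1 y01); last by apply: rect_contS cV.
rewrite (J0 x0 u0) ?lexx//; [|exact: le_trans u01 b1|]; last first.
  by case/orP: a4 => [/eqP->|->]; rewrite ?eqxx ?orbT.
rewrite (J0 u1 x1) ?lexx//; [|exact: le_trans a1 u01|]; last first.
  by case/orP: b4 => [/eqP->|->]; rewrite ?eqxx ?orbT.
rewrite add0r addr0.
have cV' : rect_cont V u0 u1 y0 y1 by apply: rect_contS cV.
rewrite (boundary_integral_splity u01 c1 (le_trans v01 d1) cV').
rewrite (boundary_integral_splity u01 v01 d1); last by apply: rect_contS cV'.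
rewrite (J0 u0 u1 y0 v0) ?lexx//; [|exact: le_trans v01 d1|]; last first.
  by case/orP: c4 => [/eqP->|->]; rewrite ?eqxx ?orbT.
rewrite (J0 u0 u1 v1 y1) ?lexx//; [|exact: le_trans c1 v01|]; last first.
  by case/orP: d4 => [/eqP->|->]; rewrite ?eqxx ?orbT.
rewrite add0r addr0.
apply: le_trans (normr_boundary_integral_le u01 v01 _ (k := k) _) _.
- by apply: rect_contS cV'.
- move=> x y /andP[xx0 xx1] /andP[yy0 yy1].
  rewrite -[V _](subrK (V (px +i* py))) (le_trans (cabsD _ _))// /k addrC lerD2l.
  apply/ltW/dP; rewrite (le_lt_trans (cabs_le_ReIm _))//=.
  have : `|x - px| <= n by rewrite ler_norml; apply/andP; split; lra.
  have : `|y - py| <= n by rewrite ler_norml; apply/andP; split; lra.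
  by lra.
have s : u1 - u0 + (v1 - v0) <= 4 * n by lra.
apply: (@le_trans _ _ (2 * k * (4 * n))); first by rewrite ler_wpM2l// mulr_ge0// ltW.
rewrite (_ : 2 * k * (4 * n) = 8 * k * n); last by ring.
by rewrite mulrC -ler_pdivlMr// mulr_gt0.
Qed.

End Goursat.

(** * The complex exponential *)

Section Taylor.
Context {R : realType}.
Implicit Types (x y C r : R).

(** Iterated along successive derivatives, this yields the Taylor bounds below. *)
Lemma mean_value_power (f df : R -> R) C r k : 0 <= C -> f 0 = 0 ->
  (forall x, is_derive x 1 f (df x)) ->
  (forall x, `|x| <= r -> `|df x| <= C * `|x| ^+ k) ->
  forall x, `|x| <= r -> `|f x| <= C * `|x| ^+ k.+1.
Proof.
move=> C0 f0 dF dfC x xr.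
have cf a b : {within `[a, b], continuous f}.
  apply: derivable_within_continuous => t _; exact: ex_derive.
have main c : `|c| <= `|x| -> `|df c| * `|x| <= C * `|x| ^+ k.+1.
  move=> cx; rewrite exprSr mulrA ler_wpM2r//.
  rewrite (le_trans (dfC _ (le_trans cx xr)))// ler_wpM2l//.
  by rewrite lerXn2r ?nnegrE.
have [x0|x0] := leP 0 x.
  have [c] := MVT_segment x0 (fun t _ => dF t) (cf _ _).
  rewrite f0 !subr0 in_itv/= => /andP[c0 cx] ->; rewrite normrM main//.
  by rewrite !ger0_norm.
have [c] := MVT_segment (ltW x0) (fun t _ => dF t) (cf _ _).
rewrite f0 !sub0r in_itv/= => /andP[c0 cx] /eqP.
rewrite eqr_oppLR => /eqP ->; rewrite !normrN normrM normrN main//.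
by rewrite !ler0_norm ?lerN2// ltW.
Qed.

Lemma is_derive_half_sqr x : is_derive x 1 (fun t : R => t ^+ 2 / 2) x.
Proof.
have := @is_deriveZ _ _ _ _ 2^-1 x 1 _ (@is_deriveX _ _ (id : R -> R) 2 x 1 1 (is_derive_id x 1)).
rewrite (_ : _ \*: _ = (fun t : R => t ^+ 2 / 2)); last first.
  by apply/funext => t; rewrite !fctE /GRing.scale/= mulrC.
by rewrite /GRing.scale/= mulr1 expr1 mulrA mulVf// mul1r.
Qed.

Lemma expR_taylor2 x : `|x| <= 2^-1 ->
  `|expR x - 1 - x - x ^+ 2 / 2| <= 2 * `|x| ^+ 3.
Proof.
have e2 y : `|y| <= 2^-1 -> `|expR y| <= 2 * `|y| ^+ 0.
  move=> hy; rewrite expr0 mulr1 ger0_norm ?expR_ge0//.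
  have := expR_ge1Dx (- y); rewrite expRN.
  have := expR_gt0 y; set e := expR y => e0 h.
  have : 1 - y >= 2^-1 by move: hy; rewrite ler_norml => /andP[_]; lra.
  move=> h2; rewrite -[e]invrK -[leRHS]invrK lef_pV2 ?posrE ?invr_gt0//.
  exact: le_trans h2 h.
apply: (@mean_value_power (fun x => expR x - 1 - x - x ^+ 2 / 2)
  (fun x => expR x - 0 - 1 - x)) => //; first by rewrite expR0 expr0n/=; lra.
  by move=> y; apply: is_deriveB; exact: is_derive_half_sqr.
apply: (@mean_value_power (fun x => expR x - 0 - 1 - x)
  (fun x => expR x - 0 - 0 - 1)) => //; first by rewrite expR0; lra.
apply: (@mean_value_power (fun x => expR x - 0 - 0 - 1)
  (fun x => expR x - 0 - 0 - 0)) => //; first by rewrite expR0; lra.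
by move=> y hy; rewrite !subr0; exact: e2.
Qed.

Lemma normr_sin_le x : `|x| <= 2^-1 -> `|sin x| <= 1 * `|x| ^+ 1.
Proof.
apply: (@mean_value_power sin cos) => //; first by rewrite sin0.
by move=> y _; rewrite expr0 mulr1 ler_norml cos_le1 cos_geN1.
Qed.

Lemma cos_taylor x : `|x| <= 2^-1 -> `|cos x - 1| <= 1 * `|x| ^+ 2.
Proof.
apply: (@mean_value_power (fun x => cos x - 1) (fun x => - sin x - 0)) => //.
- by rewrite cos0 subrr.
- by move=> y hy; rewrite subr0 normrN; exact: normr_sin_le.
Qed.

Lemma sin_taylor x : `|x| <= 2^-1 -> `|sin x - x| <= 1 * `|x| ^+ 3.
Proof.
apply: (@mean_value_power (fun x => sin x - x) (fun x => cos x - 1)) => //.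
- by rewrite sin0 subrr.
- exact: cos_taylor.
Qed.

Lemma cos_taylor2 x : `|x| <= 2^-1 -> `|cos x - 1 + x ^+ 2 / 2| <= 1 * `|x| ^+ 4.
Proof.
apply: (@mean_value_power (fun x => cos x - 1 + x ^+ 2 / 2)
  (fun x => - sin x - 0 + x)) => //.
- by rewrite cos0 expr0n/=; lra.
- by move=> y; apply: is_deriveD; exact: is_derive_half_sqr.
- move=> y hy; rewrite subr0 -normrN opprD opprK; exact: sin_taylor.
Qed.

End Taylor.

Section ComplexExp.
Context {R : realType}.
Implicit Types (z w h : R[i]) (V : R[i] -> R[i]).

Definition cexp z : R[i] :=
  (expR (complex.Re z) * cos (complex.Im z)) +i*
  (expR (complex.Re z) * sin (complex.Im z)).

Lemma cexpD z w : cexp (z + w) = cexp z * cexp w.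
Proof.
rewrite /cexp cReD cImD expRD cosD sinD.
by apply/eqP; rewrite eq_complex/=; apply/andP; split; apply/eqP; ring.
Qed.

Lemma cexp0 : cexp 0 = 1.
Proof. by rewrite /cexp/= expR0 cos0 sin0 mulr0 mulr1. Qed.

Lemma cabs_cexp z : cabs (cexp z) = expR (complex.Re z).
Proof.
rewrite /cabs/= !exprMn -mulrDr cos2Dsin2 mulr1 sqrtr_sqr ger0_norm// expR_ge0.
Qed.

Lemma cexp_taylor h : cabs h <= 2^-1 ->
  cabs (cexp h - 1 - h - h ^+ 2 / 2) <= 12 * cabs h ^+ 3.
Proof.
case: h => x y; set r := cabs _ => hr.
have r0 : 0 <= r by exact: cabs_ge0.
have xr : `|x| <= r by exact: (normr_Re_le (x +i* y)).
have yr : `|y| <= r by exact: (normr_Im_le (x +i* y)).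
have P k (t : R) : `|t| <= r -> `|t| ^+ k <= r ^+ k by move=> tr; rewrite lerXn2r ?nnegrE.
have x3 := le_trans (expR_taylor2 (le_trans xr hr)) (ler_wpM2l (ler0n _ _) (P 3%N _ xr)).
have s3 := le_trans (sin_taylor (le_trans yr hr)) (ler_wpM2l ler01 (P 3%N _ yr)).
have c3 := le_trans (cos_taylor2 (le_trans yr hr)) (ler_wpM2l ler01 (P 4%N _ yr)).
have s1 : `|sin y| <= 1 by rewrite ler_norml sin_le1 sin_geN1.
have c1 : `|cos y| <= 1 by rewrite ler_norml cos_le1 cos_geN1.
set p := expR x - 1 - x - x ^+ 2 / 2 in x3.
set u := sin y - y in s3; set v := cos y - 1 + y ^+ 2 / 2 in c3.
have E : (x +i* y) ^+ 2 / 2 = ((x ^+ 2 - y ^+ 2) / 2) +i* (x * y).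
  apply: (mulIf (_ : 2%:R != 0)); first by rewrite pnatr_eq0.
  rewrite divfK ?pnatr_eq0// mulr_natr expr2 mulr2n.
  by apply/eqP; rewrite eq_complex/=; apply/andP; split; apply/eqP; field.
have RE : complex.Re (cexp (x +i* y) - 1 - x +i* y - (x +i* y) ^+ 2 / 2) =
   p * cos y + (1 + x + x ^+ 2 / 2) * v - x * y ^+ 2 / 2 - x ^+ 2 * y ^+ 2 / 4.
  by rewrite E !cReB /cexp /p /v /=; field.
have IE : complex.Im (cexp (x +i* y) - 1 - x +i* y - (x +i* y) ^+ 2 / 2) =
   p * sin y + (1 + x + x ^+ 2 / 2) * u + x ^+ 2 * y / 2.
  by rewrite E !cImB /cexp /p /u /=; field.
apply: le_trans (cabs_le_ReIm _) _; rewrite RE IE.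
have w2 : `|1 + x + x ^+ 2 / 2| <= 2.
  have := P 2%N _ xr; rewrite -normrX; move: xr; rewrite !ler_norml => /andP[? ?] /andP[? ?].
  have : r ^+ 2 <= 1 by rewrite expr_le1//; lra.
  by move=> ?; apply/andP; split; lra.
have r43 : r ^+ 4 <= r ^+ 3 by rewrite [r ^+ 4]exprS ler_piMl ?exprn_ge0//; lra.
have q1 : `|p * cos y| <= 2 * r ^+ 3.
  by rewrite normrM -[leRHS]mulr1 ler_pM.
have q2 : `|p * sin y| <= 2 * r ^+ 3.
  by rewrite normrM -[leRHS]mulr1 ler_pM.
have q3 : `|(1 + x + x ^+ 2 / 2) * v| <= 2 * r ^+ 3.
  by rewrite normrM ler_pM// (le_trans c3)// mul1r.
have q4 : `|(1 + x + x ^+ 2 / 2) * u| <= 2 * r ^+ 3.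
  by rewrite normrM ler_pM// (le_trans s3)// mul1r.
have q5 : `|x * y ^+ 2 / 2| <= r ^+ 3.
  rewrite normrM [`|x * _|]normrM normrX; apply: (@le_trans _ _ (r ^+ 3 * 1)); last by rewrite mulr1.
  rewrite [r ^+ 3]exprS; apply: ler_pM => //; last by rewrite ger0_norm//; lra.
  by rewrite ler_pM// P.
have q6 : `|x ^+ 2 * y / 2| <= r ^+ 3.
  rewrite normrM [`|x ^+ 2 * y|]normrM normrX; apply: (@le_trans _ _ (r ^+ 3 * 1)); last by rewrite mulr1.
  rewrite [r ^+ 3]exprSr; apply: ler_pM => //; last by rewrite ger0_norm//; lra.
  by rewrite ler_pM// P.
have q7 : `|x ^+ 2 * y ^+ 2 / 4| <= r ^+ 3.
  apply: le_trans r43; rewrite normrM [`|x ^+ 2 * _|]normrM !normrX.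
  apply: (@le_trans _ _ (r ^+ 4 * 1)); last by rewrite mulr1.
  rewrite (_ : r ^+ 4 = r ^+ 2 * r ^+ 2); last by rewrite -exprD.
  apply: ler_pM => //; last by rewrite ger0_norm//; lra.
  by rewrite ler_pM// P.
set a1 := p * cos y in q1 *; set a2 := _ * v in q3 *; set a3 := x * y ^+ 2 / 2 in q5 *.
set a4 := x ^+ 2 * y ^+ 2 / 4 in q7 *; set b1 := p * sin y in q2 *.
set b2 := _ * u in q4 *; set b3 := x ^+ 2 * y / 2 in q6 *.
have A : `|a1 + a2 - a3 - a4| <= `|a1| + `|a2| + `|a3| + `|a4|.
  by rewrite !(le_trans (ler_normB _ _))// lerD2r (le_trans (ler_normB _ _))// lerD2r ler_normD.
have B : `|b1 + b2 + b3| <= `|b1| + `|b2| + `|b3|.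
  by rewrite (le_trans (ler_normD _ _))// lerD2r ler_normD.
have r30 : 0 <= r ^+ 3 by rewrite exprn_ge0.
by lra.
Qed.

Lemma cabs_differentiable V w l :
  (forall e : R, 0 < e -> exists2 d : R, 0 < d &
    forall h, cabs h < d -> cabs (V (w + h) - V w - l * h) <= e * cabs h) ->
  differentiable V w.
Proof.
move=> hV; apply/derivable1_diffP; apply/cvg_ex; exists l.
apply/(@cvg_cabsP R (R[i]) (0^')) => e e0.
have e20 : 0 < e / 2 by rewrite divr_gt0.
have [d d0 dP] := hV _ e20.
apply/nbhs_cabsP; exists d; first exact: d0.
move=> h; rewrite subr0 => hd h0 /=.
have -> : h *: (1 : R[i]) = h by exact: mulr1.
rewrite -[_ *: _]/(h^-1 * _).
rewrite (_ : _ - l = h^-1 * (V (w + h) - V w - l * h)); last first.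
  by rewrite [in RHS]mulrBr [h^-1 * (l * h)]mulrCA mulVf// mulr1 [h + w]addrC.
have ch : 0 < cabs h by rewrite cabs_gt0.
rewrite cabsM cabsV mulrC ltr_pdivrMr// (le_lt_trans (dP _ hd))//.
by rewrite ltr_pM2r// ltr_pdivrMr// ltr_pMr// ltr1n.
Qed.

Lemma holo_cexp w : differentiable cexp w.
Proof.
apply: (@cabs_differentiable _ _ (cexp w)) => e e0.
pose k := expR (complex.Re w).
have k0 : 0 < k by exact: expR_gt0.
exists (Num.min 2^-1 (e / (7 * k))).
  by rewrite lt_min invr_gt0 ltr0n/= divr_gt0// mulr_gt0.
move=> h; rewrite lt_min => /andP[h1 h2].
rewrite cexpD (_ : _ - _ = cexp w * (cexp h - 1 - h)); last by ring.
have E : cexp h - 1 - h = (cexp h - 1 - h - h ^+ 2 / 2) + h ^+ 2 / 2 by rewrite subrK.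
have two : cabs (2%:R : R[i]) = 2.
  by rewrite (_ : 2%:R = (2%:R)%:C) ?cabs_real ?ger0_norm// rmorph_nat.
have B : cabs (cexp h - 1 - h) <= 7 * cabs h ^+ 2.
  rewrite E (le_trans (cabsD _ _))//.
  have := cexp_taylor (ltW h1); rewrite cabsM cabsX cabsV two.
  set r := cabs h in h1 *.
  have r0 : 0 <= r by exact: cabs_ge0.
  have : 12 * r ^+ 3 <= 6 * r ^+ 2.
    rewrite (_ : 12 * r ^+ 3 = (12 * r) * r ^+ 2); last by ring.
    by rewrite ler_wpM2r ?exprn_ge0//; lra.
  have : 0 <= r ^+ 2 by rewrite exprn_ge0.
  by lra.
rewrite cabsM cabs_cexp -/k.
apply: (le_trans (ler_wpM2l (ltW k0) B)).
rewrite (_ : k * (7 * cabs h ^+ 2) = (cabs h * (7 * k)) * cabs h); last by ring.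
by rewrite ler_wpM2r ?cabs_ge0// -ler_pdivlMr ?mulr_gt0// ltW.
Qed.

(** The function [(e^w - 1) / w] is entire, and it decays like [1 / |w|] on vertical
    strips: its powers are the multipliers that turn polynomial growth into
    decay. *)
Definition expq w : R[i] := if w == 0 then 1 else (cexp w - 1) / w.

Lemma expq0 : expq 0 = 1. Proof. by rewrite /expq eqxx. Qed.

Lemma expqE w : w * expq w = cexp w - 1.
Proof.
rewrite /expq; case: eqP => [->|/eqP w0]; first by rewrite mul0r cexp0 subrr.
by rewrite mulrC divfK.
Qed.

Lemma near_holo V W w (d : R) : 0 < d ->
  (forall h, cabs h < d -> V (w + h) = W (w + h)) ->
  differentiable W w -> differentiable V w.
Proof.
move=> d0 VW /differentiable_cabs[l hl]; apply: (@cabs_differentiable _ _ l) => e e0.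
have [d' d'0 dP] := hl _ e0; exists (Num.min d d'); first by rewrite lt_min d0.
move=> h; rewrite lt_min => /andP[hd hd']; rewrite VW//.
have := VW 0; rewrite cabs0 addr0 => /(_ d0) ->; exact: dP.
Qed.

Lemma holo_expq w : differentiable expq w.
Proof.
have [->|w0] := eqVneq w 0; last first.
  apply: (@near_holo _ (fun w => (cexp w - 1) / w) _ (cabs w)); first by rewrite cabs_gt0.
    move=> h hw; rewrite /expq; case: eqP => // /eqP; rewrite addr_eq0 => /eqP wh.
    by move: hw; rewrite wh cabsN ltxx.
  apply: holoM; first by apply: holoB; [exact: holo_cexp|exact: holo_cst].
  by apply: holoV; [exact: holo_id|].
apply: (@cabs_differentiable _ _ (2^-1)) => e e0.
exists (Num.min 2^-1 (e / 12)); first by rewrite lt_min invr_gt0 ltr0n/= divr_gt0.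
move=> h; rewrite lt_min => /andP[h1 h2]; rewrite add0r expq0.
have [->|h0] := eqVneq h 0; first by rewrite expq0 subrr mulr0 subr0 cabs0 mulr0.
have ch : 0 < cabs h by rewrite cabs_gt0.
rewrite -(ler_pM2l ch) -cabsM.
rewrite (_ : h * _ = cexp h - 1 - h - h ^+ 2 / 2); last first.
  by rewrite !mulrBr expqE mulr1 expr2; congr (_ - _); rewrite mulrCA mulrC.
apply: (le_trans (cexp_taylor (ltW h1))).
rewrite (_ : 12 * cabs h ^+ 3 = (cabs h * 12) * cabs h ^+ 2); last by ring.
rewrite (_ : _ * (e * _) = e * cabs h ^+ 2); last by ring.
by rewrite ler_wpM2r ?exprn_ge0 ?cabs_ge0// -ler_pdivlMr// ltW.
Qed.

(** Near the origin this follows from the Taylor expansion, elsewhere from the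
    trivial bound on the numerator. *)
Lemma cabs_expq_le w :
  cabs (expq w) <= 12 * expR `|complex.Re w| / (1 + cabs w).
Proof.
have c0 := cabs_ge0 w; have c1 : 0 < 1 + cabs w by rewrite ltr_pwDl.
have e1 : 1 <= expR `|complex.Re w| by rewrite -expR0 ler_expR.
have [w0|w0] := eqVneq w 0.
  by move: e1; rewrite w0 expq0 cabs1 cabs0 addr0 divr1 => e1; lra.
have cw : 0 < cabs w by rewrite cabs_gt0.
rewrite ler_pdivlMr//.
have [w1|w1] := leP (cabs w) 2^-1.
  have two : cabs (2%:R : R[i]) = 2.
    by rewrite (_ : 2%:R = (2%:R)%:C) ?cabs_real ?ger0_norm// rmorph_nat.
  have : cabs w * cabs (expq w) <= cabs w * 8.
    rewrite -cabsM expqE.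
    rewrite (_ : cexp w - 1 = (cexp w - 1 - w - w ^+ 2 / 2) + (w + w ^+ 2 / 2)); last first.
      by ring.
    apply: (le_trans (cabsD _ _)); have := cexp_taylor w1.
    have := cabsD w (w ^+ 2 / 2); rewrite cabsM cabsX cabsV two.
    set r := cabs w in c0 w1 *; set t := cabs _ ; set t' := cabs _.
    have : r ^+ 2 <= r * 1 by rewrite expr2 ler_wpM2l//; lra.
    have : r ^+ 3 <= r ^+ 2 * 2^-1 by rewrite exprSr ler_wpM2l// exprn_ge0.
    by lra.
  rewrite ler_pM2l// => h5.
  apply: (@le_trans _ _ (8 * (1 + 2^-1))); last by lra.
  by apply: ler_pM => //; [exact: cabs_ge0|lra|lra].
have : cabs w * cabs (expq w) <= 2 * expR `|complex.Re w|.
  rewrite -cabsM expqE (le_trans (cabsB _ _))// cabs1 cabs_cexp.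
  have : expR (complex.Re w) <= expR `|complex.Re w| by rewrite ler_expR ler_norm.
  by lra.
set r := cabs w in w1 *; set t := cabs _; set e := expR _ in e1 *.
have t0 : 0 <= t by exact: cabs_ge0.
have : 1 * t <= 2 * r * t by rewrite ler_wpM2r//; lra.
by lra.
Qed.

End ComplexExp.

(** * Values of decaying functions of exponential type *)

Section LineShift.
Context {R : realType}.
Implicit Types (V : R[i] -> R[i]) (T a b k : R).

Definition line_integral V y T : R := Ri (- T) T (fun t => complex.Re (V (t +i* y))).
Local Notation L := line_integral.

Lemma column_integral_le V x y0 y1 k : y0 <= y1 ->
  (forall y, y0 <= y <= y1 -> {for (x +i* y), continuous V}) ->
  (forall y, y0 <= y <= y1 -> cabs (V (x +i* y)) <= k) ->
  `|Ri y0 y1 (fun y => complex.Im (V (x +i* y)))| <= k * (y1 - y0).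
Proof.
move=> y01 cV Vk; apply: normr_segment_integral_le => // [y yy|y yy].
  by have [] := continuous_column (cV _ yy).
by rewrite (le_trans (normr_Im_le _))// Vk.
Qed.

Lemma line_integral_le V y T k : 0 <= T ->
  (forall x, - T <= x <= T -> {for (x +i* y), continuous V}) ->
  (forall x, - T <= x <= T -> cabs (V (x +i* y)) <= k) ->
  `|L V y T| <= k * (2 * T).
Proof.
move=> T0 cV Vk; rewrite (_ : 2 * T = T - - T); last by ring.
apply: normr_segment_integral_le => [|x xx|x xx]; first lra.
  by have [] := continuous_line (cV _ xx).
by rewrite (le_trans (normr_Re_le _))// Vk.
Qed.

(** Only the two short vertical sides separate the integrals along the two
    horizontal ones. *)
Lemma line_shift V T a b k : 0 <= T -> a <= b ->
  rect_cont V (- T) T a b -> J V (- T) T a b = 0 ->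
  (forall y, a <= y <= b -> cabs (V ((- T) +i* y)) <= k) ->
  (forall y, a <= y <= b -> cabs (V (T +i* y)) <= k) ->
  `|L V a T - L V b T| <= 2 * k * (b - a).
Proof.
move=> T0 ab cV; rewrite /J -/(L V a T) -/(L V b T) => J0 k1 k2.
have Tr : - T <= T <= T by rewrite lexx andbT; lra.
have Tl : - T <= - T <= T by rewrite lexx /=; lra.
have c1 := column_integral_le ab (fun y yy => cV _ _ Tr yy) k2.
have c2 := column_integral_le ab (fun y yy => cV _ _ Tl yy) k1.
set u := Ri _ _ _ in J0 c1; set v := Ri _ _ _ in J0 c2.
have -> : L V a T - L V b T = u - v by lra.
by apply: (le_trans (ler_normB _ _)); lra.
Qed.

End LineShift.
Notation L := line_integral.

Section Slope.
Context {R : realType}.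
Implicit Types (V : R[i] -> R[i]).

(** The quotient [V u / u], completed by the derivative at 0. Continuity at 0 is
    all that [goursat_except] asks of it. *)
Lemma slope_exists V : differentiable V 0 -> V 0 = 0 -> exists q : R[i] -> R[i],
  [/\ forall u, u * q u = V u, {for (0 : R[i]), continuous q} &
      forall u, u != 0 -> differentiable V u -> differentiable q u].
Proof.
move=> /differentiable_cabs[l hl] V0.
exists (fun u => if u == 0 then l else V u / u); split=> [u||u u0 dV].
- by case: eqP => [->|/eqP u0]; [rewrite mul0r V0|rewrite mulrC divfK].
- apply/continuous_cabsP => e e0; have e20 : 0 < e / 2 by rewrite divr_gt0.
  have [d d0 dP] := hl _ e20; exists d; first exact: d0.
  move=> z; rewrite subr0 eqxx => zd; case: eqP => [_|/eqP z0].
    by rewrite subrr cabs0.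
  have := dP z zd; rewrite add0r V0 subr0 => h.
  have cz : 0 < cabs z by rewrite cabs_gt0.
  rewrite -(ltr_pM2r cz) -cabsM mulrBl divfK// (le_lt_trans h)// ltr_pM2r//.
  by rewrite ltr_pdivrMr// ltr_pMr// ltr1n.
- apply: (@near_holo _ _ (fun u => V u / u) _ (cabs u)); first by rewrite cabs_gt0.
    move=> h hu; case: eqP => // /eqP; rewrite addr_eq0 => /eqP uh.
    by move: hu; rewrite uh cabsN ltxx.
  by apply: holoM; [exact: dV|apply: holoV; [exact: holo_id|exact: u0]].
Qed.

End Slope.

Section Reproducing.
Context {R : realType}.
Implicit Types (z u w : R[i]) (Q : R[i] -> R[i]).

Lemma le_of_inverse_error (g b e T0 : R) : 
  (forall T, T0 <= T -> 0 < T -> g <= b + e / T) -> g <= b.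
Proof.
move=> h; rewrite leNgt; apply/negP => bg.
pose T := Num.max (Num.max T0 1) (2 * `|e| / (g - b)).
have gb : 0 < g - b by rewrite subr_gt0.
have T1 : 1 <= T by rewrite !le_max lexx orbT.
have T0' : 0 < T by lra.
have := h T; rewrite !le_max lexx => /(_ isT T0').
have : 2 * `|e| / (g - b) <= T by rewrite !le_max lexx orbT.
rewrite ler_pdivrMr// => h1 h2.
have : e / T <= (g - b) / 2.
  rewrite ler_pdivrMr// (le_trans (ler_norm _))//.
  by rewrite -(ler_pM2l (_ : 0 < 2 :> R))// (le_trans h1)//; lra.
by lra.
Qed.

Lemma rotation_exists z : exists c : R[i], cabs c = 1 /\ c * z = (cabs z)%:C.
Proof.
have [->|z0] := eqVneq z 0; first by exists 1; rewrite cabs1 mulr0 cabs0.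
exists ((cabs z)%:C / z); rewrite divfK// cabsM cabsV cabs_real ger0_norm ?cabs_ge0//.
by rewrite divff// cabs_eq0.
Qed.

Lemma cont_on_cabs Q a b y : (forall u, {for u, continuous Q}) ->
  cont_on a b (fun t => cabs (Q (t +i* y))).
Proof.
move=> cQ t _; apply/continuous_epsP => e e0.
have /continuous_cabsP/(_ _ e0)[d d0 dP] := cQ (t +i* y).
exists d => // t' tt'.
have := dP (t' +i* y); rewrite (_ : t' +i* y - t +i* y = (t' - t)%:C); last first.
  by congr (_ +i* _); rewrite subrr.
rewrite cabs_real => /(_ tt'); apply: le_lt_trans; rewrite ler_norml; apply/andP; split.
  have := cabsD (Q (t' +i* y)) (Q (t +i* y) - Q (t' +i* y)).
  by rewrite addrC subrK cabsBC; lra.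
by have := cabsD (Q (t +i* y)) (Q (t' +i* y) - Q (t +i* y)); rewrite addrC subrK; lra.
Qed.

End Reproducing.

Section ValueAtOrigin.
Context {R : realType} (Q : R[i] -> R[i]) (g s A y H I : R).
Context (dQ : forall u, differentiable Q u) (Q0 : Q 0 = g%:C) (g0 : 0 <= g).
Context (s0 : 0 <= s) (A0 : 0 <= A) (yH : `|y| <= H).
Context (hQ : forall u, cabs (Q u) * (1 + cabs u ^+ 2) <= A * expR (s * `|complex.Im u|)).
Context (hI : forall T : R, 0 <= T -> Ri (- T) T (fun t => cabs (Q (t +i* y))) <= I).
Implicit Types (u : R[i]) (t x : R).

Let H0 : 0 <= H. Proof. exact: le_trans yH. Qed.
(* The line at height [- h] avoids the origin and lies below the line at height
   [y]. The kernel [k u] is [sin (s u) / u], written as an entire function, and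
   [K u = (Up u - Um u) / (2 i u)]. *)
Let h := H + 1.
Let h0 : 0 < h. Proof. by rewrite /h; have := H0; lra. Qed.
Let a : R[i] := 'i * s%:C.
Let Rea u : complex.Re (a * u) = - (s * complex.Im u).
Proof. by rewrite /a; case: u => ? ? /=; ring. Qed.
Let ReNa u : complex.Re (- (a * u)) = s * complex.Im u.
Proof. by rewrite cReN Rea opprK. Qed.
Let k u : R[i] := s%:C * cexp (- (a * u)) * expq (2%:R * a * u).
Let K u : R[i] := Q u * k u.
Let Up u : R[i] := Q u * cexp (a * u).
Let Um u : R[i] := Q u * cexp (- (a * u)).

Let two : (2%:R : R[i]) = (2%:R : R)%:C. Proof. by rewrite rmorph_nat. Qed.

Let KE u : K u * (2%:R * 'i * u) = Up u - Um u.
Proof.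
rewrite /K /Up /Um -mulrBr -mulrA; congr (_ * _).
have := expqE (2%:R * a * u).
have -> : cexp (2%:R * a * u) = cexp (a * u) * cexp (a * u).
  by rewrite -cexpD; congr cexp; ring.
have : cexp (a * u) * cexp (- (a * u)) = 1 by rewrite -cexpD subrr cexp0.
rewrite /k; set e1 := cexp (a * u); set e2 := cexp (- _); set e3 := expq _ => e12 E.
have -> : s%:C * e2 * e3 * (2%:R * 'i * u) = e2 * (2%:R * a * u * e3).
  by rewrite /a; ring.
by rewrite E mulrBr mulr1 mulrA [e2 * e1]mulrC e12 mul1r.
Qed.

Let expqB u : cabs (expq (2%:R * a * u)) <= 12 * expR (2 * s * `|complex.Im u|).
Proof.
apply: (le_trans (cabs_expq_le _)).
rewrite ler_pdivrMr; last by rewrite ltr_pwDl ?cabs_ge0.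
have -> : complex.Re (2%:R * a * u) = - (2 * s * complex.Im u).
  by rewrite -mulrA two cReM Rea /=; ring.
rewrite normrN normrM ger0_norm ?mulr_ge0//.
by rewrite ler_peMr ?mulr_ge0 ?expR_ge0// lerDl cabs_ge0.
Qed.

Let kB u : cabs (k u) <= 12 * s * expR (3 * s * `|complex.Im u|).
Proof.
rewrite /k cabsM [cabs (s%:C * _)]cabsM cabs_real ger0_norm// cabs_cexp ReNa.
apply: (@le_trans _ _ (s * expR (s * `|complex.Im u|) * (12 * expR (2 * s * `|complex.Im u|)))).
  apply: ler_pM; rewrite ?mulr_ge0 ?expR_ge0 ?cabs_ge0//.
  by rewrite ler_wpM2l// ler_expR ler_wpM2l// ler_norm.
set E := expR (3 * s * _).
have -> : E = expR (s * `|complex.Im u|) * expR (2 * s * `|complex.Im u|).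
  by rewrite -expRD; congr expR; ring.
by rewrite le_eqVlt; apply/orP; left; apply/eqP; ring.
Qed.

Let da u : differentiable (fun u => a * u) u.
Proof. by apply: holoM; [exact: holo_cst|exact: holo_id]. Qed.

Let dNa u : differentiable (fun u => - (a * u)) u.
Proof.
under eq_fun do rewrite -mulNr.
by apply: holoM; [exact: holo_cst|exact: holo_id].
Qed.

Let dUp u : differentiable Up u.
Proof. by apply: holoM; [exact: dQ|exact: (holo_comp (da u) (holo_cexp _))]. Qed.

Let dUm u : differentiable Um u.
Proof. by apply: holoM; [exact: dQ|exact: (holo_comp (dNa u) (holo_cexp _))]. Qed.

Let dK u : differentiable K u.
Proof.
apply: holoM; first exact: dQ.
apply: holoM; first by apply: holoM; [exact: holo_cst|exact: (holo_comp (dNa u) (holo_cexp _))].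
apply: (@holo_comp _ (fun u => 2%:R * a * u) expq); last exact: holo_expq.
by apply: holoM; [exact: holo_cst|exact: holo_id].
Qed.

(* The comparison function [B] equals 1 at the origin, has a double pole at
   [- 2 h i] and decays quadratically above the line at height [- h]. *)
Let B u : R[i] := (2%:R * 'i * h%:C) ^+ 2 / (u + 2%:R * 'i * h%:C) ^+ 2.

Let twoih : 2%:R * 'i * h%:C = 0 +i* (2 * h) :> R[i].
Proof.
by rewrite two; apply/eqP; rewrite eq_complex/=; apply/andP; split; apply/eqP; ring.
Qed.

Let den u : - h <= complex.Im u -> u + 2%:R * 'i * h%:C != 0.
Proof.
move=> hu; rewrite twoih; apply/eqP => /(congr1 (@complex.Im R)).
by rewrite cImD /= => ?; have := h0; lra.
Qed.

Let dB u : - h <= complex.Im u -> differentiable B u.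
Proof.
move=> hu; apply: holoM; first exact: holo_cst.
apply: holoV; last by rewrite expf_neq0// den.
by apply: holoX; apply: holoD; [exact: holo_id|exact: holo_cst].
Qed.

Let B0 : B 0 = 1.
Proof.
rewrite /B add0r divff// expf_neq0//; have := @den 0; rewrite add0r; apply.
by rewrite /=; have := h0; lra.
Qed.

Let Vp u : R[i] := Up u - g%:C * B u.

Let Vp0 : Vp 0 = 0.
Proof. by rewrite /Vp /Up Q0 mulr0 cexp0 B0 !mulr1 subrr. Qed.

Let dVp u : - h <= complex.Im u -> differentiable Vp u.
Proof.
move=> hu; apply: holoB; first exact: dUp.
by apply: holoM; [exact: holo_cst|exact: dB].
Qed.

Let q_exists : exists q : R[i] -> R[i],
  [/\ forall u, u * q u = Vp u, {for (0 : R[i]), continuous q} &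
      forall u, u != 0 -> differentiable Vp u -> differentiable q u].
Proof. by apply: (slope_exists (dVp _) Vp0); rewrite /=; have := h0; lra. Qed.

Let q := projT1 (cid q_exists).
Let qE u : u * q u = Vp u. Proof. by rewrite /q; case: cid => ? []. Qed.
Let q0 : {for (0 : R[i]), continuous q}. Proof. by rewrite /q; case: cid => ? []. Qed.
Let dq u : u != 0 -> differentiable Vp u -> differentiable q u.
Proof. by rewrite /q; case: cid => ? [? ? /=]; apply. Qed.

(* On the line at height [- h], [K] is the sum of [Wm], which decays downwards,
   of [Wp], which is regular and decays upwards, and of the explicit [W]. *)
Let ih : R[i] := 'i / 2%:R.
Let cih : cabs ih = 2^-1.
Proof. by rewrite cabsM cabs_i mul1r cabsV two cabs_real ger0_norm. Qed.
Let Wp u : R[i] := - ih * q u.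
Let Wm u : R[i] := ih * (Um u / u).
Let W u : R[i] := - ih * (g%:C * B u / u).

Let KW t : K (t +i* (- h)) = Wm (t +i* (- h)) + Wp (t +i* (- h)) + W (t +i* (- h)).
Proof.
set u := t +i* (- h).
have u0 : u != 0 by apply/eqP => /(congr1 (@complex.Im R)) /= ?; have := h0; lra.
have i0 : 'i != 0 :> R[i] by rewrite eq_complex/= oner_eq0 andbF.
have n2 : (2%:R : R[i]) != 0 by rewrite pnatr_eq0.
have qu : q u = (Up u - g%:C * B u) / u by rewrite -/(Vp u) -qE mulrAC divff// mul1r.
apply: (mulIf (_ : 2%:R * 'i * u != 0)); first by rewrite !mulf_neq0.
rewrite KE /Wm /Wp /W qu /ih.
have ii : 'i * 'i = -1 :> R[i] by rewrite -expr2 sqr_i.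
transitivity ((- ('i * 'i)) * (Up u - Um u)); first by rewrite ii opprK mul1r.
move: (Up u) (Um u) (B u) => z1 z2 z3.
by field; rewrite u0.
Qed.

Let ReW t : complex.Re (W (t +i* (- h))) = g * (2 * h ^+ 3) / (t ^+ 2 + h ^+ 2) ^+ 2.
Proof.
have t0 : t ^+ 2 + h ^+ 2 != 0 by rewrite gt_eqF// ltr_wpDl ?sqr_ge0// exprn_gt0.
pose d1 : R[i] := (t +i* h) ^+ 2 * (t +i* (- h)).
have n1 : (t +i* h) != 0 by apply/eqP => /(congr1 (@complex.Im R)) /= ?; have := h0; lra.
have n2 : (t +i* (- h)) != 0 by apply/eqP => /(congr1 (@complex.Im R)) /= ?; have := h0; lra.
have E : W (t +i* (- h)) =
    ((g * (2 * h ^+ 3) / (t ^+ 2 + h ^+ 2) ^+ 2) +i*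
     (g * (2 * h ^+ 2 * t) / (t ^+ 2 + h ^+ 2) ^+ 2)).
  have d10 : d1 != 0 by rewrite mulf_neq0// expf_neq0.
  have nn2 : (2%:R : R[i]) != 0 by rewrite pnatr_eq0.
  apply: (mulIf (_ : 2%:R * d1 != 0)); first by rewrite mulf_neq0.
  rewrite /W /ih /B twoih.
  have -> : t +i* (- h) + 0 +i* (2 * h) = t +i* h.
    by apply/eqP; rewrite eq_complex/=; apply/andP; split; apply/eqP; ring.
  transitivity (- ('i * g%:C * (0 +i* (2 * h)) ^+ 2)).
    rewrite /d1; move: (t +i* h) (t +i* - h) n1 n2 => z1 z2 n1 n2.
    by move: (0 +i* (2 * h)) => z3; field; rewrite n1 n2.
  rewrite /d1 two; apply/eqP; rewrite eq_complex/=; apply/andP; split; apply/eqP; field.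
    by rewrite t0.
  by rewrite t0.
by rewrite E.
Qed.

(* The integrand is nonnegative, and at least [g / (2 h)] on [- h, h]. *)
Let LW_ge T : h <= T -> g <= L W (- h) T.
Proof.
move=> Th; have hh := h0; rewrite /L.
rewrite (@eq_segment_integral _ _ _ _ (fun t => g * (2 * h ^+ 3) / (t ^+ 2 + h ^+ 2) ^+ 2)); last first.
  by move=> t _; rewrite ReW.
have cw a' b' : cont_on a' b' (fun t => g * (2 * h ^+ 3) / (t ^+ 2 + h ^+ 2) ^+ 2).
  move=> t _; apply: cvgM; first exact: cvg_cst.
  apply: cvgV; first by rewrite expf_neq0// gt_eqF// ltr_wpDl ?sqr_ge0// exprn_gt0.
  apply: (@cvg_comp _ _ _ (fun t : R => t ^+ 2 + h ^+ 2) (fun t => t ^+ 2)); last exact: exprn_continuous.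
  by apply: cvgD; [exact: exprn_continuous|exact: cvg_cst].
have pos a' b' : a' <= b' -> 0 <= Ri a' b' (fun t => g * (2 * h ^+ 3) / (t ^+ 2 + h ^+ 2) ^+ 2).
  move=> ab; rewrite -(mul0r (b' - a')) -segment_integral_cst//.
  apply: le_segment_integral; [by move=> x' _; exact: cst_continuous|exact: cw|].
  move=> x' _; apply: divr_ge0; last exact: sqr_ge0.
  by apply: mulr_ge0; [exact: g0|apply: mulr_ge0; [exact: ler0n|apply: exprn_ge0; exact: ltW]].
have i1 : - T <= - h by lra.
have i2 : - h <= h by lra.
rewrite (segment_integral_split i1 (le_trans i2 Th))//.
rewrite (segment_integral_split i2 Th)//.
have := pos _ _ i1; have := pos _ _ Th.
suff : g <= Ri (- h) h (fun t => g * (2 * h ^+ 3) / (t ^+ 2 + h ^+ 2) ^+ 2) by lra.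
have E : g = g / (2 * h) * (h - - h) by field; rewrite gt_eqF.
rewrite {1}E -segment_integral_cst//.
apply: le_segment_integral; [by move=> x' _; exact: cst_continuous|exact: cw|].
move=> x' /andP[x1 x2].
have x2h : x' ^+ 2 <= h ^+ 2.
  by rewrite -[x' ^+ 2]ger0_norm ?sqr_ge0// normrX lerXn2r ?nnegrE ?(ltW h0)// ler_norml x1.
have d1 : 0 < (x' ^+ 2 + h ^+ 2) ^+ 2 by rewrite exprn_gt0// ltr_wpDl ?sqr_ge0// exprn_gt0.
have D : (x' ^+ 2 + h ^+ 2) ^+ 2 <= (2 * h ^+ 2) ^+ 2.
  by rewrite lerXn2r ?nnegrE ?addr_ge0 ?sqr_ge0 ?mulr_ge0 ?sqr_ge0//; lra.
rewrite ler_pdivrMr ?mulr_gt0//.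
have -> : g * (2 * h ^+ 3) / (x' ^+ 2 + h ^+ 2) ^+ 2 * (2 * h) =
  g * ((2 * h ^+ 2) ^+ 2 / (x' ^+ 2 + h ^+ 2) ^+ 2) by ring.
by rewrite ler_peMr// ler_pdivlMr// mul1r.
Qed.

Let QB u T : 0 < T -> T <= cabs u ->
  cabs (Q u) <= A * expR (s * `|complex.Im u|) / T ^+ 2.
Proof.
move=> T0 Tu; have u1 : 0 < 1 + cabs u ^+ 2 by rewrite ltr_pwDl ?sqr_ge0.
have := hQ u; rewrite -ler_pdivlMr// => /le_trans; apply.
rewrite ler_wpM2l ?mulr_ge0 ?expR_ge0// lef_pV2 ?posrE ?exprn_gt0//.
have : T ^+ 2 <= cabs u ^+ 2 by rewrite lerXn2r ?nnegrE ?cabs_ge0// ltW.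
by lra.
Qed.

Let c3 := A * expR (2 * s * h).
Let c30 : 0 <= c3. Proof. by rewrite mulr_ge0 ?expR_ge0. Qed.
Let e1 := 12 * s * expR (3 * s * h) * c3.

Let e10 : 0 <= e1. Proof. by rewrite !mulr_ge0 ?expR_ge0. Qed.
Let e2 := c3 + g * (2 * h) ^+ 2.
Let e20 : 0 <= e2. Proof. by rewrite /e2; apply: addr_ge0; [exact: c30|apply: mulr_ge0; [exact: g0|exact: sqr_ge0]]. Qed.

Let yh : - h <= y.
Proof. by move: yH; rewrite ler_norml /h => /andP[? _]; lra. Qed.

Let cWm u : complex.Im u <= - h -> {for u, continuous Wm} /\ differentiable Wm u.
Proof.
move=> hu; suff d : differentiable Wm u by split; [exact: holo_cont|exact: d].
apply: holoM; first exact: holo_cst.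
apply: holoM; first exact: dUm.
apply: holoV; first exact: holo_id.
by apply/eqP => u0; move: hu; rewrite u0 /=; have := h0; lra.
Qed.

Let cq u : - h <= complex.Im u -> {for u, continuous q}.
Proof.
move=> hu; have [->|u0] := eqVneq u 0; first exact: q0.
by apply: holo_cont; apply: dq; [exact: u0|exact: dVp].
Qed.

Let cWp u : - h <= complex.Im u -> {for u, continuous Wp}.
Proof. by move=> hu; apply: ccontM; [exact: cst_continuous|exact: cq]. Qed.

Let cW t : {for (t +i* (- h)), continuous W}.
Proof.
apply: holo_cont; apply: holoM; first exact: holo_cst.
apply: holoM; first by apply: holoM; [exact: holo_cst|apply: dB; rewrite /=].
apply: holoV; first exact: holo_id.
by apply/eqP => /(congr1 (@complex.Im R)) /= ?; have := h0; lra.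
Qed.

Let LK T : L K (- h) T = L Wm (- h) T + L Wp (- h) T + L W (- h) T.
Proof.
have cL (V : R[i] -> R[i]) : (forall t, {for (t +i* (- h)), continuous V}) ->
    cont_on (- T) T (fun t => complex.Re (V (t +i* (- h)))).
  by move=> cV t _; have [] := continuous_line (cV t).
have c1 := cL _ (fun t => (@cWm (t +i* (- h)) (lexx _)).1).
have c2 := cL _ (fun t => @cWp (t +i* (- h)) (lexx _)).
have c3' := cL _ cW.
rewrite /L -segment_integralD// -segment_integralD//; last first.
  by move=> t tt; apply: cvgD; [exact: c1|exact: c2].
by apply: eq_segment_integral => t _; rewrite KW !cReD.
Qed.

Let LKy T : 0 <= T -> L K y T <= 12 * s * expR (3 * s * H) * I.
Proof.
move=> T0; have cQ := @cont_on_cabs _ Q (- T) T y (fun u => holo_cont (dQ u)).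
apply: (@le_trans _ _ (Ri (- T) T (fun t => 12 * s * expR (3 * s * H) * cabs (Q (t +i* y))))).
  apply: le_segment_integral.
  - by move=> t _; have [] := continuous_line (holo_cont (dK (t +i* y))).
  - by move=> t tt; apply: cvgM; [exact: cvg_cst|exact: cQ].
  - move=> t _; rewrite (le_trans (ler_norm _))// (le_trans (normr_Re_le _))//.
    rewrite /K cabsM mulrC ler_wpM2r ?cabs_ge0// (le_trans (kB _))//.
    by rewrite ler_wpM2l ?mulr_ge0// ler_expR/= ler_wpM2l ?mulr_ge0.
by rewrite segment_integralZ// ler_wpM2l ?mulr_ge0 ?expR_ge0// hI.
Qed.

Section FixedWindow.
Context (T : R) (T1 : 1 + h <= T).

Let T0 : 0 < T. Proof. by have := h0; have := T1; lra. Qed.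
Let Th : h <= T. Proof. by have := T1; lra. Qed.
Let T1' : 1 <= T. Proof. by have := h0; have := T1; lra. Qed.
Let Tp : 0 <= T ^- 2. Proof. by rewrite invr_ge0 exprn_ge0// ltW. Qed.
Let TTT : T ^- 2 * T = T^-1.
Proof. have T00 : T != 0 by rewrite gt_eqF.
by field. Qed.

Let TT : T ^- 2 <= T^-1.
Proof. by rewrite -TTT ler_peMr. Qed.

Let ColT x y' : `|x| = T -> T <= cabs (x +i* y').
Proof. by move=> <-; exact: (normr_Re_le (x +i* y')). Qed.
Let nT : `|T| = T. Proof. by rewrite ger0_norm// ltW. Qed.
Let nNT : `|- T| = T. Proof. by rewrite normrN. Qed.

Let KB x y' : `|x| = T -> - h <= y' <= y -> cabs (K (x +i* y')) <= e1 * T ^- 2.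
Proof.
move=> xT /andP[y1 y2].
have y'h : `|y'| <= h.
  by move: yH; rewrite !ler_norml => /andP[? ?]; apply/andP; split=> //; rewrite /h; lra.
rewrite /K cabsM mulrC /e1 -mulrA; apply: ler_pM; rewrite ?cabs_ge0//.
  by apply: (le_trans (kB _)); rewrite ler_wpM2l ?mulr_ge0// ler_expR/= ler_wpM2l ?mulr_ge0.
apply: (le_trans (QB T0 (ColT _ xT))); rewrite ler_wpM2r//.
rewrite /c3 ler_wpM2l// ler_expR/=.
have : s * `|y'| <= s * h by rewrite ler_wpM2l.
have : 0 <= s * h by rewrite mulr_ge0// ltW.
by lra.
Qed.

Let S1 : `|L K (- h) T - L K y T| <= 4 * e1 * h / T.
Proof.
have S : `|L K (- h) T - L K y T| <= 2 * (e1 * T ^- 2) * (y - - h).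
  apply: line_shift; first exact: ltW.
  - exact: yh.
  - by move=> x' y' _ _; exact: holo_cont.
  - apply: goursat; [by have := T0; lra|exact: yh|by move=> ? ? _ _; exact: dK].
  - by move=> y'; exact: KB.
  - by move=> y'; exact: KB.
apply: (le_trans S).
have yh' : y <= h by move: yH; rewrite ler_norml /h => /andP[_ ?]; lra.
rewrite (_ : 4 * e1 * h / T = 2 * (e1 * T^-1) * (2 * h)); last by ring.
have ? := yh.
apply: ler_pM; rewrite ?mulr_ge0//; first lra.
- by rewrite ler_wpM2l// ler_wpM2l.
- lra.
Qed.

Let WmB u : complex.Im u <= 0 -> T <= cabs u -> cabs (Wm u) <= A * T ^- 2.
Proof.
move=> u0 Tu; rewrite /Wm /Um cabsM cih [cabs (_ / u)]cabsM [cabs (Q u * _)]cabsM cabs_cexp ReNa cabsV.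
have Q1 : cabs (Q u) * expR (s * complex.Im u) <= A * T ^- 2.
  apply: (le_trans (ler_wpM2r (expR_ge0 _) (QB T0 Tu))).
  rewrite ler0_norm// [X in X <= _](_ : _ = A * T ^- 2 *
    (expR (s * - complex.Im u) * expR (s * complex.Im u))); last by ring.
  by rewrite -expRD mulrN addNr expR0 mulr1.
have u1 : (cabs u)^-1 <= 1 by rewrite invf_le1; [exact: le_trans T1' Tu|exact: lt_le_trans T0 Tu].
rewrite -[leRHS]mul1r; apply: ler_pM => //.
- by rewrite mulr_ge0 ?invr_ge0 ?cabs_ge0// mulr_ge0 ?cabs_ge0 ?expR_ge0.
- lra.
- rewrite -[leRHS]mulr1; apply: ler_pM => //; last by rewrite invr_ge0 cabs_ge0.
  by rewrite mulr_ge0 ?cabs_ge0 ?expR_ge0.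
Qed.

Let S2 : `|L Wm (- h) T| <= 4 * A / T.
Proof.
have hh := h0; have TT0 := T0; have hT : - T <= - h by rewrite lerN2.
have S : `|L Wm (- T) T - L Wm (- h) T| <= 2 * (A * T ^- 2) * (- h - - T).
  apply: line_shift; [exact: ltW|exact: hT| | | |].
  - by move=> x' y' _ /andP[_ hy']; have [] := @cWm (x' +i* y') hy'.
  - apply: goursat; [by lra|exact: hT|].
    by move=> x' y' _ /andP[_ hy']; have [] := @cWm (x' +i* y') hy'.
  - by move=> y' /andP[_ ?]; apply: WmB; [rewrite /=; lra|exact: ColT].
  - by move=> y' /andP[_ ?]; apply: WmB; [rewrite /=; lra|exact: ColT].
have S' : `|L Wm (- T) T| <= A * T ^- 2 * (2 * T).
  apply: line_integral_le; first exact: ltW.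
  - by move=> x' _; have [] := @cWm (x' +i* (- T)) hT.
  - move=> x' _; apply: WmB; first by rewrite /=; lra.
    by rewrite -[leLHS]nNT; exact: (normr_Im_le (x' +i* (- T))).
have E : 2 * (A * T ^- 2) * (- h - - T) + A * T ^- 2 * (2 * T) <= 4 * A / T.
  have -> : 2 * (A * T ^- 2) * (- h - - T) + A * T ^- 2 * (2 * T) =
    4 * A * (T ^- 2 * T) - 2 * (A * T ^- 2) * h by ring.
  by rewrite TTT lerBlDr lerDl !mulr_ge0// ltW.
apply: le_trans E; rewrite -[L Wm (- h) T](subKr (L Wm (- T) T)).
by apply: (le_trans (ler_normB _ _)); rewrite addrC lerD.
Qed.

Let WpB u : - h <= complex.Im u -> T <= cabs u -> T <= cabs (u + 2%:R * 'i * h%:C) ->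
  cabs (Wp u) <= e2 * T ^- 2.
Proof.
move=> hu Tu Tu'; have u1 : 1 <= cabs u := le_trans T1' Tu.
have q1 : cabs (q u) <= cabs (Vp u) by rewrite -qE cabsM ler_peMl ?cabs_ge0.
have B1 : cabs (B u) <= (2 * h) ^+ 2 * T ^- 2.
  rewrite /B cabsM cabsV !cabsX; apply: ler_pM; rewrite ?exprn_ge0 ?invr_ge0 ?exprn_ge0 ?cabs_ge0//.
    by rewrite twoih /cabs/= expr0n/= add0r sqrtr_sqr ger0_norm// mulr_ge0// ltW.
  rewrite lef_pV2 ?posrE ?exprn_gt0//; last exact: lt_le_trans Tu'.
  by rewrite lerXn2r ?nnegrE ?cabs_ge0 ?(ltW T0).
have U1 : cabs (Up u) <= c3 * T ^- 2.
  rewrite /Up cabsM cabs_cexp Rea.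
  apply: (le_trans (ler_wpM2r (expR_ge0 _) (QB T0 Tu))).
  rewrite mulrAC; apply: ler_wpM2r; first exact: Tp.
  rewrite -mulrA; apply: ler_wpM2l; first exact: A0.
  rewrite -expRD ler_expR.
  have hs : 0 <= s * h by rewrite mulr_ge0// ltW.
  have [v0|v0] := leP 0 (complex.Im u); first by rewrite ger0_norm// subrr; lra.
  rewrite ltr0_norm// mulrN.
  have : s * (- complex.Im u) <= s * h by rewrite ler_wpM2l//; lra.
  by lra.
have V1 : cabs (Vp u) <= e2 * T ^- 2.
  apply: (le_trans (cabsB _ _)); rewrite cabsM cabs_real (ger0_norm g0) /e2 mulrDl lerD//.
  by rewrite -mulrA ler_wpM2l.
by rewrite /Wp cabsM cabsN cih; have := cabs_ge0 (q u); lra.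
Qed.

Let S3 : `|L Wp (- h) T| <= 6 * e2 / T.
Proof.
have hh := h0.
have colB x' y' : `|x'| = T -> T <= cabs (x' +i* y' + 2%:R * 'i * h%:C).
  by move=> xT; rewrite twoih complexD addr0; exact: ColT.
have hTh := Th; have TT0 := T0; have hT : - h <= T by lra.
have S : `|L Wp (- h) T - L Wp T T| <= 2 * (e2 * T ^- 2) * (T - - h).
  apply: line_shift; [exact: ltW|exact: hT| | | |].
  - by move=> x' y' _ /andP[hy' _]; exact: cWp.
  - apply: (@goursat_except _ _ 0); [lra|exact: hT| |].
      by move=> x' y' _ /andP[hy' _]; exact: cWp.
    move=> x' y' _ /andP[hy' _] u0; apply: holoM; first exact: holo_cst.
    by apply: dq; [exact: u0|exact: dVp].
  - by move=> y' /andP[? _]; apply: WpB => //; [exact: ColT|exact: colB].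
  - by move=> y' /andP[? _]; apply: WpB => //; [exact: ColT|exact: colB].
have S' : `|L Wp T T| <= e2 * T ^- 2 * (2 * T).
  apply: line_integral_le; first exact: ltW.
  - by move=> x' _; apply: cWp; rewrite /=; lra.
  - move=> x' _; apply: WpB; first by rewrite /=; lra.
      by rewrite -[leLHS]nT; exact: (normr_Im_le (x' +i* T)).
    by apply: (le_trans _ (normr_Im_le _)); rewrite twoih /= ger0_norm; lra.
have E : 2 * (e2 * T ^- 2) * (T - - h) + e2 * T ^- 2 * (2 * T) <= 6 * e2 / T.
  have : 2 * (e2 * T ^- 2) * (T - - h) <= 2 * (e2 * T ^- 2) * (2 * T).
    by rewrite ler_wpM2l ?mulr_ge0//; lra.
  have -> : 6 * e2 / T = 6 * e2 * (T ^- 2 * T) by rewrite TTT.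
  by lra.
apply: le_trans E; rewrite -[L Wp (- h) T](subrK (L Wp T T)).
by apply: (le_trans (ler_normD _ _)); rewrite lerD.
Qed.

Lemma value_at_origin_window :
  g <= 12 * s * expR (3 * s * H) * I + (4 * e1 * h + 4 * A + 6 * e2) / T.
Proof.
have := LW_ge Th; have := LK T; have := LKy (ltW T0); rewrite !mulrDl.
move: S1 S2 S3; rewrite !ler_norml => /andP[a1 a2] /andP[b1 b2] /andP[d1 d2].
lra.
Qed.

End FixedWindow.

(** The function [Q u sin (s u) / u] is entire, so its line of integration may be
    moved down to a line avoiding the origin; there the sine is split into two
    exponentials. One of them decays downwards and contributes nothing in the
    limit. The other one decays upwards, and contributes nothing either once the
    value [g] at the origin, times the comparison function [B], is subtracted;
    the integral of that comparison term is at least [g]. *)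
Lemma value_at_origin_le : g <= 12 * s * expR (3 * s * H) * I.
Proof.
apply: (@le_of_inverse_error _ _ _ (4 * e1 * h + 4 * A + 6 * e2) (1 + h)) => T T1 _.
exact: value_at_origin_window.
Qed.

End ValueAtOrigin.

(** * Pointwise bounds in a strip by integrals over the real line *)

Section Shift.
Context {R : realType}.
Local Notation mu := (@lebesgue_measure R).
Local Open Scope ereal_scope.

Lemma measurable_shift (x : R) : measurable_fun [set: measurableTypeR R]
  (fun t : R => (x + t)%R : measurableTypeR R).
Proof. exact: measurable_funD. Qed.

Lemma lebesgue_measure_shift (x : R) (A : set R) : measurable A ->
  pushforward mu (fun t : R => (x + t)%R : measurableTypeR R) A = mu A.
Proof.
move=> mA; have mS := measurable_shift x.
apply/esym/lebesgue_measure_unique => //= _ [[a b]] _ <-.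
rewrite /pushforward (_ : _ @^-1` _ = `](a - x)%R, (b - x)%R]%classic); last first.
  apply/seteqP; split=> t /=; rewrite !in_itv/= => /andP[h1 h2]; apply/andP; split; lra.
rewrite !lebesgue_measure_itv/= !lte_fin ltrD2r; case: ifPn => // _.
by rewrite -!EFinB; congr (_%:E); ring.
Qed.

Lemma ge0_integral_shift (x : R) (f : R -> \bar R) :
  measurable_fun [set: measurableTypeR R] f -> (forall t, 0 <= f t) ->
  \int[mu]_t f (x + t)%R = \int[mu]_t f t.
Proof.
move=> mf f0; have mS := measurable_shift x.
rewrite -[LHS](@ge0_integral_pushforward _ _ _ _ _ _ mS mu setT f)//.
by apply: eq_measure_integral => A mA _; exact: lebesgue_measure_shift.
Qed.

End Shift.

Section StripBound.
Context {R : realType}.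
Implicit Types (w : R[i]) (F G : R[i] -> R[i]).
Local Notation mu := (@lebesgue_measure R).

Lemma segment_integral_le_integral a b (f phi : R -> R) k I :
  cont_on a b f -> 0 <= k -> measurable_fun [set: R] phi ->
  (forall t, 0 <= f t <= k * phi t) -> (forall t, 0 <= phi t) ->
  (\int[mu]_t (phi t)%:E <= I%:E)%E -> Ri a b f <= k * I.
Proof.
move=> cf k0 mphi fphi phi0 hI.
have fi := cont_on_integrable cf.
have mf : measurable_fun `[a, b] (EFin \o f) by case/integrableP : fi.
rewrite -lee_fin /Ri /Rintegral fineK; last exact: integrable_fin_num.
have mkphi : measurable_fun [set: R] (fun t => (k * phi t)%:E).
  by apply/measurable_EFinP; exact: measurable_funM.
apply: (@le_trans _ _ (\int[mu]_(t in `[a, b]) (k * phi t)%:E)%E).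
  apply: ge0_le_integral => //.
  - by move=> t _; rewrite lee_fin; case/andP: (fphi t).
  - exact: measurable_funS mkphi.
  - by move=> t _; rewrite lee_fin; case/andP: (fphi t).
apply: (@le_trans _ _ (\int[mu]_t (k * phi t)%:E)%E).
  by apply: ge0_subset_integral => // t _; rewrite lee_fin mulr_ge0.
under eq_integral do rewrite EFinM.
rewrite ge0_integralZl_EFin//.
- by rewrite EFinM lee_wpmul2l.
- by move=> t _; rewrite lee_fin.
- exact/measurable_EFinP.
Qed.

Lemma measurable_cabs_line0 G (y p : R) : (forall w, {for w, continuous G}) ->
  measurable_fun [set: R] (fun t : R => cabs (G (t +i* y)) `^ p).
Proof.
move=> cG; have m : measurable_fun [set: R] (fun t : R => cabs (G (t +i* y))).
  apply: continuous_measurable_fun => t.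
  by have := @cont_on_cabs _ G t t y cG; apply; rewrite lexx.
exact: (measurableT_comp (measurable_powR p) m).
Qed.

Lemma measurable_cabs_line G (x y p : R) : (forall w, {for w, continuous G}) ->
  measurable_fun [set: R] (fun t : R => cabs (G ((x + t) +i* y)) `^ p).
Proof.
move=> cG; apply: (measurableT_comp (measurable_cabs_line0 y p cG)).
exact: measurable_shift.
Qed.

(** A translation and a rotation of the values reduce this to
    [value_at_origin_le]. *)
Lemma decaying_value_le G (s A H I : R) : 0 <= s -> 0 <= A -> 0 <= H ->
  (forall w, differentiable G w) ->
  (forall w, cabs (G w) * (1 + cabs w ^+ 2) <= A * expR (s * `|complex.Im w|)) ->
  (forall x T : R, 0 <= T -> Ri (- T) T (fun t => cabs (G ((x + t) +i* 0))) <= I) ->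
  forall w, `|complex.Im w| <= H -> cabs (G w) <= 12 * s * expR (3 * s * H) * I.
Proof.
move=> s0 A0 H0 dG hG hI w wH.
have [c [c1 cw]] := rotation_exists (G w).
pose Q u : R[i] := c * G (u + w).
pose A' := 2 * (1 + cabs w ^+ 2) * A * expR (s * `|complex.Im w|).
have dQ u : differentiable Q u.
  apply: holoM; first exact: holo_cst.
  apply: (@holo_comp _ (fun u => u + w) G); last exact: dG.
  by apply: holoD; [exact: holo_id|exact: holo_cst].
apply: (@value_at_origin_le _ Q _ s A' (- complex.Im w) H I) => //.
- by rewrite /Q add0r.
- exact: cabs_ge0.
- have w2 := sqr_ge0 (cabs w).
  apply: mulr_ge0; last exact: expR_ge0.
  by apply: mulr_ge0; [lra|exact: A0].
- by rewrite normrN.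
- move=> u; rewrite /Q cabsM c1 mul1r.
  have h1 : 1 + cabs u ^+ 2 <= 2 * (1 + cabs w ^+ 2) * (1 + cabs (u + w) ^+ 2).
    have t : cabs u <= cabs (u + w) + cabs w by have := cabsB (u + w) w; rewrite addrK.
    have := cabs_ge0 u; have := cabs_ge0 w; have := cabs_ge0 (u + w).
    move: t; set a := cabs u; set b := cabs w; set d := cabs (u + w) => t d0 b0 a0.
    have : a ^+ 2 <= (d + b) ^+ 2 by rewrite lerXn2r ?nnegrE ?addr_ge0.
    have : 0 <= (d - b) ^+ 2 by exact: sqr_ge0.
    have : 0 <= b ^+ 2 * d ^+ 2 by rewrite mulr_ge0 ?sqr_ge0.
    by nra.
  apply: (le_trans (ler_wpM2l (cabs_ge0 _) h1)).
  rewrite (_ : cabs (G (u + w)) * _ = 2 * (1 + cabs w ^+ 2) *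
    (cabs (G (u + w)) * (1 + cabs (u + w) ^+ 2))); last by ring.
  have w1 : 0 <= 2 * (1 + cabs w ^+ 2) by have := sqr_ge0 (cabs w); lra.
  apply: (le_trans (ler_wpM2l w1 (hG _))).
  rewrite (_ : A' * _ = 2 * (1 + cabs w ^+ 2) *
    (A * (expR (s * `|complex.Im w|) * expR (s * `|complex.Im u|)))); last by rewrite /A'; ring.
  apply: ler_wpM2l => //; apply: ler_wpM2l => //.
  by rewrite -expRD ler_expR -mulrDr ler_wpM2l// cImD addrC ler_normD.
- move=> T T0; have := hI (complex.Re w) T T0.
  rewrite (@eq_segment_integral _ _ _ (fun t => cabs (Q (t +i* - complex.Im w)))
    (fun t => cabs (G ((complex.Re w + t) +i* 0))))// => t _.
  rewrite /Q cabsM c1 mul1r; congr (cabs (G _)); case: (w) => a b /=.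
  by rewrite complexD addNr addrC.
Qed.

(** For an exponent [q <= 1] the supremum over the strip may be divided out,
    because it is finite. *)
Lemma nikolskii_strip G (q s A H I : R) : 0 < q -> q <= 1 -> 0 <= s -> 0 <= A -> 0 <= H ->
  (forall w, differentiable G w) ->
  (forall w, cabs (G w) * (1 + cabs w ^+ 2) <= A * expR (s * `|complex.Im w|)) ->
  (\int[mu]_t (cabs (G (t +i* 0)) `^ q)%:E <= I%:E)%E ->
  forall w, `|complex.Im w| <= H -> cabs (G w) `^ q <= 12 * s * expR (3 * s * H) * I.
Proof.
move=> q0 q1 s0 A0 H0 dG hG hI w0 w0H.
set C := 12 * s * expR (3 * s * H).
have C0 : 0 <= C by apply: mulr_ge0; [rewrite mulr_ge0|exact: expR_ge0].
have cG w : {for w, continuous G} by exact: holo_cont.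
pose S := [set cabs (G w) | w in [set w | `|complex.Im w| <= H]].
have Sbd w : `|complex.Im w| <= H -> cabs (G w) <= A * expR (s * H).
  move=> wH; have w2 := sqr_ge0 (cabs w).
  apply: (@le_trans _ _ (cabs (G w) * (1 + cabs w ^+ 2))).
    by rewrite ler_peMr ?cabs_ge0//; lra.
  by rewrite (le_trans (hG _))// ler_wpM2l// ler_expR ler_wpM2l.
have supS : has_sup S.
  split; first by exists (cabs (G w0)), w0.
  by exists (A * expR (s * H)) => _ [w wH <-]; exact: Sbd.
pose M := sup S.
have leM w : `|complex.Im w| <= H -> cabs (G w) <= M.
  by move=> wH; apply: sup_upper_bound => //; exists w.
have M0 : 0 <= M by rewrite (le_trans (cabs_ge0 (G w0)))// leM.
have split_pow a : 0 <= a -> a <= M -> a <= M `^ (1 - q) * a `^ q.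
  move=> a0 aM; have [->|an0] := eqVneq a 0; first by rewrite mulr_ge0 ?powR_ge0.
  rewrite -{1}[a]powRr1// -[X in a `^ X](subrK q) powRD; last by rewrite an0 implybT.
  rewrite ler_wpM2r ?powR_ge0// ge0_ler_powR ?nnegrE// subr_ge0//.
have key w : `|complex.Im w| <= H -> cabs (G w) <= C * (M `^ (1 - q) * I).
  apply: (decaying_value_le s0 A0 H0 dG hG) => x T T0.
  apply: (@segment_integral_le_integral _ _ _ (fun t => cabs (G ((x + t) +i* 0)) `^ q)).
  - have cGx z : {for z, continuous (fun u : R[i] => G (x%:C + u))}.
      apply: holo_cont; apply: (@holo_comp _ (fun u => x%:C + u) G); last exact: dG.
      by apply: holoD; [exact: holo_cst|exact: holo_id].
    have := @cont_on_cabs _ _ (- T) T 0 cGx.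
    rewrite (_ : (fun t => cabs (G (x%:C + t +i* 0))) = (fun t => cabs (G ((x + t) +i* 0))))//.
    by apply/funext => t; rewrite complexD addr0.
  - exact: powR_ge0.
  - exact: measurable_cabs_line.
  - move=> t; rewrite cabs_ge0/=; apply: split_pow; first exact: cabs_ge0.
    by apply: leM; rewrite /= normr0.
  - by move=> t; exact: powR_ge0.
  - rewrite (ge0_integral_shift x (f := fun t => (cabs (G (t +i* 0)) `^ q)%:E))//.
    + by apply/measurable_EFinP; exact: measurable_cabs_line0.
    + by move=> t; rewrite lee_fin powR_ge0.
have Mle : M <= C * (M `^ (1 - q) * I).
  by apply: sup_le_ub; [case: supS|move=> _ [w wH <-]; exact: key].
apply: (@le_trans _ _ (M `^ q)).
  by apply: ge0_ler_powR; rewrite ?nnegrE ?cabs_ge0 ?leM// ltW.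
have I0 : 0 <= I.
  rewrite -lee_fin; apply: le_trans hI; apply: integral_ge0 => t _.
  by rewrite lee_fin powR_ge0.
have [->|Mn0] := eqVneq M 0; first by rewrite powR0 ?gt_eqF// mulr_ge0.
have Mp : 0 < M by rewrite lt_def Mn0.
rewrite -(ler_pM2l (powR_gt0 (1 - q) Mp)) -powRD ?Mn0 ?implybT// subrK powRr1//.
by rewrite mulrCA.
Qed.

(** Plancherel-Polya in pointwise form. The power [M] brings the exponent below
    1, and the power [L] of [expq] makes the function decay while keeping its
    value at the chosen point; on the real line it leaves an integrable weight. *)
Theorem strip_bound (N : nat) (sg H p : R) : 0 <= sg -> 0 <= H -> 0 < p ->
  exists C : R, 0 < C /\ forall F (A : R), (forall w, differentiable F w) -> 0 <= A ->
    (forall w, cabs (F w) <= A * (1 + cabs w) ^+ N * expR (sg * `|complex.Im w|)) ->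
    forall x y, `|y| <= H ->
      ((cabs (F (x +i* y)) `^ p)%:E <=
       \int[mu]_t (C * (cabs (F ((x + t) +i* 0)) `^ p * (1 + t ^+ 2)^-1))%:E)%E.
Proof.
move=> sg0 H0 p0.
pose M := Num.Def.archi_bound p.
have pM : p < M%:R by apply: archi_boundP; exact: ltW.
have M0 : 0 < M%:R :> R by exact: lt_trans pM.
pose q := p / M%:R.
have q0 : 0 < q by rewrite divr_gt0.
have q1 : q <= 1 by rewrite ler_pdivrMr// mul1r ltW.
have Mq : M%:R * q = p by rewrite mulrCA divff ?mulr1// gt_eqF.
pose L0 := Num.Def.archi_bound (2 / q).
(* [N * M] powers of [expq] absorb the growth of [F ^+ M], two more make the
   product integrable, and [L0] gives the weight [(1 + |t|)^-2] on the real line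
   after raising to the power [q] *)
pose L := (N * M + 2 + L0)%N.
have Lq : 2 <= L%:R * q.
  rewrite -ler_pdivrMr//; apply: (@le_trans _ _ L0%:R).
    by apply/ltW/archi_boundP; rewrite divr_ge0// ltW.
  by rewrite ler_nat leq_addl.
pose s : R := M%:R * sg + L%:R.
have L2 : 0 < L%:R :> R by rewrite ltr0n /L addn2.
have s0 : 0 < s by rewrite ltr_wpDl// mulr_ge0// ltW.
pose C1 := 12 * s * expR (3 * s * H).
have C10 : 0 < C1 by rewrite !mulr_gt0 ?expR_gt0.
pose k3 : R := 12 * expR H.
have k30 : 0 < k3 by rewrite mulr_gt0 ?expR_gt0.
pose C3 := k3 `^ (L%:R * q).
have C30 : 0 < C3 by rewrite powR_gt0.
exists (C1 * C3); split; first by rewrite mulr_gt0.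
move=> F A dF A0 hF x y yH.
pose phi t := cabs (F ((x + t) +i* 0)) `^ p * (1 + t ^+ 2)^-1.
have t2 t : 0 < 1 + t ^+ 2 :> R by rewrite ltr_pwDl ?sqr_ge0.
have phi0 t : 0 <= phi t by rewrite mulr_ge0 ?powR_ge0// invr_ge0 ltW.
have mphi : measurable_fun [set: R] phi.
  apply: measurable_funM; first by apply: measurable_cabs_line => w; exact: holo_cont.
  apply: continuous_measurable_fun => t; apply: cvgV; first by rewrite gt_eqF.
  by apply: cvgD; [exact: cvg_cst|exact: exprn_continuous].
rewrite (_ : (\int[mu]_t _)%E = ((C1 * C3)%:E * \int[mu]_t (phi t)%:E)%E); last first.
  under eq_integral do rewrite EFinM.
  rewrite ge0_integralZl_EFin//.
  - by move=> t _; rewrite lee_fin; exact: phi0.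
  - exact/measurable_EFinP.
  - by rewrite mulr_ge0// ltW.
have I00 : (0 <= \int[mu]_t (phi t)%:E)%E by apply: integral_ge0 => t _; rewrite lee_fin.
have [Ioo|Ifin] := eqVneq (\int[mu]_t (phi t)%:E)%E +oo%E.
  by rewrite Ioo gt0_muley ?leey// lte_fin mulr_gt0.
have Inum : (\int[mu]_t (phi t)%:E)%E \is a fin_num.
  by rewrite ge0_fin_numE// ltey.
pose I0 := fine (\int[mu]_t (phi t)%:E)%E.
have EI : (\int[mu]_t (phi t)%:E)%E = I0%:E by rewrite fineK.
rewrite EI -EFinM lee_fin.
(* [expq (v w)] is 1 at [w = i y], and decays along horizontal lines *)
pose v w : R[i] := 'i * (w - 0 +i* y).
have Rev w : complex.Re (v w) = y - complex.Im w.
  by rewrite /v; case: w => a b /=; ring.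
have cv w : cabs (v w) = cabs (w - 0 +i* y) by rewrite /v cabsM cabs_i mul1r.
pose G w : R[i] := F (w + x%:C) ^+ M * expq (v w) ^+ L.
have dG w : differentiable G w.
  apply: holoM; apply: holoX.
    apply: (@holo_comp _ (fun w => w + x%:C) F); last exact: dF.
    by apply: holoD; [exact: holo_id|exact: holo_cst].
  apply: (@holo_comp _ v expq); last exact: holo_expq.
  apply: holoM; first exact: holo_cst.
  by apply: holoB; [exact: holo_id|exact: holo_cst].
have expqv w : cabs (expq (v w)) * (1 + cabs (w - 0 +i* y)) <= k3 * expR `|complex.Im w|.
  have c1 : 0 < 1 + cabs (w - 0 +i* y) by rewrite ltr_pwDl ?cabs_ge0.
  rewrite -ler_pdivlMr// -cv (le_trans (cabs_expq_le _))//.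
  rewrite ler_wpM2r ?invr_ge0 ?addr_ge0 ?cabs_ge0// /k3 -mulrA ler_wpM2l// -expRD ler_expR.
  by rewrite Rev (le_trans (ler_normB _ _))// lerD2r.
pose A' := (A * (1 + `|x|) ^+ N) ^+ M * (k3 * (1 + H)) ^+ L.
have A'0 : 0 <= A'.
  apply: mulr_ge0; apply: exprn_ge0; apply: mulr_ge0 => //.
  - exact: ltW.
  - by rewrite addr_ge0.
have hG w : cabs (G w) * (1 + cabs w ^+ 2) <= A' * expR (s * `|complex.Im w|).
  have w0 := cabs_ge0 w; have z0 := cabs_ge0 (w - 0 +i* y).
  have zw : 1 + cabs w <= (1 + H) * (1 + cabs (w - 0 +i* y)).
    have : cabs w <= cabs (w - 0 +i* y) + H.
      rewrite -[X in cabs X](subrK (0 +i* y)) (le_trans (cabsD _ _))// lerD2l.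
      by rewrite (le_trans _ yH)// /cabs/= expr0n/= add0r sqrtr_sqr.
    by move: w0 z0; set a := cabs w; set b := cabs _ => a0 b0 hab; nra.
  have F1 : cabs (F (w + x%:C)) <= A * (1 + `|x|) ^+ N * (1 + cabs w) ^+ N * expR (sg * `|complex.Im w|).
    apply: (le_trans (hF _)); rewrite cImD/= addr0 ler_wpM2r ?expR_ge0// -mulrA ler_wpM2l//.
    rewrite -exprMn lerXn2r ?nnegrE ?mulr_ge0 ?addr_ge0 ?cabs_ge0//.
    have := cabsD w x%:C; rewrite cabs_real.
    have : 0 <= `|x| * cabs w by rewrite mulr_ge0.
    by lra.
  have F2 : cabs (F (w + x%:C)) ^+ M <= (A * (1 + `|x|) ^+ N) ^+ M * (1 + cabs w) ^+ (N * M) *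
      expR (M%:R * sg * `|complex.Im w|).
    rewrite -[M%:R * sg * _]mulrA expRM_natl exprM -!exprMn.
    by rewrite lerXn2r ?nnegrE ?cabs_ge0// (le_trans _ F1)// cabs_ge0.
  have P1 : (1 + cabs w) ^+ (N * M) * (1 + cabs w ^+ 2) <= (1 + H) ^+ L * (1 + cabs (w - 0 +i* y)) ^+ L.
    apply: (@le_trans _ _ ((1 + cabs w) ^+ L)); last first.
      by rewrite -exprMn lerXn2r ?nnegrE ?mulr_ge0 ?addr_ge0.
    apply: (@le_trans _ _ ((1 + cabs w) ^+ (N * M + 2))).
      rewrite exprD ler_wpM2l ?exprn_ge0 ?addr_ge0//.
      by rewrite sqrrD expr1n mul1r; lra.
    by rewrite ler_weXn2l ?leq_addr//; lra.
  have P2 : (1 + cabs (w - 0 +i* y)) ^+ L * cabs (expq (v w)) ^+ L <= k3 ^+ L * expR (L%:R * `|complex.Im w|).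
    rewrite -exprMn expRM_natl -exprMn lerXn2r ?nnegrE ?mulr_ge0 ?addr_ge0 ?cabs_ge0 ?expR_ge0 ?(ltW k30)//.
    by rewrite mulrC.
  rewrite /G cabsM !cabsX.
  set f := cabs (F _) ^+ M in F2 *; set e := cabs (expq _) ^+ L in P2 *.
  have e0 : 0 <= e by rewrite exprn_ge0 ?cabs_ge0.
  set ax := (A * _) ^+ M in F2; set m := (1 + cabs w) ^+ (N * M) in F2 P1.
  have ax0 : 0 <= ax by rewrite exprn_ge0// mulr_ge0// exprn_ge0// addr_ge0.
  apply: (@le_trans _ _ (ax * m * expR (M%:R * sg * `|complex.Im w|) * e * (1 + cabs w ^+ 2))).
    rewrite ler_wpM2r ?addr_ge0 ?sqr_ge0// ler_wpM2r//.
  rewrite (_ : ax * m * _ * e * _ = ax * expR (M%:R * sg * `|complex.Im w|) * (m * (1 + cabs w ^+ 2) * e)); last by ring.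
  apply: (@le_trans _ _ (ax * expR (M%:R * sg * `|complex.Im w|) *
    ((1 + H) ^+ L * (k3 ^+ L * expR (L%:R * `|complex.Im w|))))).
    rewrite ler_wpM2l ?mulr_ge0 ?expR_ge0//.
    apply: (le_trans (ler_wpM2r e0 P1)); rewrite -mulrA ler_wpM2l// exprn_ge0// addr_ge0//.
  rewrite /A' -/ax /s [(_ + L%:R) * _]mulrDl expRD [(k3 * _) ^+ L]exprMn.
  move: (k3 ^+ L) ((1 + H) ^+ L) => k3L hL.
  by rewrite le_eqVlt; apply/orP; left; apply/eqP; ring.
have powM a : 0 <= a -> (a ^+ M) `^ q = a `^ p.
  by move=> a0; rewrite -powR_mulrn// -powRrM Mq.
have hI : (\int[mu]_t (cabs (G (t +i* 0)) `^ q)%:E <= (C3 * I0)%:E)%E.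
  rewrite EFinM -EI -ge0_integralZl_EFin//; [|by move=> t _; rewrite lee_fin|exact/measurable_EFinP|exact: ltW].
  apply: ge0_le_integral => //.
  - by move=> t _; rewrite lee_fin powR_ge0.
  - by apply/measurable_EFinP; exact: (measurable_cabs_line0 0 q (fun w => holo_cont (dG w))).
  - by under eq_fun do rewrite -EFinM; apply/measurable_EFinP; exact: measurable_funM.
  suff pw (t : R) : cabs (G (t +i* 0)) `^ q <= C3 * phi t.
    by move=> t _; rewrite -EFinM lee_fin pw.
  rewrite /G cabsM !cabsX powRM ?exprn_ge0 ?cabs_ge0//.
  rewrite powM ?cabs_ge0// complexD addr0 [t + x]addrC /phi mulrCA.
  rewrite ler_wpM2l ?powR_ge0// -powR_mulrn ?cabs_ge0// -powRrM.
  have t1 : 0 < 1 + `|t| by rewrite ltr_pwDl.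
  have := expqv (t +i* 0); rewrite /= normr0 expR0 mulr1.
  have tz : `|t| <= cabs (t +i* 0 - 0 +i* y).
    by apply: (le_trans _ (normr_Re_le _)); rewrite /= subr0.
  have e0 := cabs_ge0 (expq (v (t +i* 0))).
  move: tz e0; set z := cabs (_ - _); set e := cabs (expq _) => tz e0 ez.
  have e1 : e <= k3 * (1 + `|t|)^-1.
    rewrite ler_pdivlMr// (le_trans _ ez)// ler_wpM2l//; lra.
  apply: (@le_trans _ _ ((k3 * (1 + `|t|)^-1) `^ (L%:R * q))).
    apply: ge0_ler_powR; rewrite ?nnegrE//; first by rewrite mulr_ge0 ?(ltW L2) ?(ltW q0).
    by rewrite mulr_ge0 ?invr_ge0 ?(ltW k30) ?(ltW t1).
  rewrite powRM ?invr_ge0 ?(ltW k30) ?(ltW t1)// ler_wpM2l ?(ltW C30)//.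
  apply: (@le_trans _ _ ((1 + `|t|)^-1 `^ 2%:R)).
    apply: ger_powR => //; rewrite invr_gt0 t1 invf_le1// lerDl normr_ge0//.
  rewrite powR_mulrn ?invr_ge0 ?(ltW t1)// exprVn lef_pV2 ?posrE ?exprn_gt0//.
  rewrite sqrrD expr1n mul1r real_normK ?num_real//; have := normr_ge0 t; lra.
have := nikolskii_strip q0 q1 (ltW s0) A'0 H0 dG hG hI (w := 0 +i* y) yH.
rewrite /G /v subrr mulr0 expq0 expr1n mulr1 cabsX powM ?cabs_ge0//.
by rewrite complexD addr0 add0r mulrA.
Qed.

End StripBound.

(** * Borel measurability from countable bases *)

Section CountableBase.

(** Products of Borel sigma-algebras contain the open sets of the product only
    in presence of countable bases, which are tracked explicitly here. *)
Definition has_cbase (X : topologicalType) := exists D : nat -> set X,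
  (forall i, open (D i)) /\
  forall U x, open U -> U x -> exists i, D i x /\ D i `<=` U.

Lemma has_cbase_count (X : topologicalType) (I : countType) (B : I -> set X) :
  (forall i, open (B i)) ->
  (forall U x, open U -> U x -> exists i, B i x /\ B i `<=` U) -> has_cbase X.
Proof.
move=> oB hB; exists (fun k => if unpickle k is Some i then B i else set0); split.
  by move=> k; case: unpickle => [i|]; [exact: oB|exact: open0].
move=> U x oU Ux; have [i [Bx BU]] := hB _ _ oU Ux.
by exists (pickle i); rewrite pickleK.
Qed.

Lemma cbase_real (R : realType) : has_cbase R.
Proof.
apply: (@has_cbase_count _ (rat * rat)%type (fun ab => `](ratr ab.1 : R), ratr ab.2[%classic)).
  by move=> i; exact: interval_open.
move=> U x oU Ux.
have /nbhs_ballP[e /= e0 eU] : nbhs x U by exact: open_nbhs_nbhs.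
have /rat_in_itvoo[a] : x - e < x by rewrite ltrBlDr ltrDl.
have /rat_in_itvoo[b] : x < x + e by rewrite ltrDl.
rewrite !in_itv/= => /andP[xb be] /andP[ea ax].
exists (a, b); split=> [|y]/=; rewrite in_itv/= ?ax ?xb// => /andP[ay yb].
by apply: eU; rewrite -ball_normE/= ltr_norml; apply/andP; split; lra.
Qed.

Lemma cbase_prod (X Y : topologicalType) : has_cbase X -> has_cbase Y ->
  has_cbase (X * Y)%type.
Proof.
move=> [D [oD hD]] [E [oE hE]].
apply: (@has_cbase_count _ (nat * nat)%type (fun i => D i.1 `*` E i.2)).
  move=> i; rewrite openE => -[x y] [/= Dx Ey].
  exists (D i.1, E i.2) => //=; split; apply: open_nbhs_nbhs; split=> //.
move=> U [x y] oU Uxy.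
have [[A B] /= [Ax By] ABU] : nbhs (x, y) U by exact: open_nbhs_nbhs.
have [i [Dx DA]] := hD _ _ (@open_interior _ A) Ax.
have [j [Ey EB]] := hE _ _ (@open_interior _ B) By.
exists (i, j); split=> // -[x' y'] [/= Dx' Ey']; apply: ABU; split=> /=.
  exact: interior_subset (DA _ Dx').
exact: interior_subset (EB _ Ey').
Qed.

Lemma row_nbhsP (T : topologicalType) k (v : 'rV[T]_k) (U : set 'rV[T]_k) :
  nbhs v U <-> exists2 P : 'I_k -> set T, (forall j, nbhs (v 0 j) (P j)) &
    forall w : 'rV[T]_k, (forall j, P j (w 0 j)) -> U w.
Proof.
split=> [[P Pv PU]|[P Pv PU]].
  exists (P 0) => [j|w wP]; first exact: Pv.
  by apply: PU => i j; rewrite ord1; exact: wP.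
exists (fun _ j => P j) => [i j|w wP]; first by rewrite ord1; exact: Pv.
by apply: PU => j; exact: wP.
Qed.

Lemma cbase_row (T : topologicalType) k : has_cbase T -> has_cbase 'rV[T]_k.
Proof.
move=> [D [oD hD]].
apply: (@has_cbase_count _ {ffun 'I_k -> nat} (fun s => [set v : 'rV[T]_k | forall j, D (s j) (v 0 j)])).
  move=> s; rewrite openE => v /= vD; apply/row_nbhsP.
  exists (fun j => D (s j)) => // j; apply: open_nbhs_nbhs; split=> //.
move=> U v oU Uv; have /row_nbhsP[P Pv PU] : nbhs v U by exact: open_nbhs_nbhs.
have h j : exists i, D i (v 0 j) /\ D i `<=` P j.
  have [i [Dv DP]] := hD _ _ (@open_interior _ (P j)) (Pv j).
  by exists i; split=> // x /DP; exact: interior_subset.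
have [s hs] := choice h; exists [ffun j => s j]; split=> [j|w /= wD].
  by rewrite ffunE; have [] := hs j.
by apply: PU => j; have [_] := hs j; apply; have := wD j; rewrite ffunE.
Qed.

End CountableBase.

Section BorelMaps.

Definition borel_map d (T : measurableType d) (X : topologicalType) (f : T -> X) :=
  forall U, open U -> measurable (f @^-1` U).

Lemma measurable_bigcup_count d (T : measurableType d) (I : countType) (P : set I)
    (F : I -> set T) : (forall i, P i -> measurable (F i)) ->
  measurable (\bigcup_(i in P) F i).
Proof.
move=> mF.
rewrite (_ : \bigcup_(i in P) F i = \bigcup_k
    (if unpickle k is Some i then if `[< P i >] then F i else set0 else set0)).
  apply: bigcupT_measurable => k; case: unpickle => // i.
  by case: asboolP => // ?; exact: mF.
apply/seteqP; split=> [x [i Pi Fx]|x [k _]].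
  by exists (pickle i) => //; rewrite pickleK; case: asboolP.
by case: unpickle => // i; case: asboolP => // Pi Fx; exists i.
Qed.

Context d (T : measurableType d).

Lemma borel_map_comp (X Y : topologicalType) (f : T -> X) (g : X -> Y) :
  borel_map f -> continuous g -> borel_map (g \o f).
Proof.
by move=> bf cg U oU; rewrite comp_preimage; apply: bf; exact: open_comp.
Qed.

Lemma borel_map_pair (X Y : topologicalType) (f : T -> X) (g : T -> Y) :
  has_cbase X -> has_cbase Y -> borel_map f -> borel_map g ->
  borel_map (fun t => (f t, g t)).
Proof.
move=> [D [oD hD]] [E [oE hE]] bf bg U oU.
rewrite (_ : _ @^-1` U = \bigcup_(i in [set i | D i.1 `*` E i.2 `<=` U])
    (f @^-1` D i.1 `&` g @^-1` E i.2)).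
  by apply: measurable_bigcup_count => i _; apply: measurableI; [exact: bf|exact: bg].
apply/seteqP; split=> [t /= Ut|t [i iU] [/= Dt Et]]; last by apply: iU.
have [[A B] /= [At Bt] ABU] : nbhs (f t, g t) U by exact: open_nbhs_nbhs.
have [i [Dx DA]] := hD _ _ (@open_interior _ A) At.
have [j [Ey EB]] := hE _ _ (@open_interior _ B) Bt.
exists (i, j) => //= -[x' y'] [/= Dx' Ey']; apply: ABU; split=> /=.
  exact: interior_subset (DA _ Dx').
exact: interior_subset (EB _ Ey').
Qed.

Lemma borel_map_row (X : topologicalType) k (f : T -> 'rV[X]_k) :
  has_cbase X -> (forall j, borel_map (fun t => f t 0 j)) -> borel_map f.
Proof.
move=> [D [oD hD]] bf U oU.
rewrite (_ : _ @^-1` U = \bigcup_(s in [set s : {ffun 'I_k -> nat} |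
     [set v : 'rV[X]_k | forall j, D (s j) (v 0 j)] `<=` U])
   \big[setI/setT]_(j < k) ((fun t => f t 0 j) @^-1` D (s j))).
  apply: measurable_bigcup_count => s _; apply: bigsetI_measurable => j _.
  exact: bf.
apply/seteqP; split=> [t /= Ut|t [s sU]]; last first.
  rewrite -bigcap_seq => h; apply: sU => j; apply: h.
  by rewrite /= mem_index_enum.
have /row_nbhsP[P Pv PU] : nbhs (f t) U by exact: open_nbhs_nbhs.
have h j : exists i, D i (f t 0 j) /\ D i `<=` P j.
  have [i [Dv DP]] := hD _ _ (@open_interior _ (P j)) (Pv j).
  by exists i; split=> // x /DP; exact: interior_subset.
have [s hs] := choice h; exists [ffun j => s j].
  by move=> w /= wD; apply: PU => j; have [_] := hs j; apply; have := wD j; rewrite ffunE.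
by rewrite -bigcap_seq => j _; rewrite /= ffunE; have [] := hs j.
Qed.

Lemma measurable_borel_map d' (S : measurableType d') (X : topologicalType)
    (f : S -> X) (g : T -> S) : measurable_fun setT g -> borel_map f ->
  borel_map (f \o g).
Proof.
by move=> mg bf U oU; rewrite comp_preimage -[X in measurable X]setTI; apply: mg => //; exact: bf.
Qed.

Context (R : realType).

Lemma borel_map_measurable (f : T -> R) : borel_map f -> measurable_fun setT f.
Proof.
move=> bf; apply: (measurability _ (RGenOpens.measurableE R)).
move=> _ [_ [a [b ->]] <-]; rewrite setTI; apply: bf; exact: interval_open.
Qed.

Lemma measurable_borel_map_real (f : T -> measurableTypeR R) :
  measurable_fun setT f -> borel_map (f : T -> R).
Proof.
by move=> mf U oU; rewrite -[X in measurable X]setTI; apply: mf => //; exact: open_measurable.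
Qed.

End BorelMaps.

Section ComplexTopology.
Context {R : realType}.

Lemma continuous_Re : continuous (@complex.Re R : R[i] -> R).
Proof.
move=> z; apply/(@cvgrPdist_lt _ _ _ (nbhs z)) => e e0; apply/nbhs_cabsP; exists e; first exact: e0.
by move=> w wz; rewrite distrC -cReB (le_lt_trans (normr_Re_le _)).
Qed.

Lemma continuous_Im : continuous (@complex.Im R : R[i] -> R).
Proof.
move=> z; apply/(@cvgrPdist_lt _ _ _ (nbhs z)) => e e0; apply/nbhs_cabsP; exists e; first exact: e0.
by move=> w wz; rewrite distrC -cImB (le_lt_trans (normr_Im_le _)).
Qed.

Lemma continuous_cabs : continuous (@cabs R).
Proof.
move=> z; apply/(@cvgrPdist_lt _ _ _ (nbhs z)) => e e0; apply/nbhs_cabsP; exists e; first exact: e0.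
move=> w wz; rewrite distrC (le_lt_trans _ wz)// ler_norml; apply/andP; split.
  by have := cabsD w (z - w); rewrite addrC subrK cabsBC; lra.
by have := cabsD z (w - z); rewrite addrC subrK; lra.
Qed.

Lemma continuous_Complex : continuous (fun ab : R * R => ab.1 +i* ab.2).
Proof.
move=> [a b]; apply/(@cvg_cabsP R (R * R)%type (nbhs (a, b))) => e e0.
have e2 : 0 < e / 2 by rewrite divr_gt0.
exists (ball a (e / 2), ball b (e / 2)) => /=.
  by split; apply: nbhsx_ballx.
move=> [a' b'] /= []; rewrite -!ball_normE/= => ha hb.
rewrite (le_lt_trans (cabs_le_ReIm _))//= distrC [`|b' - b|]distrC.
by lra.
Qed.

Lemma continuous_ReIm : continuous (fun z : R[i] => (complex.Re z, complex.Im z)).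
Proof.
move=> z; apply: (@cvg_pair _ _ _ (nbhs z) (nbhs (complex.Re z)) (nbhs (complex.Im z))).
  exact: continuous_Re.
exact: continuous_Im.
Qed.

Lemma cbase_complex : has_cbase R[i].
Proof.
have [D [oD hD]] := cbase_prod (cbase_real R) (cbase_real R).
exists (fun i => [set z | D i (complex.Re z, complex.Im z)]); split.
  move=> i; apply: (@open_comp _ _ (fun z : R[i] => (complex.Re z, complex.Im z))) => //.
  by move=> z _; exact: continuous_ReIm.
move=> U z oU Uz.
have oU' : open [set ab : R * R | U (ab.1 +i* ab.2)].
  by apply: open_comp oU => ? _; exact: continuous_Complex.
have [|i [Di DU]] := hD _ (complex.Re z, complex.Im z) oU'.
  by case: z Uz.
by exists i; split=> // -[a b] /= /DU.
Qed.

Lemma borel_map_Complex d (T : measurableType d) (f g : T -> R) :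
  borel_map f -> borel_map g -> borel_map (fun t => f t +i* g t : R[i]).
Proof.
move=> bf bg.
apply: (@borel_map_comp _ _ _ _ (fun t => (f t, g t)) _ _ continuous_Complex).
by apply: borel_map_pair => //; exact: cbase_real.
Qed.

End ComplexTopology.

(** * Invariance of product integrals *)

Section MeasurePreserving.
Context {R : realType}.
Local Open Scope ereal_scope.

(** Invariance is stated for integrals, the form in which Tonelli's theorem iterates
    it. *)
Definition mpres d (T : measurableType d) (m : {measure set T -> \bar R})
  (tau : T -> T) := measurable_fun setT tau /\
  forall f : T -> \bar R, measurable_fun setT f -> (forall x, 0 <= f x) ->
    \int[m]_x f (tau x) = \int[m]_x f x.

Section Product.
Context d1 d2 (T1 : measurableType d1) (T2 : measurableType d2).
Context (m1 : {sigma_finite_measure set T1 -> \bar R}).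
Context (m2 : {sigma_finite_measure set T2 -> \bar R}).
Implicit Types (f : T1 * T2 -> \bar R).

Lemma sf_tonelli1 f : measurable_fun setT f -> (forall x, 0 <= f x) ->
  \int[sf_product m1 m2]_z f z = \int[m1]_x \int[m2]_y f (x, y).
Proof. by move=> mf f0; exact: (@fubini_tonelli1 _ _ _ _ _ m1 m2 f mf f0). Qed.

Lemma sf_tonelli2 f : measurable_fun setT f -> (forall x, 0 <= f x) ->
  \int[sf_product m1 m2]_z f z = \int[m2]_y \int[m1]_x f (x, y).
Proof. by move=> mf f0; exact: (@fubini_tonelli2 _ _ _ _ _ m1 m2 f mf f0). Qed.

Lemma measurable_inner1 f : measurable_fun setT f -> (forall x, 0 <= f x) ->
  measurable_fun setT (fun x => \int[m2]_y f (x, y)).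
Proof. by move=> mf f0; exact: (@measurable_fun_fubini_tonelli_F _ _ _ _ _ m2 f mf f0). Qed.

Lemma measurable_inner2 f : measurable_fun setT f -> (forall x, 0 <= f x) ->
  measurable_fun setT (fun y => \int[m1]_x f (x, y)).
Proof. by move=> mf f0; exact: (@measurable_fun_fubini_tonelli_G _ _ _ _ _ m1 f mf f0). Qed.

Lemma measurable_section1 f x : measurable_fun setT f ->
  measurable_fun setT (fun y => f (x, y)).
Proof. by move=> mf; exact: measurableT_comp. Qed.

(** Tonelli: the inner integral is invariant for every value of the outer
    variable, and the outer integral is then invariant as well. *)
Lemma mpres_skew (tau : T1 -> T1) (sg : T1 -> T2 -> T2) : mpres m1 tau ->
  (forall x, mpres m2 (sg x)) ->
  measurable_fun setT (fun z : T1 * T2 => (tau z.1, sg z.1 z.2)) ->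
  mpres (sf_product m1 m2) (fun z => (tau z.1, sg z.1 z.2)).
Proof.
move=> [mtau htau] hsg mts; split=> // f mf f0.
have mft : measurable_fun setT (fun z => f (tau z.1, sg z.1 z.2)) by exact: (measurableT_comp mf mts).
rewrite (sf_tonelli1 mft (fun z => f0 _)) (sf_tonelli1 mf f0).
rewrite -(htau (fun x => \int[m2]_y f (x, y)) (measurable_inner1 mf f0)); last first.
  by move=> x; apply: integral_ge0.
apply: eq_integral => x _; have [_ hx] := hsg x.
by rewrite (hx (fun y => f (tau x, y)))//; exact: measurable_section1.
Qed.

End Product.

Lemma mpres_shift (x : R) : mpres (@lebesgue_measure R)
  (fun t : measurableTypeR R => (x + t)%R : measurableTypeR R).
Proof.
split; first exact: measurable_shift.
by move=> f mf f0; exact: ge0_integral_shift.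
Qed.

Lemma mpres_opp : mpres (@lebesgue_measure R)
  (fun t : measurableTypeR R => (- t)%R : measurableTypeR R).
Proof.
have mN : measurable_fun [set: measurableTypeR R] (-%R : R -> measurableTypeR R).
  exact: oppr_measurable.
split=> // f mf f0.
rewrite -[LHS](@ge0_integral_pushforward _ _ _ _ _ _ mN (@lebesgue_measure R) setT f)//.
by apply: eq_measure_integral => A mA _; exact: lebesgue_measureN.
Qed.

End MeasurePreserving.

(** * Local bounds by area integrals *)

Section Square.
Context {R : realType}.
Local Notation Rm := (measurableTypeR R).
Local Notation leb := (@lebesgue_measure R : {sigma_finite_measure set Rm -> \bar R}).
Local Notation leb2 := (sf_product leb leb).
Implicit Types (w u : R[i]) (F : R[i] -> R[i]).

(** Cauchy's formula in real terms. Let [c] be a rotation with [c F u = |F u| = g];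
    [goursat_except] applies to [- i (c F (u + w) - g) / w]. On each side of the
    square the component of [i g / w] that enters the boundary integral has
    constant sign and is at least [g / (2 r)], while the rest is at most
    [|F (u + w)| / r]. *)
Lemma square_boundary_le F u r : (forall w, differentiable F w) -> 0 < r ->
  4 * r * cabs (F u) <=
    Ri (- r) r (fun t => cabs (F (u + (t +i* - r)))) +
    Ri (- r) r (fun t => cabs (F (u + (t +i* r)))) +
    Ri (- r) r (fun t => cabs (F (u + (r +i* t)))) +
    Ri (- r) r (fun t => cabs (F (u + ((- r) +i* t)))).
Proof.
move=> dF r0; have [c [c1 cu]] := rotation_exists (F u).
set g := cabs (F u) in cu *; have g0 : 0 <= g by exact: cabs_ge0.
pose Q w : R[i] := c * F (u + w).
have QF w : cabs (Q w) = cabs (F (u + w)) by rewrite /Q cabsM c1 mul1r.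
have dQ w : differentiable Q w.
  apply: holoM; first exact: holo_cst.
  apply: (@holo_comp _ (fun w => u + w) F); last exact: dF.
  by apply: holoD; [exact: holo_cst|exact: holo_id].
pose P w : R[i] := - 'i * (Q w - g%:C).
have dP w : differentiable P w.
  apply: holoM; first exact: holo_cst.
  by apply: holoB; [exact: dQ|exact: holo_cst].
have [|V [VE V0 dV]] := slope_exists (dP 0).
  by rewrite /P /Q addr0 cu subrr mulr0.
have cV w : {for w, continuous V}.
  have [->|w0] := eqVneq w 0; first exact: V0.
  by apply: holo_cont; apply: dV; [exact: w0|exact: dP].
have rr : - r <= r by lra.
have J0 : J V (- r) r (- r) r = 0.
  apply: (@goursat_except _ _ 0 _ _ _ _ rr rr); first by move=> ? ? _ _; exact: cV.
  by move=> x y _ _ w0; apply: dV; [exact: w0|exact: dP].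
have VQ w : w != 0 -> r <= cabs w ->
    `|complex.Re (V w) - g * (complex.Im w / cabs w ^+ 2)| <= cabs (Q w) / r /\
    `|complex.Im (V w) - g * (complex.Re w / cabs w ^+ 2)| <= cabs (Q w) / r.
  move=> w0 rw; have cw : 0 < cabs w by exact: lt_le_trans rw.
  have E : V w = (- 'i * (Q w / w)) + ((g * (complex.Im w / cabs w ^+ 2)) +i*
      (g * (complex.Re w / cabs w ^+ 2))).
    have -> : V w = P w / w by rewrite -VE mulrAC divff// mul1r.
    have -> : ((g * (complex.Im w / cabs w ^+ 2)) +i* (g * (complex.Re w / cabs w ^+ 2))) =
        'i * g%:C / w.
      apply: (mulIf w0); rewrite divfK//.
      have := cabs_sqr w; have : cabs w ^+ 2 != 0 by rewrite expf_neq0// gt_eqF.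
      set n2 := cabs w ^+ 2; case: (w) => a b /= n20 En.
      apply/eqP; rewrite eq_complex/=; apply/andP; split; apply/eqP; first by ring.
      have -> : g * (b / n2) * b + g * (a / n2) * a = g * ((a ^+ 2 + b ^+ 2) / n2) by ring.
      by rewrite -En divff//; ring.
    by rewrite /P; ring.
  have B : cabs (- 'i * (Q w / w)) <= cabs (Q w) / r.
    rewrite cabsM cabsN cabs_i mul1r cabsM cabsV ler_wpM2l ?cabs_ge0//.
    by rewrite lef_pV2.
  rewrite E cReD cImD /= !addrK; split.
    exact: le_trans (normr_Re_le _) B.
  exact: le_trans (normr_Im_le _) B.
have side a b : `|a| <= r -> `|b| <= r -> (`|a| == r) || (`|b| == r) ->
    [/\ r <= cabs (a +i* b), a +i* b != 0 & r / (2 * r ^+ 2) <= r / cabs (a +i* b) ^+ 2].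
  move=> ar br ab; have h : r <= cabs (a +i* b).
    case/orP: ab => /eqP {1}<-; first exact: (normr_Re_le (a +i* b)).
    exact: (normr_Im_le (a +i* b)).
  have h0 : 0 < cabs (a +i* b) by exact: lt_le_trans h.
  split=> //; first by rewrite -cabs_gt0.
  rewrite ler_wpM2l ?(ltW r0)// lef_pV2 ?posrE ?mulr_gt0 ?exprn_gt0//.
  rewrite cabs_sqr/=.
  have : a ^+ 2 <= r ^+ 2 by rewrite -[a ^+ 2]ger0_norm ?sqr_ge0// normrX lerXn2r ?nnegrE ?(ltW r0).
  have : b ^+ 2 <= r ^+ 2 by rewrite -[b ^+ 2]ger0_norm ?sqr_ge0// normrX lerXn2r ?nnegrE ?(ltW r0).
  by lra.
have nr : `|r| = r by rewrite ger0_norm// ltW.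
have nNr : `|- r| = r by rewrite normrN.
have nr' : `|r| <= r by rewrite nr.
have nNr' : `|- r| <= r by rewrite nNr.
pose K := g * (r / (2 * r ^+ 2)).
have Kr : K * (2 * r) = g by rewrite /K; field; rewrite gt_eqF.
have cQl y : cont_on (- r) r (fun t => cabs (F (u + (t +i* y)))).
  have := @cont_on_cabs _ Q (- r) r y (fun w => holo_cont (dQ w)).
  by rewrite (_ : (fun t => _) = (fun t => cabs (F (u + (t +i* y)))))//; apply/funext => t.
have cQc x : cont_on (- r) r (fun t => cabs (F (u + (x +i* t)))).
  move=> t _.
  have dW w : differentiable (fun w => F (u + (x%:C + 'i * w))) w.
    apply: (@holo_comp _ (fun w => u + (x%:C + 'i * w)) F); last exact: dF.
    apply: holoD; first exact: holo_cst.
    apply: holoD; first exact: holo_cst.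
    by apply: holoM; [exact: holo_cst|exact: holo_id].
  have := @cont_on_cabs _ _ (- r) r 0 (fun w => holo_cont (dW w)).
  rewrite (_ : (fun t => _) = (fun t => cabs (F (u + (x +i* t))))).
    by have := @cont_on_cabs _ _ t t 0 (fun w => holo_cont (dW w)); 
       rewrite (_ : (fun t => _) = (fun t => cabs (F (u + (x +i* t)))));
       [move=> h _; apply: h; rewrite lexx|apply/funext => t'; congr (cabs (F (u + _)));
        apply/eqP; rewrite eq_complex/=; apply/andP; split; apply/eqP; ring].
  apply/funext => t'; congr (cabs (F (u + _))).
  by apply/eqP; rewrite eq_complex/=; apply/andP; split; apply/eqP; ring.
have cst_on k : cont_on (- r) r (fun=> k) by move=> ? _; exact: cst_continuous.
have bnd (f h : R -> R) : cont_on (- r) r f -> cont_on (- r) r h ->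
    (forall t, - r <= t <= r -> f t + K <= r^-1 * h t) ->
    r * Ri (- r) r f + r * g <= Ri (- r) r h.
  move=> cf ch fh.
  have ch' : cont_on (- r) r (fun t => r^-1 * h t).
    by move=> t tt; apply: cvgM; [exact: cvg_cst|exact: ch].
  have cfK : cont_on (- r) r (fun t => f t + K).
    by move=> t tt; apply: cvgD; [exact: cf|exact: cvg_cst].
  have := le_segment_integral cfK ch' fh.
  rewrite segment_integralD// segment_integral_cst// segment_integralZ//.
  rewrite (_ : K * (r - - r) = g); last by rewrite -Kr; ring.
  by rewrite -(ler_pM2l r0) mulrDr mulrA divff ?mul1r// gt_eqF.
have tt0 t : - r <= t <= r -> `|t| <= r by rewrite ler_norml.
have gK x : r / (2 * r ^+ 2) <= x -> K <= g * x by move=> h; rewrite /K ler_wpM2l.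
have b1 : r * Ri (- r) r (fun t => complex.Re (V (t +i* - r))) + r * g <=
    Ri (- r) r (fun t => cabs (F (u + (t +i* - r)))).
  apply: bnd => //; first by move=> t _; have [] := continuous_line (cV (t +i* - r)).
  move=> t /tt0 tr; have [h1 h2 h3] := side t (- r) tr nNr' (introT orP (or_intror (introT eqP nNr))).
  have [+ _] := VQ _ h2 h1; rewrite QF /= => /ler_normlP[_].
  have := gK _ h3; rewrite mulNr mulrN opprK [_ / r]mulrC; lra.
have b2 : r * Ri (- r) r (fun t => - complex.Re (V (t +i* r))) + r * g <=
    Ri (- r) r (fun t => cabs (F (u + (t +i* r)))).
  apply: bnd => //.
    by move=> t _; apply: cvgN; have [] := continuous_line (cV (t +i* r)).
  move=> t /tt0 tr; have [h1 h2 h3] := side t r tr nr' (introT orP (or_intror (introT eqP nr))).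
  have [+ _] := VQ _ h2 h1; rewrite QF /= => /ler_normlP[+ _].
  have := gK _ h3; rewrite [_ / r]mulrC; lra.
have b3 : r * Ri (- r) r (fun t => - complex.Im (V (r +i* t))) + r * g <=
    Ri (- r) r (fun t => cabs (F (u + (r +i* t)))).
  apply: bnd => //.
    by move=> t _; apply: cvgN; have [] := continuous_column (cV (r +i* t)).
  move=> t /tt0 tr; have [h1 h2 h3] := side r t nr' tr (introT orP (or_introl (introT eqP nr))).
  have [_] := VQ _ h2 h1; rewrite QF /= => /ler_normlP[+ _].
  have := gK _ h3; rewrite [_ / r]mulrC; lra.
have b4 : r * Ri (- r) r (fun t => complex.Im (V ((- r) +i* t))) + r * g <=
    Ri (- r) r (fun t => cabs (F (u + ((- r) +i* t)))).
  apply: bnd => //.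
    by move=> t _; have [] := continuous_column (cV ((- r) +i* t)).
  move=> t /tt0 tr; have [h1 h2 h3] := side (- r) t nNr' tr (introT orP (or_introl (introT eqP nNr))).
  have [_] := VQ _ h2 h1; rewrite QF /= => /ler_normlP[_].
  have := gK _ h3; rewrite mulNr mulrN opprK [_ / r]mulrC; lra.
have RiN (f : R -> R) : cont_on (- r) r f -> Ri (- r) r (fun t => - f t) = - Ri (- r) r f.
  move=> cf; rewrite -[RHS]mulN1r -segment_integralZ//.
  by apply: eq_segment_integral => t _; rewrite mulN1r.
rewrite RiN in b2; last by move=> t _; have [] := continuous_line (cV (t +i* r)).
rewrite RiN in b3; last by move=> t _; have [] := continuous_column (cV (r +i* t)).
move: J0; rewrite /J => J0.
set x1 := Ri _ _ _ in J0 b1; set x2 := Ri _ _ _ in J0 b2.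
set x3 := Ri _ _ _ in J0 b3; set x4 := Ri _ _ _ in J0 b4.
have : r * (x1 - x2 - x3 + x4) = 0 by rewrite J0 mulr0.
by lra.
Qed.

Definition sq (r : R) : set (Rm * Rm) := [set z | `|z.1| <= r /\ `|z.2| <= r].

Lemma borel_map_fst : borel_map (fun z : Rm * Rm => z.1 : R).
Proof. by apply: measurable_borel_map_real; exact: measurable_fst. Qed.

Lemma borel_map_snd : borel_map (fun z : Rm * Rm => z.2 : R).
Proof. by apply: measurable_borel_map_real; exact: measurable_snd. Qed.

Lemma borel_map_pairC : borel_map (fun z : Rm * Rm => z.1 +i* z.2 : R[i]).
Proof. by apply: borel_map_Complex; [exact: borel_map_fst|exact: borel_map_snd]. Qed.

Lemma measurable_sq r : measurable (sq r).
Proof.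
have h (f : Rm * Rm -> R) : borel_map f -> measurable [set z | `|f z| <= r].
  move=> bf; rewrite (_ : [set z | _] = ~` (f @^-1` [set x | r < `|x|])).
    apply: measurableC; apply: bf; apply: (@open_comp _ _ (@Num.norm R R) [set x | r < x]).
      by move=> x _; exact: norm_continuous.
    exact: open_gt.
  by apply/seteqP; split=> z /=; rewrite leNgt => /negP.
rewrite (_ : sq r = [set z | `|z.1 : R| <= r] `&` [set z | `|z.2 : R| <= r])//.
by apply: measurableI; apply: h; [exact: borel_map_fst|exact: borel_map_snd].
Qed.

Lemma measurable_sq_integrand F (r p : R) : (forall w, {for w, continuous F}) ->
  measurable_fun setT (fun z : Rm * Rm => cabs (F (z.1 +i* z.2)) `^ p * \1_(sq r) z).
Proof.
move=> cF; apply: measurable_funM; last exact: measurable_indic (measurable_sq r).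
apply: (measurableT_comp (measurable_powR p)); apply: borel_map_measurable.
apply: (@borel_map_comp _ _ _ _ _ (fun w : R[i] => cabs (F w)) borel_map_pairC) => w.
by apply: continuous_comp; [exact: cF|exact: continuous_cabs].
Qed.

(** The boundary bound is integrated over the squares with half-side between
    [rho / 2] and [rho]; each of the four families of sides stays inside the large
    square. *)
Lemma square_area_le F u (rho : R) : (forall w, differentiable F w) -> 0 < rho ->
  ((rho ^+ 2 * cabs (F u))%:E <=
    4%:E * \int[leb2]_z (cabs (F (u + (z.1 +i* z.2))) * \1_(sq rho) z)%:E)%E.
Proof.
move=> dF rho0; pose Phi (z : Rm * Rm) := cabs (F (u + (z.1 +i* z.2))) * \1_(sq rho) z.
have dFu w : differentiable (fun w => F (u + w)) w.
  apply: (@holo_comp _ (fun w => u + w) F); last exact: dF.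
  by apply: holoD; [exact: holo_cst|exact: holo_id].
have mPhi : measurable_fun setT (fun z => (Phi z)%:E).
  apply/measurable_EFinP.
  have := @measurable_sq_integrand (fun w => F (u + w)) rho 1 (fun w => holo_cont (dFu w)).
  by under eq_fun do rewrite powRr1 ?cabs_ge0//.
have Phi0 z : 0 <= Phi z by rewrite mulr_ge0 ?cabs_ge0.
have Phi0E z : (0 <= (Phi z)%:E)%E by rewrite lee_fin.
set I := (\int[leb2]_z _)%E.
have i1 : (\int[leb]_r \int[leb]_t (Phi (r, t))%:E)%E = I by rewrite /I (sf_tonelli1 leb leb mPhi Phi0E).
have i2 : (\int[leb]_r \int[leb]_t (Phi (- r, t)%R)%:E)%E = I.
  have [_ h] := @mpres_opp R.
  rewrite (h (fun r => \int[leb]_t (Phi (r, t))%:E)%E)//; first exact: (measurable_inner1 leb mPhi Phi0E).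
  by move=> r; apply: integral_ge0 => t _; exact: Phi0E.
have i3 : (\int[leb]_r \int[leb]_t (Phi (t, r))%:E)%E = I by rewrite /I (sf_tonelli2 leb leb mPhi Phi0E).
have i4 : (\int[leb]_r \int[leb]_t (Phi (t, - r)%R)%:E)%E = I.
  have [_ h] := @mpres_opp R.
  rewrite (h (fun r => \int[leb]_t (Phi (t, r))%:E)%E)//; first exact: (measurable_inner2 leb mPhi Phi0E).
  by move=> r; apply: integral_ge0 => t _; exact: Phi0E.
have m1 : measurable_fun setT (fun r => \int[leb]_t (Phi (r, t))%:E)%E by exact: (measurable_inner1 leb mPhi Phi0E).
have m3 : measurable_fun setT (fun r => \int[leb]_t (Phi (t, r))%:E)%E by exact: (measurable_inner2 leb mPhi Phi0E).
have mN : measurable_fun [set: Rm] (-%R : R -> Rm) by exact: oppr_measurable.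
have m2 : measurable_fun setT (fun r : Rm => \int[leb]_t (Phi (- r, t)%R)%:E)%E.
  exact: (measurableT_comp m1 mN).
have m4 : measurable_fun setT (fun r : Rm => \int[leb]_t (Phi (t, - r)%R)%:E)%E.
  exact: (measurableT_comp m3 mN).
have g1 (r : Rm) : (0 <= \int[leb]_t (Phi (r, t))%:E)%E by apply: integral_ge0 => t _; exact: Phi0E.
have g2 (r : Rm) : (0 <= \int[leb]_t (Phi (t, r))%:E)%E by apply: integral_ge0 => t _; exact: Phi0E.
have -> : (4%:E * I = I + I + I + I)%E.
  have I0 : (0 <= I)%E by apply: integral_ge0 => z _; exact: Phi0E.
  by rewrite (_ : 4 = 1 + 1 + 1 + 1)%R; [rewrite !EFinD !ge0_muleDl ?mul1e// ?adde_ge0// lee_fin|ring].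
rewrite -{1}i1 -{1}i2 -{1}i3 -{1}i4.
rewrite -(ge0_integralD _ measurableT (fun r _ => g1 r) m1 (fun r _ => g1 (- r)) m2).
rewrite -(ge0_integralD _ measurableT (fun r _ => adde_ge0 (g1 r) (g1 (- r)))
  (emeasurable_funD m1 m2) (fun r _ => g2 r) m3).
rewrite -(ge0_integralD _ measurableT
  (fun r _ => adde_ge0 (adde_ge0 (g1 r) (g1 (- r))) (g2 r))
  (emeasurable_funD (emeasurable_funD m1 m2) m3) (fun r _ => g2 (- r)) m4).
pose D : set Rm := `[rho / 2, rho]%classic.
have mD : measurable D by exact: measurable_itv.
have <- : (\int[leb]_(r in D) (2 * rho * cabs (F u))%:E = (rho ^+ 2 * cabs (F u))%:E)%E.
  transitivity ((2 * rho * cabs (F u))%:E * leb D)%E; first exact: (@integral_cst _ _ _ leb D mD).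
  have -> : leb D = (rho / 2)%:E.
    have /= := @lebesgue_measure_itv R `[rho / 2, rho].
    rewrite lte_fin ifT; last by lra.
    by move=> ->; rewrite -EFinB; congr (_%:E); field.
  by rewrite -EFinM; congr (_%:E); field.
apply: (@le_trans _ _ (\int[leb]_(r in D) (\int[leb]_t (Phi (r, t))%:E +
   \int[leb]_t (Phi (- r, t)%R)%:E + \int[leb]_t (Phi (t, r))%:E + \int[leb]_t (Phi (t, - r)%R)%:E))%E);
  last first.
  apply: ge0_subset_integral => //; first by do 3 (apply: emeasurable_funD => //).
  by move=> r _; exact: (adde_ge0 (adde_ge0 (adde_ge0 (g1 r) (g1 (- r))) (g2 r)) (g2 (- r))).
apply: ge0_le_integral => //.
- by move=> r _; rewrite lee_fin !mulr_ge0 ?cabs_ge0// ltW.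
- by apply: measurable_funTS; do 3 (apply: emeasurable_funD => //).
move=> r; rewrite /D /= in_itv/= => /andP[r1 r2].
have r0 : 0 < r by lra.
have b (f : R -> R) (h : R -> Rm * Rm) : cont_on (- r) r f -> 
    (forall t, - r <= t <= r -> f t = Phi (h t)) -> measurable_fun [set: Rm] (fun t => (Phi (h t))%:E) ->
    ((Ri (- r) r f)%:E <= \int[leb]_t (Phi (h t))%:E)%E.
  move=> cf fh mh.
  have fi := cont_on_integrable cf.
  rewrite /Ri /Rintegral fineK; last exact: integrable_fin_num.
  apply: (@le_trans _ _ (\int[leb]_(t in `[(- r)%R, r]) (Phi (h t))%:E)%E).
    rewrite le_eqVlt; apply/orP; left; apply/eqP; apply: eq_integral => t.
    by rewrite inE/= in_itv/= => tt; rewrite fh.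
  by apply: ge0_subset_integral.
have := square_boundary_le u dF r0.
rewrite -lee_fin !EFinD => sb.
apply: (@le_trans _ _ (4 * r * cabs (F u))%:E).
  by rewrite lee_fin ler_wpM2r ?cabs_ge0//; lra.
apply: (le_trans sb).
have sqP a b' : `|a| <= rho -> `|b'| <= rho -> Phi (a, b') = cabs (F (u + (a +i* b'))).
  by move=> ha hb; rewrite /Phi indicE mem_set// mulr1.
have rn : `|r| <= rho by rewrite ger0_norm ?(ltW r0).
have rNn : `|- r| <= rho by rewrite normrN.
have tn t : - r <= t <= r -> `|t| <= rho by move=> /andP[? ?]; rewrite ler_norml; apply/andP; split; lra.
have cl y : cont_on (- r) r (fun t => cabs (F (u + (t +i* y)))).
  exact: (@cont_on_cabs _ (fun w => F (u + w)) (- r) r y (fun w => holo_cont (dFu w))).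
have cc x : cont_on (- r) r (fun t => cabs (F (u + (x +i* t)))).
  move=> t _; apply: (@continuous_comp _ _ _ (fun t : R => x +i* t) (fun w => cabs (F (u + w)))).
    apply: (@continuous_comp _ _ _ (fun t : R => (x, t)) (fun ab : R * R => ab.1 +i* ab.2)).
      by apply: (@cvg_pair _ _ _ (nbhs t) (nbhs x) (nbhs t)); [exact: cvg_cst|exact: cvg_id].
    exact: continuous_Complex.
  by apply: continuous_comp; [exact: holo_cont (dFu _)|exact: continuous_cabs].
have mleft x : measurable_fun [set: Rm] (fun t => (Phi (x, t))%:E).
  exact: (measurableT_comp mPhi (measurable_fun_pair (measurable_cst x) (@measurable_id _ _ _))).
have mright x : measurable_fun [set: Rm] (fun t => (Phi (t, x))%:E).
  exact: (measurableT_comp mPhi (measurable_fun_pair (@measurable_id _ _ _) (measurable_cst x))).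
have j1 := b _ (fun t => (t, - r)) (cl (- r)) (fun t tt => esym (sqP _ _ (tn _ tt) rNn)) (mright _).
have j2 := b _ (fun t => (t, r)) (cl r) (fun t tt => esym (sqP _ _ (tn _ tt) rn)) (mright _).
have j3 := b _ (fun t => (r, t)) (cc r) (fun t tt => esym (sqP _ _ rn (tn _ tt))) (mleft _).
have j4 := b _ (fun t => (- r, t)) (cc (- r)) (fun t tt => esym (sqP _ _ rNn (tn _ tt))) (mleft _).
have := leeD (leeD (leeD j3 j4) j2) j1; apply: le_trans.
by rewrite le_eqVlt; apply/orP; left; apply/eqP; rewrite -!EFinD; congr (_%:E); ring.
Qed.

End Square.

Section LocalBound.
Context {R : realType}.
Local Notation Rm := (measurableTypeR R).
Local Notation leb := (@lebesgue_measure R : {sigma_finite_measure set Rm -> \bar R}).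
Local Notation leb2 := (sf_product leb leb).
Implicit Types (w u : R[i]) (F : R[i] -> R[i]).

Lemma mpres_shift2 (x y : R) :
  mpres leb2 (fun z => ((x + z.1)%R : Rm, (y + z.2)%R : Rm)).
Proof.
apply: (@mpres_skew _ _ _ _ _ leb leb (fun t => x + t) (fun=> fun t => y + t)).
- exact: mpres_shift.
- by move=> _; exact: mpres_shift.
apply: measurable_fun_pair.
  by apply: (measurableT_comp (measurable_shift x)); exact: measurable_fst.
by apply: (measurableT_comp (measurable_shift y)); exact: measurable_snd.
Qed.

(** For small exponents the area bound is applied at a point where [|F|]
    weighted by a power of the distance to the boundary of the square is maximal:
    on a smaller square around it [|F|] exceeds the value at the centre at most by
    a constant factor, which turns [|F|] into a power of it. *)
Lemma local_bound_small (q : R) : 0 < q -> q <= 1 -> exists C : R, 0 < C /\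
  forall F, (forall w, differentiable F w) ->
    ((cabs (F 0) `^ q)%:E <=
      C%:E * \int[leb2]_z (cabs (F (z.1 +i* z.2)) `^ q * \1_(sq 1) z)%:E)%E.
Proof.
move=> q0 q1.
(* large enough for [(s ^+ k) `^ q <= s ^+ 2], and [s ^+ 2] is the area that
   [square_area_le] provides *)
pose k := Num.Def.archi_bound (2 / q).
have kq : 2 <= k%:R * q.
  by rewrite -ler_pdivrMr//; apply/ltW/archi_boundP; rewrite divr_ge0// ltW.
pose D : R := (2 ^+ k) `^ (1 - q).
have D0 : 0 < D by rewrite powR_gt0// exprn_gt0.
exists (16 * D); split; first by rewrite mulr_gt0.
move=> F dF.
(* the distance to the boundary of the unit square *)
pose s (z : R * R) : R := 1 - Num.max `|z.1| `|z.2|.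
pose h (z : R * R) : R := cabs (F (z.1 +i* z.2)) * s z ^+ k.
pose Q : set (R * R) := [set z | z.1 \in `[-1, 1] /\ z.2 \in `[-1, 1] ].
have cs : continuous s.
  move=> z; apply: cvgB; first exact: cvg_cst.
  apply: (@continuous_max _ _ (fun z : R * R => `|z.1|) (fun z : R * R => `|z.2|)).
    by apply: continuous_comp; [exact: cvg_fst|exact: norm_continuous].
  by apply: continuous_comp; [exact: cvg_snd|exact: norm_continuous].
have ch : continuous h.
  move=> z; apply: cvgM.
    apply: (@continuous_comp _ _ _ (fun ab : R * R => ab.1 +i* ab.2) (fun w => cabs (F w))).
      exact: continuous_Complex.
    by apply: continuous_comp; [exact: holo_cont (dF _)|exact: continuous_cabs].
  by apply: (@continuous_comp _ _ _ s (fun x => x ^+ k)); [exact: cs|exact: exprn_continuous].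
have cQ : compact Q.
  rewrite (_ : Q = `[-1, 1]%classic `*` `[-1, 1]%classic).
    by apply: compact_setX; exact: segment_compact.
  by apply/seteqP; split=> z [].
have Q0 : Q (0, 0) by split; rewrite in_itv/= oppr_le0 ler01.
have QP z : Q z <-> `|z.1| <= 1 /\ `|z.2| <= 1.
  by rewrite /Q /= !in_itv/= !ler_norml.
have [z0 /set_mem/QP[z01 z02] zmax] := compact_EVT_max (ex_intro _ _ Q0) cQ (continuous_subspaceT ch).
have h0 : cabs (F 0) <= h z0.
  have := zmax _ (mem_set Q0); rewrite {1}/h /s /= normr0 maxxx subr0 expr1n mulr1.
  by rewrite (_ : 0 +i* 0 = 0).
have [sz0|sz0] := leP (s z0) 0.
  have Es : s z0 = 0 by apply/le_anti; rewrite sz0 /s subr_ge0 ge_max z01 z02.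
  have F0 : cabs (F 0) = 0.
    apply/le_anti; rewrite cabs_ge0 andbT (le_trans h0)// /h Es expr0n.
    have k0 : (k != 0)%N.
      by apply/eqP => k0; move: kq; rewrite k0 mul0r; lra.
    by rewrite (negbTE k0) mulr0.
  rewrite F0 powR0 ?gt_eqF// mule_ge0 ?lee_fin ?mulr_ge0 ?(ltW D0)//.
  by apply: integral_ge0 => z _; rewrite lee_fin mulr_ge0 ?powR_ge0.
pose r := s z0 / 2.
have r0 : 0 < r by rewrite divr_gt0.
have s2 : s z0 = 2 * r by rewrite /r mulrCA divff ?mulr1.
have s1 : s z0 <= 1 by rewrite /s gerBl le_max normr_ge0.
set a := cabs (F (z0.1 +i* z0.2)).
have a0 : 0 <= a by exact: cabs_ge0.
have near z : sq r z -> Q (z0.1 + z.1, z0.2 + z.2) /\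
    cabs (F ((z0.1 + z.1) +i* (z0.2 + z.2))) <= 2 ^+ k * a.
  move=> [z1 z2].
  have m1 : `|z0.1| <= 1 - 2 * r by rewrite -s2 /s subKr le_max lexx.
  have m2 : `|z0.2| <= 1 - 2 * r by rewrite -s2 /s subKr le_max lexx orbT.
  have n1 : `|z0.1 + z.1| <= 1 - r by rewrite (le_trans (ler_normD _ _))//; lra.
  have n2 : `|z0.2 + z.2| <= 1 - r by rewrite (le_trans (ler_normD _ _))//; lra.
  have Qz : Q (z0.1 + z.1, z0.2 + z.2) by apply/QP => /=; split; lra.
  split=> //; have := zmax _ (mem_set Qz); rewrite /h -/a s2 /= exprMn.
  set b := cabs _ => hb.
  have rs : r <= s (z0.1 + z.1, z0.2 + z.2).
    by rewrite /s/= lerBrDr -lerBrDl ge_max n1 n2.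
  rewrite -(ler_pM2r (exprn_gt0 k r0)) (le_trans _ (le_trans hb _))//.
    by rewrite ler_wpM2l ?cabs_ge0// lerXn2r// nnegrE ?(ltW r0)// (le_trans (ltW r0)).
  by rewrite mulrA [a * _]mulrC.
pose B := (2 ^+ k * a) `^ (1 - q).
have split_pow b : 0 <= b -> b <= 2 ^+ k * a -> b <= B * b `^ q.
  move=> b0 ba; have [->|bn0] := eqVneq b 0; first by rewrite mulr_ge0 ?powR_ge0.
  rewrite -{1}[b]powRr1// -[X in b `^ X](subrK q) powRD; last by rewrite bn0 implybT.
  by rewrite ler_wpM2r ?powR_ge0// ge0_ler_powR ?nnegrE ?subr_ge0 ?mulr_ge0 ?exprn_ge0.
set I := (\int[leb2]_z _)%E.
pose G z : R := cabs (F (z.1 +i* z.2)) `^ q * \1_(sq 1) z.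
have mG : measurable_fun setT (fun z => (G z)%:E).
  by apply/measurable_EFinP; apply: measurable_sq_integrand => w; exact: holo_cont (dF w).
have G0 z : (0 <= (G z)%:E)%E by rewrite lee_fin mulr_ge0 ?powR_ge0.
have B0 : 0 <= B by exact: powR_ge0.
have [mt st] := mpres_shift2 z0.1 z0.2.
have cFz w : {for w, continuous (fun w => F (z0.1 +i* z0.2 + w))}.
  apply: holo_cont; apply: (@holo_comp _ (fun w => z0.1 +i* z0.2 + w) F); last exact: dF.
  by apply: holoD; [exact: holo_cst|exact: holo_id].
have mS : measurable_fun setT (fun z : Rm * Rm =>
    (cabs (F (z0.1 +i* z0.2 + (z.1 +i* z.2))) * \1_(sq r) z)%:E).
  apply/measurable_EFinP; have := measurable_sq_integrand r 1 cFz.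
  by under eq_fun do rewrite powRr1 ?cabs_ge0//.
have key : (((r ^+ 2 * a))%:E <= (4 * B)%:E * I)%E.
  apply: (le_trans (square_area_le (z0.1 +i* z0.2) dF r0)).
  rewrite EFinM -muleA; apply: lee_wpmul2l; first by rewrite lee_fin.
  rewrite /I -[X in (_ <= _ * X)%E](st (fun z => (G z)%:E) mG G0).
  rewrite -(ge0_integralZl_EFin _ measurableT (fun z _ => G0 _) (measurableT_comp mG mt) B0).
  apply: ge0_le_integral => //.
  - by move=> z _; rewrite lee_fin mulr_ge0 ?cabs_ge0.
  - by apply: measurable_funeM; exact: (measurableT_comp mG mt).
  move=> z _; rewrite -EFinM lee_fin !indicE.
  have [zr|zr] := boolP (z \in sq r); last first.
    by rewrite mulr0 !mulr_ge0// powR_ge0.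
  have [/QP[q11 q12] ba] := near _ (set_mem zr).
  by rewrite /G indicE mem_set//= !mulr1 complexD; exact: split_pow (cabs_ge0 _) ba.
have [Ioo|Ifin] := eqVneq I +oo%E.
  by rewrite Ioo gt0_muley ?leey// lte_fin mulr_gt0.
have I0 : (0 <= I)%E by apply: integral_ge0 => z _; exact: G0.
have Inum : I \is a fin_num by rewrite ge0_fin_numE// ltey.
rewrite -[I](fineK Inum) -EFinM lee_fin.
move: key; rewrite -[I](fineK Inum) -EFinM lee_fin.
have : 0 <= fine I by exact: fine_ge0.
move: (fine I) => J J0 key.
have [az|an0] := eqVneq a 0.
  rewrite (_ : cabs (F 0) = 0) ?powR0 ?gt_eqF ?mulr_ge0 ?(ltW D0)//.
  by apply/le_anti; rewrite cabs_ge0 andbT (le_trans h0)// /h -/a az mul0r.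
have ap : 0 < a by rewrite lt_def an0.
have key2 : r ^+ 2 * a `^ q <= 4 * D * J.
  move: key; rewrite /B powRM ?exprn_ge0// -/D.
  rewrite -{1}[a]powRr1// -[X in a `^ X](subrK q) powRD; last by rewrite an0 implybT.
  rewrite (_ : r ^+ 2 * _ = (r ^+ 2 * a `^ q) * a `^ (1 - q)); last by ring.
  rewrite (_ : 4 * _ * J = 4 * D * J * a `^ (1 - q)); last by ring.
  by rewrite ler_pM2r// powR_gt0.
apply: (@le_trans _ _ ((2 * r) ^+ 2 * a `^ q)); last first.
  rewrite [fine _%:E]/= (_ : (2 * r) ^+ 2 * _ = 4 * (r ^+ 2 * a `^ q)); last by ring.
  by lra.
apply: (@le_trans _ _ ((a * (2 * r) ^+ k) `^ q)).
  have h0' : cabs (F 0) <= a * (2 * r) ^+ k by rewrite -s2.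
  apply: (ge0_ler_powR (ltW q0) _ _ h0'); rewrite nnegrE; first exact: cabs_ge0.
  exact: le_trans (cabs_ge0 _) h0'.
have r2 : 0 < 2 * r by rewrite mulr_gt0.
rewrite (powRM _ a0 (exprn_ge0 k (ltW r2))) mulrC ler_wpM2r ?powR_ge0//.
rewrite -!(powR_mulrn _ (ltW r2)) -powRrM.
by apply: ger_powR; [rewrite r2/= -s2|].
Qed.

(** A power of [F] brings the exponent below 1. *)
Theorem local_bound (p : R) : 0 < p -> exists C : R, 0 < C /\
  forall F, (forall w, differentiable F w) ->
    ((cabs (F 0) `^ p)%:E <=
      \int[leb2]_z (C * (cabs (F (z.1 +i* z.2)) `^ p * \1_(sq 1) z))%:E)%E.
Proof.
move=> p0; pose M := Num.Def.archi_bound p.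
have pM : p < M%:R by apply: archi_boundP; exact: ltW.
have M0 : 0 < M%:R :> R by exact: lt_trans pM.
pose q := p / M%:R.
have q0 : 0 < q by rewrite divr_gt0.
have q1 : q <= 1 by rewrite ler_pdivrMr// mul1r ltW.
have Mq : M%:R * q = p by rewrite mulrCA divff ?mulr1// gt_eqF.
have powM a : 0 <= a -> (a ^+ M) `^ q = a `^ p.
  by move=> a0; rewrite -powR_mulrn// -powRrM Mq.
have [C [C0 hC]] := local_bound_small q0 q1.
exists C; split=> // F dF.
have := hC (fun w => F w ^+ M) (fun w => holoX M (dF w)).
rewrite cabsX powM ?cabs_ge0//; move/le_trans; apply.
pose G (z : Rm * Rm) : R := cabs (F (z.1 +i* z.2)) `^ p * \1_(sq 1) z.
have mG : measurable_fun setT (fun z => (G z)%:E).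
  by apply/measurable_EFinP; apply: measurable_sq_integrand => w; exact: holo_cont (dF w).
have G0 z : (0 <= (G z)%:E)%E by rewrite lee_fin mulr_ge0 ?powR_ge0.
have -> : (\int[leb2]_z (C * G z)%:E = C%:E * \int[leb2]_z (G z)%:E)%E.
  rewrite -(ge0_integralZl_EFin _ measurableT (fun z _ => G0 z) mG (ltW C0)).
  by apply: eq_integral => z _; rewrite EFinM.
rewrite le_eqVlt; apply/orP; left; apply/eqP.
have e z : cabs (F (z.1 +i* z.2) ^+ M) `^ q * \1_(sq 1) z = G z.
  by rewrite /G cabsX powM; [|exact: cabs_ge0].
by under eq_integral do rewrite e.
Qed.

End LocalBound.

Lemma borel_map_cst d (T : measurableType d) (X : topologicalType) (a : X) :
  borel_map (fun _ : T => a).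
Proof. by move=> U _; rewrite preimage_cst; case: ifP. Qed.

(** * Integration over tuples, one coordinate at a time *)

Section TupleIntegration.
Context {R : realType} {d : measure_display} {T : measurableType d}.
Context (mu : {sigma_finite_measure set T -> \bar R}).
Local Open Scope ereal_scope.

Definition fcons (A : Type) k (a : A) (z : 'I_k -> A) (i : 'I_k.+1) : A :=
  if unlift ord0 i is Some j then z j else a.

Definition upd (A : Type) k (z : 'I_k -> A) (i : 'I_k) (a : A) (j : 'I_k) : A :=
  if j == i then a else z j.

Lemma fcons0 (A : Type) k (a : A) (z : 'I_k -> A) : fcons a z ord0 = a.
Proof. by rewrite /fcons unlift_none. Qed.

Lemma fconsS (A : Type) k (a : A) (z : 'I_k -> A) j : fcons a z (lift ord0 j) = z j.
Proof. by rewrite /fcons liftK. Qed.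

Lemma fconsP (A : Type) k (z : 'I_k.+1 -> A) :
  fcons (z ord0) (fun j => z (lift ord0 j)) = z.
Proof.
by apply/funext => i; case: (unliftP ord0 i) => [j|] ->; rewrite ?fconsS ?fcons0.
Qed.

Lemma upd_fcons0 (A : Type) k (a b : A) (z : 'I_k -> A) :
  upd (fcons a z) ord0 b = fcons b z.
Proof.
apply/funext => i; case: (unliftP ord0 i) => [j|] ->; rewrite /upd ?fconsS ?fcons0//.
Qed.

Lemma upd_fconsS (A : Type) k (a b : A) (z : 'I_k -> A) i :
  upd (fcons a z) (lift ord0 i) b = fcons a (upd z i b).
Proof.
apply/funext => l; case: (unliftP ord0 l) => [j|] ->; rewrite /upd ?fconsS ?fcons0//.
Qed.

Lemma tnth_tuple_cons k (p : T * k.-tuple T) (i : 'I_k.+1) :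
  tnth (tuple_cons p) i = fcons p.1 (tnth p.2) i.
Proof.
by case: (unliftP ord0 i) => [j|] ->; rewrite ?fconsS ?fcons0 ?tnth0// tnthS.
Qed.

Lemma tuple_integral0 (f : 0.-tuple T -> \bar R) : measurable_fun setT f ->
  \int[tuple_measure mu 0]_t f t = f [tuple].
Proof.
move=> mf; rewrite /= (@integral_dirac _ _ _ _ _ measurableT _ mf).
by rewrite diracE mem_set// mul1e.
Qed.

Lemma tuple_integralS k (f : k.+1.-tuple T -> \bar R) : measurable_fun setT f ->
  (forall t, 0 <= f t) ->
  \int[tuple_measure mu k.+1]_t f t =
  \int[mu]_x \int[tuple_measure mu k]_t f (tuple_cons (x, t)).
Proof.
move=> mf f0.
rewrite -(@sf_tonelli1 _ _ _ _ _ mu (tuple_measure mu k) (fun p => f (tuple_cons p)))//; last first.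
  by apply: (measurableT_comp mf); exact: measurable_tuple_cons.
transitivity (\int[pushforward (mu \x tuple_measure mu k) (@tuple_cons _ T k)]_(t in setT) f t).
  by [].
by rewrite (ge0_integral_pushforward (@measurable_tuple_cons _ T k)).
Qed.

Lemma mpres_tuple k (tau : 'I_k -> T -> T) : (forall i, mpres mu (tau i)) ->
  mpres (tuple_measure mu k) (fun t => [tuple tau i (tnth t i) | i < k]).
Proof.
move=> htau; have mt l (ta : 'I_l -> T -> T) : (forall i, mpres mu (ta i)) ->
    measurable_fun setT (fun t : l.-tuple T => [tuple ta i (tnth t i) | i < l]).
  move=> hta; apply/measurable_fun_tnthP => i.
  rewrite (_ : _ \o _ = (fun t => ta i (tnth t i))); last first.
    by apply/funext => t /=; rewrite tnth_mktuple.
  by have [mi _] := hta i; apply: (measurableT_comp mi); exact: measurable_tnth.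
split; first exact: mt.
elim: k tau htau => [|k IH] tau htau f mf f0.
  by rewrite !tuple_integral0//; [congr f; exact: tuple0|exact: (measurableT_comp mf (mt _ _ htau))].
have mfc x : measurable_fun setT (fun t => f (tuple_cons (x, t))).
  apply: (measurableT_comp mf); apply: (measurableT_comp (@measurable_tuple_cons _ T k)).
  by apply: measurable_fun_pair.
have mfp : measurable_fun setT (fun p => f (@tuple_cons _ T k p)).
  by apply: (measurableT_comp mf); exact: measurable_tuple_cons.
rewrite !tuple_integralS//; last exact: (measurableT_comp mf (mt _ _ htau)).
have [m0 h0] := htau ord0.
rewrite -(h0 (fun x => \int[tuple_measure mu k]_t f (tuple_cons (x, t)))); last 2 first.
- exact: (measurable_inner1 (tuple_measure mu k) mfp (fun=> f0 _)).
- by move=> x; apply: integral_ge0.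
apply: eq_integral => x _.
rewrite -(IH (fun i => tau (lift ord0 i)) (fun i => htau _) _ (mfc _))//.
apply: eq_integral => t _; congr f; apply: eq_from_tnth => i.
rewrite tnth_mktuple !tnth_tuple_cons /=.
by case: (unliftP ord0 i) => [j|] ->; rewrite ?fconsS ?fcons0// tnth_mktuple.
Qed.

(** An inequality that replaces one coordinate by an average extends to all
    coordinates at once by integrating it in turn with respect to each of them. *)
Lemma iterate_coordinates (A : topologicalType) (P : A -> Prop) (e : A -> T -> A)
    (kap : T -> R) k (phi : ('I_k -> A) -> R) :
  (forall a, borel_map (e a)) -> (forall a t, P (e a t)) ->
  measurable_fun setT kap -> (forall t, 0 <= kap t)%R ->
  (forall d' (S : measurableType d') (h : S -> 'I_k -> A),
     (forall i, borel_map (h^~ i)) -> measurable_fun setT (fun s => phi (h s))) ->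
  (forall z, 0 <= phi z)%R ->
  (forall z i, (forall j, P (z j)) ->
     (phi z)%:E <= \int[mu]_t (phi (upd z i (e (z i) t)) * kap t)%:E) ->
  forall z, (forall j, P (z j)) ->
    (phi z)%:E <= \int[tuple_measure mu k]_t
      (phi (fun i => e (z i) (tnth t i)) * \prod_(i < k) kap (tnth t i))%:E.
Proof.
move=> be Pe mk k0; elim: k phi => [|k IH] phi mphi phi0 h z Pz.
  rewrite tuple_integral0; last first.
    apply/measurable_EFinP; apply: measurable_funM; first by apply: mphi => -[].
    by under eq_fun do rewrite big_ord0; exact: measurable_cst.
  by rewrite big_ord0 mulr1 lee_fin (_ : (fun _ => _) = z)//; apply/funext => -[].
have mint l (ph : ('I_l -> A) -> R) (z' : 'I_l -> A) :
    (forall d' (S : measurableType d') (h : S -> 'I_l -> A),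
     (forall i, borel_map (h^~ i)) -> measurable_fun setT (fun s => ph (h s))) ->
    measurable_fun setT (fun t : l.-tuple T =>
      (ph (fun i => e (z' i) (tnth t i)) * \prod_(i < l) kap (tnth t i))%:E).
  move=> mph; apply/measurable_EFinP; apply: measurable_funM.
    apply: (mph _ _ (fun t i => e (z' i) (tnth t i))) => i.
    by apply: (@measurable_borel_map _ _ _ _ _ (e (z' i))) => //; exact: measurable_tnth.
  apply: (@measurable_prod _ _ R) => i _.
  by apply: (measurableT_comp mk); exact: measurable_tnth.
have k0' l (t : l.-tuple T) : (0 <= \prod_(i < l) kap (tnth t i))%R.
  by apply: prodr_ge0 => i _; exact: k0.
have mF := mint _ phi z mphi.
rewrite tuple_integralS//; last by move=> t; rewrite lee_fin mulr_ge0.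
pose z' := fun j => z (lift ord0 j).
have Ez : z = fcons (z ord0) z' by rewrite /z' fconsP.
have m1 : measurable_fun setT (fun x : T => phi (fcons (e (z ord0) x) z')).
  apply: mphi => i; case: (unliftP ord0 i) => [j|] ->.
    rewrite (_ : (fun s => _) = (fun=> z' j)).
      exact: borel_map_cst.
    by apply/funext => s; rewrite fconsS.
  rewrite (_ : (fun s => _) = e (z ord0)); first exact: be.
  by apply/funext => s; rewrite fcons0.
apply: (le_trans (h z ord0 Pz)).
apply: ge0_le_integral => //.
- by move=> x _; rewrite lee_fin mulr_ge0.
- apply/measurable_EFinP; apply: measurable_funM => //.
  rewrite (_ : (fun _ => _) = (fun x => phi (fcons (e (z ord0) x) z')))//.
  by apply/funext => x; rewrite {1}Ez upd_fcons0.
- apply: (measurable_inner1 (tuple_measure mu k) (f := fun p =>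
    (phi (fun i => e (z i) (tnth (tuple_cons p) i)) * \prod_(i < k.+1) kap (tnth (tuple_cons p) i))%:E)).
    by apply: (measurableT_comp mF); exact: measurable_tuple_cons.
  by move=> p; rewrite lee_fin mulr_ge0.
move=> x _; rewrite {1}Ez upd_fcons0.
set a := e (z ord0) x.
pose phi' w := phi (fcons a w).
have mphi' : forall d' (S : measurableType d') (h : S -> 'I_k -> A),
     (forall i, borel_map (h^~ i)) -> measurable_fun setT (fun s => phi' (h s)).
  move=> d' S g bg; apply: (mphi _ _ (fun s => fcons a (g s))) => i.
  case: (unliftP ord0 i) => [j|] ->.
    rewrite (_ : (fun s => _) = g^~ j); first exact: bg.
    by apply/funext => s; rewrite fconsS.
  rewrite (_ : (fun s => _) = (fun=> a)).
    exact: borel_map_cst.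
  by apply/funext => s; rewrite fcons0.
have h' w i : (forall j, P (w j)) ->
    (phi' w)%:E <= \int[mu]_t (phi' (upd w i (e (w i) t)) * kap t)%:E.
  move=> Pw; have := h (fcons a w) (lift ord0 i) _.
  rewrite fconsS /phi'; under eq_integral do rewrite upd_fconsS.
  apply; move=> j; case: (unliftP ord0 j) => [l|] ->; rewrite ?fconsS ?fcons0//.
  exact: Pe.
have := IH phi' mphi' (fun=> phi0 _) h' z' (fun j => Pz _).
set I := (X in _ <= X -> _) => hI.
have -> : \int[tuple_measure mu k]_t
     (phi (fun i => e (z i) (tnth (tuple_cons (x, t)) i)) *
      \prod_(i < k.+1) kap (tnth (tuple_cons (x, t)) i))%:E = (kap x)%:E * I.
  rewrite /I -ge0_integralZl_EFin//; last 2 first.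
  - by move=> t _; rewrite lee_fin mulr_ge0// phi0.
  - exact: mint.
  apply: eq_integral => t _; rewrite -EFinM big_ord_recl tnth_tuple_cons fcons0 /=.
  have -> : (fun i => e (z i) (tnth (tuple_cons (x, t)) i)) =
      fcons a (fun i => e (z' i) (tnth t i)).
    apply/funext => i; rewrite tnth_tuple_cons.
    by case: (unliftP ord0 i) => [j|] ->; rewrite ?fconsS ?fcons0.
  rewrite (eq_bigr (fun i => kap (tnth t i))); last first.
    by move=> i _; rewrite tnth_tuple_cons fconsS.
  by rewrite /phi' mulrCA.
by rewrite mulrC EFinM lee_wpmul2l// lee_fin.
Qed.

End TupleIntegration.

(** * The geometry of the group *)

Section Rows.
Context {R : realType}.

Lemma cvg_rowP (X T : topologicalType) k (f : X -> 'rV[T]_k) (x : X) :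
  (forall j, {for x, continuous (fun y => f y 0 j)}) -> {for x, continuous f}.
Proof.
move=> cf U /row_nbhsP[P Pf PU].
have h : \forall y \near x, forall j, P j (f y 0 j).
  by apply: filter_forall => j; exact: (cf j _ (Pf j)).
by apply: filterS h => y Py; exact: PU.
Qed.

Lemma continuous_coord (T : topologicalType) k (j : 'I_k) :
  continuous (fun v : 'rV[T]_k => v 0 j).
Proof.
move=> v U Uv; apply/row_nbhsP.
exists (fun i => if i == j then U else setT); first by move=> i; case: eqP => [->|_] //; exact: filterT.
by move=> w /(_ j); rewrite eqxx.
Qed.

Lemma continuous_vC k : continuous (@vC R k).
Proof.
move=> v; apply: cvg_rowP => j.
rewrite (_ : (fun y => _) = (fun y : 'rV[R]_k => y 0 j +i* 0)).
  apply: (@continuous_comp _ _ _ (fun y : 'rV[R]_k => (y 0 j, 0)) (fun ab : R * R => ab.1 +i* ab.2)).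
    by apply: (@cvg_pair _ _ _ (nbhs v) (nbhs (v 0 j)) (nbhs 0)); [exact: continuous_coord|exact: cvg_cst].
  exact: continuous_Complex.
by apply/funext => y; rewrite mxE.
Qed.

Lemma continuous_vRe k : continuous (@vRe R k).
Proof.
move=> v; apply: cvg_rowP => j.
rewrite (_ : (fun y => _) = (fun y : 'rV[R[i]]_k => complex.Re (y 0 j))).
  by apply: continuous_comp; [exact: continuous_coord|exact: continuous_Re].
by apply/funext => y; rewrite mxE.
Qed.

Lemma continuous_vIm k : continuous (@vIm R k).
Proof.
move=> v; apply: cvg_rowP => j.
rewrite (_ : (fun y => _) = (fun y : 'rV[R[i]]_k => complex.Im (y 0 j))).
  by apply: continuous_comp; [exact: continuous_coord|exact: continuous_Im].
by apply/funext => y; rewrite mxE.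
Qed.

Lemma continuous_conjc : continuous (@conjc R : R[i] -> R[i]).
Proof.
move=> z.
rewrite (_ : @conjc R = (fun z : R[i] => complex.Re z +i* - complex.Im z)); last first.
  by apply/funext => -[a b].
apply: (@continuous_comp _ _ _ (fun y : R[i] => (complex.Re y, - complex.Im y)) (fun ab : R * R => ab.1 +i* ab.2)).
  apply: (@cvg_pair _ _ _ (nbhs z) (nbhs (complex.Re z)) (nbhs (- complex.Im z))); first exact: continuous_Re.
  by apply: continuousN; exact: continuous_Im.
exact: continuous_Complex.
Qed.

Lemma vReD k (z w : 'rV[R[i]]_k) : vRe (z + w) = vRe z + vRe w.
Proof. by apply/rowP => j; rewrite !mxE cReD. Qed.
Lemma vImD k (z w : 'rV[R[i]]_k) : vIm (z + w) = vIm z + vIm w.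
Proof. by apply/rowP => j; rewrite !mxE cImD. Qed.
Lemma vReN k (z : 'rV[R[i]]_k) : vRe (- z) = - vRe z.
Proof. by apply/rowP => j; rewrite !mxE cReN. Qed.
Lemma vImN k (z : 'rV[R[i]]_k) : vIm (- z) = - vIm z.
Proof. by apply/rowP => j; rewrite !mxE cImN. Qed.
Lemma vRe_vC k (x : 'rV[R]_k) : vRe (vC x) = x.
Proof. by apply/rowP => j; rewrite !mxE. Qed.
Lemma vIm_vC k (x : 'rV[R]_k) : vIm (vC x) = 0.
Proof. by apply/rowP => j; rewrite !mxE. Qed.
Lemma vReiZ k (z : 'rV[R[i]]_k) : vRe ('i *: z) = - vIm z.
Proof. by apply/rowP => j; rewrite !mxE cReM/= mul0r mul1r sub0r. Qed.
Lemma vImiZ k (z : 'rV[R[i]]_k) : vIm ('i *: z) = vRe z.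
Proof. by apply/rowP => j; rewrite !mxE cImM/= mul0r mul1r add0r. Qed.
Lemma vReIm k (z : 'rV[R[i]]_k) : z = vC (vRe z) + 'i *: vC (vIm z).
Proof.
apply/rowP => j; rewrite !mxE; case: (z 0 j) => a b /=.
by apply/eqP; rewrite eq_complex/=; apply/andP; split; apply/eqP; ring.
Qed.
Lemma vReZ k (t : R) (z : 'rV[R[i]]_k) : vRe (t%:C *: z) = t *: vRe z.
Proof. by apply/rowP => j; rewrite !mxE cReM/= mul0r subr0. Qed.
Lemma vImZ k (t : R) (z : 'rV[R[i]]_k) : vIm (t%:C *: z) = t *: vIm z.
Proof. by apply/rowP => j; rewrite !mxE cImM/= mul0r addr0. Qed.

End Rows.

Section Points.
Context {R : realType} {n m : nat}.
Local Notation Rm := (measurableTypeR R).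
Local Notation E := 'rV[R[i]]_n.
Local Notation F := 'rV[R]_m.

Lemma borel_map_ptF : borel_map (@ptF R m).
Proof.
apply: borel_map_row; first exact: cbase_real.
move=> j; rewrite (_ : (fun t => _) = (fun t : m.-tuple Rm => tnth t j : R)); last first.
  by apply/funext => t; rewrite mxE.
by apply: measurable_borel_map_real; exact: measurable_tnth.
Qed.

Lemma borel_map_ptE : borel_map (@ptE R n).
Proof.
apply: borel_map_row; first exact: cbase_complex.
move=> j; rewrite (_ : (fun t => _) =
  (fun z : Rm * Rm => z.1 +i* z.2 : R[i]) \o (fun t : n.-tuple (Rm * Rm)%type => tnth t j)); last first.
  by apply/funext => t; rewrite mxE.
by apply: measurable_borel_map; [exact: measurable_tnth|exact: borel_map_pairC].
Qed.

Lemma borel_map_ptN : borel_map (@ptN R n m).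
Proof.
apply: borel_map_pair.
- exact: cbase_row cbase_complex.
- exact: cbase_row (cbase_real _).
- by apply: (@measurable_borel_map _ _ _ _ _ (@ptE R n)); [exact: measurable_fst|exact: borel_map_ptE].
- by apply: (@measurable_borel_map _ _ _ _ _ (@ptF R m)); [exact: measurable_snd|exact: borel_map_ptF].
Qed.

Definition shiftE (z : E) (t : n.-tuple (Rm * Rm)%type) : n.-tuple (Rm * Rm)%type :=
  [tuple ((complex.Re (z 0 j) + (tnth t j).1)%R, (complex.Im (z 0 j) + (tnth t j).2)%R) | j < n].
Definition shiftF (x : F) (t : m.-tuple Rm) : m.-tuple Rm :=
  [tuple (x 0 j + tnth t j)%R | j < m].

Lemma ptE_shift z t : ptE (shiftE z t) = z + ptE t.
Proof.
apply/rowP => j; rewrite !mxE tnth_mktuple /=.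
by rewrite -complexD; case: (z 0 j).
Qed.

Lemma ptF_shift x t : ptF (shiftF x t) = x + ptF t.
Proof. by apply/rowP => j; rewrite !mxE tnth_mktuple. Qed.

Lemma mpres_shiftE z : mpres (lebE R n) (shiftE z).
Proof.
apply: (mpres_tuple (tau := fun j (p : Rm * Rm) =>
  ((complex.Re (z 0 j) + p.1)%R : Rm, (complex.Im (z 0 j) + p.2)%R : Rm))) => j.
exact: mpres_shift2.
Qed.

Lemma mpres_shiftF x : mpres (lebF R m) (shiftF x).
Proof.
by apply: (mpres_tuple (tau := fun j (p : Rm) => (x 0 j + p)%R : Rm)) => j; exact: mpres_shift.
Qed.

(** Fubini's theorem makes Lebesgue measure invariant under translations of [F]
    that depend on the point of [E]; all the translations of the group have this
    form. *)
Lemma mpres_shear (z : E) (c : E -> F) : continuous c ->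
  mpres (lebN R n m) (fun v => (shiftE z v.1, shiftF (c (ptE v.1)) v.2)).
Proof.
move=> cc; apply: (@mpres_skew _ _ _ _ _ (lebE R n) (lebF R m) (shiftE z) (fun t => shiftF (c (ptE t)))).
- exact: mpres_shiftE.
- by move=> t; exact: mpres_shiftF.
apply: measurable_fun_pair.
  by have [mE _] := mpres_shiftE z; apply: (measurableT_comp mE); exact: measurable_fst.
apply/measurable_fun_tnthP => j.
rewrite (_ : _ \o _ = (fun v : n.-tuple (Rm * Rm)%type * m.-tuple Rm =>
   (c (ptE v.1) 0 j + tnth v.2 j)%R)); last by apply/funext => v /=; rewrite tnth_mktuple.
apply: measurable_funD.
  apply: (@borel_map_measurable _ _ R).
  apply: (@borel_map_comp _ _ _ _ _ (fun x : F => x 0 j)); last exact: continuous_coord.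
  apply: (@borel_map_comp _ _ _ _ _ c _ cc).
  by apply: (@measurable_borel_map _ _ _ _ _ (@ptE R n)); [exact: measurable_fst|exact: borel_map_ptE].
apply: (measurableT_comp (@measurable_tnth _ Rm m j)); exact: measurable_snd.
Qed.

End Points.

Section Hermitian.
Context {R : realType} {n m : nat}.
Local Notation E := 'rV[R[i]]_n.
Local Notation F := 'rV[R]_m.
Local Notation FC := 'rV[R[i]]_m.
Context (Phi : E -> E -> FC) (hPhi : hermitian_map Phi).

Lemma PhiDl u v w : Phi (u + v) w = Phi u w + Phi v w.
Proof. by have := hPhi.1 1 u v w; rewrite !scale1r. Qed.

Lemma Phi0l w : Phi 0 w = 0.
Proof. by have := PhiDl 0 0 w; rewrite addr0 -[LHS]addr0 => /addrI. Qed.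

Lemma PhiZl a u w : Phi (a *: u) w = a *: Phi u w.
Proof. by have := hPhi.1 a u 0 w; rewrite addr0 Phi0l addr0. Qed.

Lemma PhiNl u w : Phi (- u) w = - Phi u w.
Proof. by rewrite -scaleN1r PhiZl scaleN1r. Qed.

Lemma PhiC u v : Phi v u = map_mx (@conjc R) (Phi u v). Proof. exact: hPhi.2. Qed.

Lemma PhiDr u v w : Phi w (u + v) = Phi w u + Phi w v.
Proof. by rewrite PhiC PhiDl map_mxD -!PhiC. Qed.

Lemma Phi0r w : Phi w 0 = 0.
Proof. by rewrite PhiC Phi0l map_mx0. Qed.

Lemma PhiNr u w : Phi w (- u) = - Phi w u.
Proof. by rewrite PhiC PhiNl map_mxN -PhiC. Qed.

Lemma PhiZr a u w : Phi w (a *: u) = conjc a *: Phi w u.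
Proof. by rewrite PhiC PhiZl map_mxZ -PhiC. Qed.

Lemma vIm_PhiC u v : vIm (Phi v u) = - vIm (Phi u v).
Proof. by rewrite PhiC; apply/rowP => j; rewrite !mxE; case: (Phi u v 0 j). Qed.

Lemma vRe_PhiC u v : vRe (Phi v u) = vRe (Phi u v).
Proof. by rewrite PhiC; apply/rowP => j; rewrite !mxE; case: (Phi u v 0 j). Qed.

Lemma vIm_Phid u : vIm (Phi u u) = 0.
Proof.
have := vIm_PhiC u u => /eqP; rewrite -addr_eq0 -mulr2n => /eqP e.
apply/rowP => j; move/rowP/(_ j)/eqP: e; rewrite !mxE.
by rewrite -mulr2n mulrn_eq0/= => /eqP.
Qed.

Lemma PhidD u v : Phid Phi (u + v) = Phid Phi u + Phid Phi v + 2 *: vRe (Phi u v).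
Proof.
rewrite /Phid PhiDl !PhiDr !vReD (vRe_PhiC u v) scaler_nat mulr2n.
by rewrite -!addrA; congr (_ + _); rewrite [RHS]addrCA; congr (_ + _); exact: addrC.
Qed.

Lemma continuous_Phi : continuous (fun p : E * E => Phi p.1 p.2).
Proof.
move=> p; apply: cvg_rowP => l.
have e (q : E * E) : Phi q.1 q.2 0 l = \sum_(i < n) \sum_(j < n)
    q.1 0 i * (conjc (q.2 0 j) * Phi (delta_mx 0 i) (delta_mx 0 j) 0 l).
  rewrite {1}(row_sum_delta q.1).
  rewrite (big_morph (fun u => Phi u q.2) (fun u v => PhiDl u v q.2) (Phi0l q.2)) summxE.
  apply: eq_bigr => i _; rewrite PhiZl mxE {1}(row_sum_delta q.2).
  rewrite (big_morph (fun u => Phi (delta_mx 0 i) u) (fun u v => PhiDr u v _) (Phi0r _)) summxE.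
  by rewrite mulr_sumr; apply: eq_bigr => j _; rewrite PhiZr mxE.
rewrite (_ : (fun y => _) = (fun q : E * E => \sum_(i < n) \sum_(j < n)
    q.1 0 i * (conjc (q.2 0 j) * Phi (delta_mx 0 i) (delta_mx 0 j) 0 l))); last first.
  by apply/funext => q; exact: (e q).
have csum (I : Type) (r : seq I) (f : I -> E * E -> R[i]) : (forall i, {for p, continuous (f i)}) ->
    {for p, continuous (fun q => \sum_(i <- r) f i q)}.
  move=> cf; elim: r => [|i r IH].
    by rewrite (_ : (fun q => _) = (fun=> 0)); [exact: cst_continuous|apply/funext => q; rewrite big_nil].
  rewrite (_ : (fun q => _) = (fun q => f i q + \sum_(i <- r) f i q)).
    by apply: continuousD; [exact: cf|exact: IH].
  by apply/funext => q; rewrite big_cons.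
apply: (csum) => i; apply: (csum) => j.
apply: continuousM.
  apply: (@continuous_comp _ _ _ fst (fun v : E => v 0 i)); first exact: cvg_fst.
  exact: continuous_coord.
apply: continuousM; last exact: cst_continuous.
apply: (@continuous_comp _ _ _ (fun q : E * E => q.2 0 j) (@conjc R)); last exact: continuous_conjc.
apply: (@continuous_comp _ _ _ snd (fun v : E => v 0 j)); first exact: cvg_snd.
exact: continuous_coord.
Qed.

Lemma continuous_Phi_comp (X : topologicalType) (f g : X -> E) x :
  {for x, continuous f} -> {for x, continuous g} ->
  {for x, continuous (fun y => Phi (f y) (g y))}.
Proof.
move=> cf cg; apply: (@continuous_comp _ _ _ (fun y => (f y, g y)) (fun p : E * E => Phi p.1 p.2)).
  exact: (@cvg_pair _ _ _ (nbhs x) (nbhs (f x)) (nbhs (g x)) _ _ _ f g cf cg).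
exact: continuous_Phi.
Qed.

Lemma continuous_Phid : continuous (Phid Phi).
Proof.
move=> u; apply: (@continuous_comp _ _ _ (fun v => Phi v v) (@vRe R m)); last exact: continuous_vRe.
by apply: continuous_Phi_comp; exact: cvg_id.
Qed.

Lemma continuous_rho : continuous (rho Phi).
Proof.
move=> w; apply: cvgB.
  by apply: (@continuous_comp _ _ _ snd (@vIm R m)); [exact: cvg_snd|exact: continuous_vIm].
by apply: (@continuous_comp _ _ _ fst (Phid Phi)); [exact: cvg_fst|exact: continuous_Phid].
Qed.

Lemma continuous_mulN : continuous (fun p : (E * F) * (E * F) => mulN Phi p.1 p.2).
Proof.
have c1 : continuous (fun p : (E * F) * (E * F) => p.1.1).
  by move=> p; apply: (@continuous_comp _ _ _ fst fst); [exact: cvg_fst|exact: cvg_fst].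
have c2 : continuous (fun p : (E * F) * (E * F) => p.2.1).
  by move=> p; apply: (@continuous_comp _ _ _ snd fst); [exact: cvg_snd|exact: cvg_fst].
have c3 : continuous (fun p : (E * F) * (E * F) => p.1.2).
  by move=> p; apply: (@continuous_comp _ _ _ fst snd); [exact: cvg_fst|exact: cvg_snd].
have c4 : continuous (fun p : (E * F) * (E * F) => p.2.2).
  by move=> p; apply: (@continuous_comp _ _ _ snd snd); [exact: cvg_snd|exact: cvg_snd].
move=> p; rewrite /mulN.
apply: (@cvg_pair _ _ _ (nbhs p) (nbhs (p.1.1 + p.2.1)) (nbhs (p.1.2 + p.2.2 + 2%:R *: vIm (Phi p.1.1 p.2.1)))).
  by apply: cvgD; [exact: c1|exact: c2].
apply: cvgD; first by apply: cvgD; [exact: c3|exact: c4].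
apply: cvgZr.
apply: (@continuous_comp _ _ _ (fun p : (E * F) * (E * F) => Phi p.1.1 p.2.1) (@vIm R m)); last exact: continuous_vIm.
by apply: continuous_Phi_comp; [exact: c1|exact: c2].
Qed.

(** The identification of [E * F_C] with [N * F] by the group coordinates
    [(zeta, Re z)] and [rho]. *)
Definition coN (w : E * FC) : E * F := (w.1, vRe w.2).
Definition pt (a : E * F) (h : F) : E * FC :=
  (a.1, vC a.2 + 'i *: vC (Phid Phi a.1) + 'i *: vC h).

Lemma sliceE (T : Type) (f : E * FC -> T) h a : slice Phi f h a = f (pt a h).
Proof. by []. Qed.

Lemma coN_pt a h : coN (pt a h) = a.
Proof.
case: a => z x; rewrite /coN /pt /=; congr pair.
by rewrite !vReD !vReiZ !vIm_vC vRe_vC oppr0 !addr0.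
Qed.

Lemma rho_pt a h : rho Phi (pt a h) = h.
Proof. by rewrite /rho /pt /= !vImD !vImiZ !vRe_vC vIm_vC add0r addrAC subrr add0r. Qed.

Lemma pt_coN w : pt (coN w) (rho Phi w) = w.
Proof.
case: w => z x; rewrite /pt /coN /rho /=; congr pair.
rewrite [RHS]vReIm -addrA -scalerDr; congr (_ + _ *: _).
by rewrite /vC -map_mxD addrC subrK.
Qed.

Lemma continuous_coN : continuous coN.
Proof.
move=> w; apply: (@cvg_pair _ _ _ (nbhs w) (nbhs w.1) (nbhs (vRe w.2))); first exact: cvg_fst.
by apply: (@continuous_comp _ _ _ snd (@vRe R m)); [exact: cvg_snd|exact: continuous_vRe].
Qed.

Lemma continuous_pt : continuous (fun p : (E * F) * F => pt p.1 p.2).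
Proof.
move=> p; have c1 : {for p, continuous (fun p : (E * F) * F => p.1.1)}.
  by apply: (@continuous_comp _ _ _ fst fst); [exact: cvg_fst|exact: cvg_fst].
apply: (@cvg_pair _ _ _ (nbhs p) (nbhs p.1.1) (nbhs (vC p.1.2 + 'i *: vC (Phid Phi p.1.1) + 'i *: vC p.2))).
  exact: c1.
apply: cvgD; first apply: cvgD.
- apply: (@continuous_comp _ _ _ (fun p : (E * F) * F => p.1.2) (@vC R m)); last exact: continuous_vC.
  by apply: (@continuous_comp _ _ _ fst snd); [exact: cvg_fst|exact: cvg_snd].
- apply: cvgZr.
  apply: (@continuous_comp _ _ _ (fun p : (E * F) * F => Phid Phi p.1.1) (@vC R m)); last exact: continuous_vC.
  by apply: (@continuous_comp _ _ _ (fun p : (E * F) * F => p.1.1) (Phid Phi)); [exact: c1|exact: continuous_Phid].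
- apply: cvgZr; apply: (@continuous_comp _ _ _ snd (@vC R m)); [exact: cvg_snd|exact: continuous_vC].
Qed.

Definition invN (a : E * F) : E * F := (- a.1, - a.2).

Lemma mulNA a b c : mulN Phi a (mulN Phi b c) = mulN Phi (mulN Phi a b) c.
Proof.
rewrite /mulN /=; congr pair; first by rewrite addrA.
rewrite PhiDl PhiDr !vImD !scalerDr.
rewrite -!addrA; congr (_ + (_ + _)).
by rewrite [RHS]addrCA; congr (_ + _); rewrite [LHS]addrCA; congr (_ + _); exact: addrC.
Qed.

Lemma mul0N a : mulN Phi 0 a = a.
Proof. by case: a => z x; rewrite /mulN /= !add0r Phi0l /vIm map_mx0 scaler0 addr0. Qed.

Lemma mulN0 a : mulN Phi a 0 = a.
Proof. by case: a => z x; rewrite /mulN /= !addr0 Phi0r /vIm map_mx0 scaler0 addr0. Qed.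

Lemma mulNV a : mulN Phi a (invN a) = 0.
Proof.
by rewrite /mulN /invN /= !subrr add0r PhiNr vImN vIm_Phid oppr0 scaler0.
Qed.

Lemma mulVN a : mulN Phi (invN a) a = 0.
Proof.
by rewrite /mulN /invN /= !addNr add0r PhiNl vImN vIm_Phid oppr0 scaler0.
Qed.

Lemma mulVKN a b : mulN Phi (invN a) (mulN Phi a b) = b.
Proof. by rewrite mulNA mulVN mul0N. Qed.

Lemma mulKVN a b : mulN Phi a (mulN Phi (invN a) b) = b.
Proof. by rewrite mulNA mulNV mul0N. Qed.

Lemma mpres_left (a : E * F) : mpres (lebN R n m)
  (fun v => (shiftE a.1 v.1, shiftF (a.2 + 2%:R *: vIm (Phi a.1 (ptE v.1))) v.2)).
Proof.
apply: (@mpres_shear _ _ _ a.1 (fun z => a.2 + 2%:R *: vIm (Phi a.1 z))) => z.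
have c1 : {for z, continuous (fun=> a.2 : F)} by exact: cst_continuous.
suff c2 : {for z, continuous (fun z => 2%:R *: vIm (Phi a.1 z) : F)} by exact: (continuousD c1 c2).
apply: cvgZr; first exact: nbhs_filter.
apply: (@continuous_comp _ _ _ (fun z => Phi a.1 z) (@vIm R m)); last exact: continuous_vIm.
by apply: continuous_Phi_comp; [exact: cst_continuous|exact: cvg_id].
Qed.

Lemma mpres_right (a : E * F) : mpres (lebN R n m)
  (fun v => (shiftE a.1 v.1, shiftF (a.2 + 2%:R *: vIm (Phi (ptE v.1) a.1)) v.2)).
Proof.
apply: (@mpres_shear _ _ _ a.1 (fun z => a.2 + 2%:R *: vIm (Phi z a.1))) => z.
have c1 : {for z, continuous (fun=> a.2 : F)} by exact: cst_continuous.
suff c2 : {for z, continuous (fun z => 2%:R *: vIm (Phi z a.1) : F)} by exact: (continuousD c1 c2).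
apply: cvgZr; first exact: nbhs_filter.
apply: (@continuous_comp _ _ _ (fun z => Phi z a.1) (@vIm R m)); last exact: continuous_vIm.
by apply: continuous_Phi_comp; [exact: cvg_id|exact: cst_continuous].
Qed.

End Hermitian.

(** * The sub-mean value inequality *)

Section Norms.
Context {R : realType}.

(** Growth is measured in the sum norms, which are easy to estimate coordinate by
    coordinate. *)
Definition lone k (x : 'rV[R]_k) : R := \sum_j `|x 0 j|.
Definition lonec k (z : 'rV[R[i]]_k) : R := \sum_j cabs (z 0 j).

Lemma lone_ge0 k (x : 'rV[R]_k) : 0 <= lone x.
Proof. by apply: sumr_ge0 => j _. Qed.

Lemma lonec_ge0 k (z : 'rV[R[i]]_k) : 0 <= lonec z.
Proof. by apply: sumr_ge0 => j _; exact: cabs_ge0. Qed.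

Lemma loneD k (x y : 'rV[R]_k) : lone (x + y) <= lone x + lone y.
Proof. by rewrite -big_split; apply: ler_sum => j _; rewrite mxE ler_normD. Qed.

Lemma lonecD k (x y : 'rV[R[i]]_k) : lonec (x + y) <= lonec x + lonec y.
Proof. by rewrite -big_split; apply: ler_sum => j _; rewrite mxE cabsD. Qed.

Lemma lonecZ k a (x : 'rV[R[i]]_k) : lonec (a *: x) = cabs a * lonec x.
Proof. by rewrite /lonec mulr_sumr; apply: eq_bigr => j _; rewrite mxE cabsM. Qed.

Lemma loneZ k a (x : 'rV[R]_k) : lone (a *: x) = `|a| * lone x.
Proof. by rewrite /lone mulr_sumr; apply: eq_bigr => j _; rewrite mxE normrM. Qed.

Lemma coord_le_lone k (x : 'rV[R]_k) j : `|x 0 j| <= lone x.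
Proof. by rewrite /lone (bigD1 j)//= lerDl sumr_ge0. Qed.

Lemma coord_le_lonec k (x : 'rV[R[i]]_k) j : cabs (x 0 j) <= lonec x.
Proof. by rewrite /lonec (bigD1 j)//= lerDl sumr_ge0// => ? _; exact: cabs_ge0. Qed.

Lemma sqrt_sum_sqr_le (I : Type) (r : seq I) (f : I -> R) : (forall i, 0 <= f i) ->
  Num.sqrt (\sum_(i <- r) f i ^+ 2) <= \sum_(i <- r) f i.
Proof.
move=> f0; have S0 : 0 <= \sum_(i <- r) f i by apply: sumr_ge0.
rewrite -[leRHS]ger0_norm// -sqrtr_sqr ler_sqrt ?sqr_ge0//.
elim: r {S0} => [|i r IH]; first by rewrite !big_nil expr0n.
rewrite !big_cons sqrrD -addrA lerD2l (le_trans IH)// lerDr mulrn_wge0// mulr_ge0//.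
exact: sumr_ge0.
Qed.

Lemma enorm_le k (x : 'rV[R]_k) : enorm x <= lone x.
Proof.
rewrite /enorm; under eq_bigr do rewrite -[_ ^+ 2]ger0_norm ?sqr_ge0// normrX.
exact: sqrt_sum_sqr_le.
Qed.

Lemma ecnorm_le k (x : 'rV[R[i]]_k) : ecnorm x <= lonec x.
Proof. by apply: sqrt_sum_sqr_le => i; exact: cabs_ge0. Qed.

Lemma coord_le_enorm k (x : 'rV[R]_k) j : `|x 0 j| <= enorm x.
Proof.
rewrite -sqrtr_sqr /enorm ler_sqrt; last by apply: sumr_ge0 => ? _; exact: sqr_ge0.
by rewrite (bigD1 j)//= lerDl sumr_ge0// => ? _; exact: sqr_ge0.
Qed.

Lemma coord_le_ecnorm k (x : 'rV[R[i]]_k) j : cabs (x 0 j) <= ecnorm x.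
Proof.
rewrite -[leLHS]ger0_norm ?cabs_ge0// -sqrtr_sqr /ecnorm ler_sqrt.
  by rewrite (bigD1 j)//= lerDl sumr_ge0// => ? _; exact: sqr_ge0.
by apply: sumr_ge0 => ? _; exact: sqr_ge0.
Qed.

Lemma lone_le_enorm k (x : 'rV[R]_k) : lone x <= k%:R * enorm x.
Proof.
rewrite -[k in k%:R]card_ord -sum1_card natr_sum mulr_suml; apply: ler_sum => j _.
by rewrite mul1r coord_le_enorm.
Qed.

Lemma lonec_le_ecnorm k (x : 'rV[R[i]]_k) : lonec x <= k%:R * ecnorm x.
Proof.
rewrite -[k in k%:R]card_ord -sum1_card natr_sum mulr_suml; apply: ler_sum => j _.
by rewrite mul1r coord_le_ecnorm.
Qed.

Lemma continuous_sum (X : topologicalType) (I : Type) (r : seq I) (f : I -> X -> R) x :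
  (forall i, {for x, continuous (f i)}) -> {for x, continuous (fun y => \sum_(i <- r) f i y)}.
Proof.
move=> cf; elim: r => [|i r IH].
  rewrite (_ : (fun q => _) = (fun=> 0)); first exact: cst_continuous.
  by apply/funext => q; rewrite big_nil.
rewrite (_ : (fun q => _) = (fun q => f i q + \sum_(i <- r) f i q)).
  by apply: continuousD; [exact: cf|exact: IH].
by apply/funext => q; rewrite big_cons.
Qed.

Lemma continuous_lone k : continuous (@lone k).
Proof.
move=> x; apply: continuous_sum => j.
by apply: continuous_comp; [exact: continuous_coord|exact: norm_continuous].
Qed.

Definition boxE k (r : R) : set 'rV[R[i]]_k :=
  [set z | forall j, `|complex.Re (z 0 j)| <= r /\ `|complex.Im (z 0 j)| <= r].
Definition boxF k (r : R) : set 'rV[R]_k := [set x | forall j, `|x 0 j| <= r].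

Lemma compact_itv_norm (r : R) : compact [set x : R | `|x| <= r].
Proof.
rewrite (_ : [set x | _] = `[- r, r]%classic); first exact: segment_compact.
by apply/seteqP; split=> x /=; rewrite in_itv/= ler_norml.
Qed.

Lemma compact_boxF k r : compact (@boxF k r).
Proof.
have h := @rV_compact R k (fun=> [set x : R | `|x| <= r]) (fun=> @compact_itv_norm r).
rewrite (_ : boxF r = [set v : 'rV[R]_k | forall i, [set x : R | `|x| <= r] (v ord0 i)])//.
Qed.

Lemma compact_square (r : R) :
  compact [set z : R[i] | `|complex.Re z| <= r /\ `|complex.Im z| <= r].
Proof.
rewrite (_ : [set z | _] = (fun ab : R * R => ab.1 +i* ab.2) @`
    ([set x : R | `|x| <= r] `*` [set x : R | `|x| <= r])).
  apply: continuous_compact; first exact: continuous_subspaceT continuous_Complex.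
  by apply: compact_setX; exact: compact_itv_norm.
apply/seteqP; split=> [z [h1 h2]|_ [[a b] [h1 h2] <-]]//.
by exists (complex.Re z, complex.Im z) => //=; case: z {h1 h2}.
Qed.

Lemma compact_boxE k r : compact (@boxE k r).
Proof.
have h := @rV_compact R[i] k (fun=> [set z : R[i] | `|complex.Re z| <= r /\ `|complex.Im z| <= r])
  (fun=> @compact_square r).
exact: h.
Qed.

End Norms.

Section SubMean.
Context {R : realType} {n m : nat}.
Local Notation Rm := (measurableTypeR R).
Local Notation E := 'rV[R[i]]_n.
Local Notation F := 'rV[R]_m.
Local Notation FC := 'rV[R[i]]_m.
Context (Phi : E -> E -> FC) (hPhi : hermitian_map Phi).

Definition entire (f : E * FC -> R[i]) := forall w, differentiable f w.

Definition tame (N : nat) (sg A : R) (f : E * FC -> R[i]) := forall w,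
  cabs (f w) <= A * (1 + lonec w.1 + lonec w.2) ^+ N * expR (sg * lone (rho Phi w)).

Lemma holo_line f (q v : E * FC) w : entire f ->
  differentiable (fun w : R[i] => f (q + w *: v)) w.
Proof.
move=> hf; have d : differentiable (fun w : R[i] => q + w *: v) w.
  apply: differentiableD; first exact: differentiable_cst.
  by apply: differentiableZl.
exact: (differentiable_comp d (hf _)).
Qed.

Lemma row_upd k (z : 'I_k -> R[i]) i a :
  \row_j upd z i a j = \row_j upd z i 0 j + a *: delta_mx 0 i.
Proof.
apply/rowP => j; rewrite !mxE eqxx /upd /=.
by case: eqVneq => _; rewrite ?mulr1 ?mulr0 ?add0r ?addr0.
Qed.

Lemma entire_continuous f : entire f -> continuous f.
Proof. by move=> hf w; exact: differentiable_continuous (hf w). Qed.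

Lemma measurable_cabs_powR d (T : measurableType d) (h : T -> E * FC) (f : E * FC -> R[i]) (p : R) :
  continuous f -> borel_map h -> measurable_fun setT (fun t => cabs (f (h t)) `^ p).
Proof.
move=> cf bh; apply: (measurableT_comp (measurable_powR p)); apply: borel_map_measurable.
apply: (@borel_map_comp _ _ _ _ h (fun w => cabs (f w)) bh) => w.
by apply: continuous_comp; [exact: cf|exact: continuous_cabs].
Qed.

(** On the fibres of the projection to [E], [rho] is an imaginary part, so in each
    coordinate the function has exponential type [sg]; [strip_bound] is applied to
    one coordinate after the other. *)
Lemma fiber_bound (N : nat) (sg H p : R) : 0 <= sg -> 0 <= H -> 0 < p ->
  exists C : R, 0 < C /\ forall f A, entire f -> 0 <= A -> tame N sg A f ->
    forall (u : E) (z : FC), boxF H (vIm z) ->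
    ((cabs (f (u, z + 'i *: vC (Phid Phi u))) `^ p)%:E <=
      \int[lebF R m]_s (cabs (f (u, vC (vRe z + ptF s) + 'i *: vC (Phid Phi u))) `^ p *
         \prod_(j < m) (C * (1 + tnth s j ^+ 2)^-1))%:E)%E.
Proof.
move=> sg0 H0 p0; have [C [C0 hC]] := @strip_bound R N sg H p sg0 H0 p0.
exists C; split=> // f A hf A0 tf u z zH.
pose c := 'i *: vC (Phid Phi u) : FC.
pose phi (z : 'I_m -> R[i]) := cabs (f (u, \row_j z j + c)) `^ p.
have bpair d' (S : measurableType d') (h : S -> 'I_m -> R[i]) :
    (forall i, borel_map (h^~ i)) -> borel_map (fun s => (u, \row_j h s j + c) : E * FC).
  move=> bh; apply: borel_map_pair.
  - exact: cbase_row cbase_complex.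
  - exact: cbase_row cbase_complex.
  - exact: borel_map_cst.
  apply: (@borel_map_comp _ _ _ _ (fun s => \row_j h s j) (fun v : FC => v + c)).
    apply: borel_map_row; first exact: cbase_complex.
    move=> j; rewrite (_ : (fun t => _) = h^~ j); first exact: bh.
    by apply/funext => t; rewrite mxE.
  move=> v; have c1 : {for v, continuous (fun v : FC => v)} by exact: cvg_id.
  have c2 : {for v, continuous (fun _ : FC => c)} by exact: cst_continuous.
  exact: (continuousD c1 c2).
have mk : measurable_fun [set: Rm] (fun t : Rm => C * (1 + t ^+ 2)^-1).
  apply: measurable_funM => //.
  apply: continuous_measurable_fun => t; apply: cvgV; first by rewrite gt_eqF// ltr_pwDl ?sqr_ge0.
  by apply: cvgD; [exact: cvg_cst|exact: exprn_continuous].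
have k0 (t : Rm) : 0 <= C * (1 + t ^+ 2)^-1.
  by rewrite mulr_ge0 ?(ltW C0)// invr_ge0 addr_ge0 ?sqr_ge0.
have := @iterate_coordinates R _ Rm (@lebesgue_measure R) R[i]
  (fun a => `|complex.Im a| <= H) (fun a t => (complex.Re a + t) +i* 0)
  (fun t => C * (1 + t ^+ 2)^-1) m phi.
move=> /(_ _ _ mk k0 _ _ _ (fun j => z 0 j)) h.
have {}h := h _ _ _ (fun=> powR_ge0 _ _) _ _.
have -> : (u, z + c) = (u, \row_j z 0 j + c).
  by congr (u, _ + c); apply/rowP => j; rewrite mxE.
apply: (le_trans (h _ _ _ _ _)).
- move=> a; apply: borel_map_Complex; last exact: borel_map_cst.
  apply: measurable_borel_map_real; exact: measurable_shift.
- by move=> a t /=; rewrite normr0.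
- by move=> d' S g bg; apply: (measurable_cabs_powR p (entire_continuous hf)); exact: bpair.
- clear h zH z; move=> z i Pz.
  pose q : E * FC := (u, \row_j upd z i 0 j + c).
  pose v : E * FC := (0, delta_mx 0 i).
  pose G w := f (q + w *: v).
  have GE w : f (u, \row_j upd z i w j + c) = G w.
    have e : q + w *: v = (q.1 + w *: v.1, q.2 + w *: v.2) by [].
    by rewrite /G e /q /v /= scaler0 addr0 addrAC -row_upd.
  have dG w : differentiable G w by exact: holo_line.
  pose S : R := \sum_j `|complex.Im (z j)|.
  pose B := \sum_j cabs (z j) + lonec u + lonec c.
  have S0 : 0 <= S by apply: sumr_ge0.
  have B0 : 0 <= B.
    by rewrite !addr_ge0 ?lonec_ge0//; apply: sumr_ge0 => ? _; exact: cabs_ge0.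
  pose A' : R := A * (1 + B) ^+ N * expR (sg * S).
  have B1 : 0 <= 1 + B by exact: addr_ge0 ler01 B0.
  have A'0 : 0 <= A' by apply: mulr_ge0; [apply: mulr_ge0 => //; exact: exprn_ge0|exact: expR_ge0].
  have hG w : cabs (G w) <= A' * (1 + cabs w) ^+ N * expR (sg * `|complex.Im w|).
    rewrite -GE; apply: (le_trans (tf _)) => /=.
    have r1 : lone (rho Phi (u, \row_j upd z i w j + c)) <= S + `|complex.Im w|.
      have -> : rho Phi (u, \row_j upd z i w j + c) = \row_j complex.Im (upd z i w j).
        rewrite /rho /= vImD vImiZ vRe_vC addrK; apply/rowP => j; by rewrite !mxE.
      rewrite /lone (bigD1 i)//= mxE /upd eqxx addrC lerD2r /S [leRHS](bigD1 i)//=.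
      rewrite (eq_bigr (fun j => `|complex.Im (z j)|)) ?lerDr//.
      by move=> j /negbTE ji; rewrite mxE ji.
    have r2 : 1 + lonec u + lonec (\row_j upd z i w j + c) <= (1 + B) * (1 + cabs w).
      have : lonec (\row_j upd z i w j) <= \sum_j cabs (z j) + cabs w.
        rewrite /lonec (bigD1 i)//= mxE /upd eqxx addrC lerD2r [leRHS](bigD1 i)//=.
        rewrite (eq_bigr (fun j => cabs (z j))) ?lerDr ?cabs_ge0//.
        by move=> j /negbTE ji; rewrite mxE ji.
      have := lonecD (\row_j upd z i w j) c; have := cabs_ge0 w.
      have : 0 <= B * cabs w by rewrite mulr_ge0 ?cabs_ge0.
      by rewrite /B; lra.
    have r3 : 0 <= 1 + lonec u + lonec (\row_j upd z i w j + c) by rewrite !addr_ge0 ?lonec_ge0.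
    apply: (@le_trans _ _ (A * ((1 + B) * (1 + cabs w)) ^+ N * expR (sg * (S + `|complex.Im w|)))).
      apply: ler_pM; rewrite ?expR_ge0 ?mulr_ge0 ?exprn_ge0//.
        by rewrite ler_wpM2l// lerXn2r// nnegrE// (le_trans r3).
      by rewrite ler_expR ler_wpM2l.
    rewrite [sg * _]mulrDr expRD exprMn /A'.
    by rewrite le_eqVlt; apply/orP; left; apply/eqP; ring.
  have := hC G A' dG A'0 hG (complex.Re (z i)) (complex.Im (z i)) (Pz i).
  rewrite /phi -GE (_ : upd z i _ = z); last first.
    apply/funext => j; rewrite /upd; case: eqP => // ->; by case: (z i).
  move/le_trans; apply; rewrite le_eqVlt; apply/orP; left; apply/eqP.
  by apply: eq_integral => t _; rewrite -GE mulrCA.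
- by move=> j; have := zH j; rewrite mxE.
rewrite le_eqVlt; apply/orP; left; apply/eqP; apply: eq_integral => s _.
rewrite /phi; have -> : \row_j ((complex.Re (z 0 j) + tnth s j) +i* 0) = vC (vRe z + ptF s).
  by apply/rowP => j; rewrite !mxE.
exact: erefl.
Qed.

(** The right translation by [(u, 0)] of the complex group. It is holomorphic in
    [u], and it is the right translation by [(u, 0)] in the group coordinate. *)
Definition actR (w : E * FC) (u : E) : E * FC :=
  (w.1 + u, w.2 + 2%:R * 'i *: Phi u w.1).

(** Along each coordinate of [u], [actR w u] is an affine complex line, where
    [local_bound] applies. *)
Lemma base_bound (p : R) : 0 < p ->
  exists C : R, 0 < C /\ forall f, entire f -> forall w,
    ((cabs (f w) `^ p)%:E <=
      \int[lebE R n]_t (cabs (f (actR w (ptE t))) `^ p *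
         \prod_(j < n) (C * \1_(@sq R 1) (tnth t j)))%:E)%E.
Proof.
move=> p0; have [C [C0 hC]] := @local_bound R p p0.
exists C; split=> // f hf w.
pose phi (z : 'I_n -> R[i]) := cabs (f (actR w (\row_j z j))) `^ p.
have cact : continuous (actR w).
  move=> u; apply: (@cvg_pair _ _ _ (nbhs u) (nbhs (w.1 + u)) (nbhs (w.2 + 2%:R * 'i *: Phi u w.1))).
    by apply: cvgD; [exact: cvg_cst|exact: cvg_id].
  have c1 : {for u, continuous (fun=> w.2 : FC)} by exact: cst_continuous.
  suff c2 : {for u, continuous (fun u => 2%:R * 'i *: Phi u w.1 : FC)} by exact: (continuousD c1 c2).
  have c3 : {for u, continuous (fun u : E => Phi u w.1)}.
    apply: (@continuous_Phi_comp _ _ _ _ hPhi _ (fun u : E => u) (fun=> w.1)).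
      exact: cvg_id.
    exact: cst_continuous.
  exact: (cvgZr c3).
have mk : measurable_fun [set: Rm * Rm] (fun t : Rm * Rm => C * \1_(@sq R 1) t).
  by apply: measurable_funM => //; exact: measurable_indic (measurable_sq 1).
have k0 (t : Rm * Rm) : 0 <= C * \1_(@sq R 1) t by rewrite mulr_ge0// ltW.
have h := @iterate_coordinates R _ (Rm * Rm)%type
  (sf_product (@lebesgue_measure R) (@lebesgue_measure R)) R[i]
  (fun a => True) (fun a t => a + (t.1 +i* t.2))
  (fun t => C * \1_(@sq R 1) t) n phi _ (fun _ _ => I) mk k0 _ (fun=> powR_ge0 _ _) _ (fun=> 0) (fun=> I).
have actR0 : actR w (\row_(j < n) 0) = w.
  rewrite (_ : \row_(j < n) 0 = 0); last by apply/rowP => j; rewrite !mxE.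
  by rewrite /actR (Phi0l hPhi) scaler0 !addr0; case: (w).
rewrite /phi actR0 in h.
apply: (le_trans (h _ _ _)).
- move=> a; apply: (@borel_map_comp _ _ _ _ _ (fun z : R[i] => a + z) borel_map_pairC) => z.
  by apply: continuousD; [exact: cst_continuous|exact: cvg_id].
- move=> d' S g bg; apply: (measurable_cabs_powR p (entire_continuous hf)).
  apply: (@borel_map_comp _ _ _ _ (fun s => \row_j g s j) _ _ cact).
  apply: borel_map_row; first exact: cbase_complex.
  move=> j; rewrite (_ : (fun t => _) = g^~ j); first exact: bg.
  by apply/funext => t; rewrite mxE.
- move=> z i _.
  pose q : E * FC := actR w (\row_j z j).
  pose v : E * FC := (delta_mx 0 i, 2%:R * 'i *: Phi (delta_mx 0 i) w.1).
  have GE x : actR w (\row_j upd z i (z i + x) j) = q + x *: v.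
    have -> : \row_j upd z i (z i + x) j = \row_j z j + x *: delta_mx 0 i.
      apply/rowP => j; rewrite !mxE eqxx /upd /=.
      by case: eqVneq => [->|_]; rewrite ?mulr1 ?mulr0 ?addr0.
    rewrite (_ : q + x *: v = (q.1 + x *: v.1, q.2 + x *: v.2)); last by [].
    rewrite /actR (PhiDl hPhi) (PhiZl hPhi) scalerDr !addrA /q /v /actR /=.
    by rewrite !scalerA [_ * x]mulrC.
  have := hC (fun x => f (q + x *: v)) (fun x => holo_line q v x hf).
  rewrite scale0r addr0; move/le_trans; apply; rewrite le_eqVlt; apply/orP; left; apply/eqP.
  by apply: eq_integral => t _; rewrite GE mulrCA.
rewrite le_eqVlt; apply/orP; left; apply/eqP; apply: eq_integral => t _.
have -> : \row_j (0 + ((tnth t j).1 +i* (tnth t j).2)) = ptE t.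
  by apply/rowP => j; rewrite !mxE add0r.
exact: erefl.
Qed.

End SubMean.

Section Kernels.
Context {R : realType} {n m : nat}.
Local Notation Rm := (measurableTypeR R).
Local Notation NN := (n.-tuple (Rm * Rm)%type * m.-tuple Rm)%type.
Local Notation E := 'rV[R[i]]_n.
Local Notation F := 'rV[R]_m.
Local Notation FC := 'rV[R[i]]_m.

Definition kernE (r C : R) (t : n.-tuple (Rm * Rm)%type) : R :=
  \prod_(j < n) (C * \1_(@sq R r) (tnth t j)).
Definition kernF (C : R) (s : m.-tuple Rm) : R :=
  \prod_(j < m) (C * (1 + tnth s j ^+ 2)^-1).
(** Compactly supported in the directions of [E], where the bounds are local, but
    only integrable in those of [F]. *)
Definition kern (r C D : R) (v : NN) : R := kernE r C v.1 * kernF D v.2.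

Lemma onedsqr_gt0 (x : R) : 0 < 1 + x ^+ 2. Proof. by rewrite ltr_pwDl ?sqr_ge0. Qed.

Lemma kernE_ge0 r C t : 0 <= C -> 0 <= kernE r C t.
Proof. by move=> C0; apply: prodr_ge0 => j _; rewrite mulr_ge0. Qed.

Lemma kernF_ge0 C s : 0 <= C -> 0 <= kernF C s.
Proof.
by move=> C0; apply: prodr_ge0 => j _; rewrite mulr_ge0// invr_ge0 ltW// onedsqr_gt0.
Qed.

Lemma kern_ge0 r C D v : 0 <= C -> 0 <= D -> 0 <= kern r C D v.
Proof. by move=> C0 D0; rewrite mulr_ge0 ?kernE_ge0 ?kernF_ge0. Qed.

Lemma measurable_onedsqrV (C : R) :
  measurable_fun [set: Rm] (fun t : Rm => C * (1 + t ^+ 2)^-1).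
Proof.
apply: measurable_funM => //.
apply: continuous_measurable_fun => t; apply: cvgV; first by rewrite gt_eqF// onedsqr_gt0.
by apply: cvgD; [exact: cvg_cst|exact: exprn_continuous].
Qed.

Lemma measurable_sq_weight (r C : R) :
  measurable_fun [set: Rm * Rm] (fun t : Rm * Rm => C * \1_(@sq R r) t).
Proof. by apply: measurable_funM => //; exact: measurable_indic (measurable_sq r). Qed.

Lemma measurable_kernE r C : measurable_fun setT (kernE r C).
Proof.
apply: (@measurable_prod _ _ R) => j _.
by apply: (measurableT_comp (measurable_sq_weight r C)); exact: measurable_tnth.
Qed.

Lemma measurable_kernF C : measurable_fun setT (kernF C).
Proof.
apply: (@measurable_prod _ _ R) => j _.
by apply: (measurableT_comp (measurable_onedsqrV C)); exact: measurable_tnth.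
Qed.

Lemma measurable_kern r C D : measurable_fun setT (kern r C D).
Proof.
apply: measurable_funM.
  by apply: (measurableT_comp (measurable_kernE r C)); exact: measurable_fst.
by apply: (measurableT_comp (measurable_kernF D)); exact: measurable_snd.
Qed.

Lemma kernE_neq0 r C t : kernE r C t != 0 -> boxE r (ptE t).
Proof.
move=> /prodf_neq0 h j; have := h j isT; rewrite mxE indicE.
by case: (boolP (tnth t j \in sq r)) => [/set_mem[]|_]; rewrite ?mulr0 ?eqxx.
Qed.

Section TupleProduct.
Context {d : measure_display} {T : measurableType d}.
Context (mu : {sigma_finite_measure set T -> \bar R}) (kap : T -> R).
Context (mk : measurable_fun setT kap) (k0 : forall t, 0 <= kap t).

Lemma tuple_integral_prodS k :
  (\int[tuple_measure mu k.+1]_t (\prod_(i < k.+1) kap (tnth t i))%:E =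
   \int[mu]_t (kap t)%:E * \int[tuple_measure mu k]_t (\prod_(i < k) kap (tnth t i))%:E)%E.
Proof.
have mP l : measurable_fun setT (fun t : l.-tuple T => (\prod_(i < l) kap (tnth t i))%:E).
  apply/measurable_EFinP; apply: (@measurable_prod _ _ R) => j _.
  by apply: (measurableT_comp mk); exact: measurable_tnth.
have P0 l (t : l.-tuple T) : 0 <= \prod_(i < l) kap (tnth t i) by apply: prodr_ge0 => i _; exact: k0.
rewrite tuple_integralS; [|exact: mP|by move=> t; rewrite lee_fin].
set J := (\int[tuple_measure mu k]_t _)%E.
have J0 : (0 <= J)%E by apply: integral_ge0 => t _; rewrite lee_fin.
rewrite -ge0_integralZr//; last 2 first.
- exact/measurable_EFinP.
- by move=> x _; rewrite lee_fin.
apply: eq_integral => x _.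
rewrite /J -(ge0_integralZl_EFin _ measurableT (fun t _ => _) (mP k) (k0 x)); last by move=> ?; rewrite lee_fin.
apply: eq_integral => t _; rewrite -EFinM; congr (_%:E).
rewrite big_ord_recl tnth_tuple_cons fcons0; congr (_ * _).
by apply: eq_bigr => i _; rewrite tnth_tuple_cons fconsS.
Qed.

Lemma tuple_integral_prod0 :
  (\int[tuple_measure mu 0]_t (\prod_(i < 0) kap (tnth t i))%:E = 1)%E.
Proof.
rewrite tuple_integral0; first by rewrite big_ord0.
by under eq_fun do rewrite big_ord0; exact: measurable_cst.
Qed.

Lemma tuple_integral_prod_lty k : (\int[mu]_t (kap t)%:E < +oo)%E ->
  (\int[tuple_measure mu k]_t (\prod_(i < k) kap (tnth t i))%:E < +oo)%E.
Proof.
move=> koo; have I0 : (0 <= \int[mu]_t (kap t)%:E)%E.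
  by apply: integral_ge0 => t _; rewrite lee_fin.
elim: k => [|k IH]; first by rewrite tuple_integral_prod0 ltry.
by rewrite tuple_integral_prodS lte_mul_pinfty// ge0_fin_numE.
Qed.

Lemma tuple_integral_prod_gt0 k : (0 < \int[mu]_t (kap t)%:E)%E ->
  (0 < \int[tuple_measure mu k]_t (\prod_(i < k) kap (tnth t i))%:E)%E.
Proof.
move=> koo; elim: k => [|k IH]; first by rewrite tuple_integral_prod0.
by rewrite tuple_integral_prodS mule_gt0.
Qed.

End TupleProduct.

Lemma sq_lty (r : R) :
  (sf_product (@lebesgue_measure R) (@lebesgue_measure R) (@sq R r) < +oo)%E.
Proof.
pose D : set Rm := `[- r, r]%classic.
have mD : measurable D by exact: measurable_itv.
have -> : sq r = D `*` D.
  by apply/seteqP; split=> z; rewrite /sq /D /= !in_itv/= !ler_norml.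
have Df : (@lebesgue_measure R D < +oo)%E.
  have /= h := @lebesgue_measure_itv R `[- r, r].
  by rewrite [X in (X < _)%E]h; case: ifP => _; rewrite ?ltry.
rewrite /sf_product product_measure1E//.
by rewrite lte_mul_pinfty// ge0_fin_numE.
Qed.

Lemma kern_lty r C D : 0 <= C -> 0 <= D -> (\int[lebN R n m]_v (kern r C D v)%:E < +oo)%E.
Proof.
move=> C0 D0.
have hF : (\int[lebF R m]_s (kernF D s)%:E < +oo)%E.
  apply: (@tuple_integral_prod_lty _ Rm (@lebesgue_measure R) (fun t : Rm => D * (1 + t ^+ 2)^-1) _ _ m).
    exact: measurable_onedsqrV.
    by move=> t; rewrite mulr_ge0// invr_ge0 ltW// onedsqr_gt0.
  have cV : continuous (fun t : R => (1 + t ^+ 2)^-1).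
    move=> t; apply: cvgV; first by rewrite gt_eqF// onedsqr_gt0.
    by apply: cvgD; [exact: cvg_cst|exact: exprn_continuous].
  under eq_integral do rewrite EFinM.
  rewrite ge0_integralZl_EFin//; last 2 first.
  - by move=> t _; rewrite lee_fin invr_ge0 ltW// onedsqr_gt0.
  - by apply/measurable_EFinP; exact: continuous_measurable_fun.
  apply: lte_mul_pinfty => //; rewrite (@ge0_symfun_integralT R (fun t => (1 + t ^+ 2)^-1))//.
  - apply: lte_mul_pinfty => //.
    have := @integral0y_oneDsqr R; rewrite set_itvcy /oneDsqr => ->.
    by rewrite ltry.
  - by move=> t; rewrite invr_ge0 ltW// onedsqr_gt0.
  - by move=> t /=; rewrite sqrrN.
have hE : (\int[lebE R n]_t (kernE r C t)%:E < +oo)%E.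
  apply: (@tuple_integral_prod_lty _ (Rm * Rm)%type (sf_product (@lebesgue_measure R) (@lebesgue_measure R))
    (fun t => C * \1_(@sq R r) t) _ _ n).
    exact: measurable_sq_weight.
    by move=> t; rewrite mulr_ge0.
  under eq_integral do rewrite EFinM.
  rewrite ge0_integralZl_EFin//; last by apply/measurable_EFinP; exact: measurable_indic (measurable_sq r).
  by rewrite integral_indic//; [rewrite setIT lte_mul_pinfty// sq_lty|exact: measurable_sq].
have mk : measurable_fun setT (fun v => (kern r C D v)%:E).
  by apply/measurable_EFinP; exact: measurable_kern.
have k0 v : (0 <= (kern r C D v)%:E)%E by rewrite lee_fin kern_ge0.
rewrite (sf_tonelli1 (lebE R n) (lebF R m) mk k0).
set J := (\int[lebF R m]_s _)%E in hF.
have J0 : (0 <= J)%E by apply: integral_ge0 => t _; rewrite lee_fin kernF_ge0.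
have Jf : J \is a fin_num by rewrite ge0_fin_numE.
have -> : (\int[lebE R n]_x \int[lebF R m]_y (kern r C D (x, y))%:E =
    \int[lebE R n]_x ((fine J)%:E * (kernE r C x)%:E))%E.
  apply: eq_integral => x _; rewrite fineK// muleC /J -ge0_integralZl_EFin//; last 3 first.
  - by move=> s _; rewrite lee_fin kernF_ge0.
  - by apply/measurable_EFinP; exact: measurable_kernF.
  - exact: kernE_ge0.
rewrite ge0_integralZl_EFin//; last 3 first.
- by move=> x _; rewrite lee_fin kernE_ge0.
- by apply/measurable_EFinP; exact: measurable_kernE.
- exact: fine_ge0.
by rewrite lte_mul_pinfty// lee_fin fine_ge0.
Qed.

End Kernels.

Section SubMeanN.
Context {R : realType} {n m : nat}.
Local Notation Rm := (measurableTypeR R).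
Local Notation NN := (n.-tuple (Rm * Rm)%type * m.-tuple Rm)%type.
Local Notation E := 'rV[R[i]]_n.
Local Notation F := 'rV[R]_m.
Local Notation FC := 'rV[R[i]]_m.
Context (Phi : E -> E -> FC) (hPhi : hermitian_map Phi).

Lemma pt0 (a : E * F) : pt Phi a 0 = (a.1, vC a.2 + 'i *: vC (Phid Phi a.1)).
Proof. by rewrite /pt /vC map_mx0 scaler0 addr0. Qed.

Lemma rho_actR w u : rho Phi (actR Phi w u) = rho Phi w - Phid Phi u.
Proof.
rewrite /rho /actR /= vImD (PhidD hPhi) -scalerA.
have -> : vIm (2%:R *: ('i *: Phi u w.1)) = 2%:R *: vRe (Phi w.1 u).
  have := @vImZ R m 2 ('i *: Phi u w.1); rewrite vImiZ (vRe_PhiC hPhi).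
  by rewrite (_ : 2%:C = 2%:R)//; apply/eqP; rewrite eq_complex/= !addr0 !eqxx.
by rewrite !opprD !addrA [_ + _ - _ - _ - _]addrAC [_ - Phid Phi w.1]addrAC addrK addrAC.
Qed.

Lemma coN_actR w u : coN (actR Phi w u) = mulN Phi (coN w) (u, 0).
Proof.
rewrite /coN /actR /mulN /=; congr pair; rewrite vReD addr0 -scalerA; congr (_ + _).
have := @vReZ R m 2 ('i *: Phi u w.1); rewrite vReiZ (vIm_PhiC hPhi) opprK => <-.
by rewrite (_ : 2%:C = 2%:R)//; apply/eqP; rewrite eq_complex/= !addr0 !eqxx.
Qed.

Lemma continuous_slice0 (f : E * FC -> R[i]) (e : E * F) : continuous f ->
  continuous (fun a => f (pt Phi (mulN Phi e a) 0)).
Proof.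
move=> cf a; apply: (@continuous_comp _ _ _ (fun a => pt Phi (mulN Phi e a) 0) f); last exact: cf.
apply: (@continuous_comp _ _ _ (fun a => (mulN Phi e a, 0 : F)) (fun p : (E * F) * F => pt Phi p.1 p.2)).
  apply: (@cvg_pair _ _ _ (nbhs a) (nbhs (mulN Phi e a)) (nbhs (0 : F))); last exact: cvg_cst.
  apply: (@continuous_comp _ _ _ (fun a => (e, a)) (fun p : (E * F) * (E * F) => mulN Phi p.1 p.2)).
    by apply: (@cvg_pair _ _ _ (nbhs a) (nbhs e) (nbhs a)); [exact: cvg_cst|exact: cvg_id].
  exact: continuous_mulN.
exact: continuous_pt.
Qed.

Lemma measurable_slice0 (f : E * FC -> R[i]) (e : E * F) p : continuous f ->
  measurable_fun setT (fun v => cabs (f (pt Phi (mulN Phi e (@ptN R n m v)) 0)) `^ p).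
Proof.
move=> cf; apply: (measurableT_comp (measurable_powR p)); apply: borel_map_measurable.
apply: (@borel_map_comp _ _ _ _ _ (fun a => cabs (f (pt Phi (mulN Phi e a) 0))) borel_map_ptN) => a.
by apply: continuous_comp; [exact: continuous_slice0|exact: continuous_cabs].
Qed.

Lemma bounded_on_boxE (g : E -> F) r : continuous g ->
  exists2 D, 0 <= D & forall u, boxE r u -> boxF D (g u).
Proof.
move=> cg; have [->|b0] := eqVneq (@boxE R n r) set0; first by exists 0.
have cl : {within boxE r, continuous (fun u => lone (g u))}.
  apply: continuous_subspaceT => u.
  by apply: continuous_comp; [exact: cg|exact: continuous_lone].
have [u0 _ hu] := compact_EVT_max (proj1 (set0P _) b0) (@compact_boxE R n r) cl.
exists (lone (g u0)); first exact: lone_ge0.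
by move=> u ur j; rewrite (le_trans (coord_le_lone _ _))// hu// inE.
Qed.

(** An average in the directions of [E], which lowers [rho] by a bounded amount
    only, is followed by an average in those of [F]. Both move points by right
    translations, so that together they form one kernel on the group. *)
Theorem submean (N : nat) (sg H p : R) : 0 <= sg -> 0 <= H -> 0 < p ->
  exists C D : R, [/\ 0 < C, 0 < D & forall f A, entire f -> 0 <= A -> tame Phi N sg A f ->
    forall w, boxF H (rho Phi w) ->
    ((cabs (f w) `^ p)%:E <= \int[lebN R n m]_v
      (cabs (f (pt Phi (mulN Phi (coN w) (ptN v)) 0)) `^ p * kern 1 C D v)%:E)%E].
Proof.
move=> sg0 H0 p0.
have [B B0 hB] := bounded_on_boxE 1 (continuous_Phid hPhi).
have [C [C0 hC]] := base_bound hPhi p0.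
have [D [D0 hD]] := fiber_bound Phi N sg0 (addr_ge0 H0 B0) p0.
exists C, D; split=> // f A hf A0 tf w wH.
have cf := entire_continuous hf.
have mK : measurable_fun setT (fun v : NN =>
    (cabs (f (pt Phi (mulN Phi (coN w) (ptN v)) 0)) `^ p * kern 1 C D v)%:E).
  apply/measurable_EFinP; apply: measurable_funM; first exact: measurable_slice0.
  exact: measurable_kern.
have K0 v : (0 <= (cabs (f (pt Phi (mulN Phi (coN w) (ptN v)) 0)) `^ p * kern 1 C D v)%:E)%E.
  by rewrite lee_fin mulr_ge0 ?powR_ge0 ?kern_ge0 ?ltW.
rewrite (sf_tonelli1 (lebE R n) (lebF R m) mK K0).
apply: (le_trans (hC f hf w)).
have cact : continuous (actR Phi w).
  move=> u; apply: (@cvg_pair _ _ _ (nbhs u) (nbhs (w.1 + u)) (nbhs (w.2 + 2%:R * 'i *: Phi u w.1))).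
    by apply: cvgD; [exact: cvg_cst|exact: cvg_id].
  have c1 : {for u, continuous (fun=> w.2 : FC)} by exact: cst_continuous.
  suff c2 : {for u, continuous (fun u => 2%:R * 'i *: Phi u w.1 : FC)} by exact: (continuousD c1 c2).
  have c3 : {for u, continuous (fun u : E => Phi u w.1)}.
    apply: (@continuous_Phi_comp _ _ _ _ hPhi _ (fun u : E => u) (fun=> w.1)).
      exact: cvg_id.
    exact: cst_continuous.
  exact: (cvgZr c3).
apply: ge0_le_integral => //.
- by move=> t _; rewrite lee_fin mulr_ge0 ?powR_ge0// (kernE_ge0 1 t (ltW C0)).
- apply/measurable_EFinP; apply: measurable_funM; last exact: (measurable_kernE 1 C).
  apply: (measurable_cabs_powR p cf).
  exact: (@borel_map_comp _ _ _ _ (@ptE R n) _ borel_map_ptE cact).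
- exact: (measurable_inner1 (lebF R m) mK K0).
move=> t _; rewrite -/(kernE 1 C t).
have [k0|kn0] := eqVneq (kernE 1 C t) 0.
  by rewrite k0 mulr0; apply: integral_ge0.
have tb := kernE_neq0 kn0.
set u := ptE t in tb *.
pose q := actR Phi w u.
pose z := q.2 - 'i *: vC (Phid Phi q.1).
have qE : q = (q.1, z + 'i *: vC (Phid Phi q.1)) by rewrite subrK; case: (q).
have zI : vIm z = rho Phi q by rewrite /z vImD vImN vImiZ vRe_vC.
have zR : vRe z = (coN q).2 by rewrite /z vReD vReN vReiZ vIm_vC !oppr0 addr0.
have zH : boxF (H + B) (vIm z).
  move=> j; rewrite zI rho_actR.
  have -> : (rho Phi w - Phid Phi u) 0 j = rho Phi w 0 j - Phid Phi u 0 j.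
    by rewrite mxE; congr (_ + _); rewrite mxE.
  apply: (le_trans (ler_normB _ _)); apply: lerD; first exact: wH.
  exact: hB.
have := hD f A hf A0 tf q.1 z zH; rewrite -qE.
rewrite -(@lee_pmul2r _ (kernE 1 C t)%:E)//; last first.
  by rewrite lte_fin lt_def kn0 kernE_ge0// ltW.
rewrite -EFinM; move/le_trans; apply.
have ms : measurable_fun setT (fun s => (cabs (f (q.1, vC (vRe z + ptF s) + 'i *: vC (Phid Phi q.1))) `^ p *
    kernF D s)%:E).
  apply/measurable_EFinP; apply: measurable_funM; last exact: measurable_kernF.
  apply: (measurable_cabs_powR p cf); apply: borel_map_pair.
  - exact: cbase_row cbase_complex.
  - exact: cbase_row cbase_complex.
  - exact: borel_map_cst.
  apply: (@borel_map_comp _ _ _ _ (@ptF R m) (fun x => vC (vRe z + x) + 'i *: vC (Phid Phi q.1)) borel_map_ptF).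
  move=> x; have c1 : {for x, continuous (fun x : F => vC (vRe z + x))}.
    apply: (@continuous_comp _ _ _ (fun x : F => vRe z + x) (@vC R m)); last exact: continuous_vC.
    have c2 : {for x, continuous (fun=> vRe z : F)} by exact: cst_continuous.
    have c3 : {for x, continuous (fun x : F => x)} by exact: cvg_id.
    exact: (continuousD c2 c3).
  have c2 : {for x, continuous (fun _ : F => 'i *: vC (Phid Phi q.1))} by exact: cst_continuous.
  exact: (continuousD c1 c2).
rewrite muleC -ge0_integralZl_EFin//; last 2 first.
- by move=> s _; rewrite lee_fin mulr_ge0 ?powR_ge0// (kernF_ge0 s (ltW D0)).
- by rewrite kernE_ge0// ltW.
rewrite le_eqVlt; apply/orP; left; apply/eqP; apply: eq_integral => s _.
have -> : mulN Phi (coN w) (ptN (t, s)) = (q.1, vRe z + ptF s).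
  rewrite zR /q coN_actR /mulN /ptN /= addr0; congr pair.
  by rewrite addrAC.
rewrite pt0 -EFinM -/(kernF D s); congr (_%:E).
exact: mulrCA.
Qed.

End SubMeanN.

(** * A majorant on the group *)

Section Majorant.
Context {R : realType} {n m : nat}.
Local Notation Rm := (measurableTypeR R).
Local Notation NN := (n.-tuple (Rm * Rm)%type * m.-tuple Rm)%type.
Local Notation E := 'rV[R[i]]_n.
Local Notation F := 'rV[R]_m.
Local Notation FC := 'rV[R[i]]_m.
Context (Phi : E -> E -> FC) (hPhi : hermitian_map Phi).

Lemma ptE_inj : injective (@ptE R n).
Proof.
move=> t u tu; apply: eq_from_tnth => j; move/rowP/(_ j): tu; rewrite !mxE.
by case: (tnth t j) (tnth u j) => [a b] [c d] /= [-> ->].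
Qed.

Lemma ptF_inj : injective (@ptF R m).
Proof. by move=> t u tu; apply: eq_from_tnth => j; move/rowP/(_ j): tu; rewrite !mxE. Qed.

Lemma ptN_inj : injective (@ptN R n m).
Proof. by move=> [t s] [t' s'] [/ptE_inj -> /ptF_inj ->]. Qed.

Definition transL (a : E * F) (v : NN) : NN :=
  (shiftE a.1 v.1, shiftF (a.2 + 2%:R *: vIm (Phi a.1 (ptE v.1))) v.2).

Lemma ptN_transL a v : ptN (transL a v) = mulN Phi a (ptN v).
Proof. by rewrite /ptN /transL /= ptE_shift ptF_shift /mulN /=; congr pair; rewrite addrAC. Qed.

Lemma transLK a : cancel (transL a) (transL (invN a)).
Proof. by move=> v; apply: ptN_inj; rewrite !ptN_transL mulVKN. Qed.

Lemma mpres_transL a : mpres (lebN R n m) (transL a).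
Proof. exact: mpres_left. Qed.

Lemma boxED (r s : R) (z w : E) : boxE r z -> boxE s w -> boxE (r + s) (z + w).
Proof.
move=> hz hw j; rewrite mxE cReD cImD; have [a b] := hz j; have [c d] := hw j.
by split; apply: (le_trans (ler_normD _ _)); exact: lerD.
Qed.

Lemma boxEN (r : R) (z : E) : boxE r z -> boxE r (- z).
Proof. by move=> hz j; rewrite mxE cReN cImN !normrN; exact: hz. Qed.

(** A bounded translation moves the box into a larger one and changes the weight in
    the directions of [F] by a bounded factor. *)
Lemma kern_shift (C D : R) : 0 < C -> 0 < D -> exists D' : R, 0 < D' /\
  forall b v, boxE 1 b.1 -> boxF 1 b.2 -> kern 1 C D (transL (invN b) v) <= kern 2 C D' v.
Proof.
move=> C0 D0.
pose g (p : E * E) : R := lone (vIm (Phi p.1 p.2)).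
have cg : continuous g.
  move=> p; apply: (@continuous_comp _ _ _ (fun p : E * E => vIm (Phi p.1 p.2)) (@lone R m)).
    apply: (@continuous_comp _ _ _ (fun p : E * E => Phi p.1 p.2) (@vIm R m)).
      exact: continuous_Phi.
    exact: continuous_vIm.
  exact: continuous_lone.
have bE0 (r : R) : 0 <= r -> boxE r (0 : E) by move=> r0 j; rewrite mxE /= normr0.
have [p _ hp] : exists2 c, c \in boxE 1 `*` boxE 2 &
    forall t, t \in boxE 1 `*` boxE 2 -> g t <= g c.
  apply: compact_EVT_max; last exact: continuous_subspaceT.
    by exists (0, 0); split; exact: bE0.
  by apply: compact_setX; exact: compact_boxE.
pose B := 1 + 2 * g p.
have gp0 : 0 <= g p by exact: lone_ge0.
have B0 : 0 <= B by rewrite addr_ge0// mulr_ge0.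
(* Peetre: [1 + x^2 <= 2 (1 + d^2) (1 + (d + x)^2)], for the shift [d] of a
   coordinate, which is at most [B] *)
exists (D * (2 * (1 + B ^+ 2))); split; first by rewrite !mulr_gt0// onedsqr_gt0.
move=> b v b1 b2; set D' := D * _.
have D'0 : 0 <= D' by rewrite !mulr_ge0 ?(ltW D0) ?(ltW (onedsqr_gt0 B)).
rewrite {1}/kern; set t := (transL _ _).1; set s := (transL _ _).2.
have [k0|/kernE_neq0 tb] := eqVneq (kernE 1 C t) 0; first by rewrite k0 mul0r kern_ge0// ltW.
have Et : ptE t = - b.1 + ptE v.1 by rewrite /t /transL /= ptE_shift.
have vb : boxE 2 (ptE v.1).
  have -> : ptE v.1 = b.1 + ptE t by rewrite Et addrA subrr add0r.
  by rewrite (_ : 2 = 1 + 1 :> R)//; exact: boxED.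
apply: ler_pM; [by rewrite kernE_ge0// ltW|by rewrite kernF_ge0// ltW| |].
  apply: ler_prod => j _; rewrite mulr_ge0 ?(ltW C0)//= ler_wpM2l ?(ltW C0)//.
  rewrite !indicE; case: (boolP (tnth v.1 j \in sq 2)) => [_|/negP []]; first by case: (_ \in _).
  by rewrite inE; have := vb j; rewrite mxE.
apply: ler_prod => j _; apply/andP; split.
  by rewrite mulr_ge0 ?(ltW D0)// invr_ge0 ltW// onedsqr_gt0.
rewrite /D' -mulrA ler_wpM2l ?(ltW D0)//.
pose d : R := ((invN b).2 + 2%:R *: vIm (Phi (invN b).1 (ptE v.1))) 0 j.
have Es : tnth s j = d + tnth v.2 j by rewrite /s /transL /= tnth_mktuple.
have dB : `|d| <= B.
  rewrite /d mxE (le_trans (ler_normD _ _))// lerD//; first by rewrite /invN/= mxE normrN; exact: b2.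
  rewrite mxE normrM ger0_norm// ler_wpM2l//.
  apply: (le_trans (coord_le_lone _ _)); apply: (hp (- b.1, ptE v.1)).
  by rewrite inE; split=> //=; exact: boxEN.
rewrite Es; move: (tnth v.2 j : R) => x.
rewrite -[leLHS]mul1r ler_pdivrMr ?onedsqr_gt0// mulrAC ler_pdivlMr ?onedsqr_gt0// mul1r.
have : d ^+ 2 <= B ^+ 2.
  by rewrite -[d ^+ 2]ger0_norm ?sqr_ge0// normrX lerXn2r ?nnegrE.
have := sqr_ge0 (d + x); have := sqr_ge0 (2 * d + x); have := sqr_ge0 B.
have : 0 <= (d + x) ^+ 2 * B ^+ 2 by rewrite mulr_ge0 ?sqr_ge0.
have e1 : (2 * d + x) ^+ 2 = 4 * d ^+ 2 + 4 * (d * x) + x ^+ 2 by ring.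
have e2 : (d + x) ^+ 2 = d ^+ 2 + 2 * (d * x) + x ^+ 2 by ring.
rewrite e1 e2.
set q := d * x; set d2 := d ^+ 2; set x2 := x ^+ 2; set B2 := B ^+ 2 => h1 h2 h3 h4 h5.
have e3 : 2 * (1 + B2) * (1 + (d2 + 2 * q + x2)) =
  2 + 2 * B2 + 2 * (d2 + 2 * q + x2) + 2 * ((d2 + 2 * q + x2) * B2) by ring.
by rewrite e3; lra.
Qed.

Section Psi.
Context (p C D : R) (C0 : 0 < C) (D0 : 0 < D).
Implicit Types (g : E * F -> R[i]).

(** The majorant of the values [|f w|^p] for [w] near the group element [e]. *)
Definition Psi g (e : E * F) : \bar R :=
  \int[lebN R n m]_v (cabs (g (mulN Phi e (ptN v))) `^ p * kern 2 C D v)%:E.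

Lemma Psi_ge0 g e : (0 <= Psi g e)%E.
Proof.
by apply: integral_ge0 => v _; rewrite lee_fin mulr_ge0 ?powR_ge0// kern_ge0 ?ltW.
Qed.

Lemma measurable_comp_N g d (T : measurableType d) (h : T -> E * F) : continuous g ->
  borel_map h -> measurable_fun setT (fun t => cabs (g (h t)) `^ p).
Proof.
move=> cg bh; apply: (measurableT_comp (measurable_powR p)); apply: borel_map_measurable.
apply: (@borel_map_comp _ _ _ _ h (fun w => cabs (g w)) bh) => w.
by apply: continuous_comp; [exact: cg|exact: continuous_cabs].
Qed.

Lemma borel_map_mulN d (T : measurableType d) (h1 h2 : T -> E * F) :
  borel_map h1 -> borel_map h2 -> borel_map (fun t => mulN Phi (h1 t) (h2 t)).
Proof.
move=> b1 b2.
have bEF : has_cbase (E * F)%type.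
  by apply: cbase_prod; apply: cbase_row; [exact: cbase_complex|exact: cbase_real].
apply: (@borel_map_comp _ _ _ _ (fun t => (h1 t, h2 t)) (fun p : (E * F) * (E * F) => mulN Phi p.1 p.2)).
  exact: borel_map_pair.
exact: continuous_mulN.
Qed.

Lemma measurable_Psi_integrand g : continuous g ->
  measurable_fun setT (fun uv : NN * NN =>
    (cabs (g (mulN Phi (ptN uv.1) (ptN uv.2))) `^ p * kern 2 C D uv.2)%:E).
Proof.
move=> cg; apply/measurable_EFinP; apply: measurable_funM; last first.
  by apply: (measurableT_comp (measurable_kern 2 C D)); exact: measurable_snd.
apply: measurable_comp_N => //; apply: borel_map_mulN.
  by apply: (@measurable_borel_map _ _ _ _ _ (@ptN R n m)); [exact: measurable_fst|exact: borel_map_ptN].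
by apply: (@measurable_borel_map _ _ _ _ _ (@ptN R n m)); [exact: measurable_snd|exact: borel_map_ptN].
Qed.

Lemma Psi_integrand_ge0 g (uv : NN * NN) :
  (0 <= (cabs (g (mulN Phi (ptN uv.1) (ptN uv.2))) `^ p * kern 2 C D uv.2)%:E)%E.
Proof. by rewrite lee_fin mulr_ge0 ?powR_ge0// kern_ge0 ?ltW. Qed.

Lemma measurable_Psi g : continuous g -> measurable_fun setT (fun u => Psi g (ptN u)).
Proof.
move=> cg; exact: (measurable_inner1 (lebN R n m) (measurable_Psi_integrand cg)
  (Psi_integrand_ge0 g)).
Qed.

(** Right invariance of Haar measure gives the majorant the integral of [|g|^p]
    times that of the kernel. *)
Lemma Psi_lty g : continuous g ->
  (\int[lebN R n m]_u (cabs (g (ptN u)) `^ p)%:E < +oo)%E ->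
  (\int[lebN R n m]_u Psi g (ptN u) < +oo)%E.
Proof.
move=> cg goo.
set J := (\int[lebN R n m]_u _)%E in goo.
have J0 : (0 <= J)%E by apply: integral_ge0 => u _; rewrite lee_fin powR_ge0.
have Jf : J \is a fin_num by rewrite ge0_fin_numE.
rewrite /Psi -(sf_tonelli1 (lebN R n m) (lebN R n m) (measurable_Psi_integrand cg) (Psi_integrand_ge0 g)).
rewrite (sf_tonelli2 (lebN R n m) (lebN R n m) (measurable_Psi_integrand cg) (Psi_integrand_ge0 g)) /=.
have -> : (\int[lebN R n m]_v \int[lebN R n m]_u
    (cabs (g (mulN Phi (ptN u) (ptN v))) `^ p * kern 2 C D v)%:E =
    \int[lebN R n m]_v ((fine J)%:E * (kern 2 C D v)%:E))%E.
  apply: eq_integral => v _; rewrite fineK// muleC.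
  have [mR hR] := mpres_right hPhi (ptN v).
  pose G (u : NN) := (cabs (g (ptN u)) `^ p)%:E.
  have mG : measurable_fun setT G.
    by apply/measurable_EFinP; apply: measurable_comp_N => //; exact: borel_map_ptN.
  have G0 u : (0 <= G u)%E by rewrite lee_fin powR_ge0.
  rewrite /J -(hR G mG G0) -ge0_integralZl_EFin//; last 2 first.
  - exact: (measurableT_comp mG mR).
  - by rewrite kern_ge0// ltW.
  apply: eq_integral => u _; rewrite /G -EFinM mulrC; congr (_ * cabs (g _) `^ p)%:E.
  rewrite /ptN /= ptE_shift ptF_shift /mulN /=.
  by congr pair; [rewrite addrC|rewrite -addrA addrC].
rewrite ge0_integralZl_EFin//; last 3 first.
- by move=> x _; rewrite lee_fin kern_ge0// ltW.
- by apply/measurable_EFinP; exact: measurable_kern.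
- exact: fine_ge0.
by apply: lte_mul_pinfty; rewrite ?lee_fin ?fine_ge0//; apply: kern_lty; exact: ltW.
Qed.

End Psi.

(** [submean] at [w], with its kernel moved from [coN w] to the nearby point [e]. *)
Theorem Psi_bound (N : nat) (sg H p : R) : 0 <= sg -> 0 <= H -> 0 < p ->
  exists C D : R, [/\ 0 < C, 0 < D & forall f A, entire f -> 0 <= A -> tame Phi N sg A f ->
    forall w e b, coN w = mulN Phi e b -> boxE 1 b.1 -> boxF 1 b.2 -> boxF H (rho Phi w) ->
    ((cabs (f w) `^ p)%:E <= Psi p C D (slice Phi f 0) e)%E].
Proof.
move=> sg0 H0 p0; have [C [D [C0 D0 hCD]]] := submean hPhi N sg0 H0 p0.
have [D' [D'0 hD']] := kern_shift C0 D0.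
exists C, D'; split=> // f A hf A0 tf w e b web b1 b2 wH.
apply: (le_trans (hCD f A hf A0 tf w wH)); rewrite web.
have cf := entire_continuous hf.
have cg : continuous (slice Phi f 0).
  move=> a; have := @continuous_slice0 R n m Phi hPhi f 0 cf a.
  have -> : (fun a => f (pt Phi (mulN Phi 0 a) 0)) = slice Phi f 0; last exact.
  by apply/funext => x; rewrite (mul0N hPhi).
pose G v := (cabs (slice Phi f 0 (mulN Phi e (ptN v))) `^ p * kern 1 C D (transL (invN b) v))%:E.
have mk : measurable_fun setT (fun v : NN => kern 1 C D (transL (invN b) v)).
  by have [mL _] := mpres_transL (invN b); apply: (measurableT_comp (measurable_kern 1 C D)).
have mg : measurable_fun setT (fun v : NN => cabs (slice Phi f 0 (mulN Phi e (ptN v))) `^ p).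
  apply: measurable_comp_N => //; apply: borel_map_mulN; last exact: borel_map_ptN.
  exact: borel_map_cst.
have mG : measurable_fun setT G by apply/measurable_EFinP; exact: measurable_funM.
have G0 v : (0 <= G v)%E by rewrite lee_fin mulr_ge0 ?powR_ge0// kern_ge0 ?ltW.
have [_ hb] := mpres_transL b.
have -> : (\int[lebN R n m]_v (cabs (f (pt Phi (mulN Phi (mulN Phi e b) (ptN v)) 0)) `^ p *
    kern 1 C D v)%:E = \int[lebN R n m]_v G v)%E.
  rewrite -(hb G mG G0); apply: eq_integral => v _.
  by rewrite /G transLK ptN_transL (mulNA hPhi).
apply: ge0_le_integral => //.
  apply/measurable_EFinP; apply: measurable_funM => //; exact: measurable_kern.
by move=> v _; rewrite lee_fin ler_wpM2l ?powR_ge0// hD'.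
Qed.

End Majorant.

(** * Integrals of arbitrary functions *)

Section Unmeasurable.
Context {R : realType} {d : measure_display} {T : measurableType d}.
Context (mu : {measure set T -> \bar R}).
Local Open Scope ereal_scope.
Implicit Types (f g : T -> \bar R).
Import HBNNSimple.

Lemma le_integral_any f g : (forall x, 0 <= f x) -> (forall x, f x <= g x) ->
  \int[mu]_x f x <= \int[mu]_x g x.
Proof.
move=> f0 fg; have g0 x : 0 <= g x by exact: le_trans (f0 x) (fg x).
rewrite (ge0_integralTE mu f0) (ge0_integralTE mu g0).
by apply: le_ereal_sup => _ [h hf <-]; exists h => // x; exact: le_trans (hf x) (fg x).
Qed.

Lemma integral_le_approx g B : (forall x, 0 <= g x) ->
  (forall h, measurable_fun setT h -> (forall x, 0 <= h x) -> (forall x, h x <= g x) ->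
     \int[mu]_x h x <= B) -> \int[mu]_x g x <= B.
Proof.
move=> g0 hB; rewrite (ge0_integralTE mu g0); apply: ge_ereal_sup => _ [h hg <-].
have := hB (fun x => (h x)%:E); rewrite integral_nnsfun// patch_setT; apply => //.
- exact/measurable_EFinP.
- by move=> x; rewrite lee_fin; exact: fun_ge0.
Qed.

(** The spectrum is defined by integrals of products with no measurability attached;
    their invariance comes from the simple functions below the integrand. *)
Lemma integral_any_mpres (tau sg : T -> T) f : mpres mu tau -> mpres mu sg ->
  cancel tau sg -> cancel sg tau -> \int[mu]_x f (tau x) = \int[mu]_x f x.
Proof.
move=> mt ms ts st.
have le (ta s : T -> T) g : mpres mu ta -> (forall x, 0 <= g x) -> 
    \int[mu]_x g x <= \int[mu]_x g (ta x).
  move=> [mta hta] g0; apply: integral_le_approx => // h mh h0 hg.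
  by rewrite -(hta h mh h0); apply: le_integral_any.
have eq g : (forall x, 0 <= g x) -> \int[mu]_x g (tau x) = \int[mu]_x g x.
  move=> g0; apply/le_anti/andP; split; last exact: (le tau sg).
  have := le sg tau (fun x => g (tau x)) ms (fun=> g0 _).
  by under [X in _ <= X]eq_integral do rewrite st.
rewrite [LHS]integralE [RHS]integralE; congr (_ - _).
  rewrite -(eq (fun x => f^\+ x)) => [|x]; last exact: funepos_ge0.
  by apply: eq_integral => x _; rewrite !funeposE.
rewrite -(eq (fun x => f^\- x)) => [|x]; last exact: funeneg_ge0.
by apply: eq_integral => x _; rewrite !funenegE.
Qed.

Lemma ge0_integral_anyZ (k : R) g : (0 < k)%R -> (forall x, 0 <= g x) ->
  \int[mu]_x (k%:E * g x) = k%:E * \int[mu]_x g x.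
Proof.
have le (c : R) f : (0 < c)%R -> (forall x, 0 <= f x) ->
    c%:E * \int[mu]_x f x <= \int[mu]_x (c%:E * f x).
  move=> c0 f0; rewrite -lee_pdivlMl//; apply: integral_le_approx => // h mh h0 hf.
  rewrite lee_pdivlMl// -ge0_integralZl_EFin//; last exact: ltW.
  by apply: le_integral_any => x; rewrite ?mule_ge0 ?lee_fin ?(ltW c0)// lee_pmul2l.
move=> k0 g0; apply/le_anti/andP; split; last exact: le.
rewrite -lee_pdivrMl//; apply: (le_trans (le _ _ _ _)).
- by rewrite invr_gt0.
- by move=> x; rewrite mule_ge0// lee_fin ltW.
by under eq_integral do rewrite muleA -EFinM mulVf ?mul1e ?gt_eqF//.
Qed.

Lemma Rintegral_anyZ (k : R) (f : T -> R) : (0 < k)%R ->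
  (\int[mu]_x (k * f x) = k * \int[mu]_x f x)%R.
Proof.
move=> k0; rewrite /Rintegral.
rewrite [X in fine X = _]integralE [X in _ = (k * fine X)%R]integralE.
have -> : \int[mu]_x (fun x => (k * f x)%:E)^\+ x = k%:E * \int[mu]_x (fun x => (f x)%:E)^\+ x.
  rewrite -ge0_integral_anyZ => [|//|x]; last exact: funepos_ge0.
  by apply: eq_integral => x _; rewrite !funeposE maxe_pMr ?lee_fin ?(ltW k0)// mule0 EFinM.
have -> : \int[mu]_x (fun x => (k * f x)%:E)^\- x = k%:E * \int[mu]_x (fun x => (f x)%:E)^\- x.
  rewrite -ge0_integral_anyZ => [|//|x]; last exact: funeneg_ge0.
  by apply: eq_integral => x _; rewrite !funenegE maxe_pMr ?lee_fin ?(ltW k0)// mule0 EFinM muleN.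
have : 0 <= \int[mu]_x (fun x => (f x)%:E)^\+ x by apply: integral_ge0 => x _; exact: funepos_ge0.
have : 0 <= \int[mu]_x (fun x => (f x)%:E)^\- x by apply: integral_ge0 => x _; exact: funeneg_ge0.
case: (\int[mu]_x _) => [y||]//; case: (\int[mu]_x _) => [x||]// _ _;
  rewrite ?gt0_muley ?lte_fin//= ?mulr0//.
by rewrite mulrBr.
Qed.

End Unmeasurable.

Section CIntegral.
Context {R : realType} {d : measure_display} {T : measurableType d}.
Context (mu : {measure set T -> \bar R}).
Implicit Types (f : T -> R[i]).

Lemma cintegral_mpres (tau sg : T -> T) f : mpres mu tau -> mpres mu sg ->
  cancel tau sg -> cancel sg tau -> cintegral mu (fun x => f (tau x)) = cintegral mu f.
Proof.
move=> mt ms ts st; rewrite /cintegral /Rintegral.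
rewrite (integral_any_mpres (fun x => (complex.Re (f x))%:E) mt ms ts st).
by rewrite (integral_any_mpres (fun x => (complex.Im (f x))%:E) mt ms ts st).
Qed.

Lemma cintegralZ (k : R) f : 0 < k ->
  cintegral mu (fun x => k%:C * f x) = k%:C * cintegral mu f.
Proof.
move=> k0; rewrite /cintegral.
under eq_Rintegral do rewrite cReM /= mul0r subr0.
rewrite Rintegral_anyZ//.
under [X in _ +i* X]eq_Rintegral do rewrite cImM /= mul0r addr0.
rewrite Rintegral_anyZ//.
by apply/eqP; rewrite eq_complex /= !mul0r subr0 addr0 !eqxx.
Qed.

Lemma cintegral0 : cintegral mu (fun=> 0) = 0.
Proof.
rewrite /cintegral /Rintegral /= integral0_eq//.
Qed.

(** Unlike [Lpnorm], additive in the domain of integration and free of roots. *)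
Definition energy (p : R) f : \bar R := \int[mu]_x (cabs (f x) `^ p)%:E.

Lemma energy_ge0 p f : (0 <= energy p f)%E.
Proof. by apply: integral_ge0 => x _; rewrite lee_fin powR_ge0. Qed.

Lemma LpnormE p f : Lpnorm mu p f = (energy p f `^ p^-1)%E.
Proof.
rewrite /Lpnorm unlock /energy; congr (_ `^ _)%E; apply: eq_integral => x _ /=.
by rewrite ger0_norm ?cabs_ge0.
Qed.

Lemma Lpnorm_lt p f (e : R) : 0 < p -> 0 < e ->
  (Lpnorm mu p f < e%:E)%E = (energy p f < (e `^ p)%:E)%E.
Proof.
move=> p0 e0; rewrite LpnormE.
have := energy_ge0 p f; case: (energy p f) => [x||]// x0; last first.
  by rewrite poweRyr ?invr_eq0 ?gt_eqF// !ltNge !leey.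
rewrite poweR_EFin !lte_fin.
apply/idP/idP => h.
  rewrite -[x]powRr1 -?lee_fin// -(mulVf (lt0r_neq0 p0)) powRrM.
  by rewrite gt0_ltr_powR// nnegrE ?powR_ge0// ltW.
rewrite -[e]powRr1 ?(ltW e0)// -(mulfV (lt0r_neq0 p0)) powRrM.
by rewrite gt0_ltr_powR ?invr_gt0// nnegrE ?powR_ge0.
Qed.

Lemma Lpnorm_lty p f : 0 < p -> (Lpnorm mu p f < +oo)%E = (energy p f < +oo)%E.
Proof.
move=> p0; rewrite LpnormE; apply/idP/idP; last exact: poweR_lty.
by apply: lty_poweRy; rewrite invr_eq0 gt_eqF.
Qed.

Lemma energyZ p (k : R) f : 0 < k ->
  energy p (fun x => k%:C * f x) = ((k `^ p)%:E * energy p f)%E.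
Proof.
move=> k0; rewrite /energy -ge0_integral_anyZ ?powR_gt0//; last by move=> x; rewrite lee_fin powR_ge0.
apply: eq_integral => x _; rewrite -EFinM cabsM cabs_real ger0_norm ?(ltW k0)//.
by rewrite powRM ?cabs_ge0 ?(ltW k0).
Qed.

End CIntegral.

(** * Derivatives along curves *)

Section Along.
Context {R : realType}.

(** When the difference quotients diverge, both derivatives are the default value 0. *)
Lemma derive1_anyZ (k : R) (f : R -> R) a : k != 0 ->
  derive1 (fun t => k * f t) a = k * derive1 f a.
Proof.
move=> k0; rewrite /derive1.
have h (c : R) (g : R -> R) : cvg (h^-1 *: (g (h + a) - g a) @[h --> 0^']) ->
    (h^-1 *: (c * g (h + a) - c * g a) @[h --> 0^'] --> c * lim (h^-1 *: (g (h + a) - g a) @[h --> 0^'])).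
  move=> cg; rewrite (_ : (fun h => _) = (fun h => c * (h^-1 *: (g (h + a) - g a)))).
    by apply: cvgMr.
  by apply/funext => x /=; rewrite -mulrBr scalerAr.
have [cf|ncf] := pselect (cvg (h^-1 *: (f (h + a) - f a) @[h --> 0^'])).
  by apply: cvg_lim => //; exact: h.
rewrite [in RHS]dvgP// mulr0 dvgP//.
move=> ck; apply: ncf.
have := h k^-1 (fun t => k * f t) ck.
rewrite (_ : (fun h => _) = (fun h => h^-1 *: (f (h + a) - f a))).
  by move=> c; apply/cvg_ex; eexists; exact: c.
by apply/funext => x; rewrite !mulrA mulVf// !mul1r.
Qed.

Lemma cderive0Z (k : R) (g : R -> R[i]) : k != 0 ->
  cderive0 (fun t => k%:C * g t) = k%:C * cderive0 g.
Proof.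
move=> k0; rewrite /cderive0.
rewrite (_ : (fun t => complex.Re _) = (fun t => k * complex.Re (g t))); last first.
  by apply/funext => t; rewrite cReM /= mul0r subr0.
rewrite (_ : (fun t => complex.Im _) = (fun t => k * complex.Im (g t))); last first.
  by apply/funext => t; rewrite cImM /= mul0r addr0.
rewrite !derive1_anyZ//.
by apply/eqP; rewrite eq_complex /= !mul0r subr0 addr0 !eqxx.
Qed.

Lemma cderive0_cst (c : R[i]) : cderive0 (fun _ : R => c) = 0.
Proof. by rewrite /cderive0 !derive1_cst. Qed.

Context {V : topologicalType} (line : V -> V -> R -> V).

Lemma iter_derivZ (k : R) vs (f : V -> R[i]) : k != 0 ->
  iter_deriv_along line vs (fun x => k%:C * f x) =
  (fun x => k%:C * iter_deriv_along line vs f x).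
Proof.
move=> k0; elim: vs => //= v vs ->; apply/funext => x.
by rewrite /deriv_along cderive0Z.
Qed.

Lemma iter_deriv0 vs : iter_deriv_along line vs (fun _ : V => 0) = (fun=> 0).
Proof.
by elim: vs => //= v vs ->; apply/funext => x; rewrite /deriv_along cderive0_cst.
Qed.

Lemma iter_deriv_transport (phi psi : V -> V) vs (f : V -> R[i]) :
  (forall p v t, phi (line p v t) = line (phi p) (psi v) t) ->
  iter_deriv_along line vs (fun x => f (phi x)) =
  (fun x => iter_deriv_along line (map psi vs) f (phi x)).
Proof.
move=> h; elim: vs => //= v vs ->; apply/funext => x.
by rewrite /deriv_along; congr cderive0; apply/funext => t; rewrite h.
Qed.

Lemma smooth_transport (phi psi : V -> V) (f : V -> R[i]) : continuous phi ->
  (forall p v t, phi (line p v t) = line (phi p) (psi v) t) ->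
  smooth_along line f -> smooth_along line (fun x => f (phi x)).
Proof.
move=> cphi h sf vs; rewrite (iter_deriv_transport vs f h); have [c1 d1] := sf (map psi vs); split.
  by move=> x; apply: continuous_comp; [exact: cphi|exact: c1].
move=> v p; have [a b] := d1 (psi v) (phi p); split.
  by rewrite (_ : (fun t => _) = (fun t => complex.Re (iter_deriv_along line [seq psi i | i <- vs] f (line (phi p) (psi v) t))));
    [|apply/funext => t; rewrite h].
by rewrite (_ : (fun t => _) = (fun t => complex.Im (iter_deriv_along line [seq psi i | i <- vs] f (line (phi p) (psi v) t))));
    [|apply/funext => t; rewrite h].
Qed.

Definition cis_derive (g : R -> R[i]) (c : R[i]) :=
  is_derive (0 : R) (1 : R) (fun t => complex.Re (g t)) (complex.Re c) /\
  is_derive (0 : R) (1 : R) (fun t => complex.Im (g t)) (complex.Im c).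

Lemma cis_deriveP g c : cis_derive g c <-> cderivable0 g /\ cderive0 g = c.
Proof.
split=> [[h1 h2]|[[h1 h2] <-]].
  split; first by split; exact: ex_derive.
  by rewrite /cderive0 !derive1E !derive_val; case: c {h1 h2}.
by split; rewrite /= derive1E; apply: DeriveDef.
Qed.

Lemma cis_deriveD f g a b : cis_derive f a -> cis_derive g b ->
  cis_derive (fun t => f t + g t) (a + b).
Proof.
move=> [f1 f2] [g1 g2]; rewrite /cis_derive cReD cImD; split.
  rewrite (_ : (fun t => _) = (fun t => complex.Re (f t)) + (fun t => complex.Re (g t))).
    exact: is_deriveD.
  by apply/funext => t; rewrite cReD.
rewrite (_ : (fun t => _) = (fun t => complex.Im (f t)) + (fun t => complex.Im (g t))).
  exact: is_deriveD.
by apply/funext => t; rewrite cImD.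
Qed.

Lemma cis_deriveM f g a b : cis_derive f a -> cis_derive g b ->
  cis_derive (fun t => f t * g t) (f 0 * b + g 0 * a).
Proof.
move=> [f1 f2] [g1 g2].
have h (u v : R -> R) (x y : R) : is_derive (0 : R) (1 : R) u x -> is_derive (0 : R) (1 : R) v y ->
    is_derive (0 : R) (1 : R) (fun t => u t * v t) (u 0 * y + v 0 * x).
  by move=> du dv; apply: is_derive_eq.
split.
  rewrite (_ : (fun t => _) = (fun t => complex.Re (f t) * complex.Re (g t)) -
     (fun t => complex.Im (f t) * complex.Im (g t))); last first.
    by apply/funext => t; rewrite cReM.
  apply: (is_derive_eq (is_deriveB (h _ _ _ _ f1 g1) (h _ _ _ _ f2 g2))).
  by rewrite cReD !cReM; ring.
rewrite (_ : (fun t => _) = (fun t => complex.Re (f t) * complex.Im (g t)) +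
   (fun t => complex.Im (f t) * complex.Re (g t))); last first.
  by apply/funext => t; rewrite cImM.
apply: (is_derive_eq (is_deriveD (h _ _ _ _ f1 g2) (h _ _ _ _ f2 g1))).
by rewrite cImD !cImM; ring.
Qed.

Lemma cis_derive_cst c : cis_derive (fun=> c) 0.
Proof. by split; exact: is_derive_cst. Qed.

End Along.

(** * The symmetries of the Bernstein space *)

Section SmoothF.
Context {R : realType} {m : nat}.
Local Notation F := 'rV[R]_m.
Local Notation smooth := (@smooth_along R F affine_lineF).
Local Notation D := (@deriv_along R F affine_lineF).
Implicit Types (phi psi : F -> R[i]).

Lemma affine_lineF0 (p v : F) : affine_lineF p v 0 = p.
Proof. by rewrite /affine_lineF scale0r addr0. Qed.

Lemma smooth_cis_derive phi p v : smooth phi ->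
  cis_derive (fun t => phi (affine_lineF p v t)) (D v phi p).
Proof. by move=> sphi; apply/cis_deriveP; split=> //; have [_ h] := sphi [::]; exact: h. Qed.

Lemma smooth_deriv phi v : smooth phi -> smooth (D v phi).
Proof.
move=> sphi vs; have := sphi (rcons vs v).
by rewrite /iter_deriv_along foldr_rcons.
Qed.

Lemma iter_deriv_comb phi psi (k : R[i]) vs : smooth phi -> smooth psi ->
  iter_deriv_along affine_lineF vs (fun x => phi x + k * psi x) =
  (fun x => iter_deriv_along affine_lineF vs phi x + k * iter_deriv_along affine_lineF vs psi x).
Proof.
move=> s1 s2; elim: vs => //= v vs ->; apply/funext => x.
have d1 : cis_derive (fun t => iter_deriv_along affine_lineF vs phi (affine_lineF x v t))
    (deriv_along affine_lineF v (iter_deriv_along affine_lineF vs phi) x).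
  by apply/cis_deriveP; split=> //; have [_ h] := s1 vs; exact: h.
have d2 : cis_derive (fun t => iter_deriv_along affine_lineF vs psi (affine_lineF x v t))
    (deriv_along affine_lineF v (iter_deriv_along affine_lineF vs psi) x).
  by apply/cis_deriveP; split=> //; have [_ h] := s2 vs; exact: h.
have /cis_deriveP[_ h] := cis_deriveD d1 (cis_deriveM (cis_derive_cst k) d2).
by rewrite {1}/deriv_along h mulr0 addr0.
Qed.

Lemma smooth_comb phi psi (k : R[i]) : smooth phi -> smooth psi ->
  smooth (fun x => phi x + k * psi x).
Proof.
move=> s1 s2 vs; rewrite iter_deriv_comb//; have [c1 d1] := s1 vs; have [c2 d2] := s2 vs.
split=> [x|v p].
  have h2 : {for x, continuous (fun x => k * iter_deriv_along affine_lineF vs psi x)}.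
    apply: (@continuousM _ _ (fun=> k) (iter_deriv_along affine_lineF vs psi)); last exact: c2.
    exact: cst_continuous.
  exact: (continuousD (c1 x) h2).
have e1 := proj2 (cis_deriveP _ _) (conj (d1 v p) erefl).
have e2 := proj2 (cis_deriveP _ _) (conj (d2 v p) erefl).
by have /cis_deriveP[] := cis_deriveD e1 (cis_deriveM (cis_derive_cst k) e2).
Qed.

Lemma pairingDl (l l' x : F) : pairing (l + l') x = pairing l x + pairing l' x.
Proof. by rewrite /pairing -big_split; apply: eq_bigr => j _; rewrite mxE mulrDl. Qed.

Lemma pairingDr (l x x' : F) : pairing l (x + x') = pairing l x + pairing l x'.
Proof. by rewrite /pairing -big_split; apply: eq_bigr => j _; rewrite mxE mulrDr. Qed.

Lemma pairingZl t (l x : F) : pairing (t *: l) x = t * pairing l x.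
Proof. by rewrite /pairing mulr_sumr; apply: eq_bigr => j _; rewrite mxE mulrA. Qed.

Lemma continuous_pairing (c : F) : continuous (fun x : F => pairing x c).
Proof.
move=> x; apply: continuous_sum => j.
apply: (@continuousM _ _ (fun y : F => y 0 j) (fun=> c 0 j)); first exact: continuous_coord.
exact: cst_continuous.
Qed.

Lemma is_derive_affine (a b x : R) : is_derive x (1 : R) (fun t => a + t * b) b.
Proof.
rewrite (_ : (fun t => _) = cst a + b *: (id : R -> R)); last first.
  by apply/funext => t /=; rewrite mulrC.
have e : b = 0 + b *: (1 : R) by rewrite add0r /GRing.scale/= mulr1.
rewrite [X in is_derive _ _ _ X]e.
exact: (@is_deriveD _ _ _ (cst a) (b *: (id : R -> R)) x 1 _ _ (is_derive_cst a x 1)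
  (@is_deriveZ _ _ _ (id : R -> R) b x 1 _ (is_derive_id x 1))).
Qed.

Definition wave (c l : F) : R[i] := cos (pairing l c) +i* sin (pairing l c).

Lemma cabs_wave c l : cabs (wave c l) = 1.
Proof. by rewrite /cabs /= cos2Dsin2 sqrtr1. Qed.

Lemma continuous_wave c : continuous (wave c).
Proof.
move=> x; apply: (@continuous_comp _ _ _ (fun l => (cos (pairing l c), sin (pairing l c)))
   (fun ab : R * R => ab.1 +i* ab.2)); last exact: continuous_Complex.
apply: (@cvg_pair _ _ _ (nbhs x) (nbhs (cos (pairing x c))) (nbhs (sin (pairing x c)))).
  by apply: (@continuous_comp _ _ _ (fun l : F => pairing l c) cos); [exact: continuous_pairing|exact: continuous_cos].
by apply: (@continuous_comp _ _ _ (fun l : F => pairing l c) sin); [exact: continuous_pairing|exact: continuous_sin].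
Qed.

Lemma cis_derive_wave c p v :
  cis_derive (fun t => wave c (affine_lineF p v t)) ('i * (pairing v c)%:C * wave c p).
Proof.
set a := pairing p c; set b := pairing v c.
have e t : pairing (affine_lineF p v t) c = a + t * b.
  by rewrite /affine_lineF pairingDl pairingZl.
have dl : is_derive (0 : R) (1 : R) (fun t => a + t * b) b.
  exact: is_derive_affine.
split.
  rewrite (_ : (fun t => _) = cos \o (fun t => a + t * b)); last first.
    by apply/funext => t; rewrite /wave /= e.
  apply: (is_derive_eq (is_derive1_comp (is_derive_cos _) dl)).
  by rewrite !cReM /= mul0r addr0; ring.
rewrite (_ : (fun t => _) = sin \o (fun t => a + t * b)); last first.
  by apply/funext => t; rewrite /wave /= e.
apply: (is_derive_eq (is_derive1_comp (is_derive_sin _) dl)).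
by rewrite !(cReM, cImM) /= mul0r addr0; ring.
Qed.

(** Multiplication by a wave turns each derivative of [phi] into a first-order
    combination, so the iterated derivatives stay of the form smooth times wave. *)
Lemma smooth_wave phi c : smooth phi -> smooth (fun l => phi l * wave c l).
Proof.
move=> sphi.
have step psi v : smooth psi -> forall p, cis_derive (fun t => psi (affine_lineF p v t) * wave c (affine_lineF p v t))
    ((D v psi p + ('i * (pairing v c)%:C) * psi p) * wave c p).
  move=> spsi p; have := cis_deriveM (smooth_cis_derive p v spsi) (cis_derive_wave c p v).
  rewrite affine_lineF0; congr cis_derive; ring.
have key vs : exists2 psi, smooth psi &
    iter_deriv_along affine_lineF vs (fun l => phi l * wave c l) = (fun l => psi l * wave c l).
  elim: vs => [|v vs [psi spsi E]]; first by exists phi.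
  exists (fun p => D v psi p + ('i * (pairing v c)%:C) * psi p).
    exact: smooth_comb (smooth_deriv v spsi) spsi.
  rewrite /= E; apply/funext => p.
  by have /cis_deriveP[_ h] := step psi v spsi p; rewrite /deriv_along h.
move=> vs; have [psi spsi ->] := key vs; split=> [x|v p].
  apply: continuousM; last exact: continuous_wave.
  by have [h _] := spsi [::]; exact: h.
by have /cis_deriveP[] := step psi v spsi p.
Qed.

Lemma shiftFK (c : F) : cancel (shiftF c) (shiftF (- c)).
Proof. by move=> s; apply: ptF_inj; rewrite !ptF_shift addrA addNr add0r. Qed.

(** Translating a function amounts to multiplying the test function by a wave, which
    preserves smoothness and support. *)
Lemma spectrum_shift K (h : F -> R[i]) c : spectrum_in K h -> spectrum_in K (fun x => h (c + x)).
Proof.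
move=> hK phi sphi cphi dphi.
pose phi' l := phi l * wave c l.
have supE : [set l | phi' l != 0] = [set l | phi l != 0].
  have wn0 l : (wave c l == 0) = false by rewrite -cabs_eq0 cabs_wave oner_eq0.
  by apply/seteqP; split=> l /=; rewrite /phi' mulf_eq0 wn0 orbF.
have := hK phi' (smooth_wave c sphi); rewrite supE => /(_ cphi dphi) <-.
have fE x : fourier phi (x - c) = fourier phi' x.
  rewrite /fourier; congr cintegral; apply/funext => s.
  rewrite /phi' -mulrA; congr (_ * _).
  have -> : pairing (ptF s) (x - c) = pairing (ptF s) x - pairing (ptF s) c.
    rewrite pairingDr; congr (_ + _); rewrite /pairing -sumrN.
    by apply: eq_bigr => j _; rewrite [(- c) 0 j]mxE mulrN.
  rewrite cosB sinB /wave.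
  by apply/eqP; rewrite eq_complex /=; apply/andP; split; apply/eqP; ring.
rewrite -(cintegral_mpres (fun s => h (ptF s) * fourier phi' (ptF s)) (mpres_shiftF c)
  (mpres_shiftF (- c)) (shiftFK c)); last by have := shiftFK (- c); rewrite opprK.
congr cintegral; apply/funext => s; rewrite -fE ptF_shift.
by rewrite [c + _ - c]addrAC subrr add0r.
Qed.

End SmoothF.

Section Symmetries.
Context {R : realType} {n m : nat}.
Local Notation Rm := (measurableTypeR R).
Local Notation E := 'rV[R[i]]_n.
Local Notation F := 'rV[R]_m.
Local Notation FC := 'rV[R[i]]_m.
Context (Phi : E -> E -> FC) (hPhi : hermitian_map Phi).
Context (K : set F) (p : R) (p0 : 0 < p).
Implicit Types (f : E * FC -> R[i]).

Definition energyN f : \bar R := energy (lebN R n m) p (slice Phi f 0 \o ptN).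

Lemma continuous_slice f : entire f -> continuous (slice Phi f 0).
Proof.
move=> hf a; have cf := entire_continuous hf.
have := @continuous_slice0 R n m Phi hPhi f 0 cf a.
have -> : (fun a => f (pt Phi (mulN Phi 0 a) 0)) = slice Phi f 0; last exact.
by apply/funext => x; rewrite (mul0N hPhi).
Qed.

Lemma slice_inLp f : entire f ->
  inLp (lebN R n m) p (slice Phi f 0 \o ptN) <-> (energyN f < +oo)%E.
Proof.
move=> hf; rewrite /inLp Lpnorm_lty//; split=> [[]//|h].
have bs : borel_map (slice Phi f 0 \o ptN).
  exact: (borel_map_comp borel_map_ptN (continuous_slice hf)).
split=> //; apply: borel_map_measurable.
  exact: (borel_map_comp bs (@continuous_Re R)).
exact: (borel_map_comp bs (@continuous_Im R)).
Qed.

Lemma bernsteinP f : bernstein Phi p K f <-> Hol_K Phi K f /\ (energyN f < +oo)%E.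
Proof.
split=> -[h1 h2]; split=> //; first by apply/slice_inLp => //; case: h1.
by apply/slice_inLp => //; case: h1.
Qed.

Lemma bernstein_0 : bernstein Phi p K (fun=> 0).
Proof.
apply/bernsteinP; split; last first.
  rewrite /energyN /energy integral0_eq ?ltry// => x _.
  by rewrite /= cabs0 powR0// gt_eqF.
split.
- by move=> w; exact: differentiable_cst.
- exists 0%N, 1; split=> // w; rewrite cabs0 mule_ge0 ?expeR_ge0//.
  by rewrite lee_fin mulr_ge0// exprn_ge0// !addr_ge0 ?sqrtr_ge0.
split.
- move=> vs; rewrite iter_deriv0; split=> [x|v q]; first exact: cst_continuous.
  by split; exact: derivable_cst.
- by move=> v a; rewrite /Zbar /deriv_along !cderive0_cst mulr0 addr0 mulr0.
- move=> vs; exists 0%N, 0 => a; rewrite iter_deriv0 cabs0 mul0r//.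
- move=> z phi _ _ _; under [X in cintegral _ X]eq_fun do rewrite mul0r.
  exact: cintegral0.
Qed.

Lemma CR_scale (k : R) (g : E * F -> R[i]) : k != 0 -> CR Phi g -> CR Phi (fun a => k%:C * g a).
Proof.
move=> kn0 hg v a; have hv := hg v a.
have -> : Zbar Phi v (fun a => k%:C * g a) a = k%:C * Zbar Phi v g a.
  rewrite /Zbar /deriv_along (cderive0Z (fun t => g (left_lineN Phi a (v, 0) t)) kn0).
  rewrite (cderive0Z (fun t => g (left_lineN Phi a ('i *: v, 0) t)) kn0).
  by rewrite [X in _ * (_ + X)]mulrCA -mulrDr mulrCA.
by rewrite hv mulr0.
Qed.

Lemma bernstein_scale (k : R) f : 0 < k -> bernstein Phi p K f ->
  bernstein Phi p K (fun w => k%:C * f w).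
Proof.
move=> k0 /bernsteinP[[df [N [C [C0 hC]]] [sf CRf mf spf]] ef].
have kn0 : k != 0 by rewrite gt_eqF.
have kC : cabs k%:C = k by rewrite cabs_real ger0_norm ?ltW.
have sE : slice Phi (fun w => k%:C * f w) 0 = (fun a => k%:C * slice Phi f 0 a) by [].
apply/bernsteinP; split; last first.
  rewrite /energyN sE; move: ef; rewrite /energyN; move: (slice Phi f 0) => g ef.
  have -> := energyZ (lebN R n m) p (g \o ptN) k0 : energy _ _ ((fun a => k%:C * g a) \o ptN) = _.
  by rewrite lte_mul_pinfty// lee_fin powR_ge0.
split.
- by move=> w; apply: differentiableM => //; exact: differentiable_cst.
- exists N, (k * C); split; first by rewrite mulr_gt0.
  move=> w; rewrite cabsM kC EFinM -[k * C * _]mulrA EFinM -muleA.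
  by apply: lee_wpmul2l; [rewrite lee_fin ltW|exact: hC].
rewrite sE; split.
- move=> vs; rewrite iter_derivZ//; have [c d] := sf vs; split=> [x|v q].
    apply: (@continuousM _ _ (fun=> k%:C)); last exact: c.
    exact: cst_continuous.
  have e := proj2 (cis_deriveP _ _) (conj (d v q) erefl).
  by have /cis_deriveP[] := cis_deriveM (cis_derive_cst k%:C) e.
- exact: CR_scale.
- move=> vs; have [N' [C' hC']] := mf vs; exists N', (k * C') => a.
  by rewrite iter_derivZ// cabsM kC -mulrA ler_wpM2l ?(ltW k0).
- move=> z phi s c d; have := spf z phi s c d => h.
  under [X in cintegral _ X]eq_fun do rewrite -mulrA.
  by rewrite cintegralZ// h mulr0.
Qed.

(** The left translation by [a], written in the coordinates [coN] and [rho], of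
    which it changes the first one only. *)
Definition actL (a : E * F) (w : E * FC) : E * FC :=
  pt Phi (mulN Phi a (coN w)) (rho Phi w).

Lemma coN_actL a w : coN (actL a w) = mulN Phi a (coN w).
Proof. by rewrite /actL coN_pt. Qed.

Lemma rho_actL a w : rho Phi (actL a w) = rho Phi w.
Proof. by rewrite /actL rho_pt. Qed.

Lemma slice_actL f a h b : slice Phi (fun w => f (actL a w)) h b = slice Phi f h (mulN Phi a b).
Proof. by rewrite !sliceE /actL coN_pt rho_pt. Qed.

Definition actL_linear (a : E) (w : E * FC) : E * FC :=
  (w.1, 2%:R * 'i *: Phi w.1 a + w.2).

Lemma actL_linear_is_linear a : linear (actL_linear a).
Proof.
move=> c u v.
have -> : c *: actL_linear a u + actL_linear a v = (c *: u.1 + v.1,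
    c *: (2%:R * 'i *: Phi u.1 a + u.2) + (2%:R * 'i *: Phi v.1 a + v.2)) by [].
rewrite /actL_linear /= (PhiDl hPhi) (PhiZl hPhi).
congr pair; rewrite !scalerDr !scalerA [_ * c]mulrC.
by rewrite -!addrA; congr (_ + _); rewrite addrCA.
Qed.

HB.instance Definition _ a := GRing.isLinear.Build R[i] (E * FC)%type (E * FC)%type *:%R
  (actL_linear a) (actL_linear_is_linear a).

(** Left translations are affine over the complex numbers, hence holomorphic. *)
Lemma actLE a w : actL a w = pt Phi a 0 + actL_linear a.1 w.
Proof.
set q := _ + _.
have Eq : q = ((actR Phi (pt Phi a 0) w.1).1, (actR Phi (pt Phi a 0) w.1).2 + w.2).
  rewrite /q /actL_linear /actR [LHS]/(_ + _) /= -/(pt Phi a 0).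
  by congr pair; rewrite addrA.
have -> : q = pt Phi (coN q) (rho Phi q) by rewrite pt_coN.
rewrite /actL; congr (pt Phi _ _).
  have : coN q = (( coN (actR Phi (pt Phi a 0) w.1)).1, (coN (actR Phi (pt Phi a 0) w.1)).2 + vRe w.2).
    by rewrite Eq /coN /= vReD.
  rewrite (coN_actR hPhi) coN_pt => ->; rewrite /mulN /coN /= addr0; congr pair.
  by rewrite addrAC.
have : rho Phi q = rho Phi (actR Phi (pt Phi a 0) w.1) + vIm w.2.
  by rewrite Eq /rho /= vImD addrAC.
by rewrite (rho_actR hPhi) rho_pt sub0r addrC => ->.
Qed.

Lemma continuous_actL_linear a : continuous (actL_linear a).
Proof.
move=> w; apply: (@cvg_pair _ _ _ (nbhs w) (nbhs w.1) (nbhs (2%:R * 'i *: Phi w.1 a + w.2))).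
  exact: cvg_fst.
have c3 : {for w, continuous (fun w : E * FC => Phi w.1 a)}.
  apply: (@continuous_Phi_comp _ _ _ _ hPhi _ (fun w : E * FC => w.1) (fun=> a)).
    exact: cvg_fst.
  exact: cst_continuous.
have c4 : {for w, continuous (fun w : E * FC => 2%:R * 'i *: Phi w.1 a)} by exact: (cvgZr c3).
have c5 : {for w, continuous (fun w : E * FC => w.2)} by exact: cvg_snd.
exact: (continuousD c4 c5).
Qed.

Lemma entire_actL a f : entire f -> entire (fun w => f (actL a w)).
Proof.
move=> hf w; have d : differentiable (actL a) w.
  rewrite (_ : actL a = (fun w => pt Phi a 0 + actL_linear a.1 w)); last first.
    by apply/funext => x; rewrite actLE.
  apply: differentiableD; first exact: differentiable_cst.
  by apply: linear_differentiable; exact: continuous_actL_linear.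
exact: (differentiable_comp d (hf _)).
Qed.

Lemma lonec_Phi_le (a : E) : exists2 M : R, 0 <= M & forall u, lonec (Phi u a) <= M * lonec u.
Proof.
exists (\sum_j lonec (Phi (delta_mx 0 j) a)); first by apply: sumr_ge0 => j _; exact: lonec_ge0.
move=> u; rewrite {1}(row_sum_delta u).
rewrite (big_morph (fun u => Phi u a) (fun u v => PhiDl hPhi u v a) (Phi0l hPhi a)).
apply: (@le_trans _ _ (\sum_j lonec (Phi (u 0 j *: delta_mx 0 j) a))).
  elim/big_ind2: _ => [|x y z t h1 h2|//]; first by rewrite /lonec big1// => j _; rewrite mxE cabs0.
  by rewrite (le_trans (lonecD _ _))// lerD.
rewrite mulr_suml; apply: ler_sum => j _.
rewrite (PhiZl hPhi) lonecZ mulrC ler_wpM2l ?lonec_ge0//.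
exact: coord_le_lonec.
Qed.

Lemma lone_vIm_le k (z : 'rV[R[i]]_k) : lone (vIm z) <= lonec z.
Proof. by apply: ler_sum => j _; rewrite mxE; exact: normr_Im_le. Qed.

Lemma actL_growth a : exists2 C : R, 0 < C & forall w,
  1 + ecnorm (actL a w).1 + ecnorm (actL a w).2 <= C * (1 + ecnorm w.1 + ecnorm w.2).
Proof.
have [M M0 hM] := lonec_Phi_le a.1.
pose c := pt Phi a 0.
pose C := 1 + lonec c.1 + lonec c.2 + (1 + 2 * M) * n%:R + m%:R.
have l1 := lonec_ge0 c.1; have l2 := lonec_ge0 c.2.
have Mn : 0 <= (1 + 2 * M) * n%:R by rewrite mulr_ge0// addr_ge0// mulr_ge0.
exists C; first by rewrite /C; have := ler0n R m; lra.
move=> w; rewrite actLE -/c.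
have e1 : (c + actL_linear a.1 w).1 = c.1 + w.1 by [].
have e2 : (c + actL_linear a.1 w).2 = c.2 + (2%:R * 'i *: Phi w.1 a.1 + w.2) by [].
rewrite e1 e2.
have h1 : ecnorm (c.1 + w.1) <= lonec c.1 + n%:R * ecnorm w.1.
  by rewrite (le_trans (ecnorm_le _))// (le_trans (lonecD _ _))// lerD2l lonec_le_ecnorm.
have h2 : ecnorm (c.2 + (2%:R * 'i *: Phi w.1 a.1 + w.2)) <=
    lonec c.2 + (2 * M * n%:R * ecnorm w.1 + m%:R * ecnorm w.2).
  rewrite (le_trans (ecnorm_le _))// (le_trans (lonecD _ _))// lerD2l.
  rewrite (le_trans (lonecD _ _))// lerD ?lonec_le_ecnorm// lonecZ cabsM cabs_i mulr1.
  rewrite (_ : 2%:R = 2%:C :> R[i]); last by apply/eqP; rewrite eq_complex/= !addr0 !eqxx.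
  rewrite cabs_real ger0_norm// -!mulrA ler_wpM2l// (le_trans (hM _))// ler_wpM2l//.
  exact: lonec_le_ecnorm.
have w1 : 0 <= ecnorm w.1 by exact: sqrtr_ge0.
have w2 : 0 <= ecnorm w.2 by exact: sqrtr_ge0.
set x := ecnorm w.1 in h1 h2 w1 *; set y := ecnorm w.2 in h2 w2 *.
have q1 := mulr_ge0 l1 w1; have q2 := mulr_ge0 l1 w2; have q3 := mulr_ge0 l2 w1.
have q4 := mulr_ge0 l2 w2; have q5 := mulr_ge0 (ler0n R m) w1.
have q6 := mulr_ge0 Mn w2; have := ler0n R m.
rewrite /C; have -> : (1 + lonec c.1 + lonec c.2 + (1 + 2 * M) * n%:R + m%:R) * (1 + x + y) =
  1 + lonec c.1 + lonec c.2 + (1 + 2 * M) * n%:R + m%:R + x + y + lonec c.1 * x + lonec c.1 * y +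
  lonec c.2 * x + lonec c.2 * y + n%:R * x + 2 * M * n%:R * x + (1 + 2 * M) * n%:R * y + m%:R * x + m%:R * y.
  by ring.
by lra.
Qed.

Lemma mulN_growth a : exists2 C : R, 0 < C & forall b : E * F,
  1 + ecnorm (mulN Phi a b).1 + enorm (mulN Phi a b).2 <= C * (1 + ecnorm b.1 + enorm b.2).
Proof.
have [M M0 hM] := lonec_Phi_le a.1.
pose C := 1 + lonec a.1 + lone a.2 + (1 + 2 * M) * n%:R + m%:R.
have l1 := lonec_ge0 a.1; have l2 := lone_ge0 a.2.
have Mn : 0 <= (1 + 2 * M) * n%:R by rewrite mulr_ge0// addr_ge0// mulr_ge0.
exists C; first by rewrite /C; have := ler0n R m; lra.
move=> w; rewrite /mulN /=.
have h1 : ecnorm (a.1 + w.1) <= lonec a.1 + n%:R * ecnorm w.1.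
  by rewrite (le_trans (ecnorm_le _))// (le_trans (lonecD _ _))// lerD2l lonec_le_ecnorm.
have h2 : enorm (a.2 + w.2 + 2%:R *: vIm (Phi a.1 w.1)) <=
    lone a.2 + m%:R * enorm w.2 + 2 * M * n%:R * ecnorm w.1.
  rewrite (le_trans (enorm_le _))// (le_trans (loneD _ _))// lerD//.
    by rewrite (le_trans (loneD _ _))// lerD2l lone_le_enorm.
  rewrite loneZ ger0_norm// -!mulrA ler_wpM2l// (vIm_PhiC hPhi) -scaleN1r loneZ normrN normr1 mul1r.
  rewrite (le_trans (lone_vIm_le _))// (le_trans (hM _))// ler_wpM2l//.
  exact: lonec_le_ecnorm.
have w1 : 0 <= ecnorm w.1 by exact: sqrtr_ge0.
have w2 : 0 <= enorm w.2 by exact: sqrtr_ge0.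
set x := ecnorm w.1 in h1 h2 w1 *; set y := enorm w.2 in h2 w2 *.
have q1 := mulr_ge0 l1 w1; have q2 := mulr_ge0 l1 w2; have q3 := mulr_ge0 l2 w1.
have q4 := mulr_ge0 l2 w2; have q5 := mulr_ge0 (ler0n R m) w1.
have q6 := mulr_ge0 Mn w2; have := ler0n R m.
rewrite /C; have -> : (1 + lonec a.1 + lone a.2 + (1 + 2 * M) * n%:R + m%:R) * (1 + x + y) =
  1 + lonec a.1 + lone a.2 + (1 + 2 * M) * n%:R + m%:R + x + y + lonec a.1 * x + lonec a.1 * y +
  lone a.2 * x + lone a.2 * y + n%:R * x + 2 * M * n%:R * x + (1 + 2 * M) * n%:R * y + m%:R * x + m%:R * y.
  by ring.
by lra.
Qed.

Lemma energyN_actL a f : entire f -> energyN (fun w => f (actL a w)) = energyN f.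
Proof.
move=> hf; have [_ h] := mpres_transL hPhi a; have cg := continuous_slice hf.
rewrite /energyN (_ : slice Phi _ 0 = (fun b => slice Phi f 0 (mulN Phi a b))); last first.
  by apply/funext => b; rewrite slice_actL.
move: (slice Phi f 0) cg => g cg; rewrite /energy.
pose G v := (cabs (g (ptN v)) `^ p)%:E.
transitivity (\int[lebN R n m]_v G (transL Phi a v))%E.
  by apply: eq_integral => v _; rewrite /G ptN_transL.
apply: h; last by move=> v; rewrite lee_fin powR_ge0.
by apply/measurable_EFinP; apply: measurable_comp_N; [exact: cg|exact: borel_map_ptN].
Qed.

Lemma CR_left a (g : E * F -> R[i]) : CR Phi g -> CR Phi (fun b => g (mulN Phi a b)).
Proof.
move=> hg v b; have := hg v (mulN Phi a b); rewrite /Zbar.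
have h u : deriv_along (left_lineN Phi) u (fun b => g (mulN Phi a b)) b =
    deriv_along (left_lineN Phi) u g (mulN Phi a b).
  have e : (fun t => g (mulN Phi a (left_lineN Phi b u t))) =
      (fun t => g (left_lineN Phi (mulN Phi a b) u t)).
    by apply/funext => t; rewrite /left_lineN (mulNA hPhi).
  by rewrite /deriv_along e.
by rewrite (h (v, 0)) (h ('i *: v, 0)).
Qed.

Lemma moderate_left a (g : E * F -> R[i]) : moderate g -> moderate (fun b => g (mulN Phi a b)).
Proof.
have [Cb Cb0 hCb] := mulN_growth a.
move=> [N' [C' hC']]; exists N', (`|C'| * Cb ^+ N') => b.
have g1 : 0 <= 1 + ecnorm (mulN Phi a b).1 + enorm (mulN Phi a b).2.
  by rewrite !addr_ge0 ?sqrtr_ge0.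
apply: (le_trans (hC' _)).
apply: (@le_trans _ _ (`|C'| * (1 + ecnorm (mulN Phi a b).1 + enorm (mulN Phi a b).2) ^+ N')).
  by rewrite ler_wpM2r ?ler_norm// exprn_ge0.
rewrite -mulrA ler_wpM2l// -exprMn lerXn2r// nnegrE//.
exact: le_trans g1 (hCb b).
Qed.

Lemma smooth_left a (g : E * F -> R[i]) : smoothN g -> smoothN (fun b => g (mulN Phi a b)).
Proof.
apply: (@smooth_transport _ _ _ (mulN Phi a) (fun v => (v.1, v.2 + 2%:R *: vIm (Phi a.1 v.1)))).
  move=> b; apply: (@continuous_comp _ _ _ (fun b => (a, b)) (fun q : (E * F) * (E * F) => mulN Phi q.1 q.2)).
    by apply: (@cvg_pair _ _ _ (nbhs b) (nbhs a) (nbhs b)); [exact: cvg_cst|exact: cvg_id].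
  exact: (continuous_mulN hPhi).
move=> q v t; rewrite /affine_lineN /mulN /= (PhiDr hPhi) (PhiZr hPhi) vImD.
have -> : conjc t%:C = t%:C by rewrite /= oppr0.
rewrite vImZ; congr pair; first by rewrite addrA.
rewrite !scalerDr !scalerA [2 * t]mulrC !addrA; congr (_ + _).
by rewrite [LHS]addrAC.
Qed.

(** All the conditions that define the space are left invariant, up to constants in
    the growth bounds and up to a translation in [F] for the spectrum. *)
Theorem bernstein_actL a f : bernstein Phi p K f -> bernstein Phi p K (fun w => f (actL a w)).
Proof.
move=> /bernsteinP[[df [N [C [C0 hC]]] [sf CRf mf spf]] ef].
apply/bernsteinP; split; last by rewrite energyN_actL.
have [Ca Ca0 hCa] := actL_growth a.
have sE : slice Phi (fun w => f (actL a w)) 0 = (fun b => slice Phi f 0 (mulN Phi a b)).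
  by apply/funext => b; rewrite slice_actL.
split; first exact: entire_actL.
  exists N, (C * Ca ^+ N); split; first by rewrite mulr_gt0// exprn_gt0.
  move=> w; apply: (le_trans (hC _)); rewrite rho_actL.
  apply: lee_wpmul2r; first exact: expeR_ge0.
  rewrite lee_fin -mulrA; apply: ler_wpM2l; first exact: ltW.
  have g1 : 0 <= 1 + ecnorm (actL a w).1 + ecnorm (actL a w).2 by rewrite !addr_ge0 ?sqrtr_ge0.
  rewrite -exprMn lerXn2r// nnegrE//.
  exact: le_trans g1 (hCa w).
rewrite sE; move: (slice Phi f 0) sf CRf mf spf => g sf CRf mf spf; split.
- exact: smooth_left.
- exact: CR_left.
- move=> vs; rewrite (@iter_deriv_transport _ _ _ (mulN Phi a) id vs); last first.
    by move=> q v t; rewrite /left_lineN (mulNA hPhi).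
  by rewrite map_id; exact: moderate_left.
- move=> z; have := spectrum_shift (a.2 + 2%:R *: vIm (Phi a.1 z)) (spf (a.1 + z)).
  congr spectrum_in; apply/funext => x; rewrite /mulN /=; congr (g (_, _)).
  by rewrite addrAC.
Qed.

End Symmetries.

(** * Homogeneous distances *)

Section Distance.
Context {R : realType} {n m : nat}.
Local Notation E := 'rV[R[i]]_n.
Local Notation F := 'rV[R]_m.
Local Notation FC := 'rV[R[i]]_m.
Context (Phi : E -> E -> FC) (hPhi : hermitian_map Phi).
Context (dN : E * F -> E * F -> R) (hdN : homogeneous_left_distance Phi dN).

Definition gN (a : E * F) : R := dN 0 a.

Lemma gN_ge0 a : 0 <= gN a. Proof. by have [[h _ _ _] _] := hdN; exact: h. Qed.

Lemma gN_eq0 a : gN a = 0 -> a = 0.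
Proof. by have [[_ h _ _] _] := hdN; move=> /h ->. Qed.

Lemma gN_0 : gN 0 = 0.
Proof. by have [[_ h _ _] _] := hdN; apply/h. Qed.

Lemma dN_gN a b : dN a b = gN (mulN Phi (invN a) b).
Proof.
have [_ [h _]] := hdN; rewrite /gN -(h _ _ (invN a)).
by rewrite (mulVN hPhi).
Qed.

Lemma gN_M a b : gN (mulN Phi a b) <= gN a + gN b.
Proof.
have [[_ _ _ tr] [h _]] := hdN.
rewrite (le_trans (tr _ a _))// lerD2l /gN -(h 0 b a).
by rewrite (mulN0 hPhi).
Qed.

Lemma gN_V a : gN (invN a) = gN a.
Proof.
have [[_ _ sy _] [h _]] := hdN.
by rewrite /gN -(h 0 (invN a) a) (mulN0 hPhi) (mulNV hPhi) sy.
Qed.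

Lemma gN_dil t a : 0 < t -> gN (dilationN t a) = t `^ (@theta R n) * gN a.
Proof.
move=> t0; have [_ [_ h]] := hdN; rewrite /gN -h//.
by rewrite {2}/dilationN /= !scaler0.
Qed.

Lemma theta_gt0 : 0 < @theta R n.
Proof. by rewrite /theta; case: n. Qed.

Definition vanish (X : topologicalType) (x : X) (f : X -> R) := f @ x --> (0 : R).

Lemma vanish_le (X : topologicalType) (x : X) (f h : X -> R) :
  (forall y, 0 <= f y <= h y) -> vanish x h -> vanish x f.
Proof.
move=> fh h0; apply: (@squeeze_cvgr _ _ _ _ (fun=> 0) h) => //.
  by apply: nearW => y; exact: fh.
exact: cvg_cst.
Qed.

Lemma vanishD (X : topologicalType) (x : X) (f h : X -> R) : vanish x f -> vanish x h ->
  vanish x (fun y => f y + h y).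
Proof. by move=> f0 h0; rewrite /vanish -[X in _ --> X](addr0 0); exact: cvgD. Qed.

Lemma vanish_powR (X : topologicalType) (x : X) (s : X -> R) : (forall y, 0 <= s y) ->
  vanish x s -> vanish x (fun y => s y `^ (@theta R n)).
Proof.
move=> s0 sx; rewrite /vanish /theta; case: n => [|k].
  by rewrite (_ : (fun y => _) = s)//; apply/funext => y; rewrite powRr1.
rewrite (_ : (fun y => _) = (fun y => Num.sqrt (s y))); last first.
  by apply/funext => y; rewrite powR12_sqrt.
rewrite -(@sqrtr0 R); apply: continuous_cvg => //; exact: sqrt_continuous.
Qed.

Lemma vanish_sum (X : topologicalType) (x : X) (I : Type) (r : seq I) (f : I -> X -> R) :
  (forall i, vanish x (f i)) -> vanish x (fun y => \sum_(i <- r) f i y).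
Proof.
move=> hf; elim: r => [|i r IH].
  by rewrite /vanish (_ : (fun y => _) = (fun=> 0)); [exact: cvg_cst|apply/funext => y; rewrite big_nil].
rewrite (_ : (fun y => _) = (fun y => f i y + \sum_(i <- r) f i y)); last first.
  by apply/funext => y; rewrite big_cons.
exact: vanishD.
Qed.

Lemma gN_F_scale (x : F) (s : R) : gN (0, s *: x) = `|s| `^ (@theta R n) * gN (0, x).
Proof.
have pos t : 0 < t -> gN (0, t *: x) = t `^ (@theta R n) * gN (0, x).
  by move=> t0; rewrite -gN_dil// /dilationN /= scaler0.
have [s0|s0|->] := ltgtP s 0.
- rewrite -[gN (0, s *: x)]gN_V /invN /= oppr0 -scaleNr pos ?oppr_gt0//.
  by rewrite ltr0_norm.
- by rewrite pos// gtr0_norm.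
by rewrite scale0r normr0 powR0 ?gt_eqF ?theta_gt0// mul0r gN_0.
Qed.

Lemma gN_E_scale (z : E) (s : R) : gN (s%:C *: z, 0) = (s ^+ 2) `^ (@theta R n) * gN (z, 0).
Proof.
have pos t : 0 < t -> gN (t%:C *: z, 0) = (t ^+ 2) `^ (@theta R n) * gN (z, 0).
  move=> t0; rewrite -gN_dil ?exprn_gt0// /dilationN /= scaler0.
  by rewrite sqrtr_sqr gtr0_norm.
have [s0|s0|->] := ltgtP s 0.
- rewrite -[gN (s%:C *: z, 0)]gN_V /invN /= oppr0 -scaleNr.
  have -> : - s%:C = (- s)%:C by apply/eqP; rewrite eq_complex /= oppr0 !eqxx.
  by rewrite pos ?oppr_gt0// sqrrN.
- by rewrite pos.
by rewrite scale0r expr0n powR0 ?gt_eqF ?theta_gt0// mul0r gN_0.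
Qed.

Lemma vanish_gN_F (X : topologicalType) (x : X) (u : X -> F) :
  {for x, continuous u} -> u x = 0 -> vanish x (fun y => gN (0, u y)).
Proof.
move=> cu u0.
have hb (v : F) : 0 <= gN (0, v) <= \sum_j `|v 0 j| `^ (@theta R n) * gN (0, delta_mx 0 j).
  rewrite gN_ge0/=; rewrite {1}(row_sum_delta v).
  elim/big_ind2: _ => [|a s b t ha hb|j _]; first by rewrite gN_0.
    have -> : (0, a + b) = mulN Phi (0, a) (0, b) :> E * F.
      by rewrite /mulN /= (Phi0l hPhi) addr0 /vIm map_mx0 scaler0 addr0.
    by rewrite (le_trans (gN_M _ _))// lerD.
  by rewrite gN_F_scale.
apply: vanish_le (fun y => hb (u y)) _.
apply: vanish_sum => j; rewrite /vanish -(mul0r (gN (0, delta_mx 0 j))).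
apply: cvgM; last exact: cvg_cst.
apply: vanish_powR => //; rewrite /vanish -(@normr0 _ R).
apply: cvg_norm.
have e : u x 0 j = 0 by rewrite u0 mxE.
suff : u y 0 j @[y --> x] --> u x 0 j by rewrite e.
exact: (@continuous_comp _ _ _ u (fun v : F => v 0 j) x cu (@continuous_coord _ _ j (u x))).
Qed.

(** [gN] is small on real lines by homogeneity. Recombining them in the group
    leaves an error [2 Im Phi] in [F], which tends to 0 too. *)
Lemma vanish_gN_E (X : topologicalType) (x : X) (u : X -> E) :
  {for x, continuous u} -> u x = 0 -> vanish x (fun y => gN (u y, 0)).
Proof.
move=> cu u0.
pose P (w : X -> E) := [/\ {for x, continuous w}, w x = 0 & vanish x (fun y => gN (w y, 0))].
have PD v w : P v -> P w -> P (fun y => v y + w y).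
  move=> [cv v0 hv] [cw w0 hw]; split.
  - exact: (continuousD cv cw).
  - by rewrite v0 w0 addr0.
  pose k y : F := - (2%:R *: vIm (Phi (v y) (w y))).
  apply: (@vanish_le _ _ _ (fun y => (gN (v y, 0) + gN (w y, 0)) + gN (0, k y))).
    move=> y; rewrite gN_ge0/=.
    have -> : (v y + w y, 0) = mulN Phi (mulN Phi (v y, 0) (w y, 0)) (0, k y).
      rewrite /mulN /= (Phi0r hPhi) !addr0 /vIm map_mx0 scaler0 addr0 add0r.
      by rewrite /k subrr.
    by rewrite (le_trans (gN_M _ _))// lerD2r gN_M.
  apply: vanishD; first exact: vanishD.
  apply: vanish_gN_F; last by rewrite /k v0 (Phi0l hPhi) /vIm map_mx0 scaler0 oppr0.
  have c1 : {for x, continuous (fun y => vIm (Phi (v y) (w y)))}.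
    apply: (@continuous_comp _ _ _ (fun y => Phi (v y) (w y)) (@vIm R m)); last exact: continuous_vIm.
    exact: (@continuous_Phi_comp _ _ _ Phi hPhi X v w x cv cw).
  exact: (cvgN (cvgZr c1)).
have Pbase (s : X -> R) (w : E) : {for x, continuous s} -> s x = 0 -> P (fun y => (s y)%:C *: w).
  move=> cs s0; split; last 2 first.
  - by rewrite s0 scale0r.
  - rewrite (_ : (fun y => _) = (fun y => (s y ^+ 2) `^ (@theta R n) * gN (w, 0))); last first.
      by apply/funext => y; rewrite gN_E_scale.
    rewrite /vanish -(mul0r (gN (w, 0))); apply: cvgM; last exact: cvg_cst.
    apply: vanish_powR; first by move=> y; exact: sqr_ge0.
    rewrite /vanish -[X in _ --> X](mul0r 0) -{1}s0.
    have : s y ^+ 2 @[y --> x] --> s x * s x by exact: (cvgM cs cs).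
    by rewrite s0.
  apply: cvg_rowP => j.
  rewrite (_ : (fun y => _) = (fun y => (s y)%:C * w 0 j)); last by apply/funext => y; rewrite mxE.
  have c1 : {for x, continuous (fun y => (s y)%:C)}.
    apply: (@continuous_comp _ _ _ (fun y => (s y, 0)) (fun ab : R * R => ab.1 +i* ab.2)).
      by apply: (@cvg_pair _ _ _ (nbhs x) (nbhs (s x)) (nbhs 0)); [exact: cs|exact: cvg_cst].
    exact: continuous_Complex.
  have c2 : {for x, continuous (fun=> w 0 j : R[i])} by exact: cst_continuous.
  exact: (cvgM c1 c2).
have cj j : {for x, continuous (fun y => u y 0 j)}.
  exact: (@continuous_comp _ _ _ u (fun v : E => v 0 j) x cu (@continuous_coord _ _ j (u x))).
have Pj j : P (fun y => u y 0 j *: delta_mx 0 j).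
  have -> : (fun y => u y 0 j *: delta_mx 0 j : E) = (fun y => (complex.Re (u y 0 j))%:C *: delta_mx 0 j +
     (complex.Im (u y 0 j))%:C *: ('i *: delta_mx 0 j)).
    apply/funext => y; rewrite scalerA -scalerDl; congr (_ *: _).
    by case: (u y 0 j) => a b; apply/eqP; rewrite eq_complex /=; apply/andP; split; apply/eqP; ring.
  apply: PD; apply: Pbase.
  - by apply: (@continuous_comp _ _ _ (fun y => u y 0 j)); [exact: cj|exact: continuous_Re].
  - by rewrite u0 mxE.
  - by apply: (@continuous_comp _ _ _ (fun y => u y 0 j)); [exact: cj|exact: continuous_Im].
  - by rewrite u0 mxE.
have : P (fun y => \sum_j u y 0 j *: delta_mx 0 j).
  elim: (index_enum _) => [|j r IH].
    rewrite (_ : (fun y => _) = (fun y => (0 : R)%:C *: (0 : E))); last first.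
      by apply/funext => y; rewrite big_nil scaler0.
    by apply: (Pbase (fun=> 0)) => //; exact: cst_continuous.
  rewrite (_ : (fun y => _) = (fun y => u y 0 j *: delta_mx 0 j + \sum_(i <- r) u y 0 i *: delta_mx 0 i)).
    exact: PD.
  by apply/funext => y; rewrite big_cons.
rewrite (_ : (fun y => _) = u); first by case.
by apply/funext => y; rewrite -row_sum_delta.
Qed.

Lemma gN_split a : gN a <= gN (a.1, 0) + gN (0, a.2).
Proof.
have {1}-> : a = mulN Phi (a.1, 0) (0, a.2); last exact: gN_M.
by case: a => z x; rewrite /mulN /= (Phi0r hPhi) !addr0 /vIm map_mx0 scaler0 addr0 add0r.
Qed.

(** Homogeneity yields continuity at the identity, and left invariance transports it
    to the other points. *)
Lemma continuous_gN : continuous gN.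
Proof.
move=> a.
have cm : {for a, continuous (fun b => mulN Phi (invN a) b)}.
  apply: (@continuous_comp _ _ _ (fun b => (invN a, b)) (fun q : (E * F) * (E * F) => mulN Phi q.1 q.2)).
    by apply: (@cvg_pair _ _ _ (nbhs a) (nbhs (invN a)) (nbhs a)); [exact: cvg_cst|exact: cvg_id].
  exact: (continuous_mulN hPhi).
have m0 : mulN Phi (invN a) a = 0 by rewrite (mulVN hPhi).
have v0 : vanish a (fun b => gN (mulN Phi (invN a) b)).
  apply: (@vanish_le _ _ _ (fun b => gN ((mulN Phi (invN a) b).1, 0) + gN (0, (mulN Phi (invN a) b).2))).
    by move=> b; rewrite gN_ge0/=; exact: gN_split.
  apply: vanishD.
    apply: vanish_gN_E; last by rewrite m0.
    by apply: (@continuous_comp _ _ _ (fun b => mulN Phi (invN a) b) fst); [exact: cm|exact: cvg_fst].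
  apply: vanish_gN_F; last by rewrite m0.
  by apply: (@continuous_comp _ _ _ (fun b => mulN Phi (invN a) b) snd); [exact: cm|exact: cvg_snd].
have le b : `|gN b - gN a| <= gN (mulN Phi (invN a) b).
  have h1 : gN b <= gN a + gN (mulN Phi (invN a) b) by rewrite -{1}(mulKVN hPhi a b) gN_M.
  have h2 : gN a <= gN b + gN (mulN Phi (invN a) b).
    rewrite -[X in _ + X]gN_V; apply: le_trans (gN_M _ _); rewrite le_eqVlt; apply/orP; left; apply/eqP.
    congr gN; move: (mulKVN hPhi a b); set c := mulN Phi (invN a) b => e.
    by rewrite -[X in mulN _ X _]e -(mulNA hPhi) (mulNV hPhi) (mulN0 hPhi).
  by rewrite ler_norml; apply/andP; split; lra.
apply/cvgrPdist_lt => e e0.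
have /cvgrPdist_lt/(_ e e0) := v0; apply: filterS => b.
rewrite sub0r normrN ger0_norm ?gN_ge0// => h.
by rewrite distrC (le_lt_trans (le b)).
Qed.

Definition boxN (B : R) : set (E * F) := [set a | boxE B a.1 /\ boxF B a.2].

Lemma compact_boxN B : compact (boxN B).
Proof.
rewrite (_ : boxN B = boxE B `*` boxF B)//.
by apply: compact_setX; [exact: compact_boxE|exact: compact_boxF].
Qed.

Lemma gN_box B : exists2 D, 0 <= D & forall a, boxN B a -> gN a <= D.
Proof.
have [->|b0] := eqVneq (boxN B) set0; first by exists 0.
have cg : {within boxN B, continuous gN} by exact: continuous_subspaceT continuous_gN.
have [u0 _ hu] := compact_EVT_max (proj1 (set0P _) b0) (@compact_boxN B) cg.
by exists (gN u0); [exact: gN_ge0|move=> a aB; rewrite hu// inE].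
Qed.

(** Homogeneous of degree 1 under the dilations, with a compact unit sphere. *)
Definition gauge (a : E * F) : R := \sum_j cabs (a.1 0 j) ^+ 2 + \sum_j `|a.2 0 j|.

Lemma gauge_ge0 a : 0 <= gauge a.
Proof. by rewrite addr_ge0// sumr_ge0// => j _; exact: sqr_ge0. Qed.

Lemma gauge_dil t a : 0 < t -> gauge (dilationN t a) = t * gauge a.
Proof.
move=> t0; rewrite /gauge mulrDr !mulr_sumr; congr (_ + _); apply: eq_bigr => j _.
  rewrite /dilationN /= mxE cabsM cabs_real exprMn ger0_norm ?sqrtr_ge0//.
  by rewrite sqr_sqrtr// ltW.
by rewrite /dilationN /= mxE normrM gtr0_norm.
Qed.

Lemma continuous_gauge : continuous gauge.
Proof.
move=> a; apply: cvgD; apply: continuous_sum => j.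
  apply: (@continuous_comp _ _ _ (fun b : E * F => cabs (b.1 0 j)) (fun x => x ^+ 2)); last exact: exprn_continuous.
  apply: (@continuous_comp _ _ _ (fun b : E * F => b.1 0 j) (@cabs R)); last exact: continuous_cabs.
  by apply: (@continuous_comp _ _ _ fst (fun v : E => v 0 j)); [exact: cvg_fst|exact: continuous_coord].
apply: (@continuous_comp _ _ _ (fun b : E * F => b.2 0 j) (fun x : R => `|x|)); last exact: norm_continuous.
by apply: (@continuous_comp _ _ _ snd (fun v : F => v 0 j)); [exact: cvg_snd|exact: continuous_coord].
Qed.

Lemma gauge_box B a : gauge a <= B -> boxN (1 + B) a.
Proof.
move=> aB; have B0 := le_trans (gauge_ge0 a) aB.
have h1 : 0 <= \sum_j cabs (a.1 0 j) ^+ 2 by apply: sumr_ge0 => j _; exact: sqr_ge0.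
have h2 : 0 <= \sum_j `|a.2 0 j| by apply: sumr_ge0.
split=> j; last first.
  have : `|a.2 0 j| <= \sum_j `|a.2 0 j| by rewrite (bigD1 j)//= lerDl sumr_ge0.
  by move: aB; rewrite /gauge; lra.
have : cabs (a.1 0 j) ^+ 2 <= \sum_j cabs (a.1 0 j) ^+ 2.
  by rewrite (bigD1 j)//= lerDl sumr_ge0// => ? _; exact: sqr_ge0.
have := sqr_ge0 (cabs (a.1 0 j) - 1); have := cabs_ge0 (a.1 0 j).
have := normr_Re_le (a.1 0 j); have := normr_Im_le (a.1 0 j).
move: aB; rewrite /gauge; set x := cabs _ => q1 q2 q3 q4 q5 q6.
have q7 : (x - 1) ^+ 2 = x ^+ 2 - 2 * x + 1 by ring.
by rewrite q7 in q5; split; nra.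
Qed.

Lemma gauge_eq0 : gauge 0 = 0.
Proof. by rewrite /gauge !big1 ?addr0// => j _; rewrite mxE ?cabs0 ?expr0n ?normr0. Qed.

(** By homogeneity the infimum of [gN] on the compact set [gauge = 1], which is
    positive, controls the gauge by a power of [gN]. *)
Lemma gN_bounded r : exists2 B, 0 <= B & forall a, gN a <= r -> boxN B a.
Proof.
pose S : set (E * F) := [set a | gauge a = 1].
have cS : compact S.
  apply: (@subclosed_compact _ _ (boxN 2)); last 2 first.
  - exact: compact_boxN.
  - by move=> a aS; rewrite (_ : 2 = 1 + 1 :> R)//; apply: gauge_box; rewrite aS.
  rewrite (_ : S = gauge @^-1` [set 1])//; apply: preimage_closed; last exact: closed_eq.
  by move=> x _; exact: continuous_gauge.
have [S0|S0] := eqVneq S set0.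
  exists 1 => // a _.
  have [a0|a0] := eqVneq (gauge a) 0.
    by rewrite -[1]addr0; apply: gauge_box; rewrite a0.
  have ap : 0 < gauge a by rewrite lt_def a0 gauge_ge0.
  suff : S (dilationN (gauge a)^-1 a) by rewrite S0.
  by rewrite /S /= gauge_dil ?invr_gt0// mulVf.
have [b bS hb] := compact_EVT_min (proj1 (set0P _) S0) cS (continuous_subspaceT continuous_gN).
have c0 : 0 < gN b.
  rewrite lt_def gN_ge0 andbT; apply/eqP => /gN_eq0 b0.
  move: bS; rewrite inE /S /= b0 gauge_eq0 => /eqP.
  by rewrite eq_sym oner_eq0.
exists (1 + (`|r| / gN b) `^ (@theta R n)^-1).
  by rewrite addr_ge0// powR_ge0.
move=> a ar; apply: gauge_box.
have [->|a0] := eqVneq (gauge a) 0; first exact: powR_ge0.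
have ap : 0 < gauge a by rewrite lt_def a0 gauge_ge0.
have aS : S (dilationN (gauge a)^-1 a) by rewrite /S /= gauge_dil ?invr_gt0// mulVf.
have := hb _ (mem_set aS); rewrite gN_dil ?invr_gt0//.
have th := theta_gt0; set th0 := @theta R n in th *.
rewrite -powR_inv1 ?(ltW ap)// -powRrM mulN1r powRN mulrC ler_pdivlMr ?powR_gt0// => h.
have h' : gauge a `^ th0 <= `|r| / gN b.
  by rewrite ler_pdivlMr// mulrC (le_trans h)// (le_trans ar)// ler_norm.
rewrite -[gauge a]powRr1 ?gauge_ge0// -(mulfV (lt0r_neq0 th)) powRrM.
apply: ge0_ler_powR => //; first by rewrite invr_ge0 ltW.
  by rewrite nnegrE powR_ge0.
by rewrite nnegrE divr_ge0// ltW.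
Qed.

End Distance.

(** * Uniform local boundedness of sampling measures *)

Section FiniteCover.
Context {R : realType} {d : measure_display} {T : measurableType d}.
Context (mu : {measure set T -> \bar R}).

Lemma measure_cover_le (I : choiceType) (D : seq I) (f : I -> set T) (c : I -> R) (A : set T) :
  measurable A -> (forall i, measurable (f i)) -> (forall i, i \in D -> (mu (f i) <= (c i)%:E)%E) ->
  A `<=` \bigcup_(i in [set` D]) f i -> (mu A <= (\sum_(i <- D) c i)%:E)%E.
Proof.
move=> mA mf hf; rewrite bigcup_seq => AD.
have mU s : measurable (\big[setU/set0]_(i <- s) f i) by apply: bigsetU_measurable.
apply: (le_trans (le_measure mu _ _ AD)); rewrite ?inE//.
elim: D hf {AD} => [|i D IH] hf; first by rewrite !big_nil measure0.
rewrite !big_cons EFinD; apply: (le_trans (measureU2 mu (mf i) (mU D))).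
apply: leeD; first by apply: hf; rewrite mem_head.
by apply: IH => j jD; apply: hf; rewrite in_cons jD orbT.
Qed.

Lemma markov_energy (p c : R) (A : set T) (g : T -> R[i]) : 0 < p -> 0 < c -> measurable A ->
  measurable_fun setT (fun x => cabs (g x) `^ p) -> (forall x, A x -> c <= cabs (g x)) ->
  (mu A <= ((c `^ p)^-1)%:E * energy mu p g)%E.
Proof.
move=> p0 c0 mA mg hA; rewrite -[mu A]mul1e -(@mulVf _ (c `^ p)) ?gt_eqF ?powR_gt0//.
rewrite EFinM -muleA; apply: lee_wpmul2l; first by rewrite lee_fin invr_ge0 powR_ge0.
rewrite -[A]setIT -integral_indic// /energy.
rewrite -ge0_integralZl_EFin//; last 2 first.
- by apply/measurable_EFinP; exact: measurable_indic.
- exact: powR_ge0.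
apply: ge0_le_integral => //.
- by move=> x _; rewrite mule_ge0 ?lee_fin ?powR_ge0.
- by apply: measurable_funeM; apply/measurable_EFinP; exact: measurable_indic.
- exact/measurable_EFinP.
move=> x _; rewrite -EFinM lee_fin indicE; case: (boolP (x \in A)) => [xA|_].
  rewrite mulr1; apply: ge0_ler_powR; rewrite ?nnegrE ?(ltW p0) ?(ltW c0) ?cabs_ge0//.
  by apply: hA; rewrite inE in xA.
by rewrite mulr0 powR_ge0.
Qed.

End FiniteCover.

Lemma compact_finite_cover (X : topologicalType) (x0 : X) (A : set X) :
  compact A -> cover_compact A.
Proof.
pose ip := isPointed.Build X x0.
pose Y : ptopologicalType := HB.pack X ip.
have : @compact Y A -> @cover_compact Y A by rewrite compact_cover.
exact.
Qed.

Section Sampling.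
Context {R : realType} {n m : nat}.
Local Notation E := 'rV[R[i]]_n.
Local Notation F := 'rV[R]_m.
Local Notation FC := 'rV[R[i]]_m.
Local Notation Borel := (g_sigma_algebraType (@open (E * FC)%type)).
Context (Phi : E -> E -> FC) (hPhi : hermitian_map Phi).
Context (K : set F) (hK : compact K) (p : R) (p0 : 0 < p).
Implicit Types (f : E * FC -> R[i]).

(** Since [K] is bounded, its support function is at most a multiple of the norm. *)
Lemma hol_tame : exists2 sg : R, 0 <= sg & forall f, Hol_K Phi K f ->
  exists (N : nat) (A : R), 0 <= A /\ tame Phi N sg A f.
Proof.
have [sg sg0 hsg] : exists2 sg : R, 0 <= sg & forall k, K k -> lone k <= sg.
  have [->|K0] := eqVneq K set0; first by exists 0.
  have cl : {within K, continuous (@lone R m)} by exact: continuous_subspaceT (@continuous_lone R m).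
  have [k _ hk] := compact_EVT_max (proj1 (set0P _) K0) hK cl.
  by exists (lone k); [exact: lone_ge0|move=> l lK; rewrite hk// inE].
exists sg => // f [_ [N [C [C0 hC]]] _]; exists N, C; split; first exact: ltW.
move=> w; rewrite -lee_fin; apply: (le_trans (hC w)); rewrite [X in (_ <= X)%E]EFinM.
apply: lee_pmul.
- by rewrite lee_fin mulr_ge0 ?(ltW C0)// exprn_ge0// !addr_ge0 ?sqrtr_ge0.
- exact: expeR_ge0.
- rewrite lee_fin ler_wpM2l ?(ltW C0)// lerXn2r ?nnegrE ?addr_ge0 ?sqrtr_ge0 ?lonec_ge0//.
  by rewrite !lerD ?ecnorm_le.
have <- : expeR (sg * lone (rho Phi w))%:E = (expR (sg * lone (rho Phi w)))%:E by [].
rewrite lee_expeR; apply: ge_ereal_sup => _ [l [k kK <-] <-]; rewrite lee_fin.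
apply: (@le_trans _ _ (\sum_j lone k * `|rho Phi w 0 j|)); last first.
  by rewrite -mulr_sumr ler_wpM2r ?lone_ge0// hsg.
apply: ler_sum => j _; apply: (le_trans (ler_norm _)); rewrite normrM ler_wpM2r//.
by rewrite [(- k) 0 j]mxE normrN coord_le_lone.
Qed.

(** After a translation in [i F] the fibre of [rho] over [h] becomes the one over 0,
    and [fiber_bound] controls all values of [f] by those on it. *)
Lemma slice_unique f h : Hol_K Phi K f -> (forall a, slice Phi f h a = 0) -> f = (fun=> 0).
Proof.
move=> hf f0; have [sg sg0 hsg] := hol_tame; have [N [A [A0 tf]]] := hsg f hf.
have ef : entire f by case: hf.
pose v : E * FC := (0, 'i *: vC h).
pose g w := f (v + w).
have vw w : v + w = (w.1, 'i *: vC h + w.2) by rewrite (_ : v + w = (v.1 + w.1, v.2 + w.2))// /v /= add0r.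
have eg : entire g.
  move=> w; have d : differentiable (fun w => v + w) w.
    apply: differentiableD; first exact: differentiable_cst.
    exact: ex_diff.
  exact: (differentiable_comp d (ef _)).
pose c := lonec ('i *: vC h) : R.
have c0 : 0 <= c by exact: lonec_ge0.
pose B := A * (1 + c) ^+ N * expR (sg * lone h).
have B0 : 0 <= B by rewrite !mulr_ge0 ?expR_ge0// exprn_ge0// addr_ge0.
have tg : tame Phi N sg B g.
  move=> w; apply: (le_trans (tf _)); rewrite vw /=.
  have r1 : lone (rho Phi (w.1, 'i *: vC h + w.2)) <= lone h + lone (rho Phi w).
    have -> : rho Phi (w.1, 'i *: vC h + w.2) = h + rho Phi w.
      by rewrite /rho /= vImD vImiZ vRe_vC addrA.
    exact: loneD.
  have u0 := lonec_ge0 w.1; have v0 := lonec_ge0 w.2.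
  have r2 : 1 + lonec w.1 + lonec ('i *: vC h + w.2) <= (1 + c) * (1 + lonec w.1 + lonec w.2).
    have := lonecD ('i *: vC h) w.2; rewrite -/c.
    have := mulr_ge0 c0 u0; have := mulr_ge0 c0 v0; lra.
  have r3 : 0 <= 1 + lonec w.1 + lonec ('i *: vC h + w.2) by rewrite !addr_ge0 ?lonec_ge0.
  apply: (@le_trans _ _ (A * ((1 + c) * (1 + lonec w.1 + lonec w.2)) ^+ N *
      expR (sg * (lone h + lone (rho Phi w))))).
    apply: ler_pM; rewrite ?expR_ge0 ?mulr_ge0 ?exprn_ge0//.
      by rewrite ler_wpM2l// lerXn2r// nnegrE// (le_trans r3).
    by rewrite ler_expR ler_wpM2l.
  rewrite [sg * _]mulrDr expRD exprMn /B.
  by rewrite le_eqVlt; apply/orP; left; apply/eqP; ring.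
have g0 w : g w = 0.
  pose H := lone (rho Phi w).
  have [C [C0 hC]] := fiber_bound Phi N sg0 (lone_ge0 (rho Phi w)) p0.
  pose z := w.2 - 'i *: vC (Phid Phi w.1).
  have zI : vIm z = rho Phi w by rewrite /z vImD vImN vImiZ vRe_vC.
  have zH : boxF H (vIm z) by move=> j; rewrite zI; exact: coord_le_lone.
  have wE : w = (w.1, z + 'i *: vC (Phid Phi w.1)) by rewrite subrK; case: (w).
  have := hC g B eg B0 tg w.1 z zH; rewrite -wE.
  have -> : (\int[lebF R m]_s (cabs (g (w.1, vC (vRe z + ptF s) + 'i *: vC (Phid Phi w.1))) `^ p *
      \prod_(j < m) (C * (1 + tnth s j ^+ 2)^-1))%:E = 0)%E.
    apply: integral0_eq => s _.
    have := f0 (w.1, vRe z + ptF s); rewrite /slice /g vw /= addrC => ->.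
    by rewrite cabs0 powR0 ?mul0r// gt_eqF.
  rewrite lee_fin => h0; have : cabs (g w) `^ p = 0.
    by apply/le_anti; rewrite h0 powR_ge0.
  by move=> /powR_eq0_eq0/eqP; rewrite cabs_eq0 => /eqP.
apply/funext => w; have := g0 (w - v); rewrite /g.
by rewrite addrC subrK.
Qed.

Section Mu.
Context (mu : {measure set Borel -> \bar R}) (hmu : radon mu).
Context (hsupp : bounded_set (rho Phi @` msupport mu)).

Lemma open_measurableB (U : set (E * FC)) : open U -> measurable (U : set Borel).
Proof. by move=> oU; exact: sub_sigma_algebra. Qed.

Lemma closed_measurableB (U : set (E * FC)) : closed U -> measurable (U : set Borel).
Proof.
move=> cU; rewrite -[U]setCK; apply: measurableC; apply: open_measurableB.
exact: closed_openC.
Qed.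

Lemma borel_map_id : borel_map (fun w : Borel => w : E * FC).
Proof. by move=> U oU; exact: open_measurableB. Qed.

Lemma measurable_cabsB f : continuous f ->
  measurable_fun [set: Borel] (fun w : Borel => cabs (f w) `^ p).
Proof. by move=> cf; apply: measurable_cabs_powR => //; exact: borel_map_id. Qed.

Definition strip (H : R) : set (E * FC) := [set w | boxF H (rho Phi w)].

Lemma closed_boxF (H : R) : closed (@boxF R m H).
Proof. by apply: compact_closed; [exact: norm_hausdorff|exact: compact_boxF]. Qed.

Lemma closed_strip H : closed (strip H).
Proof.
apply: (@preimage_closed _ _ (rho Phi) (@boxF R m H)); last exact: closed_boxF.
by move=> w _; exact: continuous_rho.
Qed.

(** By inner regularity only compact sets matter, and finitely many null open sets
    cover them. *)
Lemma mu_null (U : set (E * FC)) : open U -> U `&` msupport mu = set0 -> mu U = 0%E.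
Proof.
move=> oU U0; have [_ _ inner] := hmu.
apply/le_anti/andP; split; last exact: measure_ge0.
rewrite inner//; apply: ge_ereal_sup => _ [A [cA AU] <-].
have h w : exists V : set (E * FC), open V /\ mu V = 0%E /\ (A w -> V w).
  have [Aw|nAw] := pselect (A w); last first.
    by exists set0; split; [exact: open0|split; [exact: measure0|]].
  have : ~ msupport mu w by move=> sw; rewrite -[False]/(set0 w) -U0; split=> //; exact: AU.
  move=> /existsNP[V /not_implyP[oV /not_implyP[Vw nV]]].
  exists V; split=> //; split=> //; apply/le_anti/andP; split; last exact: measure_ge0.
  by rewrite leNgt; apply/negP.
have [V hV] := choice h.
have [D' _ AD] : finite_subset_cover A V A.
  apply: (@compact_finite_cover (E * FC)%type (0, 0) A cA); first by move=> w _; have [] := hV w.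
  by move=> w Aw; exists w => //; have [_ [_]] := hV w; exact.
have cA' : closed A by apply: compact_closed => //; exact: norm_hausdorff.
have := @measure_cover_le R _ Borel mu _ (finmap.enum_fset D') V (fun=> 0) A (closed_measurableB cA').
rewrite big1// => hh; apply: hh => //.
  by move=> w; apply: open_measurableB; have [] := hV w.
by move=> w _; have [_ [-> _]] := hV w.
Qed.

Lemma mu_strip : exists2 H : R, 0 <= H & mu (~` strip H) = 0%E.
Proof.
have [M [_ hM]] := hsupp.
pose H := Num.max 0 (M + 1).
have MH : M < H by rewrite /H lt_max; apply/orP; right; lra.
exists H; first by rewrite /H le_max lexx.
apply: mu_null; first by apply: closed_openC; exact: closed_strip.
apply/seteqP; split=> // w [nw sw]; apply: nw => j.
have := hM H MH (rho Phi w) (ex_intro2 _ _ w sw erefl).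
apply: le_trans; rewrite -[`|rho Phi w|]/(mx_norm (rho Phi w)) mx_normrE.
exact: (@le_bigmax_cond _ R _ 0 (0, j) xpredT (fun ij : 'I_1 * 'I_m => `|rho Phi w ij.1 ij.2|)).
Qed.

Context (hs : sampling Phi p K mu).

Lemma cabs0B (z : R[i]) : cabs (0 - z) = cabs z.
Proof. by rewrite sub0r cabsN. Qed.

(** Continuity of the embedding at [0], rescaled: translates of one function have
    uniformly bounded energy. *)
Lemma uniform_energy f : bernstein Phi p K f -> exists2 C : R, 0 <= C &
  forall a, (energy mu p (fun w : Borel => f (actL Phi a w)) <= C%:E)%E.
Proof.
move=> hf; have [_ hcont _ _] := hs.
have [dl dl0 hdl] := hcont _ (bernstein_0 hPhi K p0) 1 ltr01.
have [_ ef] := proj1 (bernsteinP hPhi K p0 f) hf.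
have e0 : (0 <= energyN Phi p f)%E by exact: energy_ge0.
have efin : energyN Phi p f \is a fin_num by rewrite ge0_fin_numE.
pose c := fine (energyN Phi p f).
have c0 : 0 <= c by exact: fine_ge0.
(* scaled so that [k f] has an energy less than [dl ^ p] *)
pose k := (dl `^ p / (2 * (1 + c))) `^ p^-1.
have d0 : 0 < dl `^ p / (2 * (1 + c)) by rewrite divr_gt0 ?powR_gt0// mulr_gt0// ltr_pwDl.
have k0 : 0 < k by rewrite powR_gt0.
have kp : k `^ p = dl `^ p / (2 * (1 + c)) by rewrite /k -powRrM mulVf ?gt_eqF// powRr1// ltW.
exists (k `^ p)^-1; first by rewrite invr_ge0 powR_ge0.
move=> a; have hfa := bernstein_actL hPhi p0 a hf.
have hg := bernstein_scale hPhi p0 k0 hfa.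
have efa : entire f by case: hf => -[].
have := hdl _ hg; rewrite /bernstein_norm (Lpnorm_lt _ _ p0 dl0) (Lpnorm_lt _ _ p0 ltr01) powR1.
have -> : energy (lebN R n m) p (slice Phi (fun w => 0 - k%:C * f (actL Phi a w)) 0 \o ptN) =
    ((k `^ p)%:E * energyN Phi p f)%E.
  rewrite -(energyN_actL hPhi p a efa) /energyN -(energyZ _ p _ k0).
  by apply: eq_integral => v _; congr ((_ `^ p)%:E); exact: cabs0B.
rewrite -[X in (_ * X < _)%E](fineK efin) -EFinM lte_fin -/c kp => /(_ _).
have -> : energy mu p (fun w : Borel => 0 - k%:C * f (actL Phi a w)) =
    ((k `^ p)%:E * energy mu p (fun w : Borel => f (actL Phi a w)))%E.
  rewrite -(energyZ _ p _ k0); apply: eq_integral => v _.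
  by congr ((_ `^ p)%:E); exact: cabs0B.
rewrite -kp => hh; have {}hh := ltW (hh _).
rewrite -[energy _ _ _]mul1e -(@mulVf _ (k `^ p)) ?gt_eqF ?powR_gt0// EFinM -muleA.
rewrite -[X in (_ <= X%:E)%E]mulr1 EFinM; apply: lee_wpmul2l; first by rewrite lee_fin invr_ge0 powR_ge0.
apply: hh; rewrite kp mulrAC ltr_pdivrMr ?mulr_gt0 ?ltr_pwDl//.
have := powR_gt0 p dl0; set x := dl `^ p => x0.
by have := mulr_ge0 (ltW x0) c0; lra.
Qed.

Context (dN : E * F -> E * F -> R) (hdN : homogeneous_left_distance Phi dN).
Context (hB : bernstein Phi p K <> [set cst 0]).

Lemma nonzero_bernstein : exists2 f, bernstein Phi p K f & f <> (fun=> 0).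
Proof.
apply: contrapT => h; apply: hB; apply/seteqP; split=> f /= hf.
  by apply: contrapT => fn0; apply: h; exists f.
by rewrite hf; exact: bernstein_0.
Qed.

Lemma continuous_actL a : continuous (actL Phi a).
Proof.
move=> w; have c := @continuous_actL_linear _ _ _ Phi hPhi a.1 w.
rewrite (_ : actL Phi a = (fun w => pt Phi a 0 + actL_linear Phi a.1 w)); last first.
  by apply/funext => x; rewrite actLE.
have c2 : {for w, continuous (fun _ : E * FC => pt Phi a 0)} by exact: cst_continuous.
exact: (continuousD c2 c).
Qed.

Lemma actLM a b w : actL Phi a (actL Phi b w) = actL Phi (mulN Phi a b) w.
Proof. by rewrite /actL coN_pt rho_pt (mulNA hPhi). Qed.

Definition tube (a : E * F) (r : R) : set (E * FC) :=
  [set w | gN dN (mulN Phi (invN a) (coN w)) <= r].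

Lemma closed_tube a r : closed (tube a r).
Proof.
apply: (@preimage_closed _ _ (fun w => gN dN (mulN Phi (invN a) (coN w))) [set x | x <= r]); last exact: closed_le.
move=> w _; apply: (@continuous_comp _ _ _ (fun w : E * FC => mulN Phi (invN a) (coN w)) (gN dN)).
  apply: (@continuous_comp _ _ _ (fun w : E * FC => (invN a, coN w)) (fun q : (E * F) * (E * F) => mulN Phi q.1 q.2)).
    by apply: (@cvg_pair _ _ _ (nbhs w) (nbhs (invN a)) (nbhs (coN w))); [exact: cvg_cst|exact: continuous_coN].
  exact: (continuous_mulN hPhi).
exact: (continuous_gN hPhi hdN).
Qed.

Lemma compact_cell B H : compact [set w : E * FC | boxN B (coN w) /\ strip H w].
Proof.
rewrite (_ : [set w | _] = (fun q : (E * F) * F => pt Phi q.1 q.2) @` (boxN B `*` boxF H)).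
  apply: continuous_compact; first exact: continuous_subspaceT (continuous_pt hPhi).
  by apply: compact_setX; [exact: compact_boxN|exact: compact_boxF].
apply/seteqP; split=> [w [h1 h2]|_ [[a h] [h1 h2] <-]] /=.
  by exists (coN w, rho Phi w) => //; exact: pt_coN.
by rewrite coN_pt /strip /= rho_pt.
Qed.

(** Up to a null set, the tube lies in a translate of a compact cell. Every point of
    the cell has a translate of a given non-zero function that does not vanish
    there, so finitely many translates are bounded below on a cover of the cell.
    Markov's inequality bounds the mass of each piece by an energy, and the
    energies of all translates are uniformly bounded. *)
Theorem tube_mass r : exists2 C : R, 0 <= C & forall a, (mu (tube a r) <= C%:E)%E.
Proof.
have [H H0 muH] := mu_strip.
have [f hf fn0] := nonzero_bernstein.
have ef : entire f by case: hf => -[].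
have cf := entire_continuous ef.
have [C0 C00 hC0] := uniform_energy hf.
have [B B0 hBr] := gN_bounded hPhi hdN r.
pose Q : set (E * FC) := [set w | boxN B (coN w) /\ strip H w].
pose V (i : (E * F) * nat) : set (E * FC) := [set w | i.2.+1%:R^-1 < cabs (f (actL Phi i.1 w))].
have oV i : open (V i).
  apply: (@open_comp _ _ (fun w => cabs (f (actL Phi i.1 w))) [set x | i.2.+1%:R^-1 < x]); last exact: open_gt.
  move=> w _; apply: (@continuous_comp _ _ _ (fun w => f (actL Phi i.1 w)) (@cabs R)); last exact: continuous_cabs.
  by apply: continuous_comp; [exact: continuous_actL|exact: cf].
have [D' _ QD] : finite_subset_cover setT V Q.
  apply: (@compact_finite_cover (E * FC)%type (0, 0) Q (@compact_cell B H)); first by move=> i _; exact: oV.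
  move=> w _.
  have [b fb] : exists b, f (actL Phi b w) != 0.
    apply: contrapT => h; apply: fn0; apply: (@slice_unique f (rho Phi w)); first by case: hf.
    move=> a; rewrite sliceE; apply/eqP; apply: contrapT => /negP fa; apply: h.
    exists (mulN Phi a (invN (coN w))); rewrite /actL -(mulNA hPhi) (mulVN hPhi).
    by rewrite (mulN0 hPhi).
  have c0 : 0 < cabs (f (actL Phi b w)) by rewrite cabs_gt0.
  exists (b, Num.Def.archi_bound (cabs (f (actL Phi b w)))^-1) => //=.
  rewrite /V /= invf_plt ?posrE ?ltr0Sn//.
  apply: (@lt_trans _ _ (Num.Def.archi_bound (cabs (f (actL Phi b w)))^-1)%:R).
    by apply: archi_boundP; rewrite invr_ge0 cabs_ge0.
  by rewrite ltr_nat.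
pose c (i : (E * F) * nat) : R := ((i.2.+1%:R^-1 `^ p)^-1) * C0.
have c0 i : 0 <= c i by rewrite mulr_ge0// invr_ge0 powR_ge0.
exists (\sum_(i <- finmap.enum_fset D') c i); first by apply: sumr_ge0.
move=> a.
have mtube : measurable (tube a r : set Borel) by exact: closed_measurableB (@closed_tube a r).
have mstrip : measurable (strip H : set Borel) by exact: closed_measurableB (@closed_strip H).
apply: (@le_trans _ _ (mu (tube a r `&` strip H))).
  have e : tube a r = (tube a r `&` strip H) `|` (tube a r `&` ~` strip H).
    by rewrite -setIUr setUv setIT.
  rewrite {1}e; apply: (le_trans (measureU2 _ _ _)).
  - exact: measurableI.
  - by apply: measurableI => //; exact: measurableC.
  rewrite [X in (_ + X)%E](_ : _ = 0%E) ?adde0//.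
  apply/le_anti/andP; split; last exact: measure_ge0.
  rewrite -muH; apply: le_measure; rewrite ?inE.
  - by apply: measurableI => //; exact: measurableC.
  - exact: measurableC.
  - by move=> w [].
pose W (i : (E * F) * nat) : set Borel := [set w | V i (actL Phi (invN a) w)].
apply: (@measure_cover_le R _ Borel mu _ (finmap.enum_fset D') W c).
- exact: measurableI.
- move=> i; apply: open_measurableB; apply: (@open_comp _ _ (actL Phi (invN a)) (V i)); last exact: oV.
  by move=> w _; exact: continuous_actL.
- move=> i _.
  have cg : continuous (fun w => f (actL Phi (mulN Phi i.1 (invN a)) w)).
    by move=> w; apply: continuous_comp; [exact: continuous_actL|exact: cf].
  apply: (le_trans (@markov_energy R _ Borel mu p (i.2.+1%:R^-1) _
    (fun w : Borel => f (actL Phi (mulN Phi i.1 (invN a)) w)) p0 _ _ _ _)).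
  - by rewrite invr_gt0 ltr0Sn.
  - apply: open_measurableB; apply: (@open_comp _ _ (actL Phi (invN a)) (V i)); last exact: oV.
    by move=> w _; exact: continuous_actL.
  - exact: measurable_cabsB.
  - by move=> w; rewrite /W /V /= actLM => /ltW.
  rewrite /c EFinM; apply: lee_wpmul2l; first by rewrite lee_fin invr_ge0 powR_ge0.
  exact: hC0.
move=> w [tw sw]; have : Q (actL Phi (invN a) w).
  split; first by rewrite coN_actL; exact: hBr.
  by rewrite /strip /= rho_actL.
by move=> /QD[i iD Vi]; exists i.
Qed.

End Mu.

End Sampling.

(** * The tail estimate and the lower bound *)

Section Generalities.
Context {R : realType} {d : measure_display} {T : measurableType d}.
Context (mu : {measure set T -> \bar R}).
Local Open Scope ereal_scope.

Section Exchange.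
Context d2 (T2 : measurableType d2) (m2 : {sigma_finite_measure set T2 -> \bar R}).
Context (hs : sigma_finite setT mu).
Context (f : T * T2 -> \bar R) (mf : measurable_fun setT f) (f0 : forall x, 0 <= f x).

(** The measure with its sigma-finiteness as data, where the product theorems
    apply. *)
Definition sf_of & sigma_finite setT mu : set T -> \bar R := mu.
HB.instance Definition _ := Measure.on (sf_of hs).
HB.instance Definition _ := Measure_isSigmaFinite.Build _ _ _ (sf_of hs) hs.

Lemma measurable_inner_sf : measurable_fun setT (fun y => \int[mu]_x f (x, y)).
Proof. exact: (@measurable_inner2 _ _ _ _ _ (sf_of hs) f mf f0). Qed.

Lemma exchange_sf : \int[mu]_x \int[m2]_y f (x, y) = \int[m2]_y \int[mu]_x f (x, y).
Proof.
have := @sf_tonelli2 _ _ _ _ _ (sf_of hs) m2 f mf f0.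
by rewrite (@sf_tonelli1 _ _ _ _ _ (sf_of hs) m2 f mf f0).
Qed.

End Exchange.

(** The integrals over the sets [g < k] increase to the full one. *)
Lemma integral_tail_small (h : T -> \bar R) (g : T -> R) (e : R) :
  measurable_fun setT h -> (forall x, 0 <= h x) -> \int[mu]_x h x < +oo ->
  measurable_fun setT g -> (0 < e)%R ->
  exists k : nat, \int[mu]_(x in [set x | (k%:R <= g x)%R]) h x < e%:E.
Proof.
move=> mh h0 hoo mg e0; apply: contrapT => /forallNP hk.
pose F k : set T := [set x | (g x < k%:R)%R].
have mF k : measurable (F k).
  have := mg measurableT _ (measurable_itv `]-oo, k%:R[).
  rewrite setTI; congr measurable; apply/seteqP; split=> x; by rewrite /F /= in_itv.
have ndF : nondecreasing_seq F.
  by move=> i j ij; apply/subsetPset => x /= h1; rewrite /F /=; apply: (lt_le_trans h1); rewrite ler_nat.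
have UF : \bigcup_k F k = setT.
  apply/seteqP; split=> // x _; exists (Num.bound `|g x|) => //; rewrite /F /=.
  by apply: (le_lt_trans (ler_norm _)); exact: archi_boundP (normr_ge0 _).
have cv2 : \int[mu]_(x in F k) h x @[k --> \oo] --> \int[mu]_x h x.
  rewrite -[X in \int[mu]_(x in X) h x]UF.
  apply: ge0_nondecreasing_set_cvg_integral => //.
  by move=> k; exact: (measurable_funS measurableT).
have fin : \int[mu]_x h x \is a fin_num by rewrite ge0_fin_numE ?integral_ge0.
have le k : \int[mu]_(x in F k) h x <= \int[mu]_x h x - e%:E.
  have := hk k => /negP; rewrite -leNgt => ek.
  have e1 : [set x | (k%:R <= g x)%R] = ~` F k.
    by apply/seteqP; split=> x; rewrite /F /= leNgt => /negP.
  rewrite leeBrDr//; rewrite -(setUv (F k)) ge0_integral_setU//.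
  - by rewrite leeD2l// -e1.
  - exact: measurableC.
  - by rewrite setUv.
  - by rewrite disj_set2E setICr.
have le2 : \int[mu]_x h x <= \int[mu]_x h x - e%:E.
  by rewrite -[X in X <= _](cvg_lim (@ereal_hausdorff R) cv2); apply: lime_le; [apply/cvg_ex; eexists; exact: cv2|exact: nearW].
by move: le2; rewrite -(fineK fin) -EFinB lee_fin; lra.
Qed.

(** On [A] the integrand is bounded, away from [A] it has a majorant of known
    integral. *)
Lemma integral_near_far (S A : set T) (F G : T -> \bar R) (c : R) :
  measurable S -> measurable A -> mu (~` S) = 0 -> (0 <= c)%R ->
  measurable_fun setT F -> (forall x, 0 <= F x) ->
  measurable_fun setT G -> (forall x, 0 <= G x) ->
  (forall x, S x -> A x -> F x <= c%:E) -> (forall x, S x -> ~ A x -> F x <= G x) ->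
  \int[mu]_x F x <= c%:E * mu A + \int[mu]_x G x.
Proof.
move=> mS mA S0 c0 mF F0 mG G0 hA hG.
have mcA : measurable_fun setT (fun x => c%:E * (\1_A x)%:E).
  by apply: measurable_funeM; apply/measurable_EFinP; exact: measurable_indic.
have cA0 x : 0 <= c%:E * (\1_A x)%:E by rewrite mule_ge0// lee_fin.
rewrite (@ge0_negligible_integral _ _ _ mu setT (~` S))//; last exact: measurableC.
rewrite setDE setTI setCK.
have -> : c%:E * mu A = \int[mu]_x (c%:E * (\1_A x)%:E).
  rewrite ge0_integralZl_EFin//; last by apply/measurable_EFinP; exact: measurable_indic.
  by rewrite integral_indic// setIT.
rewrite -ge0_integralD//.
apply: (@le_trans _ _ (\int[mu]_(x in S) (c%:E * (\1_A x)%:E + G x))).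
  apply: ge0_le_integral => //.
  - exact: (measurable_funS measurableT).
  - by apply: (measurable_funS measurableT) => //; exact: emeasurable_funD.
  move=> x Sx; have [Ax|nA] := pselect (A x).
    by rewrite indicE mem_set// mule1 (le_trans (hA x Sx Ax))// leeDl.
  by rewrite (le_trans (hG x Sx nA))// leeDr.
apply: ge0_subset_integral => //; first exact: emeasurable_funD.
by move=> x _; rewrite adde_ge0.
Qed.

End Generalities.

Section LowerBound.
Context {R : realType} {n m : nat}.
Local Notation Rm := (measurableTypeR R).
Local Notation NN := (n.-tuple (Rm * Rm)%type * m.-tuple Rm)%type.
Local Notation E := 'rV[R[i]]_n.
Local Notation F := 'rV[R]_m.
Local Notation FC := 'rV[R[i]]_m.
Local Notation Borel := (g_sigma_algebraType (@open (E * FC)%type)).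
Context (Phi : E -> E -> FC) (hPhi : hermitian_map Phi).
Context (K : set F) (hK : compact K) (p : R) (p0 : 0 < p).
Implicit Types (f : E * FC -> R[i]).

Lemma kern_le (C D : R) : 0 <= C -> 0 <= D -> forall v : NN, kern 1 C D v <= C ^+ n * D ^+ m.
Proof.
move=> C0 D0 v; apply: ler_pM; [exact: kernE_ge0|exact: kernF_ge0| |].
  rewrite /kernE -[X in _ <= C ^+ X](card_ord n) -prodr_const; apply: ler_prod => j _.
  rewrite mulr_ge0//= -[leRHS]mulr1 ler_wpM2l// indicE; by case: (_ \in _).
rewrite /kernF -[X in _ <= D ^+ X](card_ord m) -prodr_const; apply: ler_prod => j _.
have h := onedsqr_gt0 (tnth v.2 j).
rewrite mulr_ge0 ?invr_ge0 ?(ltW h)//= -[leRHS]mulr1 ler_wpM2l// invf_le1// lerDl.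
exact: sqr_ge0.
Qed.

(** The kernel of [submean] is bounded, and Haar measure is left invariant. *)
Lemma sup_bound H f : 0 <= H -> bernstein Phi p K f -> exists2 M : R, 0 <= M &
  forall w, boxF H (rho Phi w) -> ((cabs (f w) `^ p)%:E <= M%:E * energyN Phi p f)%E.
Proof.
move=> H0 hf; have [hh _] := hf; have [sg sg0 hsg] := hol_tame Phi hK.
have [N [A [A0 tf]]] := hsg f hh; have ef : entire f by case: hh.
have [C [D [C0 D0 hCD]]] := submean hPhi N sg0 H0 p0.
exists (C ^+ n * D ^+ m); first by rewrite mulr_ge0// exprn_ge0// ltW.
move=> w wH; apply: (le_trans (hCD f A ef A0 tf w wH)).
have cg := continuous_slice hPhi ef.
pose G v := (cabs (slice Phi f 0 (ptN v)) `^ p)%:E.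
have mG : measurable_fun setT G.
  by apply/measurable_EFinP; apply: measurable_comp_N; [exact: cg|exact: borel_map_ptN].
have G0 v : (0 <= G v)%E by rewrite lee_fin powR_ge0.
have [mt ht] := mpres_transL hPhi (coN w).
have -> : energyN Phi p f = (\int[lebN R n m]_v G (transL Phi (coN w) v))%E by rewrite ht.
have M0 : 0 <= C ^+ n * D ^+ m by rewrite mulr_ge0// exprn_ge0// ltW.
rewrite -(ge0_integralZl_EFin _ measurableT (fun v _ => G0 _) (measurableT_comp mG mt) M0).
apply: ge0_le_integral.
- exact: measurableT.
- by move=> v _; rewrite lee_fin mulr_ge0 ?powR_ge0 ?kern_ge0 ?ltW.
- apply/measurable_EFinP; apply: measurable_funM; last exact: measurable_kern.
  exact: measurable_slice0 (entire_continuous ef).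
- by apply: measurable_funeM; exact: (measurableT_comp mG mt).
move=> v _; rewrite /G ptN_transL -EFinM lee_fin mulrC ler_wpM2r ?powR_ge0//.
by apply: kern_le; exact: ltW.
Qed.

Lemma energyN_gt0 f : bernstein Phi p K f -> f <> (fun=> 0) -> (0 < energyN Phi p f)%E.
Proof.
move=> hf fn0; have [w fw] : exists w, f w != 0.
  by apply: contrapT => h; apply: fn0; apply/funext => w; apply/eqP; apply: contrapT => /negP hw; apply: h; exists w.
have [M M0 hM] := sup_bound (lone_ge0 (rho Phi w)) hf.
have := hM w (fun j => coord_le_lone _ _).
rewrite lt_neqAle energy_ge0 andbT => h; apply/eqP => e0; move: h; rewrite -e0 mule0 lee_fin.
by apply/negP; rewrite -ltNge powR_gt0// cabs_gt0.
Qed.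

Section Mu.
Context (mu : {measure set Borel -> \bar R}) (hmu : radon mu).

(** Compact cells exhaust the space. *)
Lemma sigma_finite_radon : sigma_finite setT mu.
Proof.
pose Q (k : nat) : set (E * FC) := [set w | boxN k%:R (coN w) /\ strip Phi k%:R w].
have cQ k : compact (Q k) by exact: compact_cell.
exists Q.
  apply/seteqP; split=> // w _.
  pose x := lonec (coN w).1 + lone (coN w).2 + lone (rho Phi w).
  have x0 : 0 <= x by rewrite !addr_ge0 ?lonec_ge0 ?lone_ge0.
  have xk := ltW (archi_boundP x0).
  have l1 := lonec_ge0 (coN w).1; have l2 := lone_ge0 (coN w).2; have l3 := lone_ge0 (rho Phi w).
  exists (Num.Def.archi_bound x) => //; split; [split|] => j.
  - have h := coord_le_lonec (coN w).1 j.
    have hr := normr_Re_le ((coN w).1 0 j); have hi := normr_Im_le ((coN w).1 0 j).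
    by split; apply: le_trans xk; rewrite /x; lra.
  - by apply: le_trans xk; have := coord_le_lone (coN w).2 j; rewrite /x; lra.
  - by apply: le_trans xk; have := coord_le_lone (rho Phi w) j; rewrite /x; lra.
move=> k; split; last by have [h _ _] := hmu; exact: h.
by apply: closed_measurableB; apply: compact_closed => //; exact: norm_hausdorff.
Qed.

Context (hsupp : bounded_set (rho Phi @` msupport mu)) (hs : sampling Phi p K mu).

(** Continuity of the inverse of the embedding at [0]: a function of energy
    [energyN f] cannot have a small norm in [L^p(mu)]. *)
Lemma lower_energy f : bernstein Phi p K f -> f <> (fun=> 0) -> exists2 dl : R, 0 < dl &
  forall a, (dl%:E <= energy mu p (fun w : Borel => f (actL Phi a w)))%E.
Proof.
move=> hf fn0; have [_ ef] := proj1 (bernsteinP hPhi K p0 f) hf.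
have e0 := energyN_gt0 hf fn0.
have efin : energyN Phi p f \is a fin_num by rewrite ge0_fin_numE// ltW.
pose c := fine (energyN Phi p f).
have c0 : 0 < c by rewrite fine_gt0// e0.
have [_ _ _ hinv] := hs.
have k0 : 0 < c `^ p^-1 by rewrite powR_gt0.
have [dl dl0 hdl] := hinv _ (bernstein_0 hPhi K p0) _ k0.
exists (dl `^ p); first by rewrite powR_gt0.
move=> a; have hfa := bernstein_actL hPhi p0 a hf.
have efa : entire f by case: hf => -[].
rewrite leNgt; apply/negP => hlt; have := hdl _ hfa.
rewrite /bernstein_norm (Lpnorm_lt _ _ p0 dl0) (Lpnorm_lt _ _ p0 k0).
have -> : energy (lebN R n m) p (slice Phi (fun w => 0 - f (actL Phi a w)) 0 \o ptN) = energyN Phi p f.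
  rewrite -(energyN_actL hPhi p a efa).
  by apply: eq_integral => v _; congr ((_ `^ p)%:E); exact: cabs0B.
have -> : energy mu p (fun w : Borel => 0 - f (actL Phi a w)) =
    energy mu p (fun w : Borel => f (actL Phi a w)).
  by apply: eq_integral => v _; congr ((_ `^ p)%:E); exact: cabs0B.
move=> /(_ hlt); rewrite -powRrM mulVf ?gt_eqF// powRr1 ?(ltW c0)// -(fineK efin) lte_fin.
by rewrite ltxx.
Qed.

End Mu.
End LowerBound.

Section UnitBox.
Context {R : realType} {n m : nat}.
Local Notation Rm := (measurableTypeR R).
Local Notation NN := (n.-tuple (Rm * Rm)%type * m.-tuple Rm)%type.
Local Notation E := 'rV[R[i]]_n.
Local Notation F := 'rV[R]_m.

Lemma lebesgue_unit_gt0 : (0 < @lebesgue_measure R (`[(-1)%R, 1%R]%classic : set Rm))%E.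
Proof.
have /= h := @lebesgue_measure_itv R `[(-1)%R, 1%R].
have l : (-1 : R) < 1 by lra.
by rewrite [X in (_ < X)%E]h lte_fin l -EFinB lte_fin; lra.
Qed.

Lemma measurable_unit_interval :
  measurable_fun [set: Rm] (fun t : Rm => \1_(`[(-1), 1]%classic : set Rm) t : R).
Proof. by apply: measurable_indic; exact: measurable_itv. Qed.

Definition unitF (s : m.-tuple Rm) : R :=
  \prod_(j < m) \1_(`[(-1), 1]%classic : set Rm) (tnth s j).

Lemma unitF_ge0 s : 0 <= unitF s. Proof. exact: prodr_ge0. Qed.

Lemma measurable_unitF : measurable_fun setT unitF.
Proof.
apply: (@measurable_prod _ _ R) => j _.
by apply: (measurableT_comp measurable_unit_interval); exact: measurable_tnth.
Qed.

Lemma unitF_gt0 : (0 < \int[lebF R m]_s (unitF s)%:E)%E.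
Proof.
apply: (@tuple_integral_prod_gt0 _ _ Rm (@lebesgue_measure R)
  (\1_(`[(-1), 1]%classic : set Rm) : Rm -> R) measurable_unit_interval _ m).
  by [].
rewrite integral_indic ?setIT; first exact: lebesgue_unit_gt0.
  exact: measurableT.
exact: measurable_itv.
Qed.

Lemma unitE_gt0 : (0 < \int[lebE R n]_t (kernE 1 1 t)%:E)%E.
Proof.
apply: (@tuple_integral_prod_gt0 _ _ (Rm * Rm)%type
  (sf_product (@lebesgue_measure R) (@lebesgue_measure R))
  (fun t => 1 * \1_(@sq R 1) t) (measurable_sq_weight 1 1) _ n).
  by move=> t; rewrite mulr_ge0.
under eq_integral do rewrite mul1r.
rewrite integral_indic ?setIT; [|exact: measurableT|exact: measurable_sq].
pose D : set Rm := `[(-1), 1]%classic.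
have mD : measurable D by exact: measurable_itv.
have -> : sq 1 = D `*` D.
  by apply/seteqP; split=> z; rewrite /sq /D /= !in_itv/= !ler_norml.
have := product_measure1E (@lebesgue_measure R) (@lebesgue_measure R) mD mD.
by move=> h; rewrite [X in (_ < X)%E]h mule_gt0 ?lebesgue_unit_gt0.
Qed.

(** The indicator of the box is at least a product of functions of one coordinate,
    whose integral factors. *)
Lemma unit_box_gt0 : (0 < \int[lebN R n m]_v (\1_(boxN 1) (ptN v))%:E)%E.
Proof.
pose G (v : NN) := (kernE 1 1 v.1 * unitF v.2)%:E.
have mG : measurable_fun setT G.
  apply/measurable_EFinP; apply: measurable_funM.
    by apply: (measurableT_comp (measurable_kernE 1 1)); exact: measurable_fst.
  by apply: (measurableT_comp measurable_unitF); exact: measurable_snd.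
have G0 v : (0 <= G v)%E by rewrite lee_fin mulr_ge0 ?unitF_ge0 ?kernE_ge0.
have : (0 < \int[lebN R n m]_v G v)%E.
  rewrite (sf_tonelli1 (lebE R n) (lebF R m) mG G0) /G /=.
  have -> : (\int[lebE R n]_x \int[lebF R m]_y (kernE 1 1 x * unitF y)%:E =
      \int[lebE R n]_x ((kernE 1 1 x)%:E * \int[lebF R m]_y (unitF y)%:E))%E.
    apply: eq_integral => x _.
    have mU : measurable_fun setT (fun y => (unitF y)%:E).
      by apply/measurable_EFinP; exact: measurable_unitF.
    have U0 y : setT y -> (0 <= (unitF y)%:E)%E by move=> _; rewrite lee_fin unitF_ge0.
    by rewrite -(ge0_integralZl_EFin _ measurableT U0 mU (kernE_ge0 1 x ler01)).
  rewrite ge0_integralZr; first by rewrite mule_gt0 ?unitE_gt0 ?unitF_gt0.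
  - exact: measurableT.
  - by apply/measurable_EFinP; exact: measurable_kernE.
  - by move=> x _; rewrite lee_fin kernE_ge0.
  - by apply: integral_ge0 => y _; rewrite lee_fin unitF_ge0.
move=> /lt_le_trans; apply; apply: le_integral_any; first exact: G0.
move=> [t s]; rewrite /G lee_fin /=.
have [k0|/kernE_neq0 ht] := eqVneq (kernE 1 1 t) 0; first by rewrite k0 mul0r.
have [u0|us] := eqVneq (unitF s) 0; first by rewrite u0 mulr0.
have hs : boxF 1 (ptF s).
  move=> j; move/prodf_neq0: us => /(_ j isT); rewrite mxE indicE.
  by case: (boolP (_ \in _)) => [/set_mem|]; rewrite ?eqxx//= in_itv/= ler_norml.
rewrite indicE mem_set//; apply: mulr_ile1; rewrite ?unitF_ge0 ?kernE_ge0//.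
  by apply: prodr_ile1 => j _; rewrite mul1r indicE; case: (_ \in _); rewrite /= ?lexx ler01.
by apply: prodr_ile1 => j _; rewrite indicE; case: (_ \in _); rewrite /= ?lexx ler01.
Qed.

End UnitBox.

Lemma integral_indicM {R : realType} {d} {T : measurableType d} (mu : {measure set T -> \bar R})
    (A : set T) (h : T -> \bar R) :
  (\int[mu]_x ((\1_A x)%:E * h x) = \int[mu]_(x in A) h x)%E.
Proof.
rewrite [RHS]integral_mkcond; apply: eq_integral => x _.
by rewrite patchE indicE; case: ifP => _; rewrite ?mul1e ?mul0e.
Qed.

Section Tail.
Context {R : realType} {n m : nat}.
Local Notation Rm := (measurableTypeR R).
Local Notation NN := (n.-tuple (Rm * Rm)%type * m.-tuple Rm)%type.
Local Notation E := 'rV[R[i]]_n.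
Local Notation F := 'rV[R]_m.
Local Notation FC := 'rV[R[i]]_m.
Local Notation Borel := (g_sigma_algebraType (@open (E * FC)%type)).
Context (Phi : E -> E -> FC) (hPhi : hermitian_map Phi).

Lemma closed_boxN B : closed (@boxN R n m B).
Proof.
rewrite (_ : boxN B = fst @^-1` boxE B `&` snd @^-1` boxF B)//.
apply: closedI; apply: preimage_closed.
- by move=> w _; exact: cvg_fst.
- by apply: compact_closed; [exact: norm_hausdorff|exact: compact_boxE].
- by move=> w _; exact: cvg_snd.
- exact: closed_boxF.
Qed.

Lemma measurable_boxN d (T : measurableType d) (h : T -> E * F) B : borel_map h ->
  measurable_fun setT (fun t => \1_(boxN B) (h t) : R).
Proof.
move=> bh; rewrite (_ : (fun t => _) = \1_(h @^-1` boxN B)); last first.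
  by apply/funext => t; rewrite !indicE; congr ((_ : bool)%:R); apply/idP/idP; rewrite !inE.
apply: measurable_indic; rewrite -[boxN B]setCK preimage_setC; apply: measurableC.
apply: (bh (~` boxN B)); apply: closed_openC; exact: closed_boxN.
Qed.

Lemma invN_mulV a b : invN (mulN Phi (invN a) b) = mulN Phi (invN b) a.
Proof.
set x := mulN Phi (invN a) b.
have e : mulN Phi x (mulN Phi (invN b) a) = 0.
  by rewrite /x -(mulNA hPhi) (mulKVN hPhi) (mulVN hPhi).
by rewrite -[RHS](mulVKN hPhi x) e (mulN0 hPhi).
Qed.

Lemma boxN_V B (a : E * F) : boxN B (invN a) = boxN B a.
Proof.
apply/propext; rewrite /boxN /invN /=; split=> -[h1 h2]; split=> j.
- by have := h1 j; rewrite mxE cReN cImN !normrN.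
- by have := h2 j; rewrite mxE normrN.
- by have := h1 j; rewrite mxE cReN cImN !normrN.
- by have := h2 j; rewrite mxE normrN.
Qed.

(** The left translates of the unit box cover each point to the same extent,
    because the box is symmetric. *)
Lemma box_count B c : (\int[lebN R n m]_u (\1_(boxN B) (mulN Phi (invN (ptN u)) c))%:E =
  \int[lebN R n m]_u (\1_(boxN B) (ptN u))%:E)%E.
Proof.
have [_ h] := mpres_transL hPhi (invN c).
pose G (u : NN) : \bar R := (\1_(boxN B) (ptN u))%:E.
have mG : measurable_fun setT G.
  by apply/measurable_EFinP; apply: measurable_boxN; exact: borel_map_ptN.
have G0 u : (0 <= G u)%E by rewrite lee_fin.
rewrite -[RHS](h G mG G0); apply: eq_integral => u _; rewrite /G ptN_transL -invN_mulV.
congr (_%:E); rewrite !indicE; congr ((_ : bool)%:R).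
by apply/idP/idP; rewrite !inE boxN_V.
Qed.

Context (dN : E * F -> E * F -> R) (hdN : homogeneous_left_distance Phi dN).
Local Notation gN := (gN dN).

Lemma measurable_gN : measurable_fun setT (fun u : NN => gN (ptN u)).
Proof.
by apply: borel_map_measurable; exact: (borel_map_comp borel_map_ptN (continuous_gN hPhi hdN)).
Qed.

Context (K : set F) (hK : compact K) (p : R) (p0 : 0 < p).
Context (mu : {measure set Borel -> \bar R}) (hmu : radon mu).
Context (hsupp : bounded_set (rho Phi @` msupport mu)) (hs : sampling Phi p K mu).
Context (hB : bernstein Phi p K <> [set cst 0]).

(** Averaging [Psi_bound] over the translates of the unit box that contain the group
    coordinate of [w] bounds [|f|^p], at the translated point, by an integral over
    the group. Exchanging this integral with [mu], each translate of the box
    contributes its mass, which is uniformly bounded by [tube_mass]; and the points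
    outside the tube only see the tail of the integrable function [Psi], because a
    translate of the box has bounded diameter. *)
Theorem tail_majorant f H e : 0 <= H -> bernstein Phi p K f -> 0 < e ->
  exists2 r : R, 0 <= r & forall a, exists G : Borel -> \bar R,
    [/\ measurable_fun setT G, (forall w, 0 <= G w)%E, (\int[mu]_w G w <= e%:E)%E &
      forall w, strip Phi H w -> ~ tube Phi dN a r w ->
        ((cabs (f (actL Phi (invN a) w)) `^ p)%:E <= G w)%E].
Proof.
move=> H0 hf e0; have [hh efin] := proj1 (bernsteinP hPhi K p0 f) hf.
have [sg sg0 hsg] := hol_tame Phi hK; have [N [A [A0 tf]]] := hsg f hh.
have ef : entire f by case: hh.
have cg := continuous_slice hPhi ef.
have [C [D' [C0 D'0 hPsi]]] := Psi_bound hPhi N sg0 H0 p0.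
have mPsi := measurable_Psi hPhi p C0 D'0 cg.
have Psi0 u : (0 <= Psi Phi p C D' (slice Phi f 0) u)%E by exact: Psi_ge0.
have Psioo := Psi_lty hPhi C0 D'0 cg efin.
have [D D0 hD] := gN_box hPhi hdN 1.
have [C1 C10 hC1] := tube_mass hPhi hK p0 hmu hsupp hs hdN hB D.
(* a positive lower bound for the volume of the unit box *)
have [v0 v00 hv0] : exists2 v0 : R, 0 < v0 &
    (v0%:E <= \int[lebN R n m]_v (\1_(boxN 1) (ptN v))%:E)%E.
  have := @unit_box_gt0 R n m; case: (\int[lebN R n m]_v _)%E => [x||]//.
  - by rewrite lte_fin => x0; exists x.
  - by move=> _; exists 1; rewrite ?leey.
have d0 : 0 < e * v0 / (1 + C1) by rewrite divr_gt0 ?mulr_gt0// ltr_pwDl.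
have [k hk] := integral_tail_small mPsi (fun u => Psi0 _) Psioo measurable_gN d0.
exists (k%:R + D); first by rewrite addr_ge0.
move=> a.
pose far : set NN := [set u | k%:R <= gN (ptN u)].
have mfar : measurable far.
  have := measurable_gN measurableT (measurable_itv `[k%:R, +oo[).
  rewrite setTI; congr measurable; apply/seteqP; split=> x; by rewrite /far /= in_itv/= andbT.
pose F0 u : \bar R := ((\1_far u)%:E * Psi Phi p C D' (slice Phi f 0) (ptN u))%E.
have mF0 : measurable_fun setT F0.
  by apply: emeasurable_funM => //; apply/measurable_EFinP; exact: measurable_indic.
have F00 u : (0 <= F0 u)%E by rewrite mule_ge0// lee_fin.
have [F1 [mF1 F10 iF1 F1E]] : exists F1 : NN -> \bar R, [/\ measurable_fun setT F1,
    (forall u, 0 <= F1 u)%E, (\int[lebN R n m]_u F1 u <= (e * v0 / (1 + C1))%:E)%E &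
    forall u, k%:R <= gN (mulN Phi (invN a) (ptN u)) ->
      F1 u = Psi Phi p C D' (slice Phi f 0) (mulN Phi (invN a) (ptN u))].
  have [mt ht] := mpres_transL hPhi (invN a).
  exists (fun u => F0 (transL Phi (invN a) u)); split.
  - exact: (measurableT_comp mF0 mt).
  - by move=> u; exact: F00.
  - by rewrite (ht F0 mF0 F00) /F0 integral_indicM; exact: ltW hk.
  - move=> u ku; rewrite /F0 ptN_transL indicE mem_set ?mul1e//.
    by rewrite /far /= ptN_transL.
clear F0 mF0 F00.
(* the average of [F1] over the points [u] whose box contains [coN w] *)
pose G2 (z : Borel * NN) : \bar R :=
  ((v0^-1 * \1_(boxN 1) (mulN Phi (invN (ptN z.2)) (coN (z.1 : E * FC))))%:E * F1 z.2)%E.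
have mbox : measurable_fun setT
    (fun z : Borel * NN => \1_(boxN 1) (mulN Phi (invN (ptN z.2)) (coN (z.1 : E * FC))) : R).
  apply: measurable_boxN; apply: (borel_map_mulN hPhi).
    have b2 : borel_map (fun z : Borel * NN => ptN z.2).
      by apply: (@measurable_borel_map _ _ _ _ _ (@ptN R n m)); [exact: measurable_snd|exact: borel_map_ptN].
    apply: (borel_map_comp b2 (g := @invN R n m)) => x.
    by apply: (@cvg_pair _ _ _ (nbhs x) (nbhs (- x.1)) (nbhs (- x.2)));
      apply: cvgN; [exact: cvg_fst|exact: cvg_snd].
  apply: (@measurable_borel_map _ _ _ _ _ (fun w : Borel => coN (w : E * FC))); first exact: measurable_fst.
  by apply: (borel_map_comp (@borel_map_id R n m)); exact: continuous_coN.
have mG2 : measurable_fun setT G2.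
  apply: emeasurable_funM; last by apply: (measurableT_comp mF1); exact: measurable_snd.
  by apply/measurable_EFinP; apply: measurable_funM.
have v0V : 0 <= v0^-1 by rewrite invr_ge0 ltW.
have G20 z : (0 <= G2 z)%E by apply: mule_ge0; [rewrite lee_fin mulr_ge0|exact: F10].
exists (fun w => \int[lebN R n m]_u G2 (w, u))%E; split.
- exact: (measurable_inner1 (lebN R n m) mG2 G20).
- by move=> w; apply: integral_ge0.
- rewrite (exchange_sf _ (sigma_finite_radon hPhi hmu) mG2 G20).
  apply: (@le_trans _ _ (\int[lebN R n m]_u ((v0^-1 * C1)%:E * F1 u))%E).
    apply: ge0_le_integral => //.
    - by move=> u _; apply: integral_ge0.
    - exact: (measurable_inner_sf (sigma_finite_radon hPhi hmu) mG2 G20).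
    - exact: measurable_funeM.
    move=> u _; rewrite /G2 /=.
    rewrite ge0_integralZr//; last 2 first.
    - apply/measurable_EFinP; apply: measurable_funM; first exact: measurable_cst.
      exact: (measurableT_comp mbox (measurable_pair2 u)).
    - by move=> w _; rewrite lee_fin mulr_ge0// invr_ge0 ltW.
    apply: lee_wpmul2r => //.
    under eq_integral do rewrite EFinM.
    rewrite ge0_integralZl_EFin//; last first.
      by apply/measurable_EFinP; exact: (measurableT_comp mbox (measurable_pair2 u)).
    rewrite EFinM; apply: lee_wpmul2l; first by rewrite lee_fin invr_ge0 ltW.
    apply: (le_trans _ (hC1 (ptN u))).
    have mtu : measurable (tube Phi dN (ptN u) D : set Borel).
      by apply: closed_measurableB; exact: closed_tube.
    have <- : (\int[mu]_w (\1_(tube Phi dN (ptN u) D) w)%:E = mu (tube Phi dN (ptN u) D))%E.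
      by rewrite integral_indic// setIT.
    apply: le_integral_any => w; rewrite lee_fin//.
    rewrite !indicE; case: (boolP (_ \in boxN 1)) => // /set_mem wb.
    by rewrite mem_set//; exact: hD.
  have vC : 0 <= v0^-1 * C1 by rewrite mulr_ge0// invr_ge0 ltW.
  rewrite ge0_integralZl_EFin//.
  apply: (@le_trans _ _ ((v0^-1 * C1)%:E * (e * v0 / (1 + C1))%:E)%E).
    by apply: lee_wpmul2l.
  have vn : v0 != 0 by rewrite gt_eqF.
  have cp : 0 < 1 + C1 by rewrite ltr_pwDl.
  rewrite -EFinM lee_fin.
  have -> : v0^-1 * C1 * (e * v0 / (1 + C1)) = e * (C1 / (1 + C1)).
    rewrite [e * v0]mulrC -!mulrA [C1 * (v0 * _)]mulrCA mulKf// [C1 * (e * _)]mulrCA.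
    by rewrite mulrA.
  by rewrite ger_pMr// ler_pdivrMr// mul1r lerDr.
move=> w sw ntw; set x := cabs _ `^ p.
have x0 : 0 <= x by exact: powR_ge0.
have mb : measurable_fun setT (fun u : NN => (\1_(boxN 1) (mulN Phi (invN (ptN u)) (coN w)))%:E : \bar R).
  by apply/measurable_EFinP; exact: (measurableT_comp mbox (measurable_pair1 (w : Borel))).
have vx0 : 0 <= v0^-1 * x by rewrite mulr_ge0// invr_ge0 ltW.
apply: (@le_trans _ _ (\int[lebN R n m]_u ((v0^-1 * x)%:E *
    (\1_(boxN 1) (mulN Phi (invN (ptN u)) (coN w)))%:E))%E).
  rewrite ge0_integralZl_EFin// box_count.
  apply: (@le_trans _ _ ((v0^-1 * x)%:E * v0%:E)%E); last exact: lee_wpmul2l.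
  by rewrite -EFinM lee_fin mulrAC mulVf ?mul1r// gt_eqF.
apply: le_integral_any => u; first by rewrite mule_ge0// lee_fin.
rewrite /G2 /= indicE; case: (boolP (_ \in boxN 1)) => [/set_mem wb|_]; last first.
  by rewrite mule0 mulr0 mul0e.
rewrite mule1 mulr1 EFinM; apply: lee_wpmul2l; first by rewrite lee_fin invr_ge0 ltW.
set b := mulN Phi (invN (ptN u)) (coN w) in wb *.
have eb : mulN Phi (invN a) (coN w) = mulN Phi (mulN Phi (invN a) (ptN u)) b.
  by rewrite -(mulNA hPhi) /b (mulKVN hPhi).
rewrite F1E; last first.
  have := gN_M hPhi hdN (mulN Phi (invN a) (ptN u)) b.
  rewrite -eb; have := hD b wb.
  move/negP: ntw; rewrite -ltNge; lra.
have [b1 b2] := wb.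
by apply: (hPsi f A ef A0 tf _ _ b) => //; [rewrite coN_actL eb|move=> j; rewrite rho_actL; exact: sw].
Qed.

End Tail.

Section Conclusion.
Context {R : realType} {n m : nat}.
Local Notation E := 'rV[R[i]]_n.
Local Notation F := 'rV[R]_m.
Local Notation FC := 'rV[R[i]]_m.
Local Notation Borel := (g_sigma_algebraType (@open (E * FC)%type)).
Context (Phi : E -> E -> FC) (hPhi : hermitian_map Phi).
Context (dN : E * F -> E * F -> R) (hdN : homogeneous_left_distance Phi dN).

Lemma continuous_enorm : continuous (@enorm R m).
Proof.
move=> x; apply: (@continuous_comp _ _ _ (fun x : F => \sum_i x 0 i ^+ 2) (@Num.sqrt R)); last exact: sqrt_continuous.
apply: continuous_sum => j.
apply: (@continuous_comp _ _ _ (fun x : F => x 0 j) (fun t : R => t ^+ 2)); last exact: exprn_continuous.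
exact: continuous_coord.
Qed.

Lemma cballE w r : cballEFC Phi dN w r =
  tube Phi dN (coN w) r `&` [set w' | enorm (rho Phi w - rho Phi w') <= r].
Proof.
by apply/seteqP; split=> w'; rewrite /cballEFC /distEFC /tube /= ge_max -(dN_gN hPhi hdN) => /andP.
Qed.

Lemma measurable_cball w r : measurable (cballEFC Phi dN w r : set Borel).
Proof.
apply: closed_measurableB; rewrite cballE; apply: closedI; first exact: closed_tube.
apply: (@preimage_closed _ _ (fun w' => enorm (rho Phi w - rho Phi w')) [set x | x <= r]); last exact: closed_le.
move=> w' _; apply: (@continuous_comp _ _ _ (fun w' => rho Phi w - rho Phi w') (@enorm R m)); last exact: continuous_enorm.
have c1 : {for w', continuous (fun=> rho Phi w : F)} by exact: cst_continuous.
have c2 : {for w', continuous (rho Phi)} by exact: continuous_rho.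
exact: (continuousB c1 c2).
Qed.

Lemma enorm_box H (x : F) : boxF H x -> enorm (0 - x) <= m%:R * H.
Proof.
move=> hx; apply: (le_trans (enorm_le _)); rewrite /lone.
rewrite -[X in X%:R * H](card_ord m) mulr_natl -sumr_const; apply: ler_sum => j _.
by rewrite sub0r mxE normrN; exact: hx.
Qed.

Context (K : set F) (hK : compact K) (p : R) (p0 : 0 < p).
Context (mu : {measure set Borel -> \bar R}) (hmu : radon mu).
Context (hsupp : bounded_set (rho Phi @` msupport mu)) (hs : sampling Phi p K mu).
Context (hB : bernstein Phi p K <> [set cst 0]).

(** A ball is contained in the tube of the same radius. *)
Theorem ball_upper : exists C : R, forall w, (M_ Phi dN 1 mu w <= C%:E)%E.
Proof.
have [C C0 hC] := tube_mass hPhi hK p0 hmu hsupp hs hdN hB 1.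
exists C => w; apply: (le_trans _ (hC (coN w))); apply: le_measure; rewrite ?inE.
- exact: measurable_cball.
- by apply: closed_measurableB; exact: closed_tube.
- by rewrite cballE => w' [].
Qed.

(** The sampling inequality bounds the energy of every translate of [f] from below.
    Near the centre the translate is bounded, so the near part is at most a constant
    times the mass of a tube, and the far part is less than half of the energy. *)
Theorem ball_lower : exists r C : R, [/\ 0 < r, 0 < C &
  forall a, (C%:E <= slice Phi (M_ Phi dN r mu) 0 a)%E].
Proof.
have [f hf fn0] := nonzero_bernstein hPhi p0 hB.
have [H H0 muH] := mu_strip hPhi hmu hsupp.
have [dl dl0 hdl] := lower_energy hPhi hK p0 hs hf fn0.
have [M M0 hM] := sup_bound hPhi hK p0 H0 hf.
have [hh efin] := proj1 (bernsteinP hPhi K p0 f) hf.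
have ef : entire f by case: hh.
have e0 : (0 <= energyN Phi p f)%E by exact: energy_ge0.
have efi : energyN Phi p f \is a fin_num by rewrite ge0_fin_numE.
pose c := M * fine (energyN Phi p f).
have c0 : 0 <= c by rewrite mulr_ge0// fine_ge0.
have d2 : 0 < dl / 2 by rewrite divr_gt0.
have [r r0 hr] := tail_majorant hPhi hdN hK p0 hmu hsupp hs hB H0 hf d2.
(* [m H] bounds the norm of [rho] on the strip, so the ball of this radius
   contains the part of the tube in the strip *)
pose r' := 1 + r + m%:R * H.
have mH : 0 <= m%:R * H by rewrite mulr_ge0.
exists r', (dl / (2 * (1 + c))); split; first by rewrite /r'; lra.
  by rewrite divr_gt0// mulr_gt0// ltr_pwDl.
move=> a; rewrite sliceE /M_.
have [G [mG G0 iG hG]] := hr a.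
pose A : set (E * FC) := tube Phi dN a r `&` strip Phi H.
have mS : measurable (strip Phi H : set Borel) by apply: closed_measurableB; exact: closed_strip.
have mA : measurable (A : set Borel).
  by apply: measurableI => //; apply: closed_measurableB; exact: closed_tube.
apply: (@le_trans _ _ (mu A)); last first.
  apply: le_measure; rewrite ?inE//; first exact: measurable_cball.
  move=> w [tw sw]; rewrite cballE coN_pt rho_pt; split.
    by move: tw; rewrite /tube /= /r'; lra.
  rewrite /=; apply: (le_trans (enorm_box sw)); rewrite /r'; lra.
have cfa : continuous (fun w => f (actL Phi (invN a) w)).
  by apply: entire_continuous; exact: entire_actL.
have := @integral_near_far _ _ _ mu (strip Phi H) A
  (fun w : Borel => (cabs (f (actL Phi (invN a) w)) `^ p)%:E) G c mS mA muH c0.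
move=> near_far.
have {}near_far : (dl%:E <= c%:E * mu A + \int[mu]_x G x)%E.
  apply: (le_trans (hdl (invN a))); apply: near_far => //.
  - by apply/measurable_EFinP; exact: measurable_cabsB.
  - by move=> w; rewrite lee_fin powR_ge0.
  - move=> w sw _; have := hM (actL Phi (invN a) w); rewrite rho_actL => /(_ sw).
    by rewrite /c EFinM fineK.
  - by move=> w sw nA; apply: hG => // tw; apply: nA.
have {}near_far : (dl%:E <= c%:E * mu A + (dl / 2)%:E)%E.
  by apply: (le_trans near_far); exact: leeD2l.
have solve (y : \bar R) : (0 <= y)%E -> (dl%:E <= c%:E * y + (dl / 2)%:E)%E ->
    ((dl / (2 * (1 + c)))%:E <= y)%E; last by exact: (solve _ (measure_ge0 mu A) near_far).
case: y => [x||] //; last by move=> _ _; exact: leey.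
rewrite -EFinM -EFinD !lee_fin => x0 h.
have cp : 0 < 2 * (1 + c) by rewrite mulr_gt0// ltr_pwDl.
rewrite ler_pdivrMr//; nra.
Qed.

End Conclusion.

Theorem proposition4p6 (R : realType) (n m : nat)
    (Phi : 'rV[R[i]]_n -> 'rV[R[i]]_n -> 'rV[R[i]]_m)
    (hPhi : hermitian_map Phi)
    (hLambda : Lambda_plus Phi !=set0)
    (dN : 'rV[R[i]]_n * 'rV[R]_m -> 'rV[R[i]]_n * 'rV[R]_m -> R)
    (hdN : homogeneous_left_distance Phi dN)
    (K : set 'rV[R]_m) (hK : compact K)
    (hKLambda : K `<=` closure (Lambda_plus Phi))
    (p : R) (hp : 0 < p)
    (mu : {measure set (g_sigma_algebraType
       (@open ('rV[R[i]]_n * 'rV[R[i]]_m)%type)) -> \bar R})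
    (hmu : radon mu)
    (hsupp : bounded_set (rho Phi @` msupport mu))
    (hB : bernstein Phi p K <> [set cst 0])
    (hsampling : sampling Phi p K mu) :
  (exists C : R, forall w : 'rV[R[i]]_n * 'rV[R[i]]_m,
     (M_ Phi dN 1 mu w <= C%:E)%E) /\
  (exists r C : R, [/\ 0 < r, 0 < C &
     forall a : 'rV[R[i]]_n * 'rV[R]_m,
       (C%:E <= slice Phi (M_ Phi dN r mu) 0 a)%E]).
Proof.
split; first exact: (ball_upper hPhi hdN hK hp hmu hsupp hsampling hB).
exact: (ball_lower hPhi hdN hK hp hmu hsupp hsampling hB).
Qed.
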